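(* Let $N\ge 3$, let $\Omega\subset\mathbb{R}^N$ be a bounded open set, let $B>0$, $p>0$, and let $b:\Omega\to\mathbb{R}$ be measurable with $\alpha\le b(x)\le\beta$ for a.e. $x\in\Omega$, for some constants $\alpha,\beta>0$. Let $0<\theta<1$. Assume that $f$ is a positive function belonging to $L^m(\Omega)$ with $m\ge \frac{2N}{2N-\theta(N-2)}$. Then there exists a function $u\in H^1_0(\Omega)$, strictly positive on $\Omega$, such that $\frac{|\nabla u|^2}{u^\theta}\in L^1(\Omega)$ and $$\int_\Omega \frac{b(x)}{(1+u)^p}\nabla u\cdot\nabla\varphi + B\int_\Omega \frac{|\nabla u|^2}{u^\theta}\varphi=\int_\Omega f\varphi$$ for every $\varphi\in H^1_0(\Omega)\cap L^\infty(\Omega)$.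
   Context: ''$f$ positive'' means $f>0$ a.e. in $\Omega$; ''$u$ strictly positive on $\Omega$'' means $u>0$ a.e. in $\Omega$. *)

(* Defs.v *)
From HB Require Import structures.
From mathcomp Require Import all_boot all_order all_algebra.
From mathcomp Require Import all_classical all_reals all_analysis.

Set Implicit Arguments.
Unset Strict Implicit.
Unset Printing Implicit Defensive.

Import Order.TTheory GRing.Theory Num.Theory.
Import numFieldNormedType.Exports.

Local Open Scope classical_set_scope.
Local Open Scope ring_scope.

(* Lebesgue measure on R^n is the completion of the n-fold product of the
   one-dimensional Lebesgue measure. The product is built on the library's
   product sigma-algebra on n-tuples, one coordinate at a time. *)

Section cons_measure.
Context (R : realType) (n : nat).
Notation mR := (measurableTypeR R).
Variable m : {sigma_finite_measure set (n.-tuple mR) -> \bar R}.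

Definition tcons (x : mR * n.-tuple mR) : n.+1.-tuple mR :=
  [tuple of x.1 :: x.2].

Lemma measurable_tcons : measurable_fun [set: mR * n.-tuple mR] tcons.
Proof.
exact: (measurable_cons (f := fst) (g := snd) measurable_fst measurable_snd).
Qed.

Definition cons_measure : set (n.+1.-tuple mR) -> \bar R :=
  pushforward (lebesgue_measure \x m)%E tcons.

Let cons_measure0 : cons_measure set0 = 0%E.
Proof. by rewrite /cons_measure /pushforward preimage_set0 measure0. Qed.

Let cons_measure_ge0 A : (0 <= cons_measure A)%E.
Proof.
rewrite /cons_measure /pushforward.
exact: (measure_ge0 (lebesgue_measure \x m)%E).
Qed.

Let cons_measure_sigma_additive : semi_sigma_additive cons_measure.
Proof.
move=> F mF tF mUF; rewrite /cons_measure /pushforward preimage_bigcup.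
apply: measure_semi_sigma_additive.
- by move=> k; rewrite -[X in measurable X]setTI; exact: measurable_tcons.
- apply/trivIsetP => /= i j _ _ ij; rewrite -preimage_setI.
  by move/trivIsetP : tF => /(_ _ _ _ _ ij) ->//; rewrite preimage_set0.
- by rewrite -preimage_bigcup -[X in measurable X]setTI; exact: measurable_tcons.
Qed.

HB.instance Definition _ := isMeasure.Build _ _ _ cons_measure
  cons_measure0 cons_measure_ge0 cons_measure_sigma_additive.

Let cons_measure_sigma_finite : sigma_finite setT cons_measure.
Proof.
have /sigma_finiteP[F [FT ndF mF]] := sigma_finiteT (@lebesgue_measure R).
have /sigma_finiteP[G [GT ndG mG]] := sigma_finiteT m.
pose tuncons (t : n.+1.-tuple mR) : mR * n.-tuple mR :=
  (tnth t ord0, [tuple of behead t]).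
have tconsK : cancel tcons tuncons.
  move=> [x t]; rewrite /tuncons /tcons /=; congr pair.
  exact/val_inj.
have tunconsm : measurable_fun setT tuncons.
  apply/measurable_fun_pairP; split.
    exact: measurable_tnth.
  exact: measurable_behead.
exists (fun k => tuncons @^-1` (F k `*` G k)).
  rewrite -preimage_bigcup -[LHS](preimage_setT tuncons); congr (_ @^-1` _).
  rewrite -setXTT FT GT predeqE => -[x y]; split.
    move=> [/= [j _ Fx] [k _ Gy]]; exists (maxn j k) => //; split => /=.
    - by move: x Fx; exact/subsetPset/ndF/leq_maxl.
    - by move: y Gy; exact/subsetPset/ndG/leq_maxr.
  by move=> [j _ []/= ? ?]; split; exists j.
move=> k; have [mFk Fkoo] := mF k; have [mGk Gkoo] := mG k; split.
  rewrite -[X in measurable X]setTI; apply: tunconsm => //.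
  exact: measurableX.
rewrite /cons_measure /pushforward -comp_preimage.
rewrite (_ : tuncons \o tcons = id); last first.
  by apply/funext => x /=; rewrite tconsK.
by rewrite preimage_id product_measure1E// lte_mul_pinfty// ge0_fin_numE.
Qed.

HB.instance Definition _ := Measure_isSigmaFinite.Build _ _ _ cons_measure
  cons_measure_sigma_finite.

End cons_measure.

Fixpoint tuple_lebesgue (R : realType) (n : nat) :
    {sigma_finite_measure set (n.-tuple (measurableTypeR R)) -> \bar R} :=
  match n with
  | 0 => dirac [tuple]
  | n.+1 => cons_measure (tuple_lebesgue R n)
  end.

Section lebesgue_rV.
Context (R : realType) (n : nat).

Definition lebesgue_outer (X : set 'rV[R]_n) : \bar R :=
  mu_ext (tuple_lebesgue R n) [set t | X (\row_i tnth t i)].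

Let lebesgue_outer0 : lebesgue_outer set0 = 0%E.
Proof. exact: outer_measure0. Qed.

Let lebesgue_outer_ge0 X : (0 <= lebesgue_outer X)%E.
Proof. exact: outer_measure_ge0. Qed.

Let le_lebesgue_outer : {homo lebesgue_outer : A B / A `<=` B >-> (A <= B)%E}.
Proof. by move=> A B AB; apply: le_outer_measure => t; exact: AB. Qed.

Let lebesgue_outer_sigma_subadditive : sigma_subadditive lebesgue_outer.
Proof.
move=> F; rewrite /lebesgue_outer.
exact: (outer_measure_sigma_subadditive (mu_ext (tuple_lebesgue R n))
  (fun k => [set t | F k (\row_i tnth t i)])).
Qed.

HB.instance Definition _ := isOuterMeasure.Build R 'rV[R]_n lebesgue_outer
  lebesgue_outer0 lebesgue_outer_ge0 le_lebesgue_outer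
  lebesgue_outer_sigma_subadditive.

End lebesgue_rV.

(* The Caratheodory-measurable sets of lebesgue_outer are the
   Lebesgue-measurable sets; the carrier is convertible to 'rV[R]_n. *)
Definition lebesgue (R : realType) (n : nat) :
    set (caratheodory_type (@lebesgue_outer R n)) -> \bar R :=
  @lebesgue_outer R n.
Arguments lebesgue : clear implicits.
HB.instance Definition _ (R : realType) (n : nat) :=
  isMeasure.Build _ _ _ (lebesgue R n)
    (@caratheodory_measure0 _ _ (@lebesgue_outer R n))
    (@caratheodory_measure_ge0 _ _ (@lebesgue_outer R n))
    (@caratheodory_measure_sigma_additive _ _ (@lebesgue_outer R n)).

Section sobolev.
Context (R : realType) (n : nat).
Implicit Types (O : set 'rV[R]_n) (u v phi : 'rV[R]_n -> R).
Implicit Types (G : 'rV[R]_n -> 'rV[R]_n) (i : 'I_n).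

Local Notation mu := (lebesgue R n).

(* The library's norm on 'rV[R]_n is the sup norm, so the Euclidean norm of a
   gradient goes through this product. *)
Definition dot (v w : 'rV[R]_n) : R := \sum_(i < n) v ord0 i * w ord0 i.

Definition ae_in O (P : 'rV[R]_n -> Prop) : Prop :=
  {ae mu, forall x, O x -> P x}.

(* Functions on O are total functions whose values off O are irrelevant. *)
Definition measurable_on O u : Prop :=
  measurable_fun (O : set (caratheodory_type (@lebesgue_outer R n))) u.

Definition Lp O (p : \bar R) u : Prop := u \_ O \in Lfun mu p.

Definition integ O u : R := \int[mu]_(x in O) u x.

Definition partial i u : 'rV[R]_n -> R :=
  fun x => 'D_(delta_mx ord0 i) (u : 'rV[R]_n -> R^o) x.

(* C^infinity: all iterated partial derivatives are (Frechet) differentiable. *)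
Definition smooth u : Prop := forall (s : seq 'I_n) (x : 'rV[R]_n),
  differentiable (foldr partial u s : 'rV[R]_n -> R^o) x.

Definition Cc_smooth O phi : Prop := smooth phi /\
  exists K : set 'rV[R]_n,
    [/\ compact K, K `<=` O & forall x, ~ K x -> phi x = 0].

Definition L1loc O u : Prop := forall K : set 'rV[R]_n,
  compact K -> K `<=` O -> Lp K 1%:E u.

Definition weak_gradient O u G : Prop :=
  [/\ L1loc O u, (forall i, L1loc O (fun x => G x ord0 i)) &
      forall phi i, Cc_smooth O phi ->
        integ O (fun x => u x * partial i phi x) =
        - integ O (fun x => G x ord0 i * phi x)].

(* A weak gradient is determined up to a null subset of O; the default value 0
   is taken when there is none. *)
Definition grad O u : 'rV[R]_n -> 'rV[R]_n :=
  xget (fun=> 0) [set G | weak_gradient O u G].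

Definition H1 O u : Prop :=
  [/\ Lp O 2%:E u, (exists G, weak_gradient O u G) &
      forall i, Lp O 2%:E (fun x => grad O u x ord0 i)].

Definition H1norm O u : \bar R :=
  ((\int[mu]_(x in O) ((u x) ^+ 2 + dot (grad O u x) (grad O u x))%:E)
     `^ (2^-1))%E.

Definition H10 O u : Prop := H1 O u /\
  forall e : R, 0 < e ->
    exists2 phi, Cc_smooth O phi & (H1norm O (u \- phi)%R < e%:E)%E.

End sobolev.

(* Main.v *)
(** Put [v = V(u)] with [V' = (1 + u)^(-p)], [V(0) = 0]. The equation becomes
    [- div (b grad v) + h(v) |grad v|^2 = f] with [h >= 0] singular at [0] and,
    when [p > 1], at the supremum of [V]. For [h] cut off to a bounded Lipschitz
    function and [|grad v|^2] truncated at [n^2], least nonnegative solutions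
    are obtained by monotone iteration. They decrease with [n] when [f] is
    bounded, and the solutions for the truncations of [f] increase; testing the
    equation of the larger one of two solutions with a function of the
    difference makes the gradients converge strongly in [L^2], so that the
    limits pass through the quadratic term. Positivity comes from testing with
    functions supported where [v] is small. The energy bound is
    [B int |grad u|^2 <= int f u^theta <= C + (B/2) int |grad u|^2], where the
    second step is Hoelder's and Sobolev's inequality, the exponent of [f] being
    the dual one of [2^* / theta], and Young's inequality since [theta < 2].

    This argument only uses the properties listed in [sobolev] of a class of
    pairs (function, gradient). They hold for the [L^2]-closure of the pairs
    [(phi, grad phi)] of test functions: the chain rule by Weierstrass
    approximation, uniqueness of the gradient by integration by parts and by
    test functions increasing to indicators of boxes, and Sobolev's inequality
    from Gagliardo's. *)
Require Import Defs.
From HB Require Import structures.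
From mathcomp Require Import all_boot all_order all_algebra.
From mathcomp Require Import all_classical all_reals all_analysis.
From mathcomp Require Import measurable_realfun ess_sup_inf ring lra.

Set Implicit Arguments.
Unset Strict Implicit.
Unset Printing Implicit Defensive.

Import Order.TTheory GRing.Theory Num.Theory.
Import numFieldNormedType.Exports.

Local Open Scope classical_set_scope.
Local Open Scope ring_scope.

(** * Real-valued integrals *)

(** The coefficient [b / (1 + u) ^ p] degenerates where [u] is large. In the unknown [v] the form is
    uniformly elliptic, at the price of a quadratic term that is not controlled at the two ends of
    the range of [v]. Near [0], [theta < 1] makes [t ^ (- theta)] integrable, and testing with its
    primitive bounds the mass of that term on [v < eps] by a power of [eps] ([tail_zero]). At the
    top, the total mass is at most the integral of [f], and Poincare's inequality for truncations of
    [u] turns this into a bound on the measure of [u > j + 1] ([profile_top]). In between, strong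
    convergence of truncated gradients suffices.

    The other obstacle is that the exponent of [f] may be below [2], so the integral of [f v] is not
    controlled. Solutions for truncated sources are therefore compared through the bounded quantity
    [c v / (1 + c v)]. Its concavity produces a term of the wrong sign, of order [|grad v|^2], and
    the lower bound [2 beta c <= h (1 + c t)] on the profile dominates it; [theta < 1] again allows
    the choice of [c]. *)

Lemma cvg_ler_const (R : realType) (u : nat -> R) (l c : R) :
  u @ \oo --> l -> (forall n, u n <= c) -> l <= c.
Proof.
move=> ul uc; rewrite -(cvg_lim _ ul)//; apply: limr_le; first exact: cvgP ul.
exact: nearW.
Qed.

Lemma cvg_ger_const (R : realType) (u : nat -> R) (l c : R) :
  u @ \oo --> l -> (forall n, c <= u n) -> c <= l.
Proof.
move=> ul uc; rewrite -(cvg_lim _ ul)//; apply: limr_ge; first exact: cvgP ul.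
exact: nearW.
Qed.

Lemma cvg_sqr (R : realType) (u : nat -> R) (l : R) :
  u @ \oo --> l -> u n ^+ 2 @[n --> \oo] --> l ^+ 2.
Proof.
by move=> ul; under eq_fun do rewrite expr2; rewrite expr2; exact: cvgM.
Qed.

Section integration.
Context d (T : measurableType d) (R : realType).
Variable mu : {measure set T -> \bar R}.
Implicit Types f g : T -> R.

Definition L1 f := mu.-integrable setT (EFin \o f).
Definition L2 f := measurable_fun setT f /\ L1 (fun x => f x ^+ 2).
Definition Int f : R := \int[mu]_x f x.

Lemma L1_mf f : L1 f -> measurable_fun setT f.
Proof. by move=> /measurable_int /measurable_EFinP. Qed.

Lemma L1_dom f g : measurable_fun setT f -> L1 g ->
  (\forall x \ae mu, `|f x| <= g x) -> L1 f.
Proof.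
move=> mf ig fg; apply/integrableP; split; first exact/measurable_EFinP.
have mg := L1_mf ig.
move/integrableP : ig => [_]; apply: le_lt_trans.
apply: ae_ge0_le_integral => //.
- by apply/measurable_EFinP; exact: measurableT_comp.
- by apply/measurableT_comp => //; exact/measurable_EFinP.
- apply: filterS fg => x fg _ /=.
  by rewrite lee_fin (le_trans fg)// ler_norm.
Qed.

Lemma L1_domT f g : measurable_fun setT f -> L1 g ->
  (forall x, `|f x| <= g x) -> L1 f.
Proof. by move=> mf ig fg; apply: (L1_dom mf ig); exact: aeW. Qed.

Lemma L1_ae_eq f g : measurable_fun setT g -> L1 f ->
  (\forall x \ae mu, f x = g x) -> L1 g.
Proof.
move=> mg if_ fg; apply: (@L1_dom _ (fun x => `|f x|)) => //.
  exact: integrable_norm.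
by apply: filterS fg => x ->.
Qed.

Lemma L1D f g : L1 f -> L1 g -> L1 (fun x => f x + g x).
Proof. by move=> i1 i2; have := integrableD measurableT i1 i2. Qed.

Lemma L1B f g : L1 f -> L1 g -> L1 (fun x => f x - g x).
Proof. by move=> i1 i2; have := integrableB measurableT i1 i2. Qed.

Lemma L1N f : L1 f -> L1 (fun x => - f x).
Proof. by move=> i1; have := integrableN i1. Qed.

Lemma L1Z k f : L1 f -> L1 (fun x => k * f x).
Proof. by move=> i1; have := integrableZl measurableT k i1. Qed.

Lemma L1_norm f : L1 f -> L1 (fun x => `|f x|).
Proof. exact: integrable_norm. Qed.

Lemma L1_0 : L1 (fun=> 0).
Proof. exact: (integrable0 mu setT). Qed.


Lemma L1_sum (J : Type) (s : seq J) (F : J -> T -> R) :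
  (forall j, L1 (F j)) -> L1 (fun x => \sum_(j <- s) F j x).
Proof.
move=> iF; elim: s => [|j s ih].
  by under eq_fun do rewrite big_nil; exact: L1_0.
by under eq_fun do rewrite big_cons; exact: L1D.
Qed.

Lemma L1_mulbdd (m : T -> R) f C : measurable_fun setT m -> (forall x, `|m x| <= C) ->
  L1 f -> L1 (fun x => m x * f x).
Proof.
move=> mm mC if_; apply: (@L1_domT _ (fun x => C * `|f x|)).
- by apply: measurable_funM => //; exact: L1_mf.
- by apply: L1Z; exact: L1_norm.
- by move=> x; rewrite normrM ler_wpM2r.
Qed.

Lemma IntD f g : L1 f -> L1 g -> Int (fun x => f x + g x) = Int f + Int g.
Proof. by move=> ? ?; rewrite /Int RintegralD. Qed.

Lemma IntB f g : L1 f -> L1 g -> Int (fun x => f x - g x) = Int f - Int g.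
Proof. by move=> ? ?; rewrite /Int RintegralB. Qed.

Lemma IntZ k f : L1 f -> Int (fun x => k * f x) = k * Int f.
Proof. by move=> ?; rewrite /Int RintegralZl. Qed.

Lemma IntN f : L1 f -> Int (fun x => - f x) = - Int f.
Proof.
move=> if_; rewrite -[RHS]mulN1r -IntZ//.
by congr Int; apply/funext => x; rewrite mulN1r.
Qed.

Lemma Int0 : Int (fun=> 0) = 0.
Proof. by rewrite /Int /Rintegral integral0. Qed.

Lemma Int_sum (J : Type) (s : seq J) (F : J -> T -> R) :
  (forall j, L1 (F j)) ->
  Int (fun x => \sum_(j <- s) F j x) = \sum_(j <- s) Int (F j).
Proof.
move=> iF; elim: s => [|j s ih].
  by rewrite big_nil -[RHS]Int0; congr Int; apply/funext => x; rewrite big_nil.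
rewrite big_cons -ih -IntD//; last exact: L1_sum.
by congr Int; apply/funext => x; rewrite big_cons.
Qed.

Lemma IntE f : L1 f -> (Int f)%:E = (\int[mu]_x (f x)%:E)%E.
Proof. by move=> if_; rewrite /Int /Rintegral fineK//; exact: integrable_fin_num. Qed.

Lemma Int_ae_eq f g : measurable_fun setT f -> measurable_fun setT g ->
  (\forall x \ae mu, f x = g x) -> Int f = Int g.
Proof.
move=> mf mg fg; rewrite /Int /Rintegral; congr fine.
apply: ae_eq_integral => //; [exact/measurable_EFinP|exact/measurable_EFinP|].
by apply: filterS fg => x /= -> _.
Qed.

Lemma Int_ge0 f : (forall x, 0 <= f x) -> 0 <= Int f.
Proof. by move=> f0; apply: Rintegral_ge0. Qed.

Lemma Int_ge0_ae f : measurable_fun setT f -> (\forall x \ae mu, 0 <= f x) -> 0 <= Int f.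
Proof.
move=> mf f0; rewrite (@Int_ae_eq _ (fun x => `|f x|))//.
- by apply: Int_ge0.
- exact: measurableT_comp.
- by apply: filterS f0 => x f0; rewrite ger0_norm.
Qed.

Lemma Int_le f g : L1 f -> L1 g -> (\forall x \ae mu, f x <= g x) -> Int f <= Int g.
Proof.
move=> if_ ig fg; rewrite -subr_ge0 -IntB//; apply: Int_ge0_ae.
  by apply: measurable_funB; exact: L1_mf.
by apply: filterS fg => x; rewrite subr_ge0.
Qed.

Lemma Int_leT f g : L1 f -> L1 g -> (forall x, f x <= g x) -> Int f <= Int g.
Proof. by move=> ? ? fg; apply: Int_le => //; exact: aeW. Qed.

Lemma Int_abs f : L1 f -> `|Int f| <= Int (fun x => `|f x|).
Proof. exact: le_normr_Rintegral. Qed.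

Lemma Int_eq0 f : L1 f -> (\forall x \ae mu, 0 <= f x) -> Int f <= 0 ->
  \forall x \ae mu, f x = 0.
Proof.
move=> if_ f0 If.
have [mf _] := integrableP _ _ _ if_.
have : ae_eq mu setT (EFin \o f) (cst 0%E).
  apply/ae_eq_integral_abs => //.
  have -> : (\int[mu]_x `|(EFin \o f) x| = \int[mu]_x (f x)%:E)%E.
    apply: ae_eq_integral => //; first exact: measurableT_comp.
    by apply: filterS f0 => x f0 _ /=; rewrite ger0_norm.
  rewrite -IntE//; congr EFin; apply/eqP; rewrite eq_le If/=.
  by apply: Int_ge0_ae => //; exact: L1_mf.
by apply: filterS => x /(_ I) [].
Qed.

Lemma Int_dct (f_ : nat -> T -> R) f g : (forall n, measurable_fun setT (f_ n)) ->
  measurable_fun setT f -> L1 g ->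
  (forall n, \forall x \ae mu, `|f_ n x| <= g x) ->
  (\forall x \ae mu, f_ ^~ x @ \oo --> f x) ->
  L1 f /\ Int (f_ n) @[n --> \oo] --> Int f.
Proof.
move=> mf_ mf ig f_g f_f.
have [||||i1 _ cv] := @dominated_convergence _ T R mu _ measurableT
    (fun n x => (f_ n x)%:E) (EFin \o f) (EFin \o g) _ _ _ ig.
- by move=> n; exact/measurable_EFinP.
- exact/measurable_EFinP.
- apply: filterS f_f => x fx _ /=.
  by apply: cvg_EFin => //; exact: nearW.
- apply: filterS (ae_foralln f_g) => x H n _ /=; rewrite lee_fin; exact: H.
split => //.
apply: fine_cvg.
rewrite -/(Rintegral mu setT f) fineK//; exact: integrable_fin_num.
Qed.

(** Integrability of the limit belongs to the conclusion: [Int] of a nonnegative function with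
    infinite integral is the default value [0], so that the bound alone would say nothing. *)
Lemma Int_fatou (f_ : nat -> T -> R) f C : (forall n, L1 (f_ n)) ->
  (forall n x, 0 <= f_ n x) -> measurable_fun setT f ->
  (\forall x \ae mu, f_ ^~ x @ \oo --> f x) ->
  (forall n, Int (f_ n) <= C) ->
  L1 f /\ Int f <= C.
Proof.
move=> if_ f_0 mf f_f f_C.
have [A [mA A0 AP]] := f_f.
have f0 : \forall x \ae mu, 0 <= f x.
  apply: filterS f_f => x fx.
  rewrite -(cvg_lim _ fx)//; apply: limr_ge; first by apply/cvg_ex; eexists; exact: fx.
  by apply: nearW => n; exact: f_0.
have le : (\int[mu]_x `|(f x)%:E| <= C%:E)%E.
  have -> : (\int[mu]_x `|(f x)%:E| = \int[mu]_x limn_einf (fun n => (f_ n x)%:E))%E.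
    apply: ae_eq_integral => //.
    - by apply: measurableT_comp => //; exact/measurable_EFinP.
    - under eq_fun do rewrite /limn_einf.
      apply: measurableT_comp => //.
      apply: measurable_fun_limn_esup => n /=.
      by apply/measurable_EFinP; apply: measurable_funN; exact: L1_mf.
    - apply: filterS2 f_f f0 => x fx f0 _.
      rewrite /= ger0_norm//; apply/esym.
      have cvE : (f_ n x)%:E @[n --> \oo] --> (f x)%:E.
        by apply: cvg_EFin => //; exact: nearW.
      by rewrite is_cvg_limn_einfE; [exact: cvg_lim cvE|apply/cvg_ex; eexists; exact: cvE].
  apply: le_trans (fatou mu measurableT _ _) _.
  - by move=> n; apply/measurable_EFinP; exact: L1_mf.
  - by move=> n x _; rewrite lee_fin.
  - apply: le_trans (limn_einf_sup _) _.
    rewrite limn_esup_lim.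
    apply: lime_le; first exact: is_cvg_esups.
    apply: nearW => n; apply: ge_ereal_sup => _ [m /= nm <-].
    by rewrite -IntE// lee_fin.
have if1 : L1 f.
  apply/integrableP; split; first exact/measurable_EFinP.
  by rewrite (le_lt_trans le)// ltry.
split => //.
rewrite -lee_fin IntE//; apply: le_trans le; apply: (le_integral _ if1) => //.
  by apply: integrable_abse; exact: if1.
by move=> x _; rewrite lee_fin/= ler_norm.
Qed.

Lemma L2_mf f : L2 f -> measurable_fun setT f. Proof. by case. Qed.

Lemma L2_dom f g : measurable_fun setT f -> L2 g ->
  (\forall x \ae mu, `|f x| <= g x) -> L2 f.
Proof.
move=> mf [mg ig] fg; split=> //.
apply: (L1_dom _ ig); first exact: measurable_funX.
apply: filterS fg => x fg.
by rewrite normrX lerXn2r// ?nnegrE ?(le_trans _ fg)//.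
Qed.

Lemma L2D f g : L2 f -> L2 g -> L2 (fun x => f x + g x).
Proof.
move=> [mf if_] [mg ig]; have mfg := measurable_funD mf mg; split => //.
apply: (@L1_domT _ (fun x => 2 * f x ^+ 2 + 2 * g x ^+ 2)).
- exact: measurable_funX.
- by apply: L1D; exact: L1Z.
- by move=> x; rewrite ger0_norm ?sqr_ge0//; have := sqr_ge0 (f x - g x); nra.
Qed.

Lemma L2Z k f : L2 f -> L2 (fun x => k * f x).
Proof.
move=> [mf if_]; split; first exact: measurable_funM.
by under eq_fun do rewrite exprMn; exact: L1Z.
Qed.

Lemma L2N f : L2 f -> L2 (fun x => - f x).
Proof. by move=> /(L2Z (-1)); under eq_fun do rewrite mulN1r. Qed.

Lemma L2B f g : L2 f -> L2 g -> L2 (fun x => f x - g x).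
Proof. by move=> L2f /L2N; exact: L2D. Qed.

Lemma L2_0 : L2 (fun=> 0).
Proof. by split => //; under eq_fun do rewrite expr0n/=; exact: L1_0. Qed.

Lemma L2_sum (J : Type) (s : seq J) (F : J -> T -> R) :
  (forall j, L2 (F j)) -> L2 (fun x => \sum_(j <- s) F j x).
Proof.
move=> iF; elim: s => [|j s ih].
  by under eq_fun do rewrite big_nil; exact: L2_0.
by under eq_fun do rewrite big_cons; exact: L2D.
Qed.

Lemma L2_norm f : L2 f -> L2 (fun x => `|f x|).
Proof.
move=> [mf if_]; split; first exact: measurableT_comp.
by under eq_fun do rewrite (real_normK (num_real _)).
Qed.

Lemma L2_mul f g : L2 f -> L2 g -> L1 (fun x => f x * g x).
Proof.
move=> [mf if_] [mg ig].
apply: (@L1_domT _ (fun x => f x ^+ 2 + g x ^+ 2)).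
- exact: measurable_funM.
- exact: L1D.
- move=> x; rewrite ler_norml; apply/andP; split.
    by have := sqr_ge0 (f x + g x); have := sqr_ge0 (f x - g x); nra.
  by have := sqr_ge0 (f x - g x); have := sqr_ge0 (f x + g x); nra.
Qed.

Lemma L2_mulbdd (m : T -> R) f C : measurable_fun setT m -> (forall x, `|m x| <= C) ->
  L2 f -> L2 (fun x => m x * f x).
Proof.
move=> mm mC L2f.
apply: (@L2_dom _ (fun x => C * `|f x|)).
- by apply: measurable_funM => //; exact: L2_mf.
- by apply: L2Z; exact: L2_norm.
- by apply: aeW => x; rewrite normrM ler_wpM2r.
Qed.

Lemma L2_ae_eq f g : measurable_fun setT g -> L2 f ->
  (\forall x \ae mu, f x = g x) -> L2 g.
Proof.
move=> mg L2f fg; apply: (L2_dom mg (L2_norm L2f)).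
by apply: filterS fg => x ->.
Qed.

Lemma Int_CS f g : L2 f -> L2 g ->
  Int (fun x => f x * g x) ^+ 2 <=
  Int (fun x => f x ^+ 2) * Int (fun x => g x ^+ 2).
Proof.
move=> L2f L2g.
have [[mf if_] [mg ig]] := (L2f, L2g).
have ifg := L2_mul L2f L2g.
set a := Int (fun x => f x ^+ 2); set b := Int (fun x => g x ^+ 2).
set c := Int (fun x => f x * g x).
have a0 : 0 <= a by apply: Int_ge0 => x; rewrite sqr_ge0.
have b0 : 0 <= b by apply: Int_ge0 => x; rewrite sqr_ge0.
have key t : 0 <= a + (2 * t) * c + t ^+ 2 * b.
  rewrite -IntZ// -IntZ// -IntD//; [|exact: L1Z].
  rewrite -IntD//; [|by apply: L1D => //; exact: L1Z|exact: L1Z].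
  apply: Int_ge0 => x; have := sqr_ge0 (f x + t * g x).
  by congr (0 <= _); ring.
have [b_0|b_neq0] := eqVneq b 0.
  have [c0|c_neq0] := eqVneq c 0; first by rewrite c0 expr0n mulr_ge0.
  (* When the coefficient of [t ^+ 2] is [0] the expression is affine in [t]; this [t] gives it the
     value [-1]. *)
  have := key (- (a + 1) / (2 * c)); rewrite b_0 mulr0 addr0.
  have -> : 2 * (- (a + 1) / (2 * c)) * c = - (a + 1) by field.
  lra.
have := key (- c / b).
have -> : a + 2 * (- c / b) * c + (- c / b) ^+ 2 * b = (a * b - c ^+ 2) / b.
  by field.
by rewrite pmulr_lge0 ?subr_ge0// invr_gt0 lt_neqAle eq_sym b_neq0.
Qed.

Lemma Int_sqr_ae_eq f g : L2 f -> L2 g -> Int (fun x => (f x - g x) ^+ 2) <= 0 ->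
  \forall x \ae mu, f x = g x.
Proof.
move=> L2f L2g /Int_eq0 h.
have : \forall x \ae mu, (f x - g x) ^+ 2 = 0.
  apply: h; first by case: (L2B L2f L2g).
  by apply: aeW => x; rewrite sqr_ge0.
by apply: filterS => x /eqP; rewrite sqrf_eq0 subr_eq0 => /eqP.
Qed.

Section finite.
Hypothesis finmu : (mu setT < +oo)%E.

Lemma L1_cst c : L1 (fun=> c).
Proof.
apply/integrableP; split; first exact/measurable_EFinP.
rewrite integral_cst//= lte_mul_pinfty//.
Qed.

Lemma L1_bdd f C : measurable_fun setT f -> (forall x, `|f x| <= C) -> L1 f.
Proof. by move=> mf fC; apply: (L1_domT mf (L1_cst C)). Qed.

Lemma L2_cst c : L2 (fun=> c).
Proof. by split => //; exact: L1_cst. Qed.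

Lemma L2_bdd f C : measurable_fun setT f -> (forall x, `|f x| <= C) -> L2 f.
Proof. by move=> mf fC; apply: (L2_dom mf (L2_cst C)); exact: aeW. Qed.

Lemma L2_L1 f : L2 f -> L1 f.
Proof.
move=> L2f; have := L2_mul (L2_cst 1) L2f.
by under eq_fun do rewrite mul1r.
Qed.

End finite.

Lemma geo_cvg (x : nat -> R) q : (forall k, `|x k.+1 - x k| <= 2 ^- k * q) ->
  cvgn x /\ forall n, `|x n - x 0%N| <= 2 * q.
Proof.
move=> xq.
have q0 : 0 <= q by have := le_trans (normr_ge0 _) (xq 0%N); rewrite expr0 invr1 mul1r.
have bd n : \sum_(0 <= k < n) `|x k.+1 - x k| <= 2 * q.
  apply: (@le_trans _ _ (2 * (1 - 2 ^- n) * q)).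
    elim: n => [|n ih]; first by rewrite big_geq// expr0 invr1 subrr mulr0 mul0r.
    rewrite big_nat_recr//=; apply: le_trans (lerD ih (xq n)) _.
    rewrite exprS invfM le_eqVlt; apply/orP; left; apply/eqP; field.
    by rewrite expf_neq0.
  rewrite ler_wpM2r// -[leRHS]mulr1 ler_wpM2l//.
have tel n : x n - x 0%N = \sum_(0 <= k < n) (x k.+1 - x k).
  by rewrite telescope_sumr.
split; last first.
  by move=> n; rewrite tel (le_trans (ler_norm_sum _ _ _))//.
have : cvgn (series (fun k => x k.+1 - x k)).
  apply: normed_cvg; apply: nondecreasing_is_cvgn.
    apply/nondecreasing_seqP => n.
    change (\sum_(0 <= k < n) `|x k.+1 - x k| <= \sum_(0 <= k < n.+1) `|x k.+1 - x k|).
    by rewrite big_nat_recr//= lerDl.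
  by exists (2 * q) => _ [n _ <-]; exact: bd.
have E : (fun=> x 0%N) + series (fun k => x k.+1 - x k) = x.
  apply/funext => n; change (x 0%N + \sum_(0 <= k < n) (x k.+1 - x k) = x n).
  by rewrite -tel addrC subrK.
by move=> /(is_cvgD (is_cvg_cst (x 0%N))); rewrite E.
Qed.

(* Fast subsequence: along it the increments are dominated by [2^-k] times a
   fixed square-integrable function, as every term of the series is bounded by
   its sum. *)
Lemma L2_family_limit (J : finType) (F : nat -> J -> T -> R) :
  (forall n j, L2 (F n j)) ->
  (forall e, 0 < e -> exists N, forall n m, (N <= n)%N -> (N <= m)%N ->
     forall j, Int (fun x => (F n j x - F m j x) ^+ 2) <= e) ->
  exists (f : J -> T -> R) (s : nat -> nat) (g : T -> R),
  [/\ (forall j, L2 (f j)),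
      (forall j, Int (fun x => (F n j x - f j x) ^+ 2) @[n --> \oo] --> 0),
      {homo s : m n / (m < n)%N}, L2 g &
      \forall x \ae mu, forall j, F (s n) j x @[n --> \oo] --> f j x /\
         forall n, `|F (s n) j x| <= g x].
Proof.
move=> L2F cau.
(* The weight [4 ^+ k] in [a] uses up one of the two factors [4 ^- k] in [16 ^- k]: the integrals of
   [a k] remain summable, and the square root of the weight yields the decay [2 ^- k] of the
   increments. *)
have e0 k : 0 < (16 ^- k : R) by rewrite invr_gt0 exprn_gt0.
have [N NP] := choice (fun k => cau _ (e0 k)).
pose s := fix s k := if k is k'.+1 then maxn (N k) (s k').+1 else N 0%N.
have sS k : (s k < s k.+1)%N by rewrite /= leq_max leqnn orbT.
have shomo : {homo s : m n / (m < n)%N} by apply: homo_ltn => //; exact: ltn_trans.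
have sN k : (N k <= s k)%N by case: k => //= k; rewrite leq_max leqnn.
have sge k : (k <= s k)%N.
  by elim: k => // k ih; exact: leq_ltn_trans (sS k).
pose a k x := \sum_j 4 ^+ k * (F (s k.+1) j x - F (s k) j x) ^+ 2.
have a_0 k x : 0 <= a k x.
  by apply: sumr_ge0 => j _; rewrite mulr_ge0 ?sqr_ge0// exprn_ge0.
have L1a k : L1 (a k).
  by apply: L1_sum => j; apply: L1Z; case: (L2B (L2F (s k.+1) j) (L2F (s k) j)).
have ma k : measurable_fun setT (a k) by exact: L1_mf.
have Ia k : Int (a k) <= #|J|%:R * 4 ^- k.
  rewrite /a Int_sum; last first.
    by move=> j; apply: L1Z; case: (L2B (L2F (s k.+1) j) (L2F (s k) j)).
  rewrite mulr_natl -sumr_const; apply: ler_sum => j _.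
  rewrite IntZ; last by case: (L2B (L2F (s k.+1) j) (L2F (s k) j)).
  have := NP k (s k.+1) (s k) (leq_trans (sN k) (ltnW (sS k))) (sN k) j.
  move=> /(ler_wpM2l (exprn_ge0 k (ler0n R 4))) /le_trans; apply.
  rewrite (_ : 16 = 4 * 4) ?exprMn; last by rewrite -natrM.
  by rewrite invfM mulrA divff ?mul1r// expf_neq0.
pose h x := (\sum_(0 <= k <oo) (a k x)%:E)%E.
have mh : measurable_fun setT h.
  apply: ge0_emeasurable_sum => //; first by move=> k x _ _; rewrite lee_fin.
  by move=> k _; exact/measurable_EFinP.
have h0 x : (0 <= h x)%E by apply: nneseries_ge0 => k _ _; rewrite lee_fin.
have ih : mu.-integrable setT h.
  apply/integrableP; split => //.
  under eq_integral do rewrite gee0_abs//.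
  rewrite integral_nneseries//; [|by move=> k; exact/measurable_EFinP|
    by move=> k x _; rewrite lee_fin].
  apply: (@le_lt_trans _ _ (#|J|%:R * 2)%:E); last exact: ltry.
  apply: lime_le.
    by apply: is_cvg_nneseries => k _ _; apply: integral_ge0 => x _; rewrite lee_fin.
  apply: nearW => n.
  under eq_bigr do rewrite -IntE//.
  rewrite sumEFin lee_fin.
  apply: (@le_trans _ _ (\sum_(0 <= k < n) #|J|%:R * 4 ^- k)).
    by apply: ler_sum => k _.
  rewrite -mulr_sumr ler_wpM2l//.
  apply: (@le_trans _ _ (4 / 3 * (1 - 4 ^- n))).
    elim: n => [|n ih]; first by rewrite big_geq// expr0 invr1 subrr mulr0.
    rewrite big_nat_recr//=; apply: le_trans (lerD ih (lexx _)) _.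
    rewrite exprS invfM le_eqVlt; apply/orP; left; apply/eqP; field.
    by rewrite expf_neq0.
  have : 0 <= (4 ^- n : R) by rewrite invr_ge0 exprn_ge0.
  lra.
pose A := [set x | h x \is a fin_num].
have mA : measurable A.
  by rewrite -[A]setTI; exact: emeasurable_fin_num.
have aeA : \forall x \ae mu, A x.
  by apply: filterS (integrable_ae measurableT ih) => x /(_ Logic.I).
pose q x := Num.sqrt (fine (h x)).
have aq x k j : A x -> `|F (s k.+1) j x - F (s k) j x| <= 2 ^- k * q x.
  move=> Ax; rewrite ler_pdivlMl ?exprn_gt0// -(@ler_pXn2r _ 2)//; last first.
    by rewrite nnegrE sqrtr_ge0.
    by rewrite nnegrE mulr_ge0 ?exprn_ge0.
  rewrite exprMn real_normK ?num_real// sqr_sqrtr ?fine_ge0//.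
  rewrite -exprM mulnC exprM (_ : 2 ^+ 2 = 4 :> R); last by rewrite expr2 -natrM.
  apply: (@le_trans _ _ (a k x)).
    rewrite /a (bigD1 j)//= lerDl; apply: sumr_ge0 => i _.
    by rewrite mulr_ge0 ?sqr_ge0// exprn_ge0.
  rewrite -lee_fin fineK// (le_trans _ (nneseries_lim_ge k.+1 _))//.
    by rewrite big_nat_recr//= leeDr// sume_ge0// => i _; rewrite lee_fin.
  by move=> i _ _; rewrite lee_fin.
pose f j x := limn (fun n => F (s n) j x * \1_A x).
have fA j x : A x -> F (s n) j x @[n --> \oo] --> f j x.
  move=> Ax; have [+ _] := @geo_cvg (fun k => F (s k) j x) (q x) (fun k => aq x k j Ax).
  rewrite (_ : (fun k => F (s k) j x) = fun n => F (s n) j x * \1_A x)//.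
  by apply/funext => n; rewrite indicE mem_set// mulr1.
have mf j : measurable_fun setT (f j).
  apply: (@measurable_fun_cvg _ _ _ setT (fun n x => F (s n) j x * \1_A x)).
    move=> n; apply: measurable_funM; first exact: L2_mf.
    exact: measurable_indic.
  move=> x _; have [Ax|nAx] := pselect (A x).
    rewrite (_ : (fun _ => _) = fun n => F (s n) j x); first exact: fA.
    by apply/funext => n; rewrite indicE mem_set// mulr1.
  have F0 : (fun n => F (s n) j x * \1_A x) = fun=> 0.
    by apply/funext => n; rewrite indicE memNset// mulr0.
  by rewrite /f F0 lim_cst//; exact: cvg_cst.
pose g x := \sum_j `|F (s 0%N) j x| + 2 * (q x * \1_A x).
have mq : measurable_fun setT q.
  have msqrt : measurable_fun setT (@Num.sqrt R).
    by apply: continuous_measurable_fun; exact: sqrt_continuous.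
  apply: (measurableT_comp msqrt).
  by apply: measurableT_comp => //; exact: measurable_fine.
have L2q : L2 (fun x => q x * \1_A x).
  split; first by apply: measurable_funM => //; exact: measurable_indic.
  apply: (@L1_ae_eq (fun x => fine (h x))).
  - apply: measurable_funX; apply: measurable_funM => //; exact: measurable_indic.
  - apply/integrableP; split.
      by apply/measurable_EFinP; apply: measurableT_comp => //; exact: measurable_fine.
    have /integrableP[_] := ih; apply: le_lt_trans.
    rewrite le_eqVlt; apply/orP; left; apply/eqP.
    apply: ae_eq_integral => //.
    + apply: measurableT_comp => //; apply/measurable_EFinP.
      by apply: measurableT_comp => //; exact: measurable_fine.
    + exact: measurableT_comp.
    + by apply: filterS aeA => x Ax _ /=; rewrite -[in RHS](fineK Ax).
  - apply: filterS aeA => x Ax.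
    by rewrite indicE mem_set// mulr1 sqr_sqrtr// fine_ge0.
have L2g : L2 g.
  apply: L2D; first by apply: L2_sum => j; apply: L2_norm.
  exact: L2Z.
have main : \forall x \ae mu, forall j, F (s n) j x @[n --> \oo] --> f j x /\
         forall n, `|F (s n) j x| <= g x.
  apply: filterS aeA => x Ax j; split; first exact: fA.
  move=> n; have [_ /(_ n) bd] := @geo_cvg (fun k => F (s k) j x) (q x) (fun k => aq x k j Ax).
  rewrite /g indicE mem_set// mulr1 (bigD1 j)//=.
  have := ler_normD (F (s n) j x - F (s 0%N) j x) (F (s 0%N) j x).
  rewrite subrK => /le_trans; apply.
  have : 0 <= \sum_(i | i != j) `|F (s 0%N) i x| by apply: sumr_ge0.
  by move: bd; rewrite /=; lra.
have L2f j : L2 (f j).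
  apply: (L2_dom (mf j) L2g); apply: filterS main => x /(_ j)[cv bd].
  exact: cvg_ler_const (cvg_norm cv) bd.
exists f, s, g; split => // j.
apply/cvgrPdist_le => e e_gt0.
have [M MP] := cau _ e_gt0.
near=> n.
rewrite sub0r normrN ger0_norm; last by apply: Int_ge0 => x; rewrite sqr_ge0.
(* Fatou's lemma along the shifted subsequence turns the Cauchy estimate into a bound on the
   distance to the limit, for the whole sequence. *)
have [//|||||] := @Int_fatou (fun m x => (F n j x - F (s (m + M)%N) j x) ^+ 2)
  (fun x => (F n j x - f j x) ^+ 2) e.
- by move=> m; case: (L2B (L2F n j) (L2F (s (m + M)%N) j)).
- by move=> m x; rewrite sqr_ge0.
- by apply: measurable_funX; apply: measurable_funB => //; exact: L2_mf.
- apply: filterS main => x /(_ j)[cv _].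
  apply: cvg_sqr; apply: cvgB; first exact: cvg_cst.
  by rewrite (cvg_shiftn M (fun n => F (s n) j x)).
- move=> m; apply: MP; first by near: n; exists M.
  exact: leq_trans (leq_addl m M) (sge _).
- by [].
Unshelve. all: by end_near. Qed.

End integration.

Lemma cvg_sumr (R : realType) (J : Type) (s : seq J) (F : nat -> J -> R) (l : J -> R) :
  (forall j, F n j @[n --> \oo] --> l j) ->
  \sum_(j <- s) F n j @[n --> \oo] --> \sum_(j <- s) l j.
Proof.
move=> Fl; elim: s => [|j s ih].
  by rewrite big_nil; under eq_fun do rewrite big_nil; exact: cvg_cst.
by rewrite big_cons; under eq_fun do rewrite big_cons; exact: cvgD.
Qed.

Lemma near_natS_gt (R : realType) (r : R) : \forall n \near \oo, r < n.+1%:R.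
Proof.
near=> n; apply: (@lt_le_trans _ _ n%:R); last by rewrite ler_nat.
by near: n; exact: nbhs_infty_gtr.
Unshelve. all: by end_near. Qed.

Lemma squeeze0 (R : realType) (u v : nat -> R) :
  (forall n, `|u n| <= v n) -> v @ \oo --> 0 -> u @ \oo --> 0.
Proof.
move=> uv v0; apply: (@squeeze_cvgr _ _ _ _ (fun n => - v n) v) => //.
  by apply: nearW => n; rewrite -ler_norml.
by rewrite -oppr0; exact: cvgN.
Qed.

Lemma cvgZ0 (R : realType) (u : nat -> R) (c : R) :
  u @ \oo --> 0 -> c * u n @[n --> \oo] --> 0.
Proof.
move=> u0; rewrite [X in _ --> X](_ : _ = c * 0); last by rewrite mulr0.
by apply: cvgM => //; exact: cvg_cst.
Qed.

(** * Smooth approximations of truncations *)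

Section calculus.
Context (R : realType).
Implicit Types (t e M : R).

Definition sqe e t := Num.sqrt (t ^+ 2 + e ^+ 2).

Lemma sqe_gt0 e t : 0 < e -> 0 < sqe e t.
Proof. by move=> e0; rewrite sqrtr_gt0 ltr_wpDl ?sqr_ge0// exprn_gt0. Qed.

Lemma sqe_ge e t : `|t| <= sqe e t.
Proof. by rewrite -sqrtr_sqr ler_wsqrtr// lerDl sqr_ge0. Qed.

Lemma sqe_gt e t : 0 < e -> `|t| < sqe e t.
Proof.
move=> e0; rewrite -sqrtr_sqr ltr_sqrt ?ltrDl ?exprn_gt0//.
by rewrite ltr_wpDl ?sqr_ge0// exprn_gt0.
Qed.

Lemma sqe_le e t : 0 <= e -> sqe e t <= `|t| + e.
Proof.
move=> e0; rewrite -[leRHS]ger0_norm ?addr_ge0// -sqrtr_sqr ler_wsqrtr//.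
rewrite sqrrD real_normK ?num_real// -addrA lerD2l lerDr.
by rewrite mulrn_wge0// mulr_ge0.
Qed.

Lemma is_derive_sqe e t : 0 < e ->
  is_derive t (1 : R) (sqe e) (t / sqe e t).
Proof.
move=> e0; have p0 : 0 < t ^+ 2 + e ^+ 2 by rewrite ltr_wpDl ?sqr_ge0// exprn_gt0.
have d1 : is_derive t (1 : R) (fun t : R => t ^+ 2 + e ^+ 2 : R) (2 * t).
  by apply: is_derive_eq; rewrite /GRing.scale/=; ring.
have := @is_derive1_comp R Num.sqrt (fun t : R => t ^+ 2 + e ^+ 2) t _ _ (is_derive1_sqrt p0) d1.
move=> h; apply: is_derive_eq; rewrite /sqe; field.
by rewrite gt_eqF// sqrtr_gt0.
Qed.

Definition clip M t := Num.max 0 (Num.min M t).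

(** [clipE] writes [clip] with two absolute values; here each of them is replaced by [sqe e]. The
    derivative stays bounded by [1] uniformly in [e]. *)
Definition clipe M e t := (sqe e t - sqe e (t - M) + M) / 2.
Definition dclipe M e t := (t / sqe e t - (t - M) / sqe e (t - M)) / 2.

Lemma clipE M t : 0 <= M -> clip M t = (`|t| - `|t - M| + M) / 2.
Proof.
move=> M0; rewrite /clip /Num.max /Num.min.
by case: (ltrP M t) => ?; case: ltrP => ?; case: (ger0P t) => ?; case: (ger0P (t - M)) => ?; lra.
Qed.

Lemma clip_ge0 M t : 0 <= clip M t. Proof. by rewrite le_max lexx. Qed.

Lemma clip_le M t : 0 <= M -> clip M t <= M.
Proof. by move=> M0; rewrite ge_max M0 ge_min lexx. Qed.

Lemma clip_le_id M t : 0 <= t -> clip M t <= t.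
Proof. by move=> t0; rewrite ge_max t0 ge_min lexx orbT. Qed.

Lemma clip_id M t : 0 <= t <= M -> clip M t = t.
Proof. by move=> /andP[t0 tM]; rewrite /clip min_r// max_r. Qed.

Lemma clip_big M t : 0 <= M <= t -> clip M t = M.
Proof. by move=> /andP[M0 Mt]; rewrite /clip min_l// max_r. Qed.

Lemma clip_neg M t : 0 <= M -> t <= 0 -> clip M t = 0.
Proof. by move=> M0 t0; rewrite /clip min_r ?(le_trans t0)// max_l. Qed.

Lemma is_derive_clipe M e t : 0 < e ->
  is_derive t (1 : R) (clipe M e) (dclipe M e t).
Proof.
move=> e0; have d1 := is_derive_sqe t e0.
have d2 : is_derive t (1 : R) (fun t : R => sqe e (t - M)) ((t - M) / sqe e (t - M)).
  have d3 : is_derive t (1 : R) (fun t : R => t - M : R) 1.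
    by apply: is_derive_eq; rewrite subr0.
  have h := @is_derive1_comp R (sqe e) (fun t : R => t - M) t _ _ (is_derive_sqe (t - M) e0) d3.
  by apply: is_derive_eq; rewrite mulr1.
have d3 : is_derive t (1 : R) (fun t => 2^-1 * (sqe e t - sqe e (t - M) + M) : R) (dclipe M e t).
  apply: is_derive_eq; rewrite /dclipe /GRing.scale/=; ring.
have -> : clipe M e = fun t => 2^-1 * (sqe e t - sqe e (t - M) + M).
  by apply/funext => s; rewrite /clipe mulrC.
exact: d3.
Qed.

(** The values stay where [W_clip] knows its outer function to be differentiable. With [a] and [b]
    the two square roots, [(a - b) (a + b) = M (2 t - M)], while [|2 t - M| < a + b]. *)
Lemma clipe_itv M e t : 0 < e -> 0 < M -> 0 < clipe M e t < M.
Proof.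
move=> e0 M0; have a0 := sqe_gt0 t e0; have b0 := sqe_gt0 (t - M) e0.
have at_ := sqe_gt t e0; have bt := sqe_gt (t - M) e0.
have E : (sqe e t - sqe e (t - M)) * (sqe e t + sqe e (t - M)) = M * (2 * t - M).
  rewrite -subr_sqr !sqr_sqrtr ?addr_ge0 ?sqr_ge0//; ring.
have k1 : `|2 * t - M| < sqe e t + sqe e (t - M).
  have -> : 2 * t - M = t + (t - M) by ring.
  by rewrite (le_lt_trans (ler_normD _ _))// ltrD.
move: k1 E; rewrite ltr_norml /clipe.
move: (sqe e t) (sqe e (t - M)) a0 b0 => a b a0 b0 {at_ bt} /andP[k1 k2] E.
have ab : 0 < a + b by rewrite addr_gt0.
apply/andP; split.
  rewrite divr_gt0// -(pmulr_lgt0 _ ab) mulrDl E -mulrDr pmulr_lgt0// ; lra.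
rewrite ltr_pdivrMr// -subr_gt0 -(pmulr_lgt0 _ ab).
have -> : (M * 2 - (a - b + M)) * (a + b) = M * ((a + b) - (2 * t - M)) by rewrite mulrBr -E; ring.
by rewrite pmulr_lgt0// subr_gt0.
Qed.

Lemma div_sqe_le1 e t : 0 < e -> `|t / sqe e t| <= 1.
Proof.
move=> e0; rewrite normf_div [`|sqe _ _|]gtr0_norm ?sqe_gt0//.
by rewrite ler_pdivrMr ?sqe_gt0// mul1r sqe_ge.
Qed.

Lemma dclipe_le1 M e t : 0 < e -> `|dclipe M e t| <= 1.
Proof.
move=> e0; have := div_sqe_le1 t e0; have := div_sqe_le1 (t - M) e0.
rewrite /dclipe !ler_norml => /andP[? ?] /andP[? ?]; apply/andP; split; lra.
Qed.

Lemma continuous_sqe e : continuous (sqe e).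
Proof.
move=> t; apply: (@continuous_comp _ _ _ (fun t => t ^+ 2 + e ^+ 2) Num.sqrt).
  by apply: cvgD; [exact: exprn_continuous|exact: cvg_cst].
exact: sqrt_continuous.
Qed.

Lemma continuous_div_sqe e : 0 < e -> continuous (fun t => t / sqe e t).
Proof.
move=> e0 t; apply: cvgM; first exact: cvg_id.
by apply: cvgV; [rewrite gt_eqF// sqe_gt0|exact: continuous_sqe].
Qed.

Lemma continuous_clipe M e : continuous (clipe M e).
Proof.
move=> t; apply: cvgM; last exact: cvg_cst.
apply: cvgD; last exact: cvg_cst.
apply: cvgB; first exact: continuous_sqe.
apply: (@continuous_comp _ _ _ (fun t => t - M) (sqe e)); last exact: continuous_sqe.
by apply: cvgB; [exact: cvg_id|exact: cvg_cst].
Qed.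

Lemma continuous_dclipe M e : 0 < e -> continuous (dclipe M e).
Proof.
move=> e0 t; apply: cvgM; last exact: cvg_cst.
apply: cvgB; first exact: continuous_div_sqe.
apply: (@continuous_comp _ _ _ (fun t => t - M) (fun t => t / sqe e t)); last exact: continuous_div_sqe.
by apply: cvgB; [exact: cvg_id|exact: cvg_cst].
Qed.

Definition en (n : nat) : R := n.+1%:R^-1.

Lemma en_gt0 n : 0 < en n. Proof. by rewrite invr_gt0. Qed.
Lemma en_cvg : en @ \oo --> 0. Proof. exact: cvg_harmonic. Qed.

Lemma en_small (e : R) : 0 < e -> exists k, forall n, (k <= n)%N -> en n <= e.
Proof.
move=> e0; have /cvgrPdist_le/(_ _ e0)[k _ kP] := en_cvg.
by exists k => n /kP; rewrite sub0r normrN gtr0_norm ?en_gt0.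
Qed.

Lemma sqe_cvg t : sqe (en n) t @[n --> \oo] --> `|t|.
Proof.
apply: (@squeeze_cvgr _ _ _ _ (fun=> `|t|) (fun n => `|t| + en n)).
- apply: nearW => n; rewrite sqe_ge/=; exact: sqe_le (ltW (en_gt0 n)).
- exact: cvg_cst.
- by rewrite -[X in _ --> X]addr0; apply: cvgD; [exact: cvg_cst|exact: en_cvg].
Qed.

Lemma div_sqe_cvg t : t / sqe (en n) t @[n --> \oo] --> Num.sg t.
Proof.
have [->|t0] := eqVneq t 0.
  rewrite sgr0; under eq_fun do rewrite mul0r; exact: cvg_cst.
have -> : Num.sg t = t / `|t|.
  by rewrite {2}(numEsg t) mulfK// normr_eq0.
apply: cvgM; first exact: cvg_cst.
by apply: cvgV; [rewrite normr_eq0|exact: sqe_cvg].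
Qed.

Lemma clipe_cvg M t : 0 <= M -> clipe M (en n) t @[n --> \oo] --> clip M t.
Proof.
move=> M0; rewrite clipE//; apply: cvgM; last exact: cvg_cst.
by apply: cvgD; [apply: cvgB; exact: sqe_cvg|exact: cvg_cst].
Qed.

Lemma dclipe_cvg M t : dclipe M (en n) t @[n --> \oo] --> (Num.sg t - Num.sg (t - M)) / 2.
Proof. by apply: cvgM; [apply: cvgB; exact: div_sqe_cvg|exact: cvg_cst]. Qed.

Lemma bounded_itv (F : R -> R) M : 0 <= M ->
  (forall t, 0 <= t <= M -> F x @[x --> t] --> F t) ->
  exists C, forall t, 0 <= t <= M -> `|F t| <= C.
Proof.
move=> M0 cF.
have cw : {within `[0, M], continuous (fun t => `|F t|)}.
  apply: continuous_in_subspaceT => t; rewrite inE/= in_itv/= => tM.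
  by apply: cvg_norm; exact: cF.
have [c _ H] := EVT_max M0 cw.
by exists `|F c| => t tM; apply: H; rewrite in_itv.
Qed.

Lemma continuous_powR (a x : R) : 0 < x -> {for x, continuous (fun s : R => s `^ a)}.
Proof.
by move=> x0; have /@ex_derive/derivable1_diffP/differentiable_continuous := is_derive1_powR a x0.
Qed.

Lemma cvg_powR (u : nat -> R) (l a : R) : 0 < l -> u @ \oo --> l ->
  u n `^ a @[n --> \oo] --> l `^ a.
Proof. by move=> l0 ul; exact: (cvg_comp _ _ ul (@continuous_powR a l l0)). Qed.

Lemma cvg_powR0 (u : nat -> R) (a : R) : 0 < a -> (forall n, 0 <= u n) ->
  u @ \oo --> 0 -> u n `^ a @[n --> \oo] --> 0.
Proof.
move=> a0 u0 /cvgrPdist_le uc; apply/cvgrPdist_le => e e0.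
have e1 : 0 < e `^ a^-1 by rewrite powR_gt0.
apply: filterS (uc _ e1) => n; rewrite !sub0r !normrN !ger0_norm ?powR_ge0// => un.
apply: (@le_trans _ _ ((e `^ a^-1) `^ a)).
  by apply: ge0_ler_powR; rewrite ?nnegrE ?powR_ge0// ltW.
by rewrite -powRrM mulVf ?gt_eqF// powRr1// ltW.
Qed.

End calculus.

(** * Weak derivatives over an abstract measure space *)

Section dot_theory.
Context (R : realType) (N : nat).
Implicit Types v w z : 'rV[R]_N.

Lemma dotC v w : dot v w = dot w v.
Proof. by apply: eq_bigr => i _; rewrite mulrC. Qed.

Lemma dotDl v w z : dot (v + w) z = dot v z + dot w z.
Proof. by rewrite /dot -big_split; apply: eq_bigr => i _; rewrite mxE mulrDl. Qed.

Lemma dotZl k v w : dot (k *: v) w = k * dot v w.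
Proof. by rewrite /dot mulr_sumr; apply: eq_bigr => i _; rewrite mxE mulrA. Qed.

Lemma dotDr v w z : dot v (w + z) = dot v w + dot v z.
Proof. by rewrite dotC dotDl !(dotC v). Qed.

Lemma dotZr k v w : dot v (k *: w) = k * dot v w.
Proof. by rewrite dotC dotZl dotC. Qed.

Lemma dotNl v w : dot (- v) w = - dot v w.
Proof. by rewrite -scaleN1r dotZl mulN1r. Qed.

Lemma dotNr v w : dot v (- w) = - dot v w.
Proof. by rewrite dotC dotNl dotC. Qed.

Lemma dotBl v w z : dot (v - w) z = dot v z - dot w z.
Proof. by rewrite dotDl dotNl. Qed.

Lemma dotBr v w z : dot v (w - z) = dot v w - dot v z.
Proof. by rewrite dotDr dotNr. Qed.

Lemma dot0l v : dot 0 v = 0.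
Proof. by rewrite -(scale0r 0) dotZl mul0r. Qed.

Lemma dot0r v : dot v 0 = 0.
Proof. by rewrite dotC dot0l. Qed.

Lemma dot_ge0 v : 0 <= dot v v.
Proof. by apply: sumr_ge0 => i _; rewrite -expr2 sqr_ge0. Qed.

Lemma sqr_le_dot v i : v ord0 i ^+ 2 <= dot v v.
Proof.
rewrite /dot (bigD1 i)//= -expr2 lerDl.
by apply: sumr_ge0 => j _; rewrite -expr2 sqr_ge0.
Qed.

Lemma dot_eq0 v : dot v v <= 0 -> v = 0.
Proof.
move=> v0; apply/rowP => i; rewrite mxE; apply/eqP; rewrite -sqrf_eq0.
by rewrite eq_le sqr_ge0 andbT (le_trans (sqr_le_dot v i)).
Qed.

Lemma dot_young v w (t : R) : 0 < t ->
  `|dot v w| <= t * dot v v + t^-1 * dot w w.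
Proof.
move=> t0; have ti0 : 0 < t^-1 by rewrite invr_gt0.
have pv := dot_ge0 v; have pw := dot_ge0 w.
have h1 := dot_ge0 (t *: v - w); have h2 := dot_ge0 (t *: v + w).
rewrite !(dotDl, dotDr, dotNl, dotNr, dotZl, dotZr) in h1 h2.
rewrite !(dotC w) in h1 h2.
have E : t * (t * dot v v + t^-1 * dot w w) = t * (t * dot v v) + dot w w.
  by field; rewrite gt_eqF.
have a1 : t * (2 * dot v w) <= t * (t * dot v v + t^-1 * dot w w) by rewrite E; lra.
have a2 : t * (- (2 * dot v w)) <= t * (t * dot v v + t^-1 * dot w w) by rewrite E; lra.
rewrite ler_pM2l// in a1; rewrite ler_pM2l// in a2.
have b1 : 0 <= t * dot v v by rewrite mulr_ge0// ltW.
have b2 : 0 <= t^-1 * dot w w by rewrite mulr_ge0// ltW.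
by rewrite ler_norml; apply/andP; split; lra.
Qed.

End dot_theory.

Section fields.
Context d (T : measurableType d) (R : realType) (N : nat).
Variable mu : {measure set T -> \bar R}.
Implicit Types (u v f : T -> R) (G H : T -> 'rV[R]_N).
Local Notation I := (Int mu).

Definition mfv G := forall i, measurable_fun setT (fun x => G x ord0 i).
Definition L2v G := forall i, L2 mu (fun x => G x ord0 i).
Definition DG G H := I (fun x => dot (G x) (H x)).

Lemma L2v_mf G : L2v G -> mfv G. Proof. by move=> h i; case: (h i). Qed.

Lemma mf_dot G H : mfv G -> mfv H -> measurable_fun setT (fun x => dot (G x) (H x)).
Proof. by move=> mG mH; apply: measurable_sum => i; exact: measurable_funM. Qed.

Lemma mfvM f G : measurable_fun setT f -> mfv G -> mfv (fun x => f x *: G x).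
Proof. by move=> mf mG i; under eq_fun do rewrite mxE; exact: measurable_funM. Qed.

Lemma mfvB G H : mfv G -> mfv H -> mfv (fun x => G x - H x).
Proof. by move=> mG mH i; under eq_fun do rewrite 2!mxE; exact: measurable_funB. Qed.

Lemma L2vD G H : L2v G -> L2v H -> L2v (fun x => G x + H x).
Proof. by move=> mG mH i; under eq_fun do rewrite mxE; exact: L2D. Qed.

Lemma L2vB G H : L2v G -> L2v H -> L2v (fun x => G x - H x).
Proof. by move=> mG mH i; under eq_fun do rewrite 2!mxE; exact: L2B. Qed.

Lemma L2vZ k G : L2v G -> L2v (fun x => k *: G x).
Proof. by move=> mG i; under eq_fun do rewrite mxE; exact: L2Z. Qed.

Lemma L2v0 : L2v (fun=> 0).
Proof. by move=> i; under eq_fun do rewrite mxE; exact: L2_0. Qed.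

Lemma L2v_mulbdd (m : T -> R) C G : measurable_fun setT m ->
  (forall x, `|m x| <= C) -> L2v G -> L2v (fun x => m x *: G x).
Proof. by move=> mm mC mG i; under eq_fun do rewrite mxE; exact: L2_mulbdd mC _. Qed.

Lemma L1_dot G H : L2v G -> L2v H -> L1 mu (fun x => dot (G x) (H x)).
Proof. by move=> LG LH; apply: L1_sum => i; exact: L2_mul. Qed.

Lemma L2v_dot G : mfv G -> L1 mu (fun x => dot (G x) (G x)) -> L2v G.
Proof.
move=> mG iG i; split; first exact: mG.
apply: (L1_domT _ iG); first exact: measurable_funX.
by move=> x; rewrite ger0_norm ?sqr_ge0// sqr_le_dot.
Qed.

Lemma L2v_ae_eq G H : mfv H -> L2v G -> (\forall x \ae mu, G x = H x) -> L2v H.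
Proof.
move=> mH LG GH i; apply: (L2_ae_eq (mH i) (LG i)).
by apply: filterS GH => x ->.
Qed.

Lemma DG_ge0 G : 0 <= DG G G.
Proof. by apply: Int_ge0 => x; exact: dot_ge0. Qed.

Section weighted.
Variables (b : T -> R) (beta : R).
Hypotheses (mb : measurable_fun setT b) (bbeta : forall x, `|b x| <= beta).

Definition EE G H := I (fun x => b x * dot (G x) (H x)).

Lemma L1_EE G H : L2v G -> L2v H -> L1 mu (fun x => b x * dot (G x) (H x)).
Proof. by move=> LG LH; apply: (L1_mulbdd mb bbeta); exact: L1_dot. Qed.

Lemma EEC G H : EE G H = EE H G.
Proof. by congr Int; apply/funext => x; rewrite dotC. Qed.

Lemma EEDl G H K : L2v G -> L2v H -> L2v K ->
  EE (fun x => G x + H x) K = EE G K + EE H K.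
Proof.
move=> LG LH LK; rewrite /EE -IntD; [|exact: L1_EE..].
by congr Int; apply/funext => x; rewrite dotDl mulrDr.
Qed.

Lemma EEZl k G K : L2v G -> L2v K -> EE (fun x => k *: G x) K = k * EE G K.
Proof.
move=> LG LK; rewrite /EE -IntZ; [|exact: L1_EE].
by congr Int; apply/funext => x; rewrite dotZl mulrCA.
Qed.

Lemma EEBl G H K : L2v G -> L2v H -> L2v K ->
  EE (fun x => G x - H x) K = EE G K - EE H K.
Proof.
move=> LG LH LK; rewrite /EE -IntB; [|exact: L1_EE..].
by congr Int; apply/funext => x; rewrite dotBl mulrBr.
Qed.

Lemma EEDr G H K : L2v G -> L2v H -> L2v K ->
  EE K (fun x => G x + H x) = EE K G + EE K H.
Proof. by move=> *; rewrite EEC EEDl// !(EEC K). Qed.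

Lemma EEZr k G K : L2v G -> L2v K -> EE K (fun x => k *: G x) = k * EE K G.
Proof. by move=> *; rewrite EEC EEZl// (EEC K). Qed.

Lemma EEBr G H K : L2v G -> L2v H -> L2v K ->
  EE K (fun x => G x - H x) = EE K G - EE K H.
Proof. by move=> *; rewrite EEC EEBl// !(EEC K). Qed.

Lemma EEBB G H : L2v G -> L2v H ->
  EE (fun x => G x - H x) (fun x => G x - H x) = EE G G - 2 * EE G H + EE H H.
Proof.
move=> LG LH; have LGH := L2vB LG LH.
by rewrite EEBl// !EEBr// (EEC H G); ring.
Qed.

Lemma EE_coercive alpha G : L2v G -> (forall x, alpha <= b x) ->
  alpha * DG G G <= EE G G.
Proof.
move=> LG ab; rewrite -IntZ; last exact: L1_dot.
apply: Int_leT; [by apply: L1Z; exact: L1_dot|exact: L1_EE|].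
by move=> x; rewrite ler_wpM2r// dot_ge0.
Qed.

Lemma EE_le G : L2v G -> EE G G <= beta * DG G G.
Proof.
move=> LG; rewrite -IntZ; last exact: L1_dot.
apply: Int_leT; [exact: L1_EE|by apply: L1Z; exact: L1_dot|].
by move=> x; rewrite ler_wpM2r ?dot_ge0// (le_trans (ler_norm _)).
Qed.

End weighted.

Lemma DGBB_le G H K : L2v G -> L2v H -> L2v K ->
  DG (fun x => G x - K x) (fun x => G x - K x) <=
  2 * DG (fun x => G x - H x) (fun x => G x - H x) +
  2 * DG (fun x => H x - K x) (fun x => H x - K x).
Proof.
move=> LG LH LK.
rewrite /DG -IntZ; last by apply: L1_dot; exact: L2vB.
rewrite -IntZ; last by apply: L1_dot; exact: L2vB.
rewrite -IntD; [|by apply: L1Z; apply: L1_dot; exact: L2vB..].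
apply: Int_leT.
- by apply: L1_dot; exact: L2vB.
- by apply: L1D; apply: L1Z; apply: L1_dot; exact: L2vB.
- move=> x; have := dot_ge0 ((G x - H x) - (H x - K x)).
  have -> : G x - K x = (G x - H x) + (H x - K x) by rewrite addrA subrK.
  move: (G x - H x) (H x - K x) => a c.
  by rewrite !(dotBl, dotBr, dotDl, dotDr) (dotC c a); lra.
Qed.

End fields.

Section dominated_convergence.
Context d (T : measurableType d) (R : realType) (N : nat).
Variable mu : {measure set T -> \bar R}.

Lemma L2_dct (g : nat -> T -> R) (h A : T -> R) :
  (forall n, measurable_fun setT (g n)) -> measurable_fun setT h -> L2 mu A ->
  (forall n, \forall x \ae mu, `|g n x| <= A x) ->
  (\forall x \ae mu, g n x @[n --> \oo] --> h x) ->
  L2 mu h /\ Int mu (fun x => (g n x - h x) ^+ 2) @[n --> \oo] --> 0.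
Proof.
move=> mg mh L2A gA gh.
have hA : \forall x \ae mu, `|h x| <= A x.
  apply: filterS2 (ae_foralln gA) gh => x H1 H2.
  exact: cvg_ler_const (cvg_norm H2) H1.
have L2h := L2_dom mh L2A hA; split => //.
suff [_] : L1 mu (fun=> 0) /\
    Int mu (fun x => (g n x - h x) ^+ 2) @[n --> \oo] --> Int mu (fun=> 0).
  by rewrite Int0.
apply: (@Int_dct _ _ _ mu _ _ (fun x => (2 * A x) ^+ 2)) => //.
- by move=> n; apply: measurable_funX; exact: measurable_funB.
- exact: (L2Z 2 L2A).2.
- move=> n; apply: filterS2 (gA n) hA => x ga ha.
  rewrite normrX lerXn2r// ?nnegrE//.
    by rewrite mulr_ge0// (le_trans _ ga).
  by rewrite (le_trans (ler_normB _ _))//; lra.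
- apply: filterS gh => x gx.
  rewrite (_ : 0 = (h x - h x) ^+ 2); last by rewrite subrr expr0n.
  by apply: cvg_sqr; apply: cvgB => //; exact: cvg_cst.
Qed.

Lemma L2v_dct (g : nat -> T -> 'rV[R]_N) (h : T -> 'rV[R]_N) (A : T -> R) :
  (forall n, L2v mu (g n)) -> mfv h -> L2 mu A ->
  (forall n i, \forall x \ae mu, `|g n x ord0 i| <= A x) ->
  (forall i, \forall x \ae mu, g n x ord0 i @[n --> \oo] --> h x ord0 i) ->
  L2v mu h /\ DG mu (fun x => g n x - h x) (fun x => g n x - h x) @[n --> \oo] --> 0.
Proof.
move=> Lg mh L2A gA gh.
have cG i := L2_dct (fun n => L2_mf (Lg n i)) (mh i) L2A (gA^~ i) (gh i).
split; first by move=> i; case: (cG i).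
have -> : (fun n => DG mu (fun x => g n x - h x) (fun x => g n x - h x)) =
    fun n => \sum_i Int mu (fun x => (g n x ord0 i - h x ord0 i) ^+ 2).
  apply/funext => n; rewrite /DG -Int_sum; last first.
    by move=> i; apply: (L2B (Lg n i) (cG i).1).2.
  congr Int; apply/funext => x; apply: eq_bigr => i _.
  by rewrite !mxE -expr2.
have := @cvg_sumr R _ (index_enum 'I_N) (fun n i => Int mu (fun x => (g n x ord0 i - h x ord0 i) ^+ 2)) (fun=> 0) (fun i => (cG i).2).
by rewrite [X in _ --> X -> _]big1.
Qed.

End dominated_convergence.

(** [W u G] reads: [u] vanishes weakly on the boundary and [G] is its gradient. A relation instead
    of a gradient operator lets both members be changed on null sets and be limits of pairs without
    any choice. The chain rule is asked only for [C^1] functions with bounded derivative;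
    truncations are recovered from it by approximation. [W_uniq] makes gradients vanish on level
    sets, and [W_cover] supplies enough nonnegative test functions for strict positivity. *)
Record sobolev d (T : measurableType d) (R : realType) (N : nat)
  (mu : {measure set T -> \bar R})
  (W : (T -> R) -> (T -> 'rV[R]_N) -> Prop) : Prop := Sobolev {
  W_L2 : forall u G, W u G -> L2 mu u ;
  W_L2v : forall u G, W u G -> L2v mu G ;
  W_lin : forall c u G v H, W u G -> W v H ->
    W (fun x => u x + c * v x) (fun x => G x + c *: H x) ;
  W_closed : forall (u_ : nat -> T -> R) (G_ : nat -> T -> 'rV[R]_N) u G,
    (forall n, W (u_ n) (G_ n)) -> L2 mu u -> L2v mu G ->
    Int mu (fun x => (u_ n x - u x) ^+ 2) @[n --> \oo] --> 0 ->
    DG mu (fun x => G_ n x - G x) (fun x => G_ n x - G x) @[n --> \oo] --> 0 ->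
    W u G ;
  W_chainC1 : forall (F F' : R -> R) (C : R),
    (forall t : R, is_derive t (1 : R) F (F' t)) -> continuous F' ->
    (forall t, `|F' t| <= C) -> F 0 = 0 ->
    forall u G, W u G -> W (fun x => F (u x)) (fun x => F' (u x) *: G x) ;
  W_uniq : forall u G v H, W u G -> W v H -> (\forall x \ae mu, u x = v x) ->
    \forall x \ae mu, G x = H x ;
  W_poincare : exists2 C, 0 < C & forall u G, W u G ->
    Int mu (fun x => u x ^+ 2) <= C * DG mu G G ;
  W_cover : exists (psi : nat -> T -> R) (H : nat -> T -> 'rV[R]_N),
    [/\ forall i, W (psi i) (H i), forall i x, 0 <= psi i x <= 1 &
     \forall x \ae mu, exists i, 0 < psi i x] }.

Section sobolev_theory.
Context d (T : measurableType d) (R : realType) (N : nat).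
Variable mu : {measure set T -> \bar R}.
Variable W : (T -> R) -> (T -> 'rV[R]_N) -> Prop.
Hypothesis finmu : (mu setT < +oo)%E.
Hypothesis HS : sobolev mu W.
Implicit Types (u v f : T -> R) (G H : T -> 'rV[R]_N).

Let WL2 := W_L2 HS.
Let WL2v := W_L2v HS.

Lemma W_mf u G : W u G -> measurable_fun setT u.
Proof. by move=> /WL2 /L2_mf. Qed.

Lemma W_mfv u G : W u G -> mfv G.
Proof. by move=> /WL2v /L2v_mf. Qed.

Lemma W_0 : W (fun=> 0) (fun=> 0).
Proof.
have [psi [H [Wpsi _ _]]] := W_cover HS.
have := W_lin HS (-1) (Wpsi 0%N) (Wpsi 0%N).
rewrite (_ : (fun x => psi 0%N x + _) = fun=> 0).
  rewrite (_ : (fun x => H 0%N x + _) = fun=> 0)//.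
  by apply/funext => x; rewrite scaleN1r subrr.
by apply/funext => x; rewrite mulN1r subrr.
Qed.

Lemma W_D u G v H : W u G -> W v H ->
  W (fun x => u x + v x) (fun x => G x + H x).
Proof.
move=> Wu Wv; have := W_lin HS 1 Wu Wv.
under eq_fun do rewrite mul1r.
by under [X in W _ X -> _]eq_fun do rewrite scale1r.
Qed.

Lemma W_Z k u G : W u G -> W (fun x => k * u x) (fun x => k *: G x).
Proof.
move=> Wu; have := W_lin HS k W_0 Wu.
under eq_fun do rewrite add0r.
by under [X in W _ X -> _]eq_fun do rewrite add0r.
Qed.

Lemma W_B u G v H : W u G -> W v H ->
  W (fun x => u x - v x) (fun x => G x - H x).
Proof.
move=> Wu Wv; have := W_lin HS (-1) Wu Wv.
under eq_fun do rewrite mulN1r.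
by under [X in W _ X -> _]eq_fun do rewrite scaleN1r.
Qed.

Lemma W_ae u G u' G' : W u G -> measurable_fun setT u' -> mfv G' ->
  (\forall x \ae mu, u x = u' x) -> (\forall x \ae mu, G x = G' x) -> W u' G'.
Proof.
move=> Wu mu' mG' uu' GG'.
apply: (@W_closed _ _ _ _ _ _ HS (fun=> u) (fun=> G)) => //.
- exact: L2_ae_eq (WL2 Wu) uu'.
- exact: L2v_ae_eq (WL2v Wu) GG'.
- rewrite (_ : (fun=> _) = fun=> 0); first exact: cvg_cst.
  apply/funext => _; rewrite -[RHS](Int0 mu); apply: Int_ae_eq => //.
    by apply: measurable_funX; apply: measurable_funB => //; exact: W_mf Wu.
  by apply: filterS uu' => x ->; rewrite subrr expr0n.
- rewrite (_ : (fun=> _) = fun=> 0); first exact: cvg_cst.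
  apply/funext => _; rewrite -[RHS](Int0 mu); apply: Int_ae_eq => //.
    by apply: mf_dot; apply: mfvB => //; exact: W_mfv Wu.
  by apply: filterS GG' => x ->; rewrite subrr dot0l.
Qed.

(** The form in which closedness is applied: dominated convergence upgrades pointwise limits of
    functions and gradients to the [L^2] limits required by [W_closed]. *)
Lemma W_lim (u_ : nat -> T -> R) (G_ : nat -> T -> 'rV[R]_N) u G A :
  (forall n, W (u_ n) (G_ n)) -> measurable_fun setT u -> mfv G -> L2 mu A ->
  (forall n, \forall x \ae mu, `|u_ n x| <= A x) ->
  (forall n i, \forall x \ae mu, `|G_ n x ord0 i| <= A x) ->
  (\forall x \ae mu, u_ n x @[n --> \oo] --> u x) ->
  (forall i, \forall x \ae mu, G_ n x ord0 i @[n --> \oo] --> G x ord0 i) ->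
  W u G.
Proof.
move=> W_ mu_ mG L2A uA GA uu GG.
have [L2u cu] := L2_dct (fun n => W_mf (W_ n)) mu_ L2A uA uu.
have [L2G cG] := L2v_dct (fun n => WL2v (W_ n)) mG L2A GA GG.
exact: (W_closed HS W_).
Qed.

(** [F n] is [en R n] times a shifted arctangent of [(t - c) / en R n]. It tends to [0] uniformly,
    whereas its derivative tends to the indicator of [t = c]. In the limit the zero function has as
    gradient the restriction of [G] to the set where [u = c], and uniqueness makes it [0]. *)
Lemma W_level c u G : W u G -> \forall x \ae mu, u x = c -> G x = 0.
Proof.
move=> Wu; have mU := W_mf Wu; have mG := W_mfv Wu.
pose F n t := en R n * (atan ((t - c) / en R n) - atan (- c / en R n)).
pose F' n t := (1 + ((t - c) / en R n) ^+ 2)^-1.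
have F'1 n t : 0 < F' n t <= 1.
  have h : 1 <= 1 + ((t - c) / en R n) ^+ 2 by rewrite lerDl sqr_ge0.
  by rewrite invr_gt0 invf_le1 ?h ?andbT// (lt_le_trans ltr01).
have e0 := en_gt0 R.
have dF n t : is_derive t (1 : R) (F n) (F' n t).
  have d1 : is_derive t (1 : R) (fun t : R => (en R n)^-1 * (t - c) : R) (en R n)^-1.
    by apply: is_derive_eq; rewrite /GRing.scale/=; ring.
  have d2 := @is_derive1_comp R atan (fun t : R => (en R n)^-1 * (t - c)) t _ _ (is_derive1_atan _) d1.
  have d3 : is_derive t (1 : R) (fun t => en R n * ((atan \o (fun t : R => (en R n)^-1 * (t - c))) t - atan (- c / en R n)) : R) (F' n t).
    apply: is_derive_eq; rewrite /F' /GRing.scale/= (mulrC (t - c)); field.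
    have := e0 n; have := sqr_ge0 ((en R n)^-1 * (t - c)).
    by move=> _ h2; rewrite gt_eqF//= gt_eqF// ltr_wpDr ?sqr_ge0// exprn_gt0.
  have -> : F n = fun t => en R n * ((atan \o (fun t : R => (en R n)^-1 * (t - c))) t - atan (- c / en R n)).
    by apply/funext => s; rewrite /F/= (mulrC (s - c)).
  exact: d3.
have cF' n : continuous (F' n).
  move=> t; apply: cvgV.
    by rewrite gt_eqF// ltr_wpDr ?sqr_ge0.
  apply: cvgD; first exact: cvg_cst.
  apply: (@continuous_comp _ _ _ (fun t => (t - c) / en R n) (fun t => t ^+ 2)); last exact: exprn_continuous.
  by apply: cvgM; [apply: cvgB; [exact: cvg_id|exact: cvg_cst]|exact: cvg_cst].
have F00 n : F n 0 = 0 by rewrite /F sub0r subrr mulr0.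
have WF n : W (fun x => F n (u x)) (fun x => F' n (u x) *: G x).
  apply: (W_chainC1 HS (C := 1) (dF n) (cF' n) _ (F00 n) Wu).
  by move=> t; case/andP: (F'1 n t) => p1 p2; rewrite gtr0_norm.
have en1 n : en R n <= 1 by rewrite /en invf_le1 ?ler1n.
have Fb n t : `|F n t| <= 4 * en R n.
  rewrite /F normrM gtr0_norm// mulrC ler_pM2r//.
  have pi4 : pi <= 4 :> R by have := pihalf_lt2 R; lra.
  have := atan_ltpi2 ((t - c) / en R n); have := atan_gtNpi2 ((t - c) / en R n).
  have := atan_ltpi2 (- c / en R n); have := atan_gtNpi2 (- c / en R n).
  by move=> ? ? ? ?; rewrite ler_norml; apply/andP; split; lra.
have Fc t : F' n t @[n --> \oo] --> ((t == c)%:R : R).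
  rewrite /F'; have [->|uc] := eqVneq t c.
    rewrite subrr; under eq_fun do rewrite mul0r expr0n addr0 invr1.
    exact: cvg_cst.
  rewrite /=; have uc2 : 0 < (t - c) ^+ 2 by rewrite exprn_even_gt0//= subr_eq0.
  apply: (@squeeze_cvgr _ _ _ _ (fun=> 0) (fun n => en R n / (t - c) ^+ 2)).
  - apply: nearW => n; have /andP[p1 p2] := F'1 n t; rewrite /F' (ltW p1)/=.
    rewrite -[leRHS]invf_div lef_pV2 ?posrE//; last first.
    + by rewrite divr_gt0.
    + by rewrite ltr_wpDr ?sqr_ge0.
    rewrite expr_div_n (@le_trans _ _ ((t - c) ^+ 2 / en R n ^+ 2)) ?lerDr//.
    rewrite ler_pM2l// lef_pV2 ?posrE ?exprn_gt0//.
    by rewrite expr2 -[leRHS]mul1r ler_pM2r.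
  - exact: cvg_cst.
  - rewrite [X in _ --> X](_ : _ = 0 / (t - c) ^+ 2); last by rewrite mul0r.
    by apply: cvgM; [exact: en_cvg|exact: cvg_cst].
have mI : measurable_fun setT (fun x => (u x == c)%:R : R).
  apply: (@measurable_fun_cvg _ _ _ setT (fun n x => F' n (u x))) => [n|x _].
    by apply: measurableT_comp => //; exact: continuous_measurable_fun.
  exact: Fc.
have W0 : W (fun=> 0) (fun x => (u x == c)%:R *: G x).
  apply: (@W_lim (fun n x => F n (u x)) (fun n x => F' n (u x) *: G x) _ _
    (fun x => 4 + \sum_i `|G x ord0 i|)) => //.
  - exact: mfvM.
  - apply: L2D; first exact: L2_cst.
    by apply: L2_sum => i; apply: L2_norm; exact: WL2v Wu i.
  - move=> n; apply: aeW => x; apply: le_trans (Fb n (u x)) _.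
    rewrite ler_wpDr ?sumr_ge0//; have := en1 n; lra.
  - move=> n i; apply: aeW => x; rewrite mxE normrM (bigD1 i)//=.
    have /andP[p1 p2] := F'1 n (u x); rewrite gtr0_norm//.
    have := ler_wpM2r (normr_ge0 (G x ord0 i)) p2.
    have : 0 <= \sum_(j < N | j != i) `|G x ord0 j| by rewrite sumr_ge0.
    lra.
  - by apply: aeW => x; apply: (squeeze0 (fun n => Fb n (u x))); apply: cvgZ0; exact: en_cvg.
  - move=> i; apply: aeW => x; under eq_fun do rewrite mxE.
    by rewrite mxE; apply: cvgM; [exact: Fc|exact: cvg_cst].
have h := W_uniq HS W0 W_0 (aeW _ (fun=> erefl)).
by apply: filterS h => x + uc; rewrite uc eqxx scale1r.
Qed.

(** [F] is only controlled on [[0, M]]. It is composed with the smoothed truncation [clipe], whose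
    values lie in that interval, and the smoothing is removed with [W_lim]. *)
Lemma W_clip (M : R) (F F' : R -> R) u G : 0 < M ->
  (forall t : R, 0 <= t <= M -> is_derive t (1 : R) F (F' t)) ->
  (forall t : R, 0 <= t <= M -> F' x @[x --> t] --> F' t) -> F 0 = 0 -> W u G ->
  W (fun x => F (clip M (u x)))
    (fun x => (if 0 < u x < M then F' (u x) else 0) *: G x).
Proof.
move=> M0 dF cF' F00 Wu; have mU := W_mf Wu; have mG := W_mfv Wu.
have [C FC] := bounded_itv (ltW M0) cF'.
have C0 : 0 <= C by apply: le_trans (normr_ge0 _) (FC 0 _); rewrite lexx ltW.
have e0 := en_gt0 R.
have ci n t : 0 <= clipe M (en R n) t <= M.
  by have /andP[/ltW-> /ltW->] := clipe_itv t (e0 n) M0.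
(* [clipe] does not vanish at [0]. The subtracted constant restores the normalization asked by the
   chain rule, and it tends to [F 0 = 0]. *)
pose Fn n t := F (clipe M (en R n) t) - F (clipe M (en R n) 0).
pose Fn' n t := F' (clipe M (en R n) t) * dclipe M (en R n) t.
have dFn n t : is_derive t (1 : R) (Fn n) (Fn' n t).
  have d1 := @is_derive1_comp R F (clipe M (en R n)) t _ _ (dF _ (ci n t)) (is_derive_clipe M t (e0 n)).
  have d2 : is_derive t (1 : R) (fun t => (F \o clipe M (en R n)) t - F (clipe M (en R n) 0) : R) (Fn' n t).
    by apply: is_derive_eq; rewrite subr0.
  exact: d2.
have cFn' n : continuous (Fn' n).
  move=> t; apply: cvgM; last exact: continuous_dclipe.
  apply: (@continuous_comp _ _ _ (clipe M (en R n)) F'); first exact: continuous_clipe.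
  exact: cF'.
have Fn'C n t : `|Fn' n t| <= C.
  rewrite normrM -[leRHS]mulr1 ler_pM//; first exact: FC.
  exact: dclipe_le1.
have WFn n : W (fun x => Fn n (u x)) (fun x => Fn' n (u x) *: G x).
  by apply: (W_chainC1 HS (dFn n) (cFn' n) (Fn'C n) _ Wu); rewrite /Fn subrr.
have cF t : 0 <= t <= M -> F x @[x --> t] --> F t.
  move=> tM; have /@ex_derive := dF t tM.
  by move=> /derivable1_diffP /differentiable_continuous.
have clM t : 0 <= clip M t <= M by rewrite clip_ge0 clip_le// ltW.
have FnF t : Fn n t @[n --> \oo] --> F (clip M t).
  rewrite -[X in _ --> X]subr0 -F00.
  have -> : F 0 = F (clip M 0) by rewrite clip_id// lexx ltW.
  by apply: cvgB; apply: continuous_cvg; [exact: cF (clM _)|exact: clipe_cvg (ltW M0)|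
    exact: cF (clM _)|exact: clipe_cvg (ltW M0)].
(* At the levels [0] and [M] this limit is half of [F'] and not [0]. The discrepancy is harmless
   because the gradient vanishes on both level sets by [W_level]. *)
pose m t := F' (clip M t) * ((Num.sg t - Num.sg (t - M)) / 2).
have Fn'm t : Fn' n t @[n --> \oo] --> m t.
  apply: cvgM; last exact: dclipe_cvg.
  by apply: continuous_cvg; [exact: cF' (clM _)|exact: clipe_cvg (ltW M0)].
have mm : measurable_fun setT (fun x => m (u x)).
  apply: (@measurable_fun_cvg _ _ _ setT (fun n x => Fn' n (u x))) => [n|x _].
    by apply: measurableT_comp => //; exact: continuous_measurable_fun.
  exact: Fn'm.
have mF : measurable_fun setT (fun x => F (clip M (u x))).
  apply: (@measurable_fun_cvg _ _ _ setT (fun n x => Fn n (u x))) => [n|x _].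
    apply: measurableT_comp => //; apply: continuous_measurable_fun => t.
    by have /@ex_derive/derivable1_diffP/differentiable_continuous := dFn n t.
  exact: FnF.
have W1 : W (fun x => F (clip M (u x))) (fun x => m (u x) *: G x).
  have [D FD] := bounded_itv (ltW M0) cF.
  have D0 : 0 <= D by apply: le_trans (normr_ge0 _) (FD 0 _); rewrite lexx ltW.
  apply: (@W_lim (fun n x => Fn n (u x)) (fun n x => Fn' n (u x) *: G x) _ _
    (fun x => 2 * D + C * \sum_i `|G x ord0 i|)) => //.
  - exact: mfvM.
  - apply: L2D; first exact: L2_cst.
    by apply: L2Z; apply: L2_sum => i; apply: L2_norm; exact: WL2v Wu i.
  - move=> n; apply: aeW => x; apply: le_trans (ler_normB _ _) _.
    have := FD _ (ci n (u x)); have := FD _ (ci n 0).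
    have : 0 <= C * \sum_i `|G x ord0 i| by rewrite mulr_ge0// sumr_ge0.
    lra.
  - move=> n i; apply: aeW => x; rewrite mxE normrM (bigD1 i)//=.
    have := ler_wpM2r (normr_ge0 (G x ord0 i)) (Fn'C n (u x)).
    have : 0 <= C * \sum_(j < N | j != i) `|G x ord0 j| by rewrite mulr_ge0// sumr_ge0.
    lra.
  - by apply: aeW => x; exact: FnF.
  - move=> i; apply: aeW => x; under eq_fun do rewrite mxE.
    by rewrite mxE; apply: cvgM; [exact: Fn'm|exact: cvg_cst].
have bE x : (if 0 < u x < M then F' (u x) else 0) = if (0 < u x) && (u x < M) then m (u x) else 0.
  case: ifP => // /andP[u0 uM].
  by rewrite /m clip_id ?(ltW u0) ?(ltW uM)// gtr0_sg// ltr0_sg ?subr_lt0// opprK divff ?mulr1.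
apply: (W_ae W1) => //.
- apply: mfvM => //; under eq_fun do rewrite bE.
  apply: measurable_fun_ifT => //.
  by apply: measurable_and; exact: measurable_fun_ltr.
- exact: aeW.
- apply: filterS2 (W_level 0 Wu) (W_level M Wu) => x u0 uM; rewrite bE.
  case: ifP => // /negbT.
  have [/u0 ->|u0'] := eqVneq (u x) 0; first by rewrite !scaler0.
  have [/uM ->|uM'] := eqVneq (u x) M; first by rewrite !scaler0.
  move=> h; congr (_ *: _); rewrite /m.
  have [ux|ux] := ltP (u x) 0.
    by rewrite ltr0_sg// ltr0_sg ?subrr ?mul0r ?mulr0// subr_lt0 (lt_trans ux).
  have u1 : 0 < u x by rewrite lt_def u0'.
  rewrite u1/= -leNgt in h.
  by rewrite gtr0_sg// gtr0_sg ?subrr ?mul0r ?mulr0// subr_gt0 lt_def uM'.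
Qed.

Lemma W_clip_id M u G : 0 < M -> W u G ->
  W (fun x => clip M (u x)) (fun x => (if 0 < u x < M then 1 else 0) *: G x).
Proof.
move=> M0 Wu; apply: (@W_clip M id (fun=> 1)) => // t _.
exact: cvg_cst.
Qed.

Lemma W_pos u G : W u G ->
  W (fun x => Num.max 0 (u x)) (fun x => (if 0 < u x then 1 else 0) *: G x).
Proof.
move=> Wu; have mU := W_mf Wu; have mG := W_mfv Wu.
apply: (@W_lim (fun n x => clip n.+1%:R (u x))
   (fun n x => (if 0 < u x < n.+1%:R then 1 else 0) *: G x) _ _
   (fun x => `|u x| + \sum_i `|G x ord0 i|)).
- by move=> n; exact: W_clip_id.
- exact: measurable_maxr.
- apply: mfvM => //; apply: measurable_fun_ifT => //; exact: measurable_fun_ltr.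
- apply: L2D; first exact: L2_norm (WL2 Wu).
  by apply: L2_sum => i; apply: L2_norm; exact: WL2v Wu i.
- move=> n; apply: aeW => x.
  rewrite ger0_norm ?clip_ge0// ler_wpDr ?sumr_ge0//.
  have [u0|u0] := leP 0 (u x); first by rewrite ger0_norm// clip_le_id.
  by rewrite clip_neg// ltW.
- move=> n i; apply: aeW => x; rewrite mxE (bigD1 i)//= addrCA ler_wpDr//.
    by rewrite addr_ge0// sumr_ge0.
  by case: ifP => _; rewrite ?mul1r// mul0r normr0.
- apply: aeW => x; apply: cvg_near_cst; near=> n.
  rewrite /clip; congr (Num.max 0 _); apply: min_r; apply: ltW.
  by near: n; exact: near_natS_gt.
- move=> i; apply: aeW => x; apply: cvg_near_cst; near=> n.
  have un : u x < n.+1%:R by near: n; exact: near_natS_gt.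
  by rewrite un andbT.
Unshelve. all: by end_near. Qed.

(** The square is the sum of the squares of the positive and the negative part, both of them
    truncations. The truncation level [2 * M] keeps [|u|] strictly below it, where the truncation
    has the full gradient. *)
Lemma W_sqr M u G : 0 < M -> (forall x, `|u x| <= M) -> W u G ->
  W (fun x => u x ^+ 2) (fun x => (2 * u x) *: G x).
Proof.
move=> M0 uM Wu.
have dF t : 0 <= t <= 2 * M -> is_derive t (1 : R) (fun t : R => t ^+ 2) (2 * t).
  by move=> _; apply: is_derive_eq; rewrite /GRing.scale/=; ring.
have cF' t : 0 <= t <= 2 * M -> (fun x : R => 2 * x) x @[x --> t] --> 2 * t.
  by move=> _; apply: cvgM; [exact: cvg_cst|exact: cvg_id].
have M2 : 0 < 2 * M by rewrite mulr_gt0.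
have F0 : (0 : R) ^+ 2 = 0 by rewrite expr0n.
have := W_D (W_clip M2 dF cF' F0 Wu) (W_clip M2 dF cF' F0 (W_Z (-1) Wu)).
have uM' x : - M <= u x <= M by rewrite -ler_norml.
rewrite (_ : (fun x => _ + _) = fun x => u x ^+ 2); last first.
  apply/funext => x; have /andP[h1 h2] := uM' x; rewrite mulN1r.
  have [u0|u0] := leP 0 (u x).
    rewrite (clip_id (t := u x)) ?(clip_neg (t := - u x)) ?expr0n ?addr0//.
    - exact: ltW.
    - by rewrite lerNl oppr0.
    - by rewrite u0/=; lra.
  rewrite (clip_neg (t := u x)) ?(clip_id (t := - u x)) ?expr0n ?add0r ?sqrrN//.
  - by apply/andP; split; lra.
  - exact: ltW.
  - exact: ltW.
congr (W _); apply/funext => x; have /andP[h1 h2] := uM' x.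
rewrite mulN1r oppr_gt0 scalerA -scalerDl; congr (_ *: _).
have l1 : (u x < 2 * M) by lra.
have l2 : (- u x < 2 * M) by lra.
rewrite l1 l2 !andbT; case: ltgtP => u0; lra.
Qed.

Lemma W_mul M u G v H : 0 < M -> (forall x, `|u x| <= M) -> (forall x, `|v x| <= M) ->
  W u G -> W v H ->
  W (fun x => u x * v x) (fun x => u x *: H x + v x *: G x).
Proof.
move=> M0 uM vM Wu Wv; have M2 : 0 < M + M by rewrite addr_gt0.
have b1 x : `|u x + v x| <= M + M by rewrite (le_trans (ler_normD _ _))// lerD.
have b2 x : `|u x - v x| <= M + M by rewrite (le_trans (ler_normB _ _))// lerD.
have := W_Z 4^-1 (W_B (W_sqr M2 b1 (W_D Wu Wv)) (W_sqr M2 b2 (W_B Wu Wv))).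
rewrite (_ : (fun x => 4^-1 * _) = fun x => u x * v x); last first.
  by apply/funext => x; field.
congr (W _); apply/funext => x; apply/rowP => i; rewrite !mxE; field.
all: by [].
Qed.

End sobolev_theory.

(** * Linear problems and comparison *)

Section sobolev_problems.
Context d (T : measurableType d) (R : realType) (N : nat).
Variable mu : {measure set T -> \bar R}.
Variable W : (T -> R) -> (T -> 'rV[R]_N) -> Prop.
Hypothesis finmu : (mu setT < +oo)%E.
Hypothesis HS : sobolev mu W.
Variables (b : T -> R) (alpha beta : R).
Hypothesis mb : measurable_fun setT b.
Hypothesis alpha0 : 0 < alpha.
Hypothesis hb : forall x, alpha <= b x <= beta.
Implicit Types (u v f F phi : T -> R) (G H K : T -> 'rV[R]_N).
Local Notation I := (Int mu).
Local Notation E := (EE mu b).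

Let WL2 := W_L2 HS.
Let WL2v := W_L2v HS.

Let bb x : `|b x| <= beta.
Proof.
by have /andP[a1 a2] := hb x; rewrite ger0_norm// (le_trans (ltW alpha0)).
Qed.

Let EBB := EEBB (N:=N) (mu:=mu) mb bb.
Let EBl := EEBl (N:=N) (mu:=mu) mb bb.
Let EBr := EEBr (N:=N) (mu:=mu) mb bb.
Let EDl := EEDl (N:=N) (mu:=mu) mb bb.
Let EDr := EEDr (N:=N) (mu:=mu) mb bb.
Let EZl := EEZl (N:=N) (mu:=mu) mb bb.
Let EZr := EEZr (N:=N) (mu:=mu) mb bb.
Let L1E := L1_EE (N:=N) (mu:=mu) mb bb.

Lemma E_ge0 G : 0 <= E G G.
Proof.
apply: Int_ge0 => x; rewrite mulr_ge0 ?dot_ge0//.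
by have /andP[/(le_trans (ltW alpha0))] := hb x.
Qed.

Lemma E_coercive G : L2v mu G -> alpha * DG mu G G <= E G G.
Proof. by move=> LG; apply: (EE_coercive mb bb LG) => x; case/andP: (hb x). Qed.

Lemma DG_sum G : L2v mu G -> DG mu G G = \sum_i I (fun x => G x ord0 i ^+ 2).
Proof.
move=> LG; rewrite /DG -Int_sum; last by move=> i; exact: (LG i).2.
by congr Int; apply/funext => x; apply: eq_bigr => i _; rewrite -expr2.
Qed.

Lemma DG_comp G i : L2v mu G -> I (fun x => G x ord0 i ^+ 2) <= DG mu G G.
Proof.
move=> LG; apply: Int_leT; [exact: (LG i).2|exact: L1_dot|].
by move=> x; exact: sqr_le_dot.
Qed.

Lemma DG_sym G H : DG mu (fun x => G x - H x) (fun x => G x - H x) =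
  DG mu (fun x => H x - G x) (fun x => H x - G x).
Proof.
congr Int; apply/funext => x.
by rewrite -opprB dotNl dotNr opprK.
Qed.

Definition DGcauchy (G_ : nat -> T -> 'rV[R]_N) := forall e, 0 < e ->
  exists k, forall n m, (k <= n)%N -> (k <= m)%N ->
    DG mu (fun x => G_ n x - G_ m x) (fun x => G_ n x - G_ m x) <= e.

(** By Poincare's inequality the functions are Cauchy as soon as the gradients are. The function and
    the components of the gradient form one family indexed by [option 'I_N], so that one subsequence
    and one dominating function serve all of them. *)
Lemma W_complete (u_ : nat -> T -> R) (G_ : nat -> T -> 'rV[R]_N) :
  (forall n, W (u_ n) (G_ n)) -> DGcauchy G_ ->
  exists u G (s : nat -> nat) (g : T -> R),
  [/\ W u G, I (fun x => (u_ n x - u x) ^+ 2) @[n --> \oo] --> 0,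
      DG mu (fun x => G_ n x - G x) (fun x => G_ n x - G x) @[n --> \oo] --> 0,
      {homo s : m n / (m < n)%N} /\ L2 mu g &
      \forall x \ae mu, (u_ (s n) x @[n --> \oo] --> u x /\
         forall n, `|u_ (s n) x| <= g x) /\
       forall i, G_ (s n) x ord0 i @[n --> \oo] --> G x ord0 i /\
         forall n, `|G_ (s n) x ord0 i| <= g x].
Proof.
move=> Wn cau; have [C C0 PC] := W_poincare HS.
pose F n (j : option 'I_N) x := if j is Some i then G_ n x ord0 i else u_ n x.
have L2F n j : L2 mu (F n j) by case: j => [i|]; [exact: WL2v (Wn n) i|exact: WL2 (Wn n)].
have LB n m : L2v mu (fun x => G_ n x - G_ m x) by apply: L2vB; exact: WL2v.
have [|f [s [g [L2f cf hs L2g ae]]]] := L2_family_limit L2F.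
  move=> e e0; have e1 : 0 < e / (1 + C) by rewrite divr_gt0// addr_gt0.
  have [k kP] := cau _ e1; exists k => n m kn km [i|].
    apply: (@le_trans _ _ (e / (1 + C))).
      apply: le_trans (kP n m kn km); apply: le_trans (DG_comp i (LB n m)).
      by rewrite le_eqVlt; apply/orP; left; apply/eqP; congr Int; apply/funext => x; rewrite !mxE.
    by rewrite ler_pdivrMr ?addr_gt0// ler_peMr ?(ltW e0)// lerDl ltW.
  apply: le_trans (PC _ _ (W_B HS (Wn n) (Wn m))) _.
  apply: le_trans (ler_wpM2l (ltW C0) (kP n m kn km)) _.
  rewrite mulrCA -[leRHS]mulr1 ler_pM2l// ler_pdivrMr ?addr_gt0// mul1r lerDr//.
pose G x : 'rV[R]_N := \row_i f (Some i) x.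
have LG : L2v mu G by move=> i; under eq_fun do rewrite mxE; exact: L2f.
have cG : DG mu (fun x => G_ n x - G x) (fun x => G_ n x - G x) @[n --> \oo] --> 0.
  have -> : (fun n => DG mu (fun x => G_ n x - G x) (fun x => G_ n x - G x)) =
     fun n => \sum_i I (fun x => (F n (Some i) x - f (Some i) x) ^+ 2).
    apply/funext => n; rewrite DG_sum; last by apply: L2vB => //; exact: WL2v.
    by apply: eq_bigr => i _; congr Int; apply/funext => x; rewrite !mxE.
  have := @cvg_sumr R _ (index_enum 'I_N) _ _ (fun i => cf (Some i)).
  by rewrite [X in _ --> X -> _]big1.
exists (f None), G, s, g; split => //.
- exact: (@W_closed _ _ _ _ _ _ HS u_ G_ _ _ Wn (L2f None) LG (cf None) cG).
- exact: cf None.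
- apply: filterS ae => x h; split; first exact: h None.
  by move=> i; rewrite mxE; exact: h (Some i).
Qed.

(** The mechanism behind strong convergence along monotone sequences: a numerical energy that is
    monotone and bounded controls the distances of the gradients. *)
Lemma energy_cauchy (G_ : nat -> T -> 'rV[R]_N) (e : nat -> R) :
  (forall n, L2v mu (G_ n)) -> cvgn e ->
  (forall n m, (n <= m)%N ->
     E (fun x => G_ n x - G_ m x) (fun x => G_ n x - G_ m x) <= `|e n - e m|) ->
  DGcauchy G_.
Proof.
move=> LG /cvg_ex[l /cvgrPdist_le el] Ee eps eps0.
have [|k _ kP] := el (alpha * eps / 2); first by rewrite divr_gt0// mulr_gt0.
have h n m : (k <= n)%N -> (k <= m)%N -> `|e n - e m| <= alpha * eps.
  move=> kn km; have := kP n kn; have := kP m km.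
  rewrite !ler_norml => /andP[? ?] /andP[? ?]; apply/andP; split; lra.
have main n m : (n <= m)%N -> (k <= n)%N -> (k <= m)%N ->
    DG mu (fun x => G_ n x - G_ m x) (fun x => G_ n x - G_ m x) <= eps.
  move=> nm kn km; rewrite -(ler_pM2l alpha0).
  apply: le_trans (E_coercive (L2vB (LG n) (LG m))) _.
  by apply: le_trans (Ee n m nm) _; exact: h.
exists k => n m kn km; have [nm|/ltnW mn] := leqP n m; first exact: main.
by rewrite DG_sym; exact: main.
Qed.


Lemma EE_CS G H : L2v mu G -> L2v mu H -> E G H ^+ 2 <= E G G * E H H.
Proof.
move=> LG LH; have b0 := E_ge0 H; have a0 := E_ge0 G.
have key t : 0 <= E G G + (2 * t) * E G H + t ^+ 2 * E H H.
  have := E_ge0 (fun x => G x + t *: H x).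
  have LtH := L2vZ t LH; have LD := L2vD LG LtH.
  rewrite EDl// !EDr// !EZl// !EZr// (EEC mu b H G).
  by congr (0 <= _); ring.
have [b_0|b_neq0] := eqVneq (E H H) 0.
  have [c0|c_neq0] := eqVneq (E G H) 0; first by rewrite c0 expr0n mulr_ge0.
  have := key (- (E G G + 1) / (2 * E G H)); rewrite b_0 mulr0 addr0.
  have -> : 2 * (- (E G G + 1) / (2 * E G H)) * E G H = - (E G G + 1) by field.
  lra.
have := key (- E G H / E H H).
have -> : E G G + 2 * (- E G H / E H H) * E G H + (- E G H / E H H) ^+ 2 * E H H
  = (E G G * E H H - E G H ^+ 2) / E H H by field.
by rewrite pmulr_lge0 ?subr_ge0// invr_gt0 lt_neqAle eq_sym b_neq0.
Qed.

Lemma sqr_squeeze0 (u v : nat -> R) c : (forall n, u n ^+ 2 <= v n * c) ->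
  v @ \oo --> 0 -> u @ \oo --> 0.
Proof.
move=> uv v0.
have s0 : Num.sqrt (u n ^+ 2) @[n --> \oo] --> 0.
  rewrite -[X in _ --> X]sqrtr0; apply: continuous_cvg; first exact: sqrt_continuous.
  apply: (@squeeze0 _ _ (fun n => c * v n)); last exact: cvgZ0.
  by move=> n; rewrite ger0_norm ?sqr_ge0// mulrC.
by apply: squeeze0 s0 => n; rewrite sqrtr_sqr.
Qed.

Lemma E_cvg (G_ : nat -> T -> 'rV[R]_N) G H : (forall n, L2v mu (G_ n)) ->
  L2v mu G -> L2v mu H ->
  DG mu (fun x => G_ n x - G x) (fun x => G_ n x - G x) @[n --> \oo] --> 0 ->
  E (G_ n) H @[n --> \oo] --> E G H.
Proof.
move=> LGn LG LH c0; apply/subr_cvg0.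
apply: (@sqr_squeeze0 _ (fun n => DG mu (fun x => G_ n x - G x) (fun x => G_ n x - G x)) (beta * E H H)) => //.
move=> n; rewrite -EBl//; have LB := L2vB (LGn n) LG.
apply: le_trans (EE_CS LB LH) _.
by rewrite mulrA (mulrC _ beta) ler_wpM2r ?E_ge0// EE_le.
Qed.

Lemma I_cvg (u_ : nat -> T -> R) u v : (forall n, L2 mu (u_ n)) ->
  L2 mu u -> L2 mu v ->
  I (fun x => (u_ n x - u x) ^+ 2) @[n --> \oo] --> 0 ->
  I (fun x => u_ n x * v x) @[n --> \oo] --> I (fun x => u x * v x).
Proof.
move=> Lun Lu Lv c0; apply/subr_cvg0.
apply: (@sqr_squeeze0 _ (fun n => I (fun x => (u_ n x - u x) ^+ 2)) (I (fun x => v x ^+ 2))) => //.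
move=> n; rewrite -IntB; [|exact: L2_mul..].
rewrite (_ : (fun x => _ - _) = fun x => (u_ n x - u x) * v x).
  by apply: Int_CS => //; exact: L2B.
by apply/funext => x; rewrite mulrBl.
Qed.

Lemma Int_sqrD u v : L2 mu u -> L2 mu v ->
  I (fun x => (u x + v x) ^+ 2) =
  I (fun x => u x ^+ 2) + 2 * I (fun x => u x * v x) + I (fun x => v x ^+ 2).
Proof.
move=> [mu_ Lu] [mv Lv].
have Luv : L1 mu (fun x => u x * v x) by exact: L2_mul.
rewrite -IntZ// -IntD//; last exact: L1Z.
rewrite -IntD//; last by apply: L1D => //; exact: L1Z.
by congr Int; apply/funext => x; ring.
Qed.

(* Minimizes the convex functional [E G G + l |v|^2 - 2 int F v]: by the
   parallelogram law minimizing sequences are Cauchy. *)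
Lemma riesz (l : R) F : 0 <= l -> L2 mu F ->
  exists v G, W v G /\ forall phi H, W phi H ->
    E G H + l * I (fun x => v x * phi x) = I (fun x => F x * phi x).
Proof.
move=> l0 LF; have [C C0 PC] := W_poincare HS.
pose Q v G := E G G + l * I (fun x => v x ^+ 2).
pose J v G := Q v G - 2 * I (fun x => F x * v x).
have I2 v : 0 <= I (fun x => v x ^+ 2) by apply: Int_ge0 => x; exact: sqr_ge0.
have QE v G : E G G <= Q v G by rewrite lerDl mulr_ge0.
have JD v G phi H t : W v G -> W phi H ->
    J (fun x => v x + t * phi x) (fun x => G x + t *: H x) =
    J v G + (2 * t) * (E G H + l * I (fun x => v x * phi x) - I (fun x => F x * phi x))
    + t ^+ 2 * Q phi H.
  move=> Wv Wp; have [Lv LG Lp LH] := And4 (WL2 Wv) (WL2v Wv) (WL2 Wp) (WL2v Wp).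
  have LtH := L2vZ t LH; have LD := L2vD LG LtH; have Ltp := L2Z t Lp.
  rewrite /J /Q EDl// !EDr// !EZl// !EZr// (EEC mu b H G) Int_sqrD//.
  have -> : I (fun x => v x * (t * phi x)) = t * I (fun x => v x * phi x).
    rewrite -IntZ; last exact: L2_mul.
    by congr Int; apply/funext => x; ring.
  have -> : I (fun x => (t * phi x) ^+ 2) = t ^+ 2 * I (fun x => phi x ^+ 2).
    rewrite -IntZ; last exact: Lp.2.
    by congr Int; apply/funext => x; ring.
  have -> : I (fun x => F x * (v x + t * phi x)) = I (fun x => F x * v x) + t * I (fun x => F x * phi x).
    rewrite -IntZ; last exact: L2_mul.
    rewrite -IntD; [|exact: L2_mul|by apply: L1Z; exact: L2_mul].
    by congr Int; apply/funext => x; ring.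
  ring.
pose S := [set r | exists v G, W v G /\ r = J v G].
have S0 : S !=set0 by exists (J (fun=> 0) (fun=> 0)), (fun=> 0), (fun=> 0); split => //; exact: (W_0 HS).
have lbS : has_lbound S.
  (* Ellipticity and Poincare's inequality bound [t] times the integral of [v ^+ 2] by [E G G];
     Young's inequality with this weight lets the form absorb the linear term. *)
  pose t := alpha / C; have t0 : 0 < t by rewrite divr_gt0.
  exists (- (t^-1 * I (fun x => F x ^+ 2))) => _ [v [G [Wv ->]]].
  have Lv := WL2 Wv.
  have h1 : 2 * I (fun x => F x * v x) <= t^-1 * I (fun x => F x ^+ 2) + t * I (fun x => v x ^+ 2).
    rewrite -IntZ; last exact: L2_mul.
    rewrite -(IntZ t^-1 LF.2) -(IntZ t Lv.2).
    rewrite -IntD; [|by apply: L1Z; exact: LF.2|by apply: L1Z; exact: Lv.2].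
    apply: Int_leT.
    - by apply: L1Z; exact: L2_mul.
    - by apply: L1D; apply: L1Z; [exact: LF.2|exact: Lv.2].
    - move=> x; rewrite -subr_ge0.
      have -> : t^-1 * F x ^+ 2 + t * v x ^+ 2 - 2 * (F x * v x) = t^-1 * (F x - t * v x) ^+ 2.
        by field; rewrite gt_eqF.
      by rewrite mulr_ge0 ?sqr_ge0// invr_ge0 ltW.
  have h2 : t * I (fun x => v x ^+ 2) <= E G G.
    apply: le_trans (E_coercive (WL2v Wv)).
    by rewrite /t mulrAC ler_pdivrMr// -mulrA ler_pM2l// mulrC PC.
  have := QE v G; rewrite /J; lra.
have infS : has_inf S by split.
pose m := inf S.
have Jm v G : W v G -> m <= J v G.
  by move=> Wv; apply: ge_inf => //; exists v, G.
have ex n : exists vG : (T -> R) * (T -> 'rV[R]_N), W vG.1 vG.2 /\ J vG.1 vG.2 < m + en R n.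
  have [_ [v [G [Wv ->]]] h] := inf_adherent (en_gt0 R n) infS.
  by exists (v, G).
have [z zP] := choice ex.
pose v_ n := (z n).1; pose G_ n := (z n).2.
have Wn n : W (v_ n) (G_ n) := (zP n).1.
have Jn n : J (v_ n) (G_ n) < m + en R n := (zP n).2.
have cau : DGcauchy G_.
  move=> e e0.
  have [|k kP] := @en_small R (alpha * e / 4); first by rewrite divr_gt0// mulr_gt0.
  exists k => n p kn kp; have en1 := kP n kn; have en2 := kP p kp.
  have WB := W_B HS (Wn p) (Wn n).
  (* The expansion at [1] reaches the [p]-th pair and the one at [1 / 2] the midpoint. Eliminating
     the linear term gives [Q <= 2 (J n + J p) - 4 m], at most [2 (en n + en p)], which explains the
     [4] in the threshold. *)
  have j1 := JD _ _ _ _ 1 (Wn n) WB; have j2 := JD _ _ _ _ 2^-1 (Wn n) WB.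
  have jm := Jm _ _ (W_lin HS 2^-1 (Wn n) WB); rewrite j2 {j2} in jm.
  have jp := Jn p; have jn := Jn n.
  have E1 : J (fun x => v_ n x + 1 * (v_ p x - v_ n x)) (fun x => G_ n x + 1 *: (G_ p x - G_ n x)) = J (v_ p) (G_ p).
    by congr J; apply/funext => x; rewrite ?scale1r ?mul1r addrC subrK.
  rewrite E1 {E1} expr1n mul1r mulr1 in j1; rewrite divff ?mul1r// expr2 in jm.
  have q := QE (fun x => v_ p x - v_ n x) (fun x => G_ p x - G_ n x).
  rewrite DG_sym -(ler_pM2l alpha0).
  apply: le_trans (E_coercive (WL2v WB)) _; apply: le_trans q _.
  lra.
have [v [G [s [g [Wv cv cG _ _]]]]] := W_complete Wn cau.
exists v, G; split => // phi H Wp.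
pose L u K := E K H + l * I (fun x => u x * phi x) - I (fun x => F x * phi x).
have cL : L (v_ n) (G_ n) @[n --> \oo] --> L v G.
  apply: cvgB; last exact: cvg_cst.
  apply: cvgD; first exact: (E_cvg (fun n => WL2v (Wn n)) (WL2v Wv) (WL2v Wp) cG).
  apply: cvgM; first exact: cvg_cst.
  exact: (I_cvg (fun n => WL2 (Wn n)) (WL2 Wv) (WL2 Wp) cv).
(* Minimality up to [en R n] passes to the limit in the expansion, and a quadratic in [t] that is
   never negative and vanishes at [0] has no linear part. *)
have key t : 0 <= 2 * t * L v G + t ^+ 2 * Q phi H.
  suff : (fun n => 2 * t * L (v_ n) (G_ n) + t ^+ 2 * Q phi H + en R n) @ \oo --> 2 * t * L v G + t ^+ 2 * Q phi H + 0.
    rewrite addr0 => /cvg_ger_const; apply => n.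
    have := JD _ _ _ _ t (Wn n) Wp; rewrite -/(L _ _).
    have := Jm _ _ (W_lin HS t (Wn n) Wp); have := Jn n; lra.
  apply: cvgD; last exact: en_cvg.
  apply: cvgD; last exact: cvg_cst.
  by apply: cvgM => //; exact: cvg_cst.
suff : L v G = 0 by move/eqP; rewrite subr_eq0 => /eqP.
have Q0 : 0 <= Q phi H by apply: le_trans (QE _ _); exact: E_ge0.
apply/eqP/negPn/negP => Ln0.
have q1 : 0 < Q phi H + 1 by rewrite ltr_wpDl.
have := key (- L v G / (Q phi H + 1)).
have -> : 2 * (- L v G / (Q phi H + 1)) * L v G + (- L v G / (Q phi H + 1)) ^+ 2 * Q phi H =
   - (L v G ^+ 2 * (Q phi H + 2) / (Q phi H + 1) ^+ 2).
  by field; rewrite gt_eqF.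
rewrite oppr_ge0 leNgt => /negP; apply.
rewrite divr_gt0 ?exprn_gt0// mulr_gt0//; last by rewrite ltr_wpDl.
by rewrite exprn_even_gt0.
Qed.

End sobolev_problems.

(** * Lipschitz reaction terms: contraction, comparison, least solutions *)

Section lipschitz_problem.
Context d (T : measurableType d) (R : realType) (N : nat).
Variable mu : {measure set T -> \bar R}.
Variable W : (T -> R) -> (T -> 'rV[R]_N) -> Prop.
Hypothesis finmu : (mu setT < +oo)%E.
Hypothesis HS : sobolev mu W.
Variables (b : T -> R) (alpha beta : R).
Hypothesis mb : measurable_fun setT b.
Hypothesis alpha0 : 0 < alpha.
Hypothesis hb : forall x, alpha <= b x <= beta.
Implicit Types (u v f F phi : T -> R) (G H K : T -> 'rV[R]_N).
Local Notation I := (Int mu).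
Local Notation E := (EE mu b).

Let WL2 := W_L2 HS.
Let WL2v := W_L2v HS.

Let bb x : `|b x| <= beta.
Proof.
by have /andP[a1 a2] := hb x; rewrite ger0_norm// (le_trans (ltW alpha0)).
Qed.

Let EBl := EEBl (N:=N) (mu:=mu) mb bb.
Let EBr := EEBr (N:=N) (mu:=mu) mb bb.
Let EBB := EEBB (N:=N) (mu:=mu) mb bb.

(* The larger of two ordered subsolutions of [- div (b grad v) = F] is tested
   with the difference; only [E] and the linear term remain. *)
Lemma ordered_energy F u G v H : L2 mu F -> W u G -> W v H ->
  E H (fun x => H x - G x) <= I (fun x => F x * (v x - u x)) ->
  E (fun x => H x - G x) (fun x => H x - G x) <=
  (E G G - 2 * I (fun x => F x * u x)) - (E H H - 2 * I (fun x => F x * v x)).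
Proof.
move=> LF Wu Wv; rewrite EBr ?EBB//; try exact: WL2v; try exact: WL2v Wv; try exact: WL2v Wu.
have -> : I (fun x => F x * (v x - u x)) = I (fun x => F x * v x) - I (fun x => F x * u x).
  rewrite -IntB; [|exact: L2_mul LF (WL2 Wv)|exact: L2_mul LF (WL2 Wu)].
  by congr Int; apply/funext => x; rewrite mulrBr.
lra.
Qed.

Definition subsol F v G := forall phi H, W phi H -> (forall x, 0 <= phi x) ->
  E G H <= I (fun x => F x * phi x).

(** Monotone sequences are ordered only almost everywhere. The test function is replaced by its
    positive part, which has the same gradient up to a null set. *)
Lemma subsol_ae F v G phi H : L2 mu F -> W v G -> subsol F v G -> W phi H ->
  (\forall x \ae mu, 0 <= phi x) -> E G H <= I (fun x => F x * phi x).
Proof.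
move=> LF Wv sv Wp p0; have mp := W_mf HS Wp.
have Wq : W (fun x => Num.max 0 (phi x)) H.
  apply: (W_ae HS Wp) => //.
  - exact: measurable_maxr.
  - exact: (L2v_mf (WL2v Wp)).
  - by apply: filterS p0 => x p0; rewrite max_r.
  - exact: aeW.
have := sv _ _ Wq _; move/(_ (fun x => _)) => h.
apply: le_trans (h _) _ => [x|]; first by rewrite le_max lexx.
rewrite le_eqVlt; apply/orP; left; apply/eqP; apply: Int_ae_eq.
- by apply: measurable_funM; [exact: L2_mf LF|exact: measurable_maxr].
- by apply: measurable_funM => //; exact: L2_mf LF.
- by apply: filterS p0 => x p0; rewrite max_r.
Qed.

(** The energy [E G G - 2 int F v] of the linear problem decreases along the sequence by
    [ordered_energy], and [B] bounds it from below. *)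
Lemma increasing_subsol F (v_ : nat -> T -> R) (G_ : nat -> T -> 'rV[R]_N) B :
  L2 mu F -> (forall n, W (v_ n) (G_ n)) -> (forall n, subsol F (v_ n) (G_ n)) ->
  (forall n m, (n <= m)%N -> \forall x \ae mu, v_ n x <= v_ m x) ->
  (forall n, I (fun x => F x * v_ n x) <= B) -> DGcauchy mu G_.
Proof.
move=> LF Wn sn mono FB.
pose e n := E (G_ n) (G_ n) - 2 * I (fun x => F x * v_ n x).
have key n m : (n <= m)%N -> E (fun x => G_ m x - G_ n x) (fun x => G_ m x - G_ n x) <= e n - e m.
  move=> nm; apply: (ordered_energy LF (Wn n) (Wn m)).
  apply: (subsol_ae LF (Wn m) (sn m) (W_B HS (Wn m) (Wn n))).
  by apply: filterS (mono _ _ nm) => x; rewrite subr_ge0.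
have ncr n m : (n <= m)%N -> e m <= e n.
  by move=> nm; rewrite -subr_ge0; apply: le_trans (key n m nm); exact: (E_ge0 mu alpha0 hb).
apply: (energy_cauchy mb alpha0 hb (e := e)) => //.
- by move=> n; exact: WL2v (Wn n).
- apply: nonincreasing_is_cvgn; first by move=> n m; exact: ncr.
  exists (- (2 * B)) => _ [n _ <-].
  have := E_ge0 mu alpha0 hb (G_ n); have := FB n; rewrite /e; lra.
- move=> n m nm; rewrite ger0_norm ?subr_ge0 ?ncr//.
  apply: le_trans (key n m nm); rewrite le_eqVlt; apply/orP; left; apply/eqP.
  by congr Int; apply/funext => x; rewrite -opprB dotNl dotNr opprK.
Qed.

(** Here the energy increases along the sequence. Testing the inequality of [v_ n] with [v_ n]
    itself shows that it is nonpositive, which is the upper bound. *)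
Lemma decreasing_subsol F (v_ : nat -> T -> R) (G_ : nat -> T -> 'rV[R]_N) :
  L2 mu F -> (forall x, 0 <= F x) ->
  (forall n, W (v_ n) (G_ n)) -> (forall n, subsol F (v_ n) (G_ n)) ->
  (forall n x, 0 <= v_ n x) ->
  (forall n m, (n <= m)%N -> \forall x \ae mu, v_ m x <= v_ n x) -> DGcauchy mu G_.
Proof.
move=> LF F0 Wn sn v0 mono.
pose e n := E (G_ n) (G_ n) - 2 * I (fun x => F x * v_ n x).
have key n m : (n <= m)%N -> E (fun x => G_ n x - G_ m x) (fun x => G_ n x - G_ m x) <= e m - e n.
  move=> nm; apply: (ordered_energy LF (Wn m) (Wn n)).
  apply: (subsol_ae LF (Wn n) (sn n) (W_B HS (Wn n) (Wn m))).
  by apply: filterS (mono _ _ nm) => x; rewrite subr_ge0.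
have ndc n m : (n <= m)%N -> e n <= e m.
  by move=> nm; rewrite -subr_ge0; apply: le_trans (key n m nm); exact: (E_ge0 mu alpha0 hb).
apply: (energy_cauchy mb alpha0 hb (e := e)) => //.
- by move=> n; exact: WL2v (Wn n).
- apply: nondecreasing_is_cvgn; first by move=> n m; exact: ndc.
  exists 0 => _ [n _ <-].
  have := sn n _ _ (Wn n) (v0 n).
  have : 0 <= I (fun x => F x * v_ n x) by apply: Int_ge0 => x; rewrite mulr_ge0.
  rewrite /e; lra.
- by move=> n m nm; rewrite distrC ger0_norm ?subr_ge0 ?ndc// key.
Qed.

(** The reaction as a function of the unknown and of its gradient, after cutting off. The Lipschitz
    bound is squared so that it integrates directly to an [L^2] estimate. *)
Variable gg : R -> 'rV[R]_N -> R.
Variable Lg : R.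
Hypothesis Lg0 : 0 < Lg.
Hypothesis gg_ge0 : forall s xi, 0 <= gg s xi.
Hypothesis gg00 : gg 0 0 = 0.
Hypothesis ggL : forall s t xi ze,
  (gg s xi - gg t ze) ^+ 2 <= Lg * ((s - t) ^+ 2 + dot (xi - ze) (xi - ze)).
Hypothesis ggm : forall v G, measurable_fun setT v -> mfv G ->
  measurable_fun setT (fun x => gg (v x) (G x)).

Lemma gg_dist_L2 v G u H : L2 mu v -> L2v mu G -> L2 mu u -> L2v mu H ->
  L2 mu (fun x => gg (v x) (G x) - gg (u x) (H x)) /\
  I (fun x => (gg (v x) (G x) - gg (u x) (H x)) ^+ 2) <=
  Lg * (I (fun x => (v x - u x) ^+ 2) + DG mu (fun x => G x - H x) (fun x => G x - H x)).
Proof.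
move=> Lv LG Lu LH.
have L1r : L1 mu (fun x => Lg * ((v x - u x) ^+ 2 + dot (G x - H x) (G x - H x))).
  apply: L1Z; apply: L1D; first exact: (L2B Lv Lu).2.
  by apply: L1_dot; exact: L2vB.
have mgg : measurable_fun setT (fun x => gg (v x) (G x) - gg (u x) (H x)).
  apply: measurable_funB; apply: ggm.
  - exact: L2_mf Lv.
  - exact: L2v_mf LG.
  - exact: L2_mf Lu.
  - exact: L2v_mf LH.
have L1g : L1 mu (fun x => (gg (v x) (G x) - gg (u x) (H x)) ^+ 2).
  apply: (L1_domT _ L1r); first exact: measurable_funX.
  by move=> x; rewrite ger0_norm ?sqr_ge0.
split; first by split.
rewrite -IntD; [|exact: (L2B Lv Lu).2|by apply: L1_dot; exact: L2vB].
rewrite -IntZ; last by apply: L1D; [exact: (L2B Lv Lu).2|by apply: L1_dot; exact: L2vB].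
by apply: Int_leT => // x.
Qed.

Lemma gg_L2 v G : L2 mu v -> L2v mu G -> L2 mu (fun x => gg (v x) (G x)).
Proof.
move=> Lv LG; have [+ _] := gg_dist_L2 Lv LG (L2_0 mu) (@L2v0 _ _ _ N mu).
by rewrite gg00; under eq_fun do rewrite subr0.
Qed.

(** Large enough for three purposes: at least [2 alpha], so that half of the zero-order term
    controls [alpha |v|^2] in [linear_dist]; at least [2 Lg / alpha], so that the iteration of
    [fixpoint] contracts by [1 / 4]; at least [alpha / 2 + Lg / (2 alpha) + 1], as needed in
    [comparison]. *)
Definition lam := 2 * alpha + 3 * Lg / alpha + 1.

Lemma lam_gt0 : 0 < lam.
Proof. by rewrite /lam !addr_gt0// ?mulr_gt0// ?invr_gt0// mulr_gt0. Qed.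

Definition Nn v G := I (fun x => v x ^+ 2) + DG mu G G.

Lemma linear_dist F1 F2 v1 G1 v2 G2 : L2 mu F1 -> L2 mu F2 ->
  W v1 G1 -> W v2 G2 ->
  (forall phi H, W phi H -> E G1 H + lam * I (fun x => v1 x * phi x) = I (fun x => F1 x * phi x)) ->
  (forall phi H, W phi H -> E G2 H + lam * I (fun x => v2 x * phi x) = I (fun x => F2 x * phi x)) ->
  alpha * Nn (fun x => v1 x - v2 x) (fun x => G1 x - G2 x) <=
  (2 * lam)^-1 * I (fun x => (F1 x - F2 x) ^+ 2).
Proof.
move=> LF1 LF2 W1 W2 e1 e2; have WB := W_B HS W1 W2.
have l0 := lam_gt0; have Ld := WL2 WB.
have := e1 _ _ WB; have := e2 _ _ WB => h2 h1.
have h : E (fun x => G1 x - G2 x) (fun x => G1 x - G2 x) + lam * I (fun x => (v1 x - v2 x) ^+ 2)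
    = I (fun x => (F1 x - F2 x) * (v1 x - v2 x)).
  rewrite EBl; try exact: WL2v WB; try exact: WL2v W1; try exact: WL2v W2.
  have -> : I (fun x => (v1 x - v2 x) ^+ 2) = I (fun x => v1 x * (v1 x - v2 x)) - I (fun x => v2 x * (v1 x - v2 x)).
    rewrite -IntB; [|exact: L2_mul (WL2 W1) Ld|exact: L2_mul (WL2 W2) Ld].
    by congr Int; apply/funext => x; ring.
  have -> : I (fun x => (F1 x - F2 x) * (v1 x - v2 x)) = I (fun x => F1 x * (v1 x - v2 x)) - I (fun x => F2 x * (v1 x - v2 x)).
    rewrite -IntB; [|exact: L2_mul LF1 Ld|exact: L2_mul LF2 Ld].
    by congr Int; apply/funext => x; ring.
  by rewrite -h1 -h2; ring.
have LFB := L2B LF1 LF2.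
have y : I (fun x => (F1 x - F2 x) * (v1 x - v2 x)) <=
   (2 * lam)^-1 * I (fun x => (F1 x - F2 x) ^+ 2) + lam / 2 * I (fun x => (v1 x - v2 x) ^+ 2).
  rewrite -(IntZ (2 * lam)^-1 LFB.2) -(IntZ (lam / 2) Ld.2).
  rewrite -IntD; [|exact: L1Z LFB.2|exact: L1Z Ld.2].
  apply: Int_leT; [exact: L2_mul|by apply: L1D; [exact: L1Z LFB.2|exact: L1Z Ld.2]|].
  move=> x; rewrite -subr_ge0.
  rewrite (_ : _ - _ = (2 * lam)^-1 * ((F1 x - F2 x) - lam * (v1 x - v2 x)) ^+ 2).
    by rewrite mulr_ge0 ?sqr_ge0// invr_ge0 mulr_ge0// ltW.
  by field; rewrite gt_eqF.
have c := E_coercive mb alpha0 hb (WL2v WB).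
have i0 : 0 <= I (fun x => (v1 x - v2 x) ^+ 2) by apply: Int_ge0 => x; exact: sqr_ge0.
have la : 2 * alpha <= lam.
  rewrite /lam -addrA lerDl addr_ge0// mulr_ge0// ?invr_ge0 ?ltW// mulr_gt0//.
have := ler_wpM2r i0 la.
rewrite /Nn; lra.
Qed.

(** Freezing the reaction at the previous iterate leaves a linear problem for [riesz]; by the choice
    of [lam] the squared distance [Nn] of successive iterates is divided by [4] at each step. *)
Lemma fixpoint F : L2 mu F -> exists v G, W v G /\ forall phi H, W phi H ->
  E G H + lam * I (fun x => v x * phi x) + I (fun x => gg (v x) (G x) * phi x)
  = I (fun x => F x * phi x).
Proof.
move=> LF.
pose P (z z' : (T -> R) * (T -> 'rV[R]_N)) := W z'.1 z'.2 /\ forall phi H, W phi H ->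
  E z'.2 H + lam * I (fun x => z'.1 x * phi x) = I (fun x => (F x - gg (z.1 x) (z.2 x)) * phi x).
have ex z : exists z', W z.1 z.2 -> P z z'.
  have [Wz|nW] := pselect (W z.1 z.2); last by exists z.
  have LFg : L2 mu (fun x => F x - gg (z.1 x) (z.2 x)).
    by apply: L2B => //; apply: gg_L2; [exact: WL2 Wz|exact: WL2v Wz].
  by have [v [G vG]] := riesz HS mb alpha0 hb (ltW lam_gt0) LFg; exists (v, G).
have [S SP] := choice ex.
pose z n := iter n S (fun=> 0, fun=> 0).
have Wz n : W (z n).1 (z n).2.
  by elim: n => [|n ih]; [exact: (W_0 HS)|exact: (SP _ ih).1].
have zP n : P (z n) (z n.+1) by exact: SP.
have LFn n : L2 mu (fun x => F x - gg ((z n).1 x) ((z n).2 x)).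
  by apply: L2B => //; apply: gg_L2; [exact: WL2 (Wz n)|exact: WL2v (Wz n)].
pose D n := Nn (fun x => (z n.+1).1 x - (z n).1 x) (fun x => (z n.+1).2 x - (z n).2 x).
have D0 n : 0 <= D n.
  by apply: addr_ge0; [apply: Int_ge0 => x; exact: sqr_ge0|exact: DG_ge0].
have Dn n : D n.+1 <= 4^-1 * D n.
  have := linear_dist (LFn n.+1) (LFn n) (Wz n.+2) (Wz n.+1) (zP n.+1).2 (zP n).2.
  rewrite -/(D n.+1).
  have -> : I (fun x => (F x - gg ((z n.+1).1 x) ((z n.+1).2 x) - (F x - gg ((z n).1 x) ((z n).2 x))) ^+ 2)
      = I (fun x => (gg ((z n.+1).1 x) ((z n.+1).2 x) - gg ((z n).1 x) ((z n).2 x)) ^+ 2).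
    by congr Int; apply/funext => x; ring.
  have := (gg_dist_L2 (WL2 (Wz n.+1)) (WL2v (Wz n.+1)) (WL2 (Wz n)) (WL2v (Wz n))).2.
  rewrite -/(Nn (fun x => (z n.+1).1 x - (z n).1 x) (fun x => (z n.+1).2 x - (z n).2 x)) -/(D n).
  move=> h1 h2; have l0 := lam_gt0.
  have l2 : 0 <= (2 * lam)^-1 by rewrite invr_ge0 mulr_ge0// ltW.
  have := le_trans h2 (ler_wpM2l l2 h1).
  rewrite mulrA => h3; rewrite -(ler_pM2l alpha0); apply: le_trans h3 _.
  rewrite mulrA ler_wpM2r// mulrC ler_pdivrMr ?mulr_gt0//.
  have -> : alpha / 4 * (2 * lam) = alpha * lam / 2 by field.
  rewrite /lam !mulrDr mulrCA (mulrC alpha (_ / _)) divfK ?gt_eqF//.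
  have : 0 <= 2 * (alpha * alpha) by rewrite !mulr_ge0// ltW.
  by have := alpha0; have := Lg0; lra.
have Dgeo n : D n <= 4 ^- n * D 0%N.
  elim: n => [|n ih]; first by rewrite expr0 invr1 mul1r.
  apply: le_trans (Dn n) _; rewrite exprS invfM -mulrA ler_pM2l// invr_gt0//.
have Lz n m : L2v mu (fun x => (z n).2 x - (z m).2 x) by apply: L2vB; exact: WL2v.
(* The squared norm satisfies the triangle inequality only with factors [2], and the ratio [1 / 4]
   beats them: [2 * 4 * 4 ^- n.+1 + 2 * 4 ^- n] is again [4 * 4 ^- n]. *)
have DGz k n : DG mu (fun x => (z (n + k)%N).2 x - (z n).2 x) (fun x => (z (n + k)%N).2 x - (z n).2 x)
     <= 4 * (4 ^- n * D 0%N).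
  elim: k n => [|k ih] n.
    rewrite addn0 /DG (_ : (fun=> _) = fun=> 0).
      by rewrite Int0 !mulr_ge0// invr_ge0 exprn_ge0.
    by apply/funext => x; rewrite subrr dot0l.
  have := ih n.+1; rewrite addSnnS => h.
  apply: le_trans (DGBB_le (WL2v (Wz (n + k.+1)%N)) (WL2v (Wz n.+1)) (WL2v (Wz n))) _.
  have h2 : DG mu (fun x => (z n.+1).2 x - (z n).2 x) (fun x => (z n.+1).2 x - (z n).2 x) <= D n.
    by rewrite /D /Nn lerDr; apply: Int_ge0 => x; exact: sqr_ge0.
  have h3 := Dgeo n.
  have E4 : (4 : R) * (4 ^- n.+1 * D 0%N) = 4 ^- n * D 0%N.
    by rewrite exprS invfM; field; rewrite expf_neq0.
  rewrite E4 in h; lra.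
have cau : DGcauchy mu (fun n => (z n).2).
  move=> e e0.
  have : (4 * D 0%N) * (4^-1) ^+ n @[n --> \oo] --> 0.
    by apply: cvgZ0; apply: cvg_expr; rewrite ger0_norm ?invr_ge0// invf_lt1// ltr1n.
  move=> /cvgrPdist_le /(_ _ e0)[k _ kP]; exists k.
  have main n m : (k <= n)%N -> (n <= m)%N ->
      DG mu (fun x => (z m).2 x - (z n).2 x) (fun x => (z m).2 x - (z n).2 x) <= e.
    move=> kn nm; have := DGz (m - n)%N n; rewrite subnKC// => /le_trans; apply.
    have := kP n kn; rewrite sub0r normrN => /(le_trans (ler_norm _)).
    by apply: le_trans; rewrite -exprVn; lra.
  move=> n m kn km; have [nm|/ltnW mn] := leqP n m.
    by rewrite DG_sym; exact: main.
  exact: main.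
have [v [G [s [g [Wv cv cG _ _]]]]] := W_complete HS Wz cau.
exists v, G; split => // phi H Wp.
have Lg_ n := gg_L2 (WL2 (Wz n)) (WL2v (Wz n)).
have Lgv := gg_L2 (WL2 Wv) (WL2v Wv).
have cg : I (fun x => (gg ((z n).1 x) ((z n).2 x) - gg (v x) (G x)) ^+ 2) @[n --> \oo] --> 0.
  apply: (@squeeze0 _ _ (fun n => Lg * Nn (fun x => (z n).1 x - v x) (fun x => (z n).2 x - G x))).
    move=> n; rewrite ger0_norm; last by apply: Int_ge0 => x; exact: sqr_ge0.
    exact: (gg_dist_L2 (WL2 (Wz n)) (WL2v (Wz n)) (WL2 Wv) (WL2v Wv)).2.
  by apply: cvgZ0; rewrite -[X in _ --> X]addr0; exact: cvgD.
have c1 : E (z n.+1).2 H + lam * I (fun x => (z n.+1).1 x * phi x) @[n --> \oo] --> E G H + lam * I (fun x => v x * phi x).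
  have := (E_cvg mb alpha0 hb (fun n => WL2v (Wz n)) (WL2v Wv) (WL2v Wp) cG).
  have := (I_cvg (fun n => WL2 (Wz n)) (WL2 Wv) (WL2 Wp) cv) => c2 c1.
  have c3 : E (z n).2 H + lam * I (fun x => (z n).1 x * phi x) @[n --> \oo] --> E G H + lam * I (fun x => v x * phi x).
    by apply: cvgD => //; apply: cvgM => //; exact: cvg_cst.
  by rewrite -cvg_shiftS in c3.
have c2 : I (fun x => F x * phi x) - I (fun x => gg ((z n).1 x) ((z n).2 x) * phi x) @[n --> \oo]
    --> I (fun x => F x * phi x) - I (fun x => gg (v x) (G x) * phi x).
  apply: cvgB; first exact: cvg_cst.
  exact: (I_cvg Lg_ Lgv (WL2 Wp) cg).
have E12 : (fun n => E (z n.+1).2 H + lam * I (fun x => (z n.+1).1 x * phi x)) =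
   fun n => I (fun x => F x * phi x) - I (fun x => gg ((z n).1 x) ((z n).2 x) * phi x).
  apply/funext => n; rewrite ((zP n).2 _ _ Wp) -IntB; [|exact: L2_mul LF (WL2 Wp)|exact: L2_mul (Lg_ n) (WL2 Wp)].
  by congr Int; apply/funext => x; rewrite mulrBl.
rewrite E12 in c1.
have := cvg_unique _ c1 c2 => /(_ _) ->.
  by rewrite subrK.
exact: Rhausdorff.
Qed.

(** The test function is the positive part of [v - w]. Young's inequality splits the difference of
    the reaction terms into half of the coercive gradient term and [k] times the square of the test
    function, and [lam] exceeds [k]. *)
Lemma comparison v G w K : W v G -> W w K ->
  (forall phi H, W phi H -> (forall x, 0 <= phi x) ->
    E G H + lam * I (fun x => v x * phi x) + I (fun x => gg (v x) (G x) * phi x) <=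
    E K H + lam * I (fun x => w x * phi x) + I (fun x => gg (w x) (K x) * phi x)) ->
  \forall x \ae mu, v x <= w x.
Proof.
move=> Wv Ww h; have WB := W_B HS Wv Ww.
have Wp := W_pos finmu HS WB; set phi := (fun x => Num.max 0 (v x - w x)) in Wp.
pose c x := if 0 < v x - w x then 1 else 0 : R.
rewrite -/(c _) in Wp.
have phi0 x : 0 <= phi x by rewrite /phi le_max lexx.
have Lp := WL2 Wp; have LH := WL2v Wp.
have Lgv := gg_L2 (WL2 Wv) (WL2v Wv); have Lgw := gg_L2 (WL2 Ww) (WL2v Ww).
have := h _ _ Wp phi0 => {}h.
have LB := WL2v WB; have LBs := WL2 WB.
have c01 x : 0 <= c x <= 1 by rewrite /c; case: ifP; rewrite ?ler01 lexx.
have e1 : E (fun x => G x - K x) (fun x => c x *: (G x - K x)) +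
    lam * I (fun x => phi x ^+ 2) <=
    I (fun x => (gg (w x) (K x) - gg (v x) (G x)) * phi x).
  rewrite EBl; try exact: WL2v Wv; try exact: WL2v Ww; try exact: LH.
  have -> : I (fun x => phi x ^+ 2) = I (fun x => v x * phi x) - I (fun x => w x * phi x).
    rewrite -IntB; [|exact: L2_mul (WL2 Wv) Lp|exact: L2_mul (WL2 Ww) Lp].
    congr Int; apply/funext => x; rewrite -mulrBl /phi.
    by case: (lerP 0 (v x - w x)) => _; rewrite expr2// !mulr0.
  have -> : I (fun x => (gg (w x) (K x) - gg (v x) (G x)) * phi x) =
     I (fun x => gg (w x) (K x) * phi x) - I (fun x => gg (v x) (G x) * phi x).
    rewrite -IntB; [|exact: L2_mul Lgw Lp|exact: L2_mul Lgv Lp].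
    by congr Int; apply/funext => x; rewrite mulrBl.
  move: h; lra.
have L1c : L1 mu (fun x => c x * dot (G x - K x) (G x - K x)).
  have := L1_dot LB LH; congr (L1 mu _); apply/funext => x; exact: dotZr.
have e2 : alpha * I (fun x => c x * dot (G x - K x) (G x - K x)) <=
    E (fun x => G x - K x) (fun x => c x *: (G x - K x)).
  rewrite -IntZ//; apply: Int_leT; [exact: L1Z|exact: (L1_EE mb bb LB LH)|].
  move=> x; rewrite dotZr ler_wpM2r//; last by case/andP: (hb x).
  by rewrite mulr_ge0 ?dot_ge0//; case/andP: (c01 x).
pose k := alpha / 2 + Lg / (2 * alpha).
have k0 : 0 < k by rewrite addr_gt0// divr_gt0// mulr_gt0.
have e3 : I (fun x => (gg (w x) (K x) - gg (v x) (G x)) * phi x) <=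
    alpha / 2 * I (fun x => c x * dot (G x - K x) (G x - K x)) + k * I (fun x => phi x ^+ 2).
  rewrite -(IntZ (alpha / 2) L1c) -(IntZ k Lp.2).
  rewrite -IntD; [|exact: L1Z L1c|exact: L1Z Lp.2].
  apply: Int_leT.
  - by apply: L2_mul => //; exact: L2B.
  - by apply: L1D; [exact: L1Z L1c|exact: L1Z Lp.2].
  - move=> x; rewrite /phi /c; case: (ltrP 0 (v x - w x)) => vw; last first.
      by rewrite mulr0 mul0r mulr0 expr0n mulr0 addr0.
    rewrite mul1r.
    have := ggL (w x) (v x) (K x) (G x).
    have -> : dot (K x - G x) (K x - G x) = dot (G x - K x) (G x - K x).
      by rewrite -opprB dotNl dotNr opprK.
    move: (gg _ _ - gg _ _) (dot _ _) => y q hy.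
    have hy2 : (w x - v x) ^+ 2 = (v x - w x) ^+ 2 by ring.
    rewrite hy2 in hy; move: (v x - w x) hy vw => s hy s0.
    have : y * s <= alpha / (2 * Lg) * y ^+ 2 + Lg / (2 * alpha) * s ^+ 2.
      rewrite -subr_ge0.
      rewrite (_ : _ - _ = (2 * Lg * alpha)^-1 * (alpha * y - Lg * s) ^+ 2).
        by rewrite mulr_ge0 ?sqr_ge0// invr_ge0 !mulr_ge0// ltW.
      by field; rewrite !gt_eqF.
    move=> /le_trans; apply.
    have a2 : 0 <= alpha / (2 * Lg) by rewrite divr_ge0 ?mulr_ge0// ltW.
    have := ler_wpM2l a2 hy.
    have -> : alpha / (2 * Lg) * (Lg * (s ^+ 2 + q)) = alpha / 2 * (s ^+ 2 + q).
      by field; rewrite gt_eqF.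
    rewrite /k; lra.
have ic : 0 <= I (fun x => c x * dot (G x - K x) (G x - K x)).
  by apply: Int_ge0 => x; rewrite mulr_ge0 ?dot_ge0//; case/andP: (c01 x).
have ip : 0 <= I (fun x => phi x ^+ 2) by apply: Int_ge0 => x; exact: sqr_ge0.
have kl : k + 1 <= lam.
  rewrite /k /lam; have -> : Lg / (2 * alpha) = Lg / alpha / 2 by field; rewrite gt_eqF.
  have -> : 3 * Lg / alpha = 3 * (Lg / alpha) by rewrite mulrA.
  have : 0 < Lg / alpha by rewrite divr_gt0.
  by have := alpha0; lra.
have z : I (fun x => phi x ^+ 2) <= 0.
  have := ler_wpM2r ip kl; have := mulr_ge0 (ltW alpha0) ic; lra.
have := Int_eq0 Lp.2 (aeW _ (fun x => sqr_ge0 (phi x))) z.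
apply: filterS => x /eqP; rewrite sqrf_eq0 /phi => /eqP h0.
by rewrite -subr_le0 -h0 le_max lexx orbT.
Qed.

Definition supersol F z Z := forall phi H, W phi H -> (forall x, 0 <= phi x) ->
  I (fun x => F x * phi x) <= E Z H + I (fun x => gg (z x) (Z x) * phi x).

(** Testing with the negative part shows that the solution without reaction is nonnegative, and it
    is a supersolution since [gg >= 0]. It serves as the barrier that bounds the integrals of [F v]
    along the iteration. *)
Lemma laplace_supersol F : L2 mu F -> (forall x, 0 <= F x) ->
  exists z Z, [/\ W z Z, forall x, 0 <= z x & supersol F z Z].
Proof.
move=> LF F0; have [z [Z [Wz zP]]] := riesz HS mb alpha0 hb (lexx 0) LF.
have eqn phi H : W phi H -> E Z H = I (fun x => F x * phi x).
  by move=> Wp; rewrite -(zP _ _ Wp) mul0r addr0.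
have WN := W_Z HS (-1) Wz; have Wp := W_pos finmu HS WN.
set phi := (fun x => Num.max 0 (-1 * z x)) in Wp.
set H := (fun x => _ *: (-1 *: Z x)) in Wp.
have phi0 x : 0 <= phi x by rewrite /phi le_max lexx.
have EH : E Z H = - E H H.
  have -> : E H H = - E Z H; last by rewrite opprK.
  rewrite /EE -IntN; last exact: (L1_EE mb bb (WL2v Wz) (WL2v Wp)).
  congr Int; apply/funext => x; rewrite /H; case: ifP => _.
    by rewrite scale1r scaleN1r !(dotNl, dotNr) !mulrN opprK.
  by rewrite !scale0r !dot0r mulr0 oppr0.
have H0 : DG mu H H <= 0.
  have : 0 <= I (fun x => F x * phi x) by apply: Int_ge0 => x; rewrite mulr_ge0.
  rewrite -(eqn _ _ Wp) EH oppr_ge0 => h.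
  by rewrite -(pmulr_rle0 _ alpha0); exact: le_trans (E_coercive mb alpha0 hb (WL2v Wp)) h.
have [C C0 PC] := W_poincare HS.
have p0 : I (fun x => phi x ^+ 2) <= 0.
  by apply: le_trans (PC _ _ Wp) _; rewrite pmulr_rle0.
have ae0 := Int_eq0 (WL2 Wp).2 (aeW _ (fun x => sqr_ge0 (phi x))) p0.
exists (fun x => Num.max 0 (z x)), Z.
have aez : \forall x \ae mu, z x = Num.max 0 (z x).
  apply: filterS ae0 => x /eqP; rewrite sqrf_eq0 /phi => /eqP h0.
  rewrite max_r//; have : -1 * z x <= 0 by rewrite -h0 le_max lexx orbT.
  by rewrite mulN1r oppr_le0.
have Wz' : W (fun x => Num.max 0 (z x)) Z.
  apply: (W_ae HS Wz) => //; last exact: aeW.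
  - by apply: measurable_maxr => //; exact: W_mf HS _ _ Wz.
  - exact: (L2v_mf (WL2v Wz)).
split => // [x|psi K Wpsi psi0]; first by rewrite le_max lexx.
rewrite -(eqn _ _ Wpsi) lerDl; apply: Int_ge0 => x; exact: mulr_ge0.
Qed.

(** Each step adds [lam v] on the left and [lam] times the previous iterate on the right, starting
    from [0]. [comparison] applies to these problems; it gives the monotonicity and the bound by
    every nonnegative supersolution. Minimality among supersolutions, and not only among solutions,
    is what later orders the solutions of different problems. *)
Lemma minimal_solution F : L2 mu F -> (forall x, 0 <= F x) ->
  exists v G, [/\ W v G, forall x, 0 <= v x,
    forall phi H, W phi H ->
      E G H + I (fun x => gg (v x) (G x) * phi x) = I (fun x => F x * phi x) &
    forall z Z, W z Z -> (forall x, 0 <= z x) -> supersol F z Z ->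
      \forall x \ae mu, v x <= z x].
Proof.
move=> LF F0.
pose P (z z' : (T -> R) * (T -> 'rV[R]_N)) := W z'.1 z'.2 /\ forall phi H, W phi H ->
  E z'.2 H + lam * I (fun x => z'.1 x * phi x) + I (fun x => gg (z'.1 x) (z'.2 x) * phi x)
  = I (fun x => F x * phi x) + lam * I (fun x => z.1 x * phi x).
have ex z : exists z', W z.1 z.2 -> P z z'.
  have [Wz|nW] := pselect (W z.1 z.2); last by exists z.
  have LFz : L2 mu (fun x => F x + lam * z.1 x) by apply: L2D => //; apply: L2Z; exact: WL2 Wz.
  have [v [G [Wv vP]]] := fixpoint LFz; exists (v, G) => _; split => //= phi H Wp.
  rewrite (vP _ _ Wp) -IntZ; last exact: L2_mul (WL2 Wz) (WL2 Wp).
  rewrite -IntD; [|exact: L2_mul LF (WL2 Wp)|by apply: L1Z; exact: L2_mul (WL2 Wz) (WL2 Wp)].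
  by congr Int; apply/funext => x; ring.
have [S SP] := choice ex.
pose z n := iter n S (fun=> 0, fun=> 0).
have Wz n : W (z n).1 (z n).2.
  by elim: n => [|n ih]; [exact: (W_0 HS)|exact: (SP _ ih).1].
have zP n : P (z n) (z n.+1) by exact: SP.
have L1p u phi H : L2 mu u -> W phi H -> L1 mu (fun x => u x * phi x).
  by move=> Lu Wp; exact: L2_mul Lu (WL2 Wp).
have lamI u v phi H : L2 mu u -> L2 mu v -> W phi H -> (forall x, 0 <= phi x) ->
    (\forall x \ae mu, u x <= v x) ->
    lam * I (fun x => u x * phi x) <= lam * I (fun x => v x * phi x).
  move=> Lu Lv Wp p0 uv; rewrite ler_pM2l ?lam_gt0//.
  apply: Int_le; [exact: L1p Wp|exact: L1p Wp|].
  by apply: filterS uv => x uv; rewrite ler_wpM2r.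
have mono n : \forall x \ae mu, (z n).1 x <= (z n.+1).1 x.
  elim: n => [|n ih].
    apply: (comparison (Wz 0%N) (Wz 1%N)) => phi H Wp p0.
    rewrite ((zP 0%N).2 _ _ Wp) /=.
    have -> : E (fun=> 0) H = 0.
      by rewrite /EE -(Int0 mu); congr Int; apply/funext => x; rewrite dot0l mulr0.
    rewrite gg00; under eq_fun do rewrite mul0r.
    rewrite Int0 mulr0 !addr0.
    by apply: Int_ge0 => x; rewrite mulr_ge0.
  apply: (comparison (Wz n.+1) (Wz n.+2)) => phi H Wp p0.
  rewrite ((zP n).2 _ _ Wp) ((zP n.+1).2 _ _ Wp) lerD2l.
  by apply: lamI Wp p0 ih; exact: WL2.
have mono2 n m : (n <= m)%N -> \forall x \ae mu, (z n).1 x <= (z m).1 x.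
  move=> /subnK <-; elim: (m - n)%N => [|k ih]; first exact: aeW.
  by apply: filterS2 ih (mono (k + n)%N) => x; exact: le_trans.
have below y Y : W y Y -> (forall x, 0 <= y x) -> supersol F y Y ->
    forall n, \forall x \ae mu, (z n).1 x <= y x.
  move=> Wy y0 sy; elim => [|n ih]; first exact: aeW.
  apply: (comparison (Wz n.+1) Wy) => phi H Wp p0.
  rewrite ((zP n).2 _ _ Wp).
  have := sy _ _ Wp p0; have := lamI _ _ _ _ (WL2 (Wz n)) (WL2 Wy) Wp p0 ih; lra.
(* As the iterates increase, [lam (z n - z n.+1)] is nonpositive, and the reaction is
   nonnegative. *)
have sub n : subsol F (z n.+1).1 (z n.+1).2.
  move=> phi H Wp p0; have := (zP n).2 _ _ Wp.
  have := lamI _ _ _ _ (WL2 (Wz n)) (WL2 (Wz n.+1)) Wp p0 (mono n).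
  have : 0 <= I (fun x => gg ((z n.+1).1 x) ((z n.+1).2 x) * phi x).
    by apply: Int_ge0 => x; rewrite mulr_ge0.
  lra.
have [y [Y [Wy y0 sy]]] := laplace_supersol LF F0.
have cau : DGcauchy mu (fun n => (z n.+1).2).
  apply: (@increasing_subsol F (fun n => (z n.+1).1) _ (I (fun x => F x * y x))) => //.
    by move=> n m nm; exact: mono2.
  move=> n; apply: Int_le; [exact: L1p LF (Wz n.+1)|exact: L1p LF Wy|].
  by apply: filterS (below _ _ Wy y0 sy n.+1) => x; exact: ler_wpM2l.
have [v [G [s [g [Wv cv cG _ ae]]]]] := W_complete HS (fun n => Wz n.+1) cau.
have v0 : \forall x \ae mu, 0 <= v x.
  apply: filterS2 ae (ae_foralln (fun n => mono2 0%N n (leq0n n))) => x [[+ _] _] h.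
  by move=> /cvg_ger_const; apply.
have aev : \forall x \ae mu, v x = Num.max 0 (v x).
  by apply: filterS v0 => x v0; rewrite max_r.
have mv := L2_mf (WL2 Wv); have mG := L2v_mf (WL2v Wv).
have mv' : measurable_fun setT (fun x => Num.max 0 (v x)) by exact: measurable_maxr.
have Wv' : W (fun x => Num.max 0 (v x)) G.
  by apply: (W_ae HS Wv) => //; exact: aeW.
exists (fun x => Num.max 0 (v x)), G; split => // [x|phi H Wp|x X Wx x0 sx].
- by rewrite le_max lexx.
- have -> : I (fun x => gg (Num.max 0 (v x)) (G x) * phi x) = I (fun x => gg (v x) (G x) * phi x).
    apply: Int_ae_eq.
    + by apply: measurable_funM; [exact: ggm|exact: L2_mf (WL2 Wp)].
    + by apply: measurable_funM; [exact: ggm|exact: L2_mf (WL2 Wp)].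
    + by apply: filterS aev => x <-.
  have Lg_ n := gg_L2 (WL2 (Wz n.+1)) (WL2v (Wz n.+1)).
  have Lgv := gg_L2 (WL2 Wv) (WL2v Wv).
  have cg : I (fun x => (gg ((z n.+1).1 x) ((z n.+1).2 x) - gg (v x) (G x)) ^+ 2) @[n --> \oo] --> 0.
    apply: (@squeeze0 _ _ (fun n => Lg * Nn (fun x => (z n.+1).1 x - v x) (fun x => (z n.+1).2 x - G x))).
      move=> n; rewrite ger0_norm; last by apply: Int_ge0 => x; exact: sqr_ge0.
      exact: (gg_dist_L2 (WL2 (Wz n.+1)) (WL2v (Wz n.+1)) (WL2 Wv) (WL2v Wv)).2.
    by apply: cvgZ0; rewrite -[X in _ --> X]addr0; exact: cvgD.
  have c1 := E_cvg mb alpha0 hb (fun n => WL2v (Wz n.+1)) (WL2v Wv) (WL2v Wp) cG.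
  have c2 := I_cvg Lg_ Lgv (WL2 Wp) cg.
  have c3 := I_cvg (fun n => WL2 (Wz n.+1)) (WL2 Wv) (WL2 Wp) cv.
  have c4 := c3; rewrite -cvg_shiftS in c4.
  have c5 : E (z n.+2).2 H + I (fun x => gg ((z n.+2).1 x) ((z n.+2).2 x) * phi x) -
      lam * (I (fun x => (z n.+1).1 x * phi x) - I (fun x => (z n.+2).1 x * phi x)) @[n --> \oo]
      --> E G H + I (fun x => gg (v x) (G x) * phi x) - lam * (I (fun x => v x * phi x) - I (fun x => v x * phi x)).
    apply: cvgB.
      by apply: cvgD; [rewrite -cvg_shiftS in c1|rewrite -cvg_shiftS in c2].
    by apply: cvgM; [exact: cvg_cst|exact: cvgB].
  rewrite subrr mulr0 subr0 in c5.
  have E5 : (fun n => E (z n.+2).2 H + I (fun x => gg ((z n.+2).1 x) ((z n.+2).2 x) * phi x) -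
      lam * (I (fun x => (z n.+1).1 x * phi x) - I (fun x => (z n.+2).1 x * phi x))) = fun=> I (fun x => F x * phi x).
    by apply/funext => n; have := (zP n.+1).2 _ _ Wp; lra.
  rewrite E5 in c5.
  by rewrite -(cvg_lim (@Rhausdorff R) c5) lim_cst//; exact: Rhausdorff.
- apply: filterS2 ae (ae_foralln (below _ _ Wx x0 sx)) => t [[+ _] _] h.
  by move=> /cvg_ler_const le; rewrite ge_max x0/=; apply: le => n.
Qed.

End lipschitz_problem.

(** * Singular profiles *)

Section cutoffs.
Context (R : realType) (Vs : nat -> R).
Hypothesis VS : forall m, Vs m < Vs m.+1.
Hypothesis V0 : 0 < Vs 0%N.

Definition inD v := exists m, v <= Vs m.
(** Vanishes up to [1 / m] and equals [1] from [2 / m] on (identically [0] for [m = 0]), whereas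
    [hi m] rises from [0] to [1] between [Vs m] and [Vs m.+1]. The product [cutoff m] thus localizes
    away from [0] and from the end of the domain exhausted by [Vs]. *)
Definition lo m v : R := clip 1 (m%:R * v - 1).
Definition hi m v : R := clip 1 ((v - Vs m) / (Vs m.+1 - Vs m)).
Definition cutoff m v : R := lo m v * (1 - hi m v).

Lemma Vs_gt0 m : 0 < Vs m.
Proof. by elim: m => // m ih; rewrite (lt_trans ih). Qed.

Lemma Vs_homo m n : (m <= n)%N -> Vs m <= Vs n.
Proof.
move=> /subnK <-; elim: (n - m)%N => // k ih.
by rewrite addSn (le_trans ih)// ltW.
Qed.

Lemma dV_gt0 m : 0 < Vs m.+1 - Vs m. Proof. by rewrite subr_gt0. Qed.

Lemma clip01 (t : R) : 0 <= clip 1 t <= 1.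
Proof. by rewrite clip_ge0 clip_le. Qed.

Lemma lo01 m v : 0 <= lo m v <= 1. Proof. exact: clip01. Qed.
Lemma hi01 m v : 0 <= hi m v <= 1. Proof. exact: clip01. Qed.

Lemma cutoff01 m v : 0 <= cutoff m v <= 1.
Proof.
have /andP[l0 l1] := lo01 m v; have /andP[h0 h1] := hi01 m v.
by rewrite mulr_ge0 ?subr_ge0//= mulr_ile1 ?subr_ge0// gerBl.
Qed.

Lemma cutoff_compl m v : 1 - cutoff m v <= (1 - lo m v) + hi m v.
Proof.
have /andP[l0 l1] := lo01 m v; have /andP[h0 h1] := hi01 m v.
have -> : 1 - cutoff m v = (1 - lo m v) + lo m v * hi m v by rewrite /cutoff; ring.
by rewrite lerD2l ler_piMl.
Qed.

Lemma clip_homo (M s t : R) : s <= t -> clip M s <= clip M t.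
Proof. by move=> st; apply: le_max2 => //; exact: le_min2. Qed.

Lemma lo1 m v : 2 <= m%:R * v -> lo m v = 1.
Proof. by move=> h; apply: clip_big; rewrite ler01/=; lra. Qed.

Lemma lo_lt1 m v : (0 < m)%N -> 2 / m%:R <= v -> lo m v = 1.
Proof. by move=> m0; rewrite ler_pdivrMr ?ltr0n// mulrC; exact: lo1. Qed.

Lemma hi0 m v : v <= Vs m -> hi m v = 0.
Proof.
by move=> vV; apply: clip_neg => //; rewrite pmulr_lle0 ?subr_le0// invr_gt0 dV_gt0.
Qed.

Lemma lo_homo m n v : (m <= n)%N -> 0 <= v -> lo m v <= lo n v.
Proof. by move=> mn v0; apply: clip_homo; rewrite lerD2r ler_wpM2r// ler_nat. Qed.

Lemma hi_homo m n v : (m <= n)%N -> hi n v <= hi m v.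
Proof.
move=> /subnK <-; elim: (n - m)%N => // k ih; rewrite addSn; apply: le_trans ih.
set p := (k + m)%N; have /andP[h0 h1] := hi01 p v.
have [vV|Vv] := leP v (Vs p.+1); first by rewrite hi0.
suff -> : hi p v = 1 by case/andP: (hi01 p.+1 v).
apply: clip_big; rewrite ler01/= ler_pdivlMr ?dV_gt0// mul1r lerD2r ltW//.
Qed.

Lemma cutoff_homo m n v : (m <= n)%N -> 0 <= v -> cutoff m v <= cutoff n v.
Proof.
move=> mn v0; have /andP[l0 l1] := lo01 m v; have /andP[h0 h1] := hi01 m v.
apply: ler_pM => //; first by rewrite subr_ge0.
  exact: lo_homo.
by rewrite lerD2l lerN2 hi_homo.
Qed.

(** Where [cutoff m] is not [0] one has [v > 1 / m], so that [n v >= 2 m v > 2], and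
    [v < Vs m.+1 <= Vs n]: there [cutoff n] equals [1]. Localizing at a fixed [m] therefore erases
    the cutoffs of all high levels. *)
Lemma cutoff_absorb m n v : (2 * m < n)%N -> 0 <= v -> cutoff m v * cutoff n v = cutoff m v.
Proof.
move=> mn v0; have [l0|l0] := eqVneq (lo m v) 0; first by rewrite /cutoff l0 !mul0r.
have [h1|h1] := eqVneq (hi m v) 1; first by rewrite /cutoff h1 subrr mulr0 mul0r.
have lv : 1 < m%:R * v.
  rewrite ltNge; apply: contra l0 => h; apply/eqP/clip_neg => //; lra.
have hv : v < Vs m.+1.
  rewrite ltNge; apply: contra h1 => h; apply/eqP/clip_big.
  by rewrite ler01/= ler_pdivlMr ?dV_gt0// mul1r lerD2r.
have -> : cutoff n v = 1; last by rewrite mulr1.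
rewrite /cutoff lo1.
  rewrite hi0 ?subr0 ?mulr1// (le_trans (ltW hv))// Vs_homo//.
  by apply: leq_ltn_trans mn; rewrite leq_pmull.
have : (2 * m)%:R * v <= n%:R * v by rewrite ler_wpM2r// ler_nat ltnW.
rewrite natrM; lra.
Qed.

Lemma inDP v : inD v -> \forall m \near \oo, v <= Vs m.
Proof. by move=> [k vk]; exists k => // m km; rewrite (le_trans vk)// Vs_homo. Qed.

Lemma cutoff_near v : 0 < v -> inD v -> \forall m \near \oo, cutoff m v = 1.
Proof.
move=> v0 /inDP vD; near=> m.
rewrite /cutoff hi0; last by near: m.
rewrite subr0 mulr1 lo1// -ler_pdivrMr//.
by near: m; exact: nbhs_infty_ger.
Unshelve. all: by end_near. Qed.

Lemma hi_cvg v : inD v -> hi m v @[m --> \oo] --> 0.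
Proof.
move=> vD; apply: cvg_near_cst; apply: filterS (inDP vD) => m; exact: hi0.
Qed.

(** A difference of truncations is available in the class [W]; this form makes [hi] of a solution a
    test function with an explicit gradient. *)
Lemma hiE m v : 0 <= v -> hi m v = (Vs m.+1 - Vs m)^-1 * (clip (Vs m.+1) v - clip (Vs m) v).
Proof.
move=> v0; have p1 := Vs_gt0 m.+1; have p0 := Vs_gt0 m; have d0 := dV_gt0 m.
have [vV|Vv] := leP v (Vs m).
  rewrite hi0// !clip_id ?subrr ?mulr0 ?v0//.
  by rewrite (le_trans vV)// ltW.
have [vV'|Vv'] := leP v (Vs m.+1).
  rewrite (clip_id (M := Vs m.+1)) ?v0// clip_big ?ltW//.
  rewrite /hi clip_id; first by rewrite mulrC.
  apply/andP; split; last by rewrite ler_pdivrMr// mul1r lerD2r.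
  by apply: divr_ge0; [rewrite subr_ge0 ltW|exact: ltW].
have -> : clip (Vs m.+1) v = Vs m.+1 by apply: clip_big; rewrite !ltW.
have -> : clip (Vs m) v = Vs m by apply: clip_big; rewrite !ltW.
rewrite mulVf ?gt_eqF//; apply: clip_big.
by rewrite ler01/= ler_pdivlMr// mul1r lerD2r ltW.
Qed.

Lemma clip_div01 (e t : R) : 0 < e -> 0 <= e^-1 * clip e t <= 1.
Proof.
move=> e0; apply/andP; split; first by rewrite mulr_ge0 ?clip_ge0// invr_ge0 ltW.
by rewrite ler_pdivrMl// mulr1 clip_le// ltW.
Qed.

Lemma continuous_clip (M : R) : continuous (clip M).
Proof.
move=> t; apply: (@continuous_comp _ _ _ (Num.min M) (Num.max 0)).
  by apply: continuous_min; [exact: cvg_cst|exact: cvg_id].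
by apply: continuous_max; [exact: cvg_cst|exact: cvg_id].
Qed.

Lemma continuous_lo m : continuous (lo m).
Proof.
move=> t; apply: (@continuous_comp _ _ _ (fun v : R => m%:R * v - 1 : R) (clip 1)); last exact: continuous_clip.
by apply: cvgB; [apply: cvgM; [exact: cvg_cst|exact: cvg_id]|exact: cvg_cst].
Qed.

Lemma continuous_hi m : continuous (hi m).
Proof.
move=> t; apply: (@continuous_comp _ _ _ (fun v : R => (v - Vs m) / (Vs m.+1 - Vs m)) (clip 1)); last exact: continuous_clip.
by apply: cvgM; [apply: cvgB; [exact: cvg_id|exact: cvg_cst]|exact: cvg_cst].
Qed.

Lemma continuous_cutoff m : continuous (cutoff m).
Proof.
move=> t; apply: cvgM; first exact: continuous_lo.
by apply: cvgB; [exact: cvg_cst|exact: continuous_hi].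
Qed.

End cutoffs.

(** * Passage to the limit in the quadratic term *)

Section stability.
Context d (T : measurableType d) (R : realType) (N : nat).
Variable mu : {measure set T -> \bar R}.
Variable W : (T -> R) -> (T -> 'rV[R]_N) -> Prop.
Hypothesis finmu : (mu setT < +oo)%E.
Hypothesis HS : sobolev mu W.
Variables (b : T -> R) (alpha beta : R).
Hypothesis mb : measurable_fun setT b.
Hypothesis alpha0 : 0 < alpha.
Hypothesis hb : forall x, alpha <= b x <= beta.
Implicit Types (u v f F g phi : T -> R) (G H K : T -> 'rV[R]_N).
Local Notation I := (Int mu).
Local Notation E := (EE mu b).

Let WL2 := W_L2 HS.
Let WL2v := W_L2v HS.

Variables (Vs : nat -> R) (h : R -> R) (theta Ch v0 : R).
Hypothesis VS : forall m, Vs m < Vs m.+1.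
Hypothesis V0 : 0 < Vs 0%N.
Hypothesis theta01 : 0 < theta < 1.
Hypothesis h_ge0 : forall t, 0 <= h t.
Hypothesis h0 : h 0 = 0.
Hypothesis mh : measurable_fun setT h.
Hypothesis v00 : 0 < v0.
Hypothesis Ch0 : 0 < Ch.
Hypothesis hCh : forall t, 0 < t <= v0 -> h t <= Ch * t `^ (- theta).
Definition cut_profile m t := h t * cutoff Vs m t.
Local Notation hm := cut_profile.
Hypothesis chm : forall m, continuous (hm m).
Hypothesis hm_bdd : forall m, exists C, forall t, `|hm m t| <= C.

Let bb x : `|b x| <= beta.
Proof.
by have /andP[a1 a2] := hb x; rewrite ger0_norm// (le_trans (ltW alpha0)).
Qed.

Lemma measurable_clip (M : R) v : measurable_fun setT v -> measurable_fun setT (fun x => clip M (v x)).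
Proof.
by move=> mv; apply: measurableT_comp => //; exact: continuous_measurable_fun (@continuous_clip R M).
Qed.

Lemma E_chi_ge0 (c : T -> R) G : (forall x, 0 <= c x) -> 0 <= E G (fun x => c x *: G x).
Proof.
move=> c0; apply: Int_ge0 => x; rewrite dotZr !mulr_ge0 ?dot_ge0//.
by case/andP: (hb x) => /(le_trans (ltW alpha0)).
Qed.

Section one_solution.
Variables (v g f F : T -> R) (G : T -> 'rV[R]_N).
Hypothesis Wv : W v G.
Hypothesis v_ge0 : forall x, 0 <= v x.
Hypothesis Lg : L1 mu g.
Hypothesis g_ge0 : forall x, 0 <= g x.
Hypothesis Lf : L1 mu f.
Hypothesis LF : L1 mu F.
Hypothesis F01 : forall x, 0 <= F x <= f x.
Hypothesis eqn : forall phi H M, W phi H -> (forall x, `|phi x| <= M) ->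
  E G H + I (fun x => g x * phi x) = I (fun x => F x * phi x).
Hypothesis g_le : \forall x \ae mu, g x <= h (v x) * dot (G x) (G x).

Let mv := L2_mf (WL2 Wv).
Let mG := L2v_mf (WL2v Wv).
Let f_ge0 x : 0 <= f x. Proof. by case/andP: (F01 x) => /le_trans; apply. Qed.

Lemma L1_mulb u phi M : measurable_fun setT phi -> (forall x, `|phi x| <= M) ->
  L1 mu u -> L1 mu (fun x => u x * phi x).
Proof.
by move=> mp pM Lu; under eq_fun do rewrite mulrC; exact: L1_mulbdd mp pM Lu.
Qed.

(* Testing with a nonnegative nondecreasing function of the solution: the
   second-order term has a sign. *)
Lemma test_le (phi c : T -> R) M : W phi (fun x => c x *: G x) ->
  (forall x, 0 <= c x) -> (forall x, 0 <= phi x <= M) ->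
  E G (fun x => c x *: G x) + I (fun x => g x * phi x) <= I (fun x => f x * phi x) /\
  I (fun x => g x * phi x) <= I (fun x => f x * phi x).
Proof.
move=> Wp c0 pM; have pM' x : `|phi x| <= M by case/andP: (pM x) => p0 p1; rewrite ger0_norm.
have mp := L2_mf (WL2 Wp).
have e := eqn Wp pM'; have s := E_chi_ge0 G c0.
have : I (fun x => F x * phi x) <= I (fun x => f x * phi x).
  apply: Int_leT; [exact: L1_mulb pM' LF|exact: L1_mulb pM' Lf|].
  by move=> x; rewrite ler_wpM2r//; [case/andP: (pM x)|case/andP: (F01 x)].
by split; lra.
Qed.

(** The test functions [clip eps v / eps] increase to the indicator of [v > 0] as [eps] tends to
    [0], and [g] vanishes where [v = 0] because [h 0 = 0]. *)
Lemma reaction_mass : I g <= I f.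
Proof.
have key n : I (fun x => g x * ((en R n)^-1 * clip (en R n) (v x))) <= I f.
  have e0 := en_gt0 R n.
  have Wp := W_Z HS (en R n)^-1 (W_clip_id finmu HS e0 Wv).
  rewrite (_ : (fun x => _ *: _) = fun x => ((en R n)^-1 * (if 0 < v x < en R n then 1 else 0)) *: G x) in Wp; last first.
    by apply/funext => x; rewrite scalerA.
  have p01 x : 0 <= (en R n)^-1 * clip (en R n) (v x) <= 1.
    exact: clip_div01.
  have [|_ le1] := test_le Wp _ p01.
    by move=> x; apply: mulr_ge0; [rewrite invr_ge0 ltW|case: ifP].
  apply: le_trans le1 _; apply: Int_leT => //.
    apply: (@L1_mulb _ _ 1); [exact: L2_mf (WL2 Wp)| |exact: Lf].
    by move=> x; case/andP: (p01 x) => p0 p1; rewrite ger0_norm.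
  by move=> x; case/andP: (p01 x) => p0 p1; rewrite ler_piMr.
have [|||||//] := @Int_fatou _ _ _ mu (fun n x => g x * ((en R n)^-1 * clip (en R n) (v x))) g (I f).
- move=> n; have e0 := en_gt0 R n; apply: (@L1_mulb _ _ 1) => //.
    by apply: measurable_funM => //; exact: measurable_clip.
  by move=> x; have /andP[p0 p1] := clip_div01 (v x) e0; rewrite ger0_norm.
- move=> n x; rewrite !mulr_ge0 ?clip_ge0// invr_ge0 ltW//; exact: en_gt0.
- exact: (L1_mf Lg).
- apply: filterS g_le => x gl; have [vx0|vx] := leP (v x) 0.
    have gx : g x = 0.
      apply/eqP; rewrite eq_le g_ge0 andbT (le_trans gl)//.
      have -> : v x = 0 by apply/eqP; rewrite eq_le vx0 v_ge0.
      by rewrite h0 mul0r.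
    by rewrite gx; under eq_fun do rewrite mul0r; exact: cvg_cst.
  rewrite -[X in _ --> X]mulr1; apply: cvgM; first exact: cvg_cst.
  apply: cvg_near_cst; have [k kP] := en_small vx; exists k => // n /kP enx.
  by rewrite clip_big ?enx ?ltW ?en_gt0// mulVf// gt_eqF// en_gt0.
- exact: key.
Qed.

(** The test function is the truncation of [v] at [eps] raised to the power [1 - theta]. Its
    derivative [(1 - theta) v ^ (- theta)] reproduces the singularity of [h], so that the coercive
    term itself controls [g] on [v < eps]. The bound does not depend on the solution, hence no mass
    concentrates near the zero set along a sequence. *)
Lemma tail_zero eps : 0 < eps <= v0 ->
  I (fun x => (if v x < eps then 1 else 0) * g x) <=
  Ch / (alpha * (1 - theta)) * (2 * eps) `^ (1 - theta) * I f.
Proof.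
move=> /andP[e0 ev0]; have /andP[t0 t1] := theta01.
have s0 : 0 < 1 - theta by rewrite subr_gt0.
(* The shift by [eps * en R n] makes the power differentiable at [0]; Fatou's lemma removes it at
   the end. Truncation and shift are both at most [eps], whence [2 * eps]. *)
set q := fun n x => (if 0 < v x < eps then (1 - theta) * (v x + eps * en R n) `^ (- theta) else 0).
have key n : alpha * I (fun x => q n x * dot (G x) (G x)) <= (2 * eps) `^ (1 - theta) * I f
   /\ L1 mu (fun x => q n x * dot (G x) (G x)).
  have d0 : 0 < eps * en R n by rewrite mulr_gt0// en_gt0.
  set del := eps * en R n in d0 *.
  have de : del <= eps by rewrite /del ler_piMr ?(ltW e0)// invf_le1// ler1n.
  pose Fd t := (t + del) `^ (1 - theta) - del `^ (1 - theta).
  pose Fd' t := (1 - theta) * (t + del) `^ (- theta).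
  have dF (t : R) : 0 <= t <= eps -> is_derive t (1 : R) Fd (Fd' t).
    move=> /andP[tt _]; have td : 0 < t + del by rewrite ltr_wpDl.
    have d1 : is_derive t (1 : R) (fun t : R => t + del : R) 1.
      by apply: is_derive_eq; rewrite addr0.
    have d2 := @is_derive1_comp R (fun s => s `^ (1 - theta)) (fun t : R => t + del) t _ _ (is_derive1_powR (1 - theta) td) d1.
    have d3 : is_derive t (1 : R) (fun t => ((fun s => s `^ (1 - theta)) \o (fun t : R => t + del)) t - del `^ (1 - theta) : R) (Fd' t).
      apply: is_derive_eq; rewrite /Fd' subr0 mulr1; congr (_ * _ `^ _); ring.
    exact: d3.
  have cF' (t : R) : 0 <= t <= eps -> Fd' x @[x --> t] --> Fd' t.
    move=> /andP[tt _]; have td : 0 < t + del by rewrite ltr_wpDl.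
    apply: cvgM; first exact: cvg_cst.
    apply: (@continuous_comp _ _ _ (fun t : R => t + del : R) (fun s => s `^ (- theta))).
      by apply: cvgD; [exact: cvg_id|exact: cvg_cst].
    by have /@ex_derive/derivable1_diffP/differentiable_continuous := is_derive1_powR (- theta) td.
  have F0 : Fd 0 = 0 by rewrite /Fd add0r subrr.
  have Wp := W_clip finmu HS e0 dF cF' F0 Wv.
  have p01 x : 0 <= Fd (clip eps (v x)) <= (2 * eps) `^ (1 - theta).
    have c0 := clip_ge0 eps (v x); have c1 := clip_le (v x) (ltW e0).
    rewrite /Fd subr_ge0 ge0_ler_powR ?nnegrE ?(ltW s0) ?(ltW d0) ?lerDr//=; last by rewrite addr_ge0// ltW.
    apply: (@le_trans _ _ ((clip eps (v x) + del) `^ (1 - theta))).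
      by rewrite gerBl powR_ge0.
    apply: ge0_ler_powR; rewrite ?nnegrE ?(ltW s0)//.
    - by rewrite addr_ge0// ltW.
    - by rewrite mulr_ge0// ltW.
    - lra.
  have q0 x : 0 <= q n x by rewrite /q; case: ifP => // _; rewrite mulr_ge0 ?powR_ge0// ltW.
  have [h1 _] := test_le Wp q0 p01.
  have Lq : L1 mu (fun x => q n x * dot (G x) (G x)).
    have := L1_dot (WL2v Wv) (WL2v Wp); congr (L1 mu _); apply/funext => x; exact: dotZr.
  split => //.
  apply: (@le_trans _ _ (E G (fun x => q n x *: G x))).
    rewrite -IntZ//; apply: Int_leT; [exact: L1Z|exact: (L1_EE mb bb (WL2v Wv) (WL2v Wp))|].
    move=> x; rewrite dotZr ler_wpM2r//; last by case/andP: (hb x).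
    by rewrite mulr_ge0 ?dot_ge0.
  have : 0 <= I (fun x => g x * Fd (clip eps (v x))).
    by apply: Int_ge0 => x; rewrite mulr_ge0//; case/andP: (p01 x).
  have : I (fun x => f x * Fd (clip eps (v x))) <= (2 * eps) `^ (1 - theta) * I f.
    rewrite -IntZ//; apply: Int_leT.
    - apply: (@L1_mulb _ _ ((2 * eps) `^ (1 - theta))) => //; first exact: L2_mf (WL2 Wp).
      by move=> x; case/andP: (p01 x) => p0 p1; rewrite ger0_norm.
    - exact: L1Z.
    - by move=> x; rewrite mulrC ler_wpM2r//; case/andP: (p01 x).
  move: h1; rewrite /q; lra.
pose qo x := (if 0 < v x < eps then (1 - theta) * (v x) `^ (- theta) else 0).
have mb1 : measurable_fun setT (fun x => (0 < v x) && (v x < eps)).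
  by apply: measurable_and; exact: measurable_fun_ltr.
have mqo : measurable_fun setT qo.
  apply: measurable_fun_ifT => //; apply: measurable_funM => //.
  exact: (measurableT_comp (measurable_powR (- theta)) mv).
have a0 : 0 < alpha * (1 - theta) by rewrite mulr_gt0.
have [|||||Lo Io] := @Int_fatou _ _ _ mu (fun n x => q n x * dot (G x) (G x))
    (fun x => qo x * dot (G x) (G x)) (alpha^-1 * ((2 * eps) `^ (1 - theta) * I f)).
- by move=> n; case: (key n).
- move=> n x; rewrite mulr_ge0 ?dot_ge0// /q; case: ifP => // _.
  by rewrite mulr_ge0 ?powR_ge0// ltW.
- by apply: measurable_funM => //; exact: mf_dot.
- apply: aeW => x; apply: cvgM; last exact: cvg_cst.
  rewrite /q /qo; case: ifP => [/andP[vx _]|_]; last exact: cvg_cst.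
  apply: cvgM; first exact: cvg_cst.
  have cvn : v x + eps * en R n @[n --> \oo] --> v x.
    rewrite -[X in _ --> X]addr0; apply: cvgD; first exact: cvg_cst.
    by apply: cvgZ0; exact: en_cvg.
  exact: cvg_powR.
- by move=> n; rewrite ler_pdivlMl//; case: (key n).
have -> : Ch / (alpha * (1 - theta)) * (2 * eps) `^ (1 - theta) * I f =
    Ch / (1 - theta) * (alpha^-1 * ((2 * eps) `^ (1 - theta) * I f)).
  by field; rewrite !gt_eqF.
apply: le_trans (ler_wpM2l _ Io); last by rewrite divr_ge0 ?ltW.
rewrite -IntZ//; apply: Int_le.
- apply: (@L1_mulbdd _ _ _ _ _ _ 1) => //.
    by apply: measurable_fun_ifT => //; exact: measurable_fun_ltr.
  by move=> x; case: ifP; rewrite ?normr0 ?normr1.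
- exact: L1Z.
- apply: filterS g_le => x gl.
  have qo0 : 0 <= qo x by rewrite /qo; case: ifP => // _; rewrite mulr_ge0 ?powR_ge0// ltW.
  have cc0 : 0 <= Ch / (1 - theta) by rewrite divr_ge0 ?ltW.
  case: ifPn => [vx|_]; last by rewrite mul0r mulr_ge0// mulr_ge0 ?dot_ge0.
  rewrite mul1r (le_trans gl)// mulrA ler_wpM2r ?dot_ge0//.
  have [vp|vn] := ltP 0 (v x).
    rewrite /qo vp vx/= mulrA divfK ?gt_eqF//; apply: hCh.
    by rewrite vp/= (le_trans (ltW vx)).
  have -> : v x = 0 by apply/eqP; rewrite eq_le vn v_ge0.
  by rewrite h0 mulr_ge0.
Qed.

(** Test with [hi] of the solution, a nondecreasing function of it: the reaction beyond [Vs m.+1] is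
    paid for by the source where the solution exceeds [Vs m]. *)
Lemma tail_top m : I (fun x => g x * hi Vs m (v x)) <= I (fun x => f x * hi Vs m (v x)).
Proof.
have d0 := dV_gt0 VS m; have V1 := Vs_gt0 VS V0 m.+1; have V2 := Vs_gt0 VS V0 m.
have Wp := W_Z HS (Vs m.+1 - Vs m)^-1 (W_B HS (W_clip_id finmu HS V1 Wv) (W_clip_id finmu HS V2 Wv)).
pose c x := (Vs m.+1 - Vs m)^-1 * ((if 0 < v x < Vs m.+1 then 1 else 0) - (if 0 < v x < Vs m then 1 else 0)).
rewrite (_ : (fun x => _ *: _) = fun x => c x *: G x) in Wp; last first.
  by apply/funext => x; rewrite -scalerBl scalerA.
rewrite (_ : (fun x => _ * _) = fun x => hi Vs m (v x)) in Wp; last first.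
  by apply/funext => x; rewrite hiE.
have c0 x : 0 <= c x.
  rewrite mulr_ge0 ?invr_ge0 ?(ltW d0)// subr_ge0.
  case: ifPn => [/andP[v1 v2]|_]; last by case: ifP.
  by rewrite v1 (lt_trans v2).
by have [_] := test_le Wp c0 (fun x => hi01 Vs m (v x)).
Qed.

End one_solution.
Lemma cutoff_to_h x : inD Vs x -> 0 <= x -> hm m x @[m --> \oo] --> h x.
Proof.
move=> xD; rewrite le_eqVlt => /predU1P[<-|x0].
  by rewrite /hm h0; under eq_fun do rewrite mul0r; exact: cvg_cst.
apply: cvg_near_cst; apply: filterS (cutoff_near VS x0 xD) => m e.
by rewrite /hm e mulr1.
Qed.

(** Convergence of the reactions is assumed only after multiplication by a fixed cutoff. The
    complement is at most [(1 - lo) + hi]: the first part is small uniformly in [n] by [tail_zero],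
    the second is bounded by an integral of the source, by [tail_top], that converges in [n] to a
    quantity vanishing with [m]. Hence [n] goes to infinity before [m]. *)
Lemma stability (v_ : nat -> T -> R) (G_ : nat -> T -> 'rV[R]_N) (g_ f_ : nat -> T -> R) f v G :
  L1 mu f ->
  (forall n, W (v_ n) (G_ n)) -> (forall n x, 0 <= v_ n x) ->
  (forall n, L1 mu (g_ n)) -> (forall n x, 0 <= g_ n x) ->
  (forall n, L1 mu (f_ n)) -> (forall n x, 0 <= f_ n x <= f x) ->
  (forall n phi H M, W phi H -> (forall x, `|phi x| <= M) ->
     E (G_ n) H + I (fun x => g_ n x * phi x) = I (fun x => f_ n x * phi x)) ->
  (forall n, \forall x \ae mu, g_ n x <= h (v_ n x) * dot (G_ n x) (G_ n x)) ->
  (\forall x \ae mu, f_ n x @[n --> \oo] --> f x) ->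
  W v G -> (forall x, 0 <= v x) ->
  (\forall x \ae mu, v_ n x @[n --> \oo] --> v x) ->
  (\forall x \ae mu, inD Vs (v x)) ->
  (forall phi H, W phi H -> E (G_ n) H @[n --> \oo] --> E G H) ->
  (forall m, L1 mu (fun x => hm m (v x) * dot (G x) (G x)) /\
    I (fun x => `|cutoff Vs m (v_ n x) * g_ n x - hm m (v x) * dot (G x) (G x)|) @[n --> \oo] --> 0) ->
  L1 mu (fun x => h (v x) * dot (G x) (G x)) /\
  forall phi H M, W phi H -> (forall x, `|phi x| <= M) ->
    E G H + I (fun x => h (v x) * dot (G x) (G x) * phi x) = I (fun x => f x * phi x).
Proof.
move=> Lf Wn vn0 Lgn gn0 Lfn fn01 eqn gnh fnf Wv v_ge0 vnv vD Ec cg.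
have mv := L2_mf (WL2 Wv); have mG := L2v_mf (WL2v Wv).
have mvn n := L2_mf (WL2 (Wn n)).
have f_ge0 x : 0 <= f x by case/andP: (fn01 0%N x) => /le_trans; apply.
have If0 : 0 <= I f by exact: Int_ge0.
have s0 : 0 < 1 - theta by case/andP: theta01; rewrite subr_gt0.
pose Q m := Ch / (alpha * (1 - theta)) * (2 * (2 / m%:R)) `^ (1 - theta) * I f.
have Q0 : Q @ \oo --> 0.
  have c1 : (2 * (2 / m%:R)) `^ (1 - theta) @[m --> \oo] --> (0 : R).
    apply: cvg_powR0 => //.
    do 2 apply: cvgZ0; rewrite -cvg_shiftS.
    exact: en_cvg.
  have -> : Q = fun m => (I f * (Ch / (alpha * (1 - theta)))) * (2 * (2 / m%:R)) `^ (1 - theta).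
    by apply/funext => m; rewrite /Q; ring.
  exact: cvgZ0.
have lo_mf n m : measurable_fun setT (fun x => lo m (v_ n x)).
  by apply: measurableT_comp => //; apply: continuous_measurable_fun; exact: continuous_lo.
have hi_mf u m : measurable_fun setT u -> measurable_fun setT (fun x => hi Vs m (u x)).
  by move=> mu1; apply: measurableT_comp => //; apply: continuous_measurable_fun; exact: continuous_hi.
have cut_mf n m : measurable_fun setT (fun x => cutoff Vs m (v_ n x)).
  by apply: measurableT_comp => //; apply: continuous_measurable_fun; exact: continuous_cutoff.
have norm01 (t : R) : 0 <= t <= 1 -> `|t| <= 1 by move=> /andP[t0 t1]; rewrite ger0_norm.
have Llo n m : L1 mu (fun x => (1 - lo m (v_ n x)) * g_ n x).
  apply: (@L1_mulbdd _ _ _ _ _ _ 1) => //; first exact: measurable_funB.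
  by move=> x; apply: norm01; have /andP[l0 l1] := lo01 m (v_ n x); rewrite subr_ge0 l1 gerBl.
have tz : \forall m \near \oo, forall n, I (fun x => (1 - lo m (v_ n x)) * g_ n x) <= Q m.
  near=> m => n.
  have m0 : (0 < m)%N by near: m; exists 1%N.
  have m1 : (0 : R) < 2 / m%:R <= v0.
    rewrite divr_gt0 ?ltr0n//= ler_pdivrMr ?ltr0n// mulrC -ler_pdivrMr//.
    by near: m; exact: nbhs_infty_ger.
  have tl := tail_zero (Wn n) (vn0 n) (Lgn n) (gn0 n) Lf (Lfn n) (fn01 n) (eqn n) (gnh n) m1.
  apply: le_trans tl.
  apply: Int_leT => //.
    apply: (@L1_mulbdd _ _ _ _ _ _ 1) => //.
      by apply: measurable_fun_ifT => //; exact: measurable_fun_ltr.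
    by move=> x; case: ifP; rewrite ?normr0 ?normr1.
  move=> x; apply: ler_wpM2r => //; case: ltP => vx.
    by case/andP: (lo01 m (v_ n x)); lra.
  by rewrite lo_lt1// subrr.
have mass n := reaction_mass (Wn n) (vn0 n) (Lgn n) (gn0 n) Lf (Lfn n) (fn01 n) (eqn n) (gnh n).
have Lcut n m : L1 mu (fun x => cutoff Vs m (v_ n x) * g_ n x).
  by apply: (@L1_mulbdd _ _ _ _ _ _ 1) => // x; apply: norm01; exact: cutoff01.
have Lhm m := (cg m).1; have chmv m := (cg m).2.
have Icg m : I (fun x => cutoff Vs m (v_ n x) * g_ n x) @[n --> \oo] --> I (fun x => hm m (v x) * dot (G x) (G x)).
  apply/subr_cvg0; apply: squeeze0 (chmv m) => n.
  by rewrite -IntB//; apply: Int_abs; exact: L1B.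
have Ihm m : I (fun x => hm m (v x) * dot (G x) (G x)) <= I f.
  apply: cvg_ler_const (Icg m) _ => n; apply: le_trans (mass n); apply: Int_leT => // x.
  by rewrite ler_piMl//; case/andP: (cutoff01 Vs m (v_ n x)).
have hm0 m t : 0 <= hm m t by rewrite mulr_ge0//; case/andP: (cutoff01 Vs m t).
have hmv : \forall x \ae mu, hm m (v x) @[m --> \oo] --> h (v x).
  by apply: filterS vD => x vDx; exact: cutoff_to_h.
have cdom m t : hm m t <= h t by rewrite ler_piMr//; case/andP: (cutoff01 Vs m t).
have hle x : 0 <= h (v x) * dot (G x) (G x) by rewrite mulr_ge0 ?dot_ge0.
have mhm m : measurable_fun setT (fun x => hm m (v x)).
  by apply: measurableT_comp => //; exact: continuous_measurable_fun.
have mhv : measurable_fun setT (fun x => h (v x)) by exact: measurableT_comp.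
have [||||Lh _] := @Int_fatou _ _ _ mu (fun m x => hm m (v x) * dot (G x) (G x)) (fun x => h (v x) * dot (G x) (G x)) (I f) Lhm.
- by move=> m x; rewrite mulr_ge0 ?dot_ge0.
- by apply: measurable_funM => //; exact: mf_dot.
- by apply: filterS hmv => x hx; apply: cvgM => //; exact: cvg_cst.
- exact: Ihm.
split => // phi H M Wp pM; have mp := L2_mf (WL2 Wp).
have M0 : 0 <= `|M| by [].
have pM' x : `|phi x| <= `|M| by rewrite (le_trans (pM x))// ler_norm.
(* [L] is the limit of the reaction integrals that the equations impose. It remains to identify it
   with the limit of the localized integrals [X m]. *)
pose L := I (fun x => f x * phi x) - E G H.
have cL : I (fun x => g_ n x * phi x) @[n --> \oo] --> L.
  have -> : (fun n => I (fun x => g_ n x * phi x)) = fun n => I (fun x => f_ n x * phi x) - E (G_ n) H.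
    by apply/funext => n; rewrite -(eqn n _ _ _ Wp pM); ring.
  rewrite /L; apply: cvgB; last exact: Ec Wp.
  apply: (Int_dct (g := fun x => f x * `|M|) _ _ _ _ _).2 => //.
  + by move=> n; apply: measurable_funM => //; exact: L1_mf.
  + by apply: measurable_funM => //; exact: L1_mf Lf.
  + by under eq_fun do rewrite mulrC; exact: L1Z.
  + move=> n; apply: aeW => x; rewrite normrM ler_pM//.
    by case/andP: (fn01 n x) => f0 f1; rewrite ger0_norm.
  + by apply: filterS fnf => x fx; apply: cvgM => //; exact: cvg_cst.
have Lhi u m : measurable_fun setT u -> L1 mu (fun x => f x * hi Vs m (u x)).
  move=> mu1; apply: (L1_mulb (M := 1)) => //; first exact: hi_mf.
  by move=> x; apply: norm01; exact: hi01.
have chi m : I (fun x => f x * hi Vs m (v_ n x)) @[n --> \oo] --> I (fun x => f x * hi Vs m (v x)).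
  apply: (Int_dct (g := f) _ _ _ _ _).2 => //.
  + by move=> n; exact: L1_mf (Lhi _ _ (mvn n)).
  + exact: L1_mf (Lhi _ _ mv).
  + move=> n; apply: aeW => x; have /andP[h0' h1'] := hi01 Vs m (v_ n x).
    by rewrite ger0_norm ?mulr_ge0// ler_piMr.
  + apply: filterS vnv => x vx; apply: cvgM; first exact: cvg_cst.
    by apply: continuous_cvg => //; exact: continuous_hi.
have chi0 : I (fun x => f x * hi Vs m (v x)) @[m --> \oo] --> 0.
  rewrite -(Int0 mu).
  apply: (Int_dct (g := f) _ _ _ _ _).2 => //.
  + by move=> n; exact: L1_mf (Lhi _ _ mv).
  + move=> n; apply: aeW => x; have /andP[h0' h1'] := hi01 Vs n (v x).
    by rewrite ger0_norm ?mulr_ge0// ler_piMr.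
  + apply: filterS vD => x vDx; rewrite [X in _ --> X](_ : _ = f x * 0); last by rewrite mulr0.
    by apply: cvgM; [exact: cvg_cst|exact: hi_cvg].
have Lgp u : L1 mu u -> L1 mu (fun x => u x * phi x) by move=> Lu; exact: L1_mulb pM' Lu.
pose X m := I (fun x => hm m (v x) * dot (G x) (G x) * phi x).
have cX m : I (fun x => cutoff Vs m (v_ n x) * g_ n x * phi x) @[n --> \oo] --> X m.
  apply/subr_cvg0; apply: (@squeeze0 _ _ (fun n => `|M| * I (fun x => `|cutoff Vs m (v_ n x) * g_ n x - hm m (v x) * dot (G x) (G x)|))); last exact: cvgZ0.
  move=> n; rewrite -IntB; [|exact: Lgp|exact: Lgp].
  have LB : L1 mu (fun x => cutoff Vs m (v_ n x) * g_ n x - hm m (v x) * dot (G x) (G x)) by exact: L1B.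
  rewrite -IntZ; last exact: L1_norm.
  rewrite (_ : (fun x => _ - _) = fun x => (cutoff Vs m (v_ n x) * g_ n x - hm m (v x) * dot (G x) (G x)) * phi x); last first.
    by apply/funext => x; rewrite mulrBl.
  apply: le_trans (Int_abs (Lgp _ LB)) _.
  apply: Int_leT; [exact: L1_norm (Lgp _ LB)|by apply: L1Z; exact: L1_norm|].
  by move=> x; rewrite normrM mulrC ler_wpM2r.
have XL : \forall m \near \oo, `|L - X m| <= `|M| * (Q m + I (fun x => f x * hi Vs m (v x))).
  apply: filterS tz => m tzm; rewrite -subr_le0.
  have : `|I (fun x => g_ n x * phi x) - I (fun x => cutoff Vs m (v_ n x) * g_ n x * phi x)| -
     `|M| * (Q m + I (fun x => f x * hi Vs m (v_ n x))) @[n --> \oo] -->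
     `|L - X m| - `|M| * (Q m + I (fun x => f x * hi Vs m (v x))).
    apply: cvgB; first by apply: cvg_norm; exact: cvgB.
    by apply: cvgM; [exact: cvg_cst|apply: cvgD; [exact: cvg_cst|exact: chi]].
  move=> /cvg_ler_const; apply => n; rewrite subr_le0.
  have L1g : L1 mu (fun x => hi Vs m (v_ n x) * g_ n x).
    apply: (@L1_mulbdd _ _ _ _ _ _ 1) => //; first exact: hi_mf.
    by move=> x; apply: norm01; exact: hi01.
  apply: (@le_trans _ _ (`|M| * (I (fun x => (1 - lo m (v_ n x)) * g_ n x) + I (fun x => hi Vs m (v_ n x) * g_ n x)))).
    rewrite -IntB; [|exact: Lgp|exact: Lgp].
    rewrite -IntD// -IntZ; last exact: L1D.
    rewrite (_ : (fun x => _ - _) = fun x => (g_ n x - cutoff Vs m (v_ n x) * g_ n x) * phi x); last first.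
      by apply/funext => x; rewrite mulrBl.
    have LB : L1 mu (fun x => g_ n x - cutoff Vs m (v_ n x) * g_ n x) by exact: L1B.
    apply: le_trans (Int_abs (Lgp _ LB)) _.
    apply: Int_leT; [exact: L1_norm (Lgp _ LB)|by apply: L1Z; exact: L1D|].
    move=> x; rewrite normrM mulrC ler_pM//.
    have -> : g_ n x - cutoff Vs m (v_ n x) * g_ n x = (1 - cutoff Vs m (v_ n x)) * g_ n x by ring.
    have /andP[c0 c1] := cutoff01 Vs m (v_ n x).
    rewrite ger0_norm ?mulr_ge0 ?subr_ge0// -mulrDl ler_wpM2r//.
    exact: cutoff_compl.
  rewrite ler_wpM2l// lerD//.
  have := tail_top (Wn n) (vn0 n) Lf (Lfn n) (fn01 n) (eqn n) m.
  by under eq_fun do rewrite mulrC.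
have cXL : X @ \oo --> L.
  have r0 : `|M| * (Q m + I (fun x => f x * hi Vs m (v x))) @[m --> \oo] --> 0.
    by apply: cvgZ0; rewrite -[X in _ --> X]addr0; exact: cvgD.
  apply/cvgrPdist_le => e e0; move/cvgrPdist_le : r0 => /(_ _ e0) r0.
  apply: filterS2 r0 XL => m; rewrite sub0r normrN => h1 h2.
  by rewrite (le_trans h2)// (le_trans (ler_norm _)).
have cXh : X @ \oo --> I (fun x => h (v x) * dot (G x) (G x) * phi x).
  apply: (Int_dct (g := fun x => `|M| * (h (v x) * dot (G x) (G x))) _ _ _ _ _).2 => //.
  + by move=> m; exact: L1_mf (Lgp _ (Lhm m)).
  + exact: L1_mf (Lgp _ Lh).
  + exact: L1Z.
  + move=> m; apply: aeW => x; rewrite normrM mulrC ler_pM//.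
    by rewrite ger0_norm; [rewrite ler_wpM2r ?dot_ge0|rewrite mulr_ge0 ?dot_ge0].
  + apply: filterS hmv => x hx; apply: cvgM; last exact: cvg_cst.
    by apply: cvgM => //; exact: cvg_cst.
have : L = I (fun x => h (v x) * dot (G x) (G x) * phi x).
  by rewrite -(cvg_lim (@Rhausdorff R) cXL) (cvg_lim (@Rhausdorff R) cXh).
by rewrite /L; lra.
Unshelve. all: by end_near. Qed.

End stability.

Section truncated_square.
Context (R : realType) (N : nat).
Implicit Types (xi ze : 'rV[R]_N) (K : R).

Lemma dot_CS xi ze : dot xi ze ^+ 2 <= dot xi xi * dot ze ze.
Proof.
have [x0|x0] := leP (dot xi xi) 0; first by rewrite (dot_eq0 x0) !dot0l expr0n/= mul0r.
have := dot_ge0 (dot xi xi *: ze - dot xi ze *: xi).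
rewrite dotBl !dotBr !dotZl !dotZr (dotC ze xi).
have -> : dot xi xi * (dot xi xi * dot ze ze) - dot xi xi * (dot xi ze * dot xi ze) -
  (dot xi ze * (dot xi xi * dot xi ze) - dot xi ze * (dot xi ze * dot xi xi)) =
  dot xi xi * (dot xi xi * dot ze ze - dot xi ze ^+ 2) by ring.
by rewrite pmulr_rge0// subr_ge0.
Qed.

(** Factor the difference of squares: the truncated length [min |xi| K] is Lipschitz with constant
    [1], and the sum of two such lengths is at most [2 K]. *)
Lemma min_sqr_lip K xi ze : 0 < K ->
  (Num.min (dot xi xi) (K ^+ 2) - Num.min (dot ze ze) (K ^+ 2)) ^+ 2 <=
  4 * K ^+ 2 * dot (xi - ze) (xi - ze).
Proof.
move=> K0; set a := Num.sqrt (dot xi xi); set c := Num.sqrt (dot ze ze).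
have a0 : 0 <= a by exact: sqrtr_ge0.
have c0 : 0 <= c by exact: sqrtr_ge0.
have aE : dot xi xi = a ^+ 2 by rewrite sqr_sqrtr// dot_ge0.
have cE : dot ze ze = c ^+ 2 by rewrite sqr_sqrtr// dot_ge0.
have ac : dot xi ze <= a * c.
  have [n|p] := leP (dot xi ze) 0; first by rewrite (le_trans n)// mulr_ge0.
  rewrite -(@ler_pXn2r _ 2)// ?nnegrE ?mulr_ge0 ?(ltW p)//.
  by rewrite exprMn -aE -cE dot_CS.
have mE (t : R) : 0 <= t -> Num.min (t ^+ 2) (K ^+ 2) = (Num.min t K) ^+ 2.
  move=> t0; have [tK|Kt] := leP t K.
    by apply: min_l; rewrite ler_pXn2r// nnegrE ltW.
  by apply: min_r; rewrite ler_pXn2r// ?nnegrE ltW.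
have d0 : (a - c) ^+ 2 <= dot (xi - ze) (xi - ze).
  by rewrite dotBl !dotBr (dotC ze xi) aE cE; lra.
rewrite aE cE !mE//.
have m0 (t : R) : 0 <= t -> 0 <= Num.min t K <= K.
  by move=> t0; rewrite le_min t0 ltW//= ge_min lexx orbT.
have /andP[s0 s1] := m0 _ a0; have /andP[t0 t1] := m0 _ c0.
have md : (Num.min a K - Num.min c K) ^+ 2 <= (a - c) ^+ 2.
  rewrite -[leLHS]real_normK ?num_real// -[leRHS]real_normK ?num_real//.
  rewrite ler_pXn2r ?nnegrE//.
  have [aK|aK] := leP a K; have [cK|cK] := leP c K => //.
  - by rewrite !ler0_norm; lra.
  - by rewrite !ger0_norm; lra.
  - by rewrite subrr normr0.
set s := Num.min a K in s0 s1 md *; set t := Num.min c K in t0 t1 md *.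
rewrite subr_sqr exprMn mulrC; apply: ler_pM; rewrite ?sqr_ge0//.
  have -> : 4 * K ^+ 2 = (2 * K) ^+ 2 by ring.
  have e0 : 0 <= s + t by lra.
  have e1 : s + t <= 2 * K by lra.
  by rewrite ler_pXn2r ?nnegrE// (le_trans e0).
exact: le_trans d0.
Qed.

End truncated_square.

(** * The singular problem for bounded and for integrable sources *)

Section singular_problem.
Context d (T : measurableType d) (R : realType) (N : nat).
Variable mu : {measure set T -> \bar R}.
Variable W : (T -> R) -> (T -> 'rV[R]_N) -> Prop.
Hypothesis finmu : (mu setT < +oo)%E.
Hypothesis HS : sobolev mu W.
Variables (b : T -> R) (alpha beta : R).
Hypothesis mb : measurable_fun setT b.
Hypothesis alpha0 : 0 < alpha.
Hypothesis hb : forall x, alpha <= b x <= beta.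
Implicit Types (u v f F g phi : T -> R) (G H K : T -> 'rV[R]_N).
Local Notation I := (Int mu).
Local Notation E := (EE mu b).

Let WL2 := W_L2 HS.
Let WL2v := W_L2v HS.

Let bb x : `|b x| <= beta.
Proof.
by have /andP[a1 a2] := hb x; rewrite ger0_norm// (le_trans (ltW alpha0)).
Qed.

Variables (Vs : nat -> R) (h : R -> R) (theta Ch v0 : R).
Hypothesis VS : forall m, Vs m < Vs m.+1.
Hypothesis V0 : 0 < Vs 0%N.
Hypothesis theta01 : 0 < theta < 1.
Hypothesis h_ge0 : forall t, 0 <= h t.
Hypothesis h0 : h 0 = 0.
Hypothesis mh : measurable_fun setT h.
Hypothesis v00 : 0 < v0.
Hypothesis Ch0 : 0 < Ch.
Hypothesis hCh : forall t, 0 < t <= v0 -> h t <= Ch * t `^ (- theta).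
Local Notation hm := (cut_profile Vs h).
Hypothesis hm_lip : forall m, exists2 L, 0 <= L & forall s t, `|hm m s - hm m t| <= L * `|s - t|.
Hypothesis hm_bdd : forall m, exists C, forall t, `|hm m t| <= C.
Variable q : nat -> R.
Hypothesis q0 : q @ \oo --> 0.
(* A bound on the mass of the singular term forces the solution to stay in
   the domain exhausted by [Vs]. *)
Hypothesis top : forall j v G A, W v G -> (forall x, 0 <= v x) ->
  (forall m, L1 mu (fun x => hm m (v x) * dot (G x) (G x))) ->
  (forall m, I (fun x => hm m (v x) * dot (G x) (G x)) <= A) ->
  I (fun x => if Vs j < v x then 1 else 0) <= q j * A.

Lemma hm_continuous m : continuous (hm m).
Proof.
have [L L0 hL] := hm_lip m => t; apply/cvgrPdist_le => e e0.
have L1 : 0 < L + 1 by rewrite ltr_wpDl.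
have /cvgrPdist_le/(_ _ (divr_gt0 e0 L1)) := @cvg_id _ (nbhs t).
apply: filterS => s; rewrite ler_pdivlMr// mulrC; apply: le_trans.
by apply: le_trans (hL t s) _; rewrite ler_wpM2r// lerDl.
Qed.

Lemma hm_ge0 m t : 0 <= hm m t.
Proof. by rewrite mulr_ge0//; case/andP: (cutoff01 Vs m t). Qed.

Lemma hm_le m t : hm m t <= h t.
Proof. by rewrite ler_piMr//; case/andP: (cutoff01 Vs m t). Qed.

Lemma hm0 m : hm m 0 = 0. Proof. by rewrite /cut_profile h0 mul0r. Qed.

Lemma hm_homo m n t : (m <= n)%N -> 0 <= t -> hm m t <= hm n t.
Proof. by move=> mn t0; rewrite ler_wpM2l// cutoff_homo. Qed.

Definition qt n (xi : 'rV[R]_N) : R := Num.min (dot xi xi) (n.+1%:R ^+ 2).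
Definition gn n s xi : R := hm n s * qt n xi.

Lemma qt_ge0 n xi : 0 <= qt n xi.
Proof. by rewrite le_min dot_ge0 sqr_ge0. Qed.

Lemma qt_le n xi : qt n xi <= dot xi xi. Proof. by rewrite ge_min lexx. Qed.

Lemma qt_homo m n xi : (m <= n)%N -> qt m xi <= qt n xi.
Proof. by move=> mn; apply: le_min2 => //; rewrite ler_pXn2r ?nnegrE// ler_nat ltnS. Qed.

Lemma gn_ge0 n s xi : 0 <= gn n s xi.
Proof. by rewrite mulr_ge0 ?hm_ge0 ?qt_ge0. Qed.

Lemma gn_le n s xi : gn n s xi <= h s * dot xi xi.
Proof. by rewrite ler_pM ?hm_ge0 ?qt_ge0 ?hm_le ?qt_le. Qed.

Lemma gn_homo m n s xi : (m <= n)%N -> 0 <= s -> gn m s xi <= gn n s xi.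
Proof. by move=> mn s0; rewrite ler_pM ?hm_ge0 ?qt_ge0 ?hm_homo ?qt_homo. Qed.

Lemma gn_lip n : exists2 L, 0 < L & forall s t xi ze,
  (gn n s xi - gn n t ze) ^+ 2 <= L * ((s - t) ^+ 2 + dot (xi - ze) (xi - ze)).
Proof.
have [L L0 hL] := hm_lip n; have [C hC] := hm_bdd n.
set k : R := n.+1%:R; have k0 : 0 < k by rewrite ltr0n.
have C0 : 0 <= C by apply: le_trans (hC 0).
exists (2 * (L * k ^+ 2) ^+ 2 + 2 * (C ^+ 2 * (4 * k ^+ 2)) + 1).
  by rewrite ltr_wpDl ?addr_ge0 ?mulr_ge0 ?sqr_ge0.
move=> s t xi ze; have hd := dot_ge0 (xi - ze); have hs := sqr_ge0 (s - t).
have h1 : ((hm n s - hm n t) * qt n xi) ^+ 2 <= (L * k ^+ 2) ^+ 2 * (s - t) ^+ 2.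
  rewrite -!exprMn -[leLHS]real_normK ?num_real// -[leRHS]real_normK ?num_real//.
  rewrite ler_pXn2r ?nnegrE// normrM [leRHS]normrM.
  rewrite (ger0_norm (_ : 0 <= L * k ^+ 2)) ?mulr_ge0 ?sqr_ge0//.
  rewrite mulrAC; apply: ler_pM => //.
  by rewrite ger0_norm ?qt_ge0// ge_min lexx orbT.
have h2 : (hm n t * (qt n xi - qt n ze)) ^+ 2 <= C ^+ 2 * (4 * k ^+ 2) * dot (xi - ze) (xi - ze).
  rewrite exprMn -mulrA; apply: ler_pM; rewrite ?sqr_ge0//; last exact: min_sqr_lip.
  by rewrite -[leLHS]real_normK ?num_real// ler_pXn2r ?nnegrE.
have -> : gn n s xi - gn n t ze = (hm n s - hm n t) * qt n xi + hm n t * (qt n xi - qt n ze).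
  by rewrite /gn; ring.
set X := (hm n s - hm n t) * qt n xi in h1 *; set Y := hm n t * _ in h2 *.
have XY : (X + Y) ^+ 2 <= 2 * X ^+ 2 + 2 * Y ^+ 2.
  by have := sqr_ge0 (X - Y); lra.
have p1 : 0 <= (L * k ^+ 2) ^+ 2 by exact: sqr_ge0.
have p2 : 0 <= C ^+ 2 * (4 * k ^+ 2) by rewrite !mulr_ge0 ?sqr_ge0.
set P1 := (L * k ^+ 2) ^+ 2 in p1 h1 *; set P2 := C ^+ 2 * (4 * k ^+ 2) in p2 h2 *.
have := mulr_ge0 p1 hd; have := mulr_ge0 p2 hs.
move: hd hs h1 h2 XY; set D := dot (xi - ze) _; set S := (s - t) ^+ 2; lra.
Qed.

Lemma gn_mf n v G : measurable_fun setT v -> mfv G ->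
  measurable_fun setT (fun x => gn n (v x) (G x)).
Proof.
move=> mv mG; apply: measurable_funM.
  by apply: measurableT_comp => //; exact: continuous_measurable_fun (@hm_continuous n).
by apply: measurable_minr => //; exact: mf_dot.
Qed.

(* The solution of the problem truncated at level [n], characterized as the
   least nonnegative supersolution. *)
Definition minsol n F v G := [/\ W v G, forall x, 0 <= v x,
  forall phi H, W phi H ->
    E G H + I (fun x => gn n (v x) (G x) * phi x) = I (fun x => F x * phi x) &
  forall z Z, W z Z -> (forall x, 0 <= z x) -> supersol mu W b (gn n) F z Z ->
    \forall x \ae mu, v x <= z x].

Lemma minsol_exists n F : L2 mu F -> (forall x, 0 <= F x) -> exists v G, minsol n F v G.
Proof.
move=> LF F0; have [L L0 hL] := gn_lip n.
apply: (minimal_solution finmu HS mb alpha0 hb L0 _ _ hL _ LF F0) => //.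
- by move=> s xi; exact: gn_ge0.
- by rewrite /gn hm0 mul0r.
- by move=> v G; exact: gn_mf.
Qed.

Lemma gn_L2 n v G : W v G -> L2 mu (fun x => gn n (v x) (G x)).
Proof.
move=> Wv; have [C hC] := hm_bdd n; apply: (L2_bdd finmu (C := C * n.+1%:R ^+ 2)).
  by apply: gn_mf; [exact: L2_mf (WL2 Wv)|exact: L2v_mf (WL2v Wv)].
move=> x; rewrite normrM ler_pM// ger0_norm ?qt_ge0// ge_min lexx orbT//.
Qed.

(** The cut-off reaction increases with the level. The solution with the lower level and the larger
    source is therefore a supersolution of the other problem, and minimality applies. *)
Lemma minsol_le m n F F' v G v' G' : (m <= n)%N -> L2 mu F -> L2 mu F' ->
  (forall x, F' x <= F x) -> minsol m F v G -> minsol n F' v' G' ->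
  \forall x \ae mu, v' x <= v x.
Proof.
move=> mn LF LF' FF [Wv v0' ev _] [Wv' v0'' ev' min]; apply: (min v G) => //.
move=> phi H Wp p0; apply: (@le_trans _ _ (I (fun x => F x * phi x))).
  apply: Int_leT; [exact: L2_mul LF' (WL2 Wp)|exact: L2_mul LF (WL2 Wp)|].
  by move=> x; rewrite ler_wpM2r.
rewrite -(ev _ _ Wp) lerD2l; apply: Int_leT.
- exact: L2_mul (gn_L2 m Wv) (WL2 Wp).
- exact: L2_mul (gn_L2 n Wv) (WL2 Wp).
- by move=> x; rewrite ler_wpM2r// gn_homo.
Qed.

(** The quadratic term is only integrable, hence the bounded test functions. That the values lie in
    the domain is part of the notion, since beyond it the profile is not meaningful. *)
Definition sol F v G := [/\ W v G, forall x, 0 <= v x, (\forall x \ae mu, inD Vs (v x)),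
  L1 mu (fun x => h (v x) * dot (G x) (G x)) &
  forall phi H M, W phi H -> (forall x, `|phi x| <= M) ->
    E G H + I (fun x => h (v x) * dot (G x) (G x) * phi x) = I (fun x => F x * phi x)].

(** The indicators of [Ws j < v] decrease to the indicator of the complement of the domain, and
    their integrals tend to [0]. The sequence is arbitrary because it is applied both to [Vs] and to
    its image under [Yf]. *)
Lemma mass_inD (Ws : nat -> R) v A : (forall m, Ws m < Ws m.+1) ->
  measurable_fun setT v ->
  (forall j, I (fun x => if Ws j < v x then 1 else 0) <= q j * A) ->
  \forall x \ae mu, inD Ws (v x).
Proof.
move=> WS mv vA.
pose w j x : R := if Ws j < v x then 1 else 0.
pose wo x : R := if `[< inD Ws (v x) >] then 0 else 1.
have mw j : measurable_fun setT (w j).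
  by apply: measurable_fun_ifT => //; exact: measurable_fun_ltr.
have cw x : w j x @[j --> \oo] --> wo x.
  apply: cvg_near_cst; rewrite /w /wo; case: asboolP => [/inDP-/(_ WS)|nD].
    by apply: filterS => j /le_gtF ->.
  exists 0%N => // j _; rewrite ltNge; case: ifPn => // /negPn vj.
  by case: nD; exists j.
have mwo : measurable_fun setT wo by apply: (measurable_fun_cvg mw) => x _; exact: cw.
have w01 j x : `|w j x| <= 1 by rewrite /w; case: ifP; rewrite ?normr0 ?normr1.
have Lwo : L1 mu wo.
  by apply: (L1_bdd finmu (C := 1)) => // x; rewrite /wo; case: asboolP; rewrite ?normr0 ?normr1.
have cI : I (w j) @[j --> \oo] --> I wo.
  apply: (Int_dct (g := fun=> 1) _ _ _ _ _).2 => //; first exact: L1_cst.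
  - by move=> j; apply: aeW.
  - exact: aeW.
have Iwo : I wo <= 0.
  have cq : q j * A @[j --> \oo] --> 0.
    by under eq_fun do rewrite mulrC; exact: cvgZ0.
  have : I (w j) - q j * A @[j --> \oo] --> I wo - 0 by exact: cvgB.
  by rewrite subr0 => /cvg_ler_const; apply => j; rewrite subr_le0; exact: vA.
have : \forall x \ae mu, wo x = 0.
  by apply: Int_eq0 => //; apply: aeW => x; rewrite /wo; case: asboolP.
by apply: filterS => x; rewrite /wo; case: asboolP => // _ /eqP; rewrite oner_eq0.
Qed.

Lemma subseq_ge (s : nat -> nat) : {homo s : m n / (m < n)%N} -> forall n, (n <= s n)%N.
Proof. by move=> ss; elim => // n ih; apply: leq_ltn_trans ih _; exact: ss. Qed.

Lemma subseq_cvg (s : nat -> nat) : {homo s : m n / (m < n)%N} -> s n @[n --> \oo] --> \oo.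
Proof.
by move=> ss P [k _ kP]; exists k => // n kn; apply: kP => /=; rewrite (leq_trans kn)// subseq_ge.
Qed.

Lemma qt_cvg (s : nat -> nat) (xi_ : nat -> 'rV[R]_N) (xi : 'rV[R]_N) : {homo s : m n / (m < n)%N} ->
  (forall i : 'I_N, xi_ n ord0 i @[n --> \oo] --> xi ord0 i) ->
  qt (s n) (xi_ n) @[n --> \oo] --> dot xi xi.
Proof.
move=> ss cxi.
have cd : dot (xi_ n) (xi_ n) @[n --> \oo] --> dot xi xi.
  by apply: cvg_sumr => i; apply: cvgM; exact: cxi.
have cd' := cd; apply: cvg_trans cd'; apply: near_eq_cvg; near=> n.
rewrite /qt min_l//; apply: (@le_trans _ _ (dot xi xi + 1)).
  by near: n; apply: (cvgr_le _ cd); rewrite ltrDl.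
have : dot xi xi + 1 < n.+1%:R by near: n; exact: near_natS_gt.
move=> /ltW /le_trans; apply; apply: (@le_trans _ _ (s n).+1%:R).
  by rewrite ler_nat ltnS subseq_ge.
by rewrite expr2 ler_peMr// ler1n.
Unshelve. all: by end_near. Qed.

(** The level tends to infinity with the source fixed. The solutions decrease and are subsolutions
    of the linear problem, so that their gradients converge strongly. The last two clauses of the
    conclusion let inequalities between the [v_ n] of two sources pass to the limits. *)
Lemma level_limit F (v_ : nat -> T -> R) (G_ : nat -> T -> 'rV[R]_N) :
  L2 mu F -> (forall x, 0 <= F x) -> (forall n, minsol n F (v_ n) (G_ n)) ->
  exists v G (s : nat -> nat), [/\ sol F v G,
    forall n, \forall x \ae mu, v x <= v_ n x &
    \forall x \ae mu, v_ (s n) x @[n --> \oo] --> v x].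
Proof.
move=> LF F0 ms; have LF1 := L2_L1 finmu LF.
have Wn n : W (v_ n) (G_ n) by case: (ms n).
have vn0 n x : 0 <= v_ n x by case: (ms n).
have eqn n phi H : W phi H ->
    E (G_ n) H + I (fun x => gn n (v_ n x) (G_ n x) * phi x) = I (fun x => F x * phi x).
  by case: (ms n) => _ _ e _; exact: e.
have mono m n : (m <= n)%N -> \forall x \ae mu, v_ n x <= v_ m x.
  by move=> mn; apply: (minsol_le mn LF LF _ (ms m) (ms n)).
have Gc : DGcauchy mu G_.
  apply: (decreasing_subsol HS mb alpha0 hb LF F0 Wn _ vn0 mono).
  move=> n phi H Wp p0; rewrite -(eqn n _ _ Wp) lerDl.
  by apply: Int_ge0 => x; rewrite mulr_ge0 ?gn_ge0.
have [w [G [s [k [Ww cw cG [ss Lk] dom]]]]] := W_complete HS Wn Gc.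
pose v x := Num.max 0 (w x).
have mv : measurable_fun setT v by apply: measurable_maxr => //; exact: L2_mf (WL2 Ww).
have mG := L2v_mf (WL2v Ww).
have vw : \forall x \ae mu, w x = v x.
  apply: filterS dom => x [[cx _] _]; rewrite /v max_r//.
  by apply: cvg_ger_const cx _ => n; exact: vn0.
have Wv : W v G by apply: (W_ae HS Ww mv mG vw); exact: aeW.
have cv : \forall x \ae mu, v_ (s n) x @[n --> \oo] --> v x.
  by apply: filterS2 dom vw => x [[cx _] _] <-.
have vle n : \forall x \ae mu, v x <= v_ n x.
  have : \forall x \ae mu, forall m, (n <= m)%N -> v_ m x <= v_ n x.
    apply: ae_foralln => m; have [/mono hn|_] := boolP (n <= m)%N; last exact: aeW.
    by apply: filterS hn.
  apply: filterS2 cv => x cx hx.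
  have := cvg_ler_const (u := fun m => v_ (s (m + n)%N) x) (l := v x) (c := v_ n x); apply.
    by move: cx; rewrite -(cvg_shiftn n).
  by move=> m; apply: hx; rewrite (leq_trans _ (subseq_ge ss _))// leq_addl.
have mvn n := L2_mf (WL2 (Wn n)); have mGn n := L2v_mf (WL2v (Wn n)).
have LG := L1_dot (WL2v Wv) (WL2v Wv).
have lim m : L1 mu (fun x => hm m (v x) * dot (G x) (G x)) /\
    I (fun x => `|cutoff Vs m (v_ (s n) x) * gn (s n) (v_ (s n) x) (G_ (s n) x) - hm m (v x) * dot (G x) (G x)|) @[n --> \oo] --> 0.
  have [C hC] := hm_bdd m; have C0 : 0 <= C by apply: le_trans (hC 0).
  have mhm u : measurable_fun setT u -> measurable_fun setT (fun x => hm m (u x)).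
    by move=> mu1; apply: measurableT_comp => //; exact: continuous_measurable_fun (@hm_continuous m).
  have Lh : L1 mu (fun x => hm m (v x) * dot (G x) (G x)).
    by apply: (L1_mulbdd (C := C)) LG => //; exact: mhm.
  split => //.
  (* Once [n > 2 m], [cutoff_absorb] removes the cutoff hidden in [gn (s n)], and the localized
     reaction becomes [X n], which has a majorant independent of [n]. *)
  pose X n x := hm m (v_ (s n) x) * qt (s n) (G_ (s n) x).
  have : I (fun x => `|X n x - hm m (v x) * dot (G x) (G x)|) @[n --> \oo] --> 0.
    rewrite -(Int0 mu).
    have mX n : measurable_fun setT (X n).
      apply: measurable_funM; first exact: mhm.
      by apply: measurable_minr => //; exact: mf_dot.
    apply: (Int_dct (g := fun x => C * \sum_(i < N) k x ^+ 2 + `|hm m (v x) * dot (G x) (G x)|) _ _ _ _ _).2 => //.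
    - move=> n; apply: measurableT_comp => //; apply: measurable_funB => //.
      exact: L1_mf Lh.
    - apply: L1D; last exact: L1_norm.
      by apply: L1Z; apply: L1_sum => i; exact: Lk.2.
    - move=> n; apply: filterS dom => x [_ dx]; rewrite normr_id.
      apply: le_trans (ler_normB _ _) _; rewrite lerD2r /X normrM ler_pM//.
      rewrite ger0_norm ?qt_ge0// (le_trans (qt_le _ _))//.
      apply: ler_sum => i _; rewrite -expr2 -[leLHS]real_normK ?num_real//.
      rewrite ler_pXn2r ?nnegrE ?(dx i).2//.
      by apply: le_trans ((dx i).2 0%N).
    - apply: filterS2 cv dom => x cx [_ dx].
      rewrite -[X in _ --> X](normr0 R) -[X in `|X|](subrr (hm m (v x) * dot (G x) (G x))).
      apply: cvg_norm; apply: cvgB; last exact: cvg_cst.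
      apply: cvgM; first by apply: continuous_cvg => //; exact: hm_continuous.
      by apply: qt_cvg => // i; exact: (dx i).1.
  apply: cvg_trans; apply: near_eq_cvg; exists (2 * m).+1 => // n mn.
  congr Int; apply/funext => x; congr `|_ - _|; rewrite /X /gn /cut_profile.
  rewrite -[in LHS](@cutoff_absorb _ _ VS m (s n))//; first by ring.
  exact: leq_trans mn (subseq_ge ss n).
have gn1 n : L1 mu (fun x => gn (s n) (v_ (s n) x) (G_ (s n) x)).
  exact: (L2_L1 finmu (gn_L2 (s n) (Wn (s n)))).
have eqs n phi H M : W phi H -> (forall x, `|phi x| <= M) ->
    E (G_ (s n)) H + I (fun x => gn (s n) (v_ (s n) x) (G_ (s n) x) * phi x) = I (fun x => F x * phi x).
  by move=> Wp _; exact: eqn.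
have F01 (n : nat) x : 0 <= F x <= F x by rewrite F0 lexx.
have gh n : \forall x \ae mu, gn (s n) (v_ (s n) x) (G_ (s n) x) <= h (v_ (s n) x) * dot (G_ (s n) x) (G_ (s n) x).
  by apply: aeW => x; exact: gn_le.
(* The uniform bound of [reaction_mass] survives in the limit on every cutoff; this is the input
   that [top] requires to keep the limit inside the domain. *)
have mass m : I (fun x => hm m (v x) * dot (G x) (G x)) <= I F.
  have [Lh ch] := lim m.
  have Lc n : L1 mu (fun x => cutoff Vs m (v_ (s n) x) * gn (s n) (v_ (s n) x) (G_ (s n) x)).
    apply: (L1_mulbdd (C := 1)) => //.
      by apply: measurableT_comp => //; exact: continuous_measurable_fun (@continuous_cutoff _ Vs m).
    by move=> x; case/andP: (cutoff01 Vs m (v_ (s n) x)) => c0 c1; rewrite ger0_norm.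
  have : I (fun x => cutoff Vs m (v_ (s n) x) * gn (s n) (v_ (s n) x) (G_ (s n) x)) @[n --> \oo] --> I (fun x => hm m (v x) * dot (G x) (G x)).
    apply/subr_cvg0; apply: squeeze0 ch => n.
    by rewrite -IntB//; apply: Int_abs; exact: L1B.
  move=> /cvg_ler_const; apply => n.
  apply: le_trans (reaction_mass finmu HS alpha0 hb h0 (Wn _) (vn0 _) (gn1 n) _ LF1 LF1 (F01 n) (eqs n) (gh n)).
    apply: Int_leT => // x; rewrite ler_piMl ?gn_ge0//.
    by case/andP: (cutoff01 Vs m (v_ (s n) x)).
  by move=> x; exact: gn_ge0.
have vD : \forall x \ae mu, inD Vs (v x).
  apply: (@mass_inD Vs v (I F)) => // j; apply: (@top j v G) => //.
  - by move=> x; rewrite /v le_max lexx.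
  - by move=> m; exact: (lim m).1.
have cGs phi H : W phi H -> E (G_ (s n)) H @[n --> \oo] --> E G H.
  move=> Wp; have := E_cvg mb alpha0 hb (fun n => WL2v (Wn n)) (WL2v Ww) (WL2v Wp) cG.
  by apply: cvg_comp; exact: subseq_cvg.
have v_ge0 x : 0 <= v x by rewrite /v le_max lexx.
have [Lh eqv] := stability finmu HS mb alpha0 hb VS V0 theta01 h_ge0 h0 mh v00 Ch0 hCh hm_continuous
  LF1 (fun n => Wn (s n)) (fun n => vn0 (s n)) gn1 (fun n x => gn_ge0 _ _ _) (fun=> LF1) F01 eqs gh
  (aeW _ (fun x => cvg_cst _)) Wv v_ge0 cv vD cGs lim.
by exists v, G, s; split.
Qed.

Lemma mf_inv g : measurable_fun setT g -> (forall x, 0 <= g x) ->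
  measurable_fun setT (fun x => (g x)^-1).
Proof.
move=> mg g0; rewrite (_ : (fun x => _) = fun x => g x `^ (- 1)).
  exact: (measurableT_comp (measurable_powR (- 1)) mg).
by apply/funext => x; rewrite powR_inv1.
Qed.

(** The test functions are [psi i * c n], where [c n] is [1] on [v = 0] and [0] once [v >= en R n].
    The derivative of [c n] contributes a term of favourable sign, which is dropped. The other terms
    tend to integrals over [v = 0], where the gradient vanishes, so that [F psi i] has no mass
    there. *)
Lemma sol_positive F v G : L1 mu F -> (forall x, 0 <= F x) ->
  (\forall x \ae mu, 0 < F x) -> sol F v G -> \forall x \ae mu, 0 < v x.
Proof.
move=> LF F0 Fp [Wv v_ge0 vD Lh eqv].
have mv := L2_mf (WL2 Wv); have mG := L2v_mf (WL2v Wv).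
have [psi [H [Wpsi psi01 psic]]] := W_cover HS.
pose z x : R := if v x == 0 then 1 else 0.
have mz : measurable_fun setT z.
  by apply: measurable_fun_ifT => //; exact: measurable_fun_eqr.
have z01 x : 0 <= z x <= 1 by rewrite /z; case: ifP; rewrite lexx ler01.
have G0 := W_level finmu HS 0 Wv.
have key i : I (fun x => F x * psi i x * z x) <= 0.
  have mp := L2_mf (WL2 (Wpsi i)).
  pose c n x := 1 - (en R n)^-1 * clip (en R n) (v x).
  have c01 n x : 0 <= c n x <= 1.
    have /andP[a1 a2] := clip_div01 (v x) (en_gt0 R n); rewrite /c; lra.
  have mc n : measurable_fun setT (c n).
    by apply: measurable_funB => //; apply: measurable_funM => //; exact: measurable_clip.
  have cz x : c n x @[n --> \oo] --> z x.
    apply: cvg_near_cst; rewrite /z /c; case: eqP => [->|/eqP vn0].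
      by exists 0%N => // n _; rewrite clip_id ?mulr0 ?subr0// lexx ltW// en_gt0.
    have vp : 0 < v x by rewrite lt_neqAle eq_sym vn0 v_ge0.
    have [k kP] := en_small vp; exists k => // n /kP enx.
    by rewrite clip_big ?enx ?ltW ?en_gt0// mulVf ?subrr// gt_eqF// en_gt0.
  have le n : I (fun x => F x * (psi i x * c n x)) <=
      I (fun x => h (v x) * dot (G x) (G x) * c n x) + I (fun x => b x * dot (G x) (H i x) * c n x).
    have e0 := en_gt0 R n.
    have Wk := W_Z HS (en R n)^-1 (W_clip_id finmu HS e0 Wv).
    have k1 x : `|(en R n)^-1 * clip (en R n) (v x)| <= 1.
      by have /andP[a1 a2] := clip_div01 (v x) (en_gt0 R n); rewrite ger0_norm.
    have p1 x : `|psi i x| <= 1 by case/andP: (psi01 i x) => a1 a2; rewrite ger0_norm.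
    have Wphi := W_B HS (Wpsi i) (W_mul finmu HS ltr01 p1 k1 (Wpsi i) Wk).
    rewrite (_ : (fun x => psi i x - _) = fun x => psi i x * c n x) in Wphi; last first.
      by apply/funext => x; rewrite /c; ring.
    have pc1 x : `|psi i x * c n x| <= 1.
      case/andP: (c01 n x) => a1 a2.
      by rewrite normrM mulr_ile1// ger0_norm.
    rewrite -(eqv _ _ _ Wphi pc1) addrC lerD//.
      apply: Int_leT.
      - by apply: (L1_mulb _ pc1) => //; exact: measurable_funM.
      - by apply: (L1_mulb (M := 1)) => // x; case/andP: (c01 n x) => a1 a2; rewrite ger0_norm.
      - move=> x; rewrite ler_wpM2l ?mulr_ge0 ?dot_ge0//.
        by case/andP: (c01 n x) => a1 a2; rewrite ler_piMl//; case/andP: (psi01 i x).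
    apply: Int_leT.
    - exact: (L1_EE mb bb (WL2v Wv) (WL2v Wphi)).
    - apply: (L1_mulb (M := 1)) => //.
        by move=> x; case/andP: (c01 n x) => a1 a2; rewrite ger0_norm.
      exact: (L1_EE mb bb (WL2v Wv) (WL2v (Wpsi i))).
    move=> x; rewrite -mulrA ler_wpM2l//; first by case/andP: (hb x) => /(le_trans (ltW alpha0)).
    rewrite dotBr dotDr !dotZr /c.
    set D := dot (G x) (H i x); set d1 := dot (G x) (G x).
    set k := (en R n)^-1 * clip _ _.
    have : 0 <= psi i x * ((en R n)^-1 * ((if 0 < v x < en R n then 1 else 0) * d1)).
      rewrite mulr_ge0 ?mulr_ge0 ?dot_ge0 ?invr_ge0 ?(ltW e0)//; last by case: ifP.
      by case/andP: (psi01 i x).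
    by move: (if _ then _ else _) => s s0; rewrite -subr_ge0; apply: le_trans s0 _; rewrite le_eqVlt; apply/orP; left; apply/eqP; ring.
  have Lb : L1 mu (fun x => b x * dot (G x) (H i x)).
    exact: (L1_EE mb bb (WL2v Wv) (WL2v (Wpsi i))).
  have dct u : L1 mu u -> I (fun x => u x * c n x) @[n --> \oo] --> I (fun x => u x * z x).
    move=> Lu; have mu1 := L1_mf Lu.
    apply: (Int_dct (g := fun x => `|u x|) _ _ _ _ _).2 => //.
    - by move=> n; exact: measurable_funM.
    - exact: measurable_funM.
    - exact: L1_norm.
    - move=> n; apply: aeW => x; case/andP: (c01 n x) => a1 a2.
      by rewrite normrM ler_piMr// ger0_norm.
    - by apply: aeW => x; apply: cvgM; [exact: cvg_cst|exact: cz].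
  have zero u : (forall x, G x = 0 -> u x = 0) -> measurable_fun setT u -> I (fun x => u x * z x) = 0.
    move=> u0 mu1; rewrite -[RHS](Int0 mu); apply: Int_ae_eq => //; first exact: measurable_funM.
    apply: filterS G0 => x g0; rewrite /z; case: eqP => [/g0/u0 ->|_]; rewrite ?mul0r ?mulr0//.
  have LFp : L1 mu (fun x => F x * psi i x).
    by apply: (L1_mulb (M := 1)) => // x; case/andP: (psi01 i x) => a1 a2; rewrite ger0_norm.
  have c1 := dct _ LFp; have c2 := dct _ Lh; have c3 := dct _ Lb.
  rewrite (zero (fun x => h (v x) * dot (G x) (G x))) in c2; last exact: (L1_mf Lh).
    rewrite (zero (fun x => b x * dot (G x) (H i x))) in c3; last exact: (L1_mf Lb).
      have c4 := cvgB c1 (cvgD c2 c3); rewrite addr0 subr0 in c4.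
      apply: (cvg_ler_const (c4 _ _)) => n; rewrite /= subr_le0.
      by have := le n; under eq_fun do rewrite mulrA.
    by move=> x ->; rewrite dot0l mulr0.
  by move=> x ->; rewrite dot0l mulr0.
have : \forall x \ae mu, forall i, F x * psi i x * z x = 0.
  apply: ae_foralln => i; have mp := L2_mf (WL2 (Wpsi i)).
  apply: Int_eq0 (key i).
  - apply: (L1_mulb (M := 1)) => //; first by move=> x; case/andP: (z01 x) => a1 a2; rewrite ger0_norm.
    by apply: (L1_mulb (M := 1)) => // x; case/andP: (psi01 i x) => a1 a2; rewrite ger0_norm.
  - apply: aeW => x; case/andP: (z01 x) => a1 _; case/andP: (psi01 i x) => b1 _.
    by rewrite !mulr_ge0.
apply: filterS3 Fp psic => x Fx [i pi] zx; rewrite lt_neqAle v_ge0 andbT eq_sym.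
apply/negP => /eqP vx; have /eqP := zx i.
by rewrite /z vx eqxx mulr1 mulf_eq0 !gt_eqF.
Qed.

Lemma dotBB_le (v w : 'rV[R]_N) : dot (v - w) (v - w) <= 2 * dot v v + 2 * dot w w.
Proof.
have := dot_ge0 (v + w); rewrite dotBl !dotBr dotDl !dotDr (dotC w v); lra.
Qed.

(* Fatou's lemma applied to the nonnegative defect in Young's inequality. *)
Lemma weak_limit (G_ : nat -> T -> 'rV[R]_N) G H A : (forall n, L2v mu (G_ n)) ->
  L2v mu G -> L2v mu H -> (forall n, DG mu (G_ n) (G_ n) <= A) ->
  (\forall x \ae mu, forall i, G_ n x ord0 i @[n --> \oo] --> G x ord0 i) ->
  E (G_ n) H @[n --> \oo] --> E G H.
Proof.
move=> Ln LG LH GA cG.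
pose a n := I (fun x => `|b x * dot (G_ n x - G x) (H x)|).
have Lb n := L1_EE mb bb (L2vB (Ln n) LG) LH.
suff a0 : a @ \oo --> 0.
  apply/subr_cvg0; apply: squeeze0 a0 => n.
  by rewrite -(EEBl mb bb)//; exact: Int_abs.
apply/cvgrPdist_le => e e0; apply: contrapT => nev.
have /choice[t tP] : forall n, exists m, (n <= m)%N /\ e < a m.
  move=> n; apply: contrapT => nex; apply: nev; exists n => // m nm; rewrite sub0r normrN ger0_norm.
    by rewrite leNgt; apply/negP => ea; apply: nex; exists m.
  by apply: Int_ge0 => x.
have ct : t n @[n --> \oo] --> \oo.
  by move=> P [k _ kP]; exists k => // n kn; apply: kP => /=; rewrite (leq_trans kn)//; exact: (tP n).1.
pose Bt := `|beta| + 1; have Bt0 : 0 < Bt by rewrite ltr_wpDl.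
have A0 : 0 <= A by apply: le_trans (GA 0%N); exact: DG_ge0.
pose M := 2 * A + 2 * DG mu G G; have G0 := DG_ge0 mu G.
have M0 : 0 <= M by rewrite /M; lra.
(* Along a subsequence where the error exceeds [e], the defect [phi n] tends to its constant part,
   but its integral is at most [eta * M - e] plus the integral of that part; [eta * M < e]
   contradicts Fatou's lemma. [M] bounds the energies of the differences. *)
pose eta := e / (2 * (M + 1)); have eta0 : 0 < eta by rewrite divr_gt0//; lra.
have etaM : eta * M < e.
  rewrite /eta mulrAC ltr_pdivrMr; last by lra.
  by rewrite ltr_pM2l//; lra.
pose phi n x := eta * dot (G_ (t n) x - G x) (G_ (t n) x - G x) + Bt ^+ 2 / eta * dot (H x) (H x)
   - `|b x * dot (G_ (t n) x - G x) (H x)|.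
have LD n : L1 mu (fun x => dot (G_ (t n) x - G x) (G_ (t n) x - G x)).
  by apply: L1_dot; exact: L2vB.
have LHH := L1_dot LH LH.
have Lphi n : L1 mu (phi n).
  apply: L1B; last exact: L1_norm.
  by apply: L1D; exact: L1Z.
have [||||] := @Int_fatou _ _ _ mu phi (fun x => Bt ^+ 2 / eta * dot (H x) (H x))
    (eta * M + Bt ^+ 2 / eta * DG mu H H - e) Lphi.
- move=> n x; rewrite /phi subr_ge0 normrM.
  have y0 : 0 < eta / Bt by exact: divr_gt0.
  have := dot_young (G_ (t n) x - G x) (H x) y0.
  have b1 : `|b x| <= Bt by rewrite /Bt (le_trans (bb x))// (le_trans (ler_norm _))// lerDl.
  move=> yg; apply: (@le_trans _ _ (Bt * (eta / Bt * dot (G_ (t n) x - G x) (G_ (t n) x - G x) + (eta / Bt)^-1 * dot (H x) (H x)))).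
    exact: ler_pM.
  rewrite le_eqVlt; apply/orP; left; apply/eqP; field.
  by rewrite !gt_eqF.
- exact: L1_mf (L1Z _ LHH).
- apply: filterS cG => x cx.
  have cx' i : (G_ (t n) x - G x) ord0 i @[n --> \oo] --> (0 : R).
    under eq_fun do rewrite !mxE.
    rewrite -(subrr (G x ord0 i)); apply: cvgB; last exact: cvg_cst.
    by have := cx i; apply: cvg_comp.
  rewrite -[X in _ --> X]subr0 -[X in _ --> X - _]add0r; apply: cvgB.
    apply: cvgD; last exact: cvg_cst.
    apply: cvgZ0; rewrite (_ : 0 = \sum_(i < N) 0 * 0 :> R); last by rewrite big1// => i _; rewrite mulr0.
    by apply: cvg_sumr => i; apply: cvgM; exact: cx'.
  rewrite -(normr0 R); apply: cvg_norm; apply: cvgZ0.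
  rewrite (_ : 0 = \sum_(i < N) 0 * H x ord0 i :> R); last by rewrite big1// => i _; rewrite mul0r.
  by apply: cvg_sumr => i; apply: cvgM; [exact: cx'|exact: cvg_cst].
- move=> n; rewrite IntB ?IntD ?IntZ//; [|exact: L1Z|exact: L1Z|by apply: L1D; exact: L1Z|exact: L1_norm].
  rewrite -/(DG mu H H); apply: lerB; last by apply: ltW; exact: (tP n).2.
  rewrite lerD2r ler_pM2l//.
  have LGG := L1_dot LG LG; have LGn := L1_dot (Ln (t n)) (Ln (t n)).
  apply: (@le_trans _ _ (2 * DG mu (G_ (t n)) (G_ (t n)) + 2 * DG mu G G)).
    rewrite -!IntZ// -IntD; [|exact: L1Z|exact: L1Z].
    apply: Int_leT => //; first by apply: L1D; exact: L1Z.
    by move=> x; exact: dotBB_le.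
  by have := GA (t n); rewrite /M; lra.
- rewrite IntZ// -/(DG mu H H); lra.
Qed.


(** * Integrable sources: increasing limits through a bounded transform *)

Section monotone_limit.
Variables (c A : R) (f : T -> R).
Hypothesis c0 : 0 < c.
Hypothesis hc : forall t : R, 0 < t -> inD Vs t -> 2 * beta * c <= h t * (1 + c * t).
Hypothesis Lf : L1 mu f.
Hypothesis f0 : forall x, 0 <= f x.
Hypothesis energy_bound : forall F v G, L1 mu F -> (forall x, 0 <= F x <= f x) ->
  sol F v G -> DG mu G G <= A.

Definition sf (t : R) := (1 + c * t)^-1.
(** Equal to [c t / (1 + c t)], increasing and bounded by [1], with derivative [c sf ^ 2].
    Boundedness makes [f Y(v)] integrable whenever [f] is. The second derivative is [- 2 c sf] times
    the first, which is the factor that the hypothesis [hc] is designed to absorb. *)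
Definition Yf t := 1 - sf t.

Lemma den_gt0 t : 0 <= t -> 0 < 1 + c * t.
Proof. by move=> t0; rewrite ltr_wpDr// mulr_ge0// ltW. Qed.

Lemma sf01 t : 0 <= t -> 0 < sf t <= 1.
Proof.
move=> t0; have p := den_gt0 t0; rewrite invr_gt0 p/= invf_le1//.
by rewrite lerDl mulr_ge0// ltW.
Qed.

Lemma Yf01 t : 0 <= t -> 0 <= Yf t < 1.
Proof. by move=> /sf01/andP[s0 s1]; rewrite /Yf; apply/andP; split; lra. Qed.

Lemma Yf_lt s t : 0 <= s -> 0 <= t -> (Yf s < Yf t) = (s < t).
Proof.
move=> s0 t0; have ps := den_gt0 s0; have pt := den_gt0 t0.
by rewrite /Yf ltrD2l ltrN2 /sf ltf_pV2 ?posrE// ltrD2l ltr_pM2l.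
Qed.

Lemma Yf_le s t : 0 <= s -> 0 <= t -> (Yf s <= Yf t) = (s <= t).
Proof. by move=> s0 t0; rewrite !leNgt Yf_lt. Qed.

Lemma is_derive_Yf (t : R) : 0 <= t -> is_derive t (1 : R) Yf (c * sf t ^+ 2).
Proof.
move=> t0; have pt := den_gt0 t0.
have d1 : is_derive t (1 : R) (fun t : R => 1 + c * t : R) c.
  by apply: is_derive_eq; rewrite /GRing.scale/=; ring.
have nz : 1 + c * t != 0 by rewrite gt_eqF.
have d2 : is_derive t (1 : R) (fun t : R => (1 + c * t)^-1 : R) (- (1 + c * t) ^- 2 *: c).
  exact: (@is_deriveV _ (fun t : R => 1 + c * t : R) t c 1 nz d1).
apply: is_derive_eq; rewrite /sf /GRing.scale/= exprVn; ring.
Qed.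

Lemma continuous_sf (t : R) : 0 <= t -> sf x @[x --> t] --> sf t.
Proof.
move=> t0; apply: cvgV; first by rewrite gt_eqF// den_gt0.
by apply: cvgD; [exact: cvg_cst|apply: cvgM; [exact: cvg_cst|exact: cvg_id]].
Qed.

Lemma sf_mf v : measurable_fun setT v -> (forall x, 0 <= v x) ->
  measurable_fun setT (fun x => sf (v x)).
Proof.
move=> mv v_ge0; apply: mf_inv => [|x]; last by rewrite ltW// den_gt0.
by apply: measurable_funD => //; exact: measurable_funM.
Qed.

Lemma W_Yf v G : W v G -> (forall x, 0 <= v x) ->
  W (fun x => Yf (v x)) (fun x => (c * sf (v x) ^+ 2) *: G x).
Proof.
move=> Wv v_ge0; have mv := L2_mf (WL2 Wv); have mG := L2v_mf (WL2v Wv).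
have msf := sf_mf mv v_ge0.
have Wn n : W (fun x => Yf (clip n.+1%:R (v x)))
    (fun x => (if 0 < v x < n.+1%:R then c * sf (v x) ^+ 2 else 0) *: G x).
  apply: (W_clip (F' := fun t => c * sf t ^+ 2) finmu HS _ _ _ _ Wv) => //.
  - by move=> t /andP[t0 _]; exact: is_derive_Yf.
  - move=> t /andP[t0 _]; apply: cvgM; first exact: cvg_cst.
    by have cs := continuous_sf t0; exact: (cvgM cs cs).
  - by rewrite /Yf /sf mulr0 addr0 invr1 subrr.
have G0 := W_level finmu HS 0 Wv.
apply: (W_lim HS Wn (A := fun x => 1 + \sum_(i < N) c * `|G x ord0 i|)).
- exact: measurable_funB.
- by apply: mfvM => //; apply: measurable_funM => //; exact: measurable_funX.
- apply: L2D; first exact: L2_cst.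
  by apply: L2_sum => i; apply: L2Z; apply: L2_norm; exact: (WL2v Wv).
- move=> n; apply: aeW => x; have /andP[y0 y1] := Yf01 (clip_ge0 n.+1%:R (v x)).
  rewrite ger0_norm// (le_trans (ltW y1))// lerDl.
  by apply: sumr_ge0 => i _; rewrite mulr_ge0// ltW.
- move=> n i; apply: aeW => x; rewrite mxE normrM.
  apply: (@le_trans _ _ (c * `|G x ord0 i|)).
    rewrite ler_wpM2r//; case: ifP => _; last by rewrite normr0 ltW.
    have /andP[s0 s1] := sf01 (v_ge0 x).
    rewrite ger0_norm; last by rewrite mulr_ge0 ?sqr_ge0// ltW.
    by apply: ler_piMr; [exact: ltW|rewrite expr_le1// ltW].
  rewrite (bigD1 i)//= addrCA lerDl addr_ge0//.
  by apply: sumr_ge0 => j _; rewrite mulr_ge0// ltW.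
- apply: aeW => x; apply: cvg_near_cst.
  have : \forall n \near \oo, v x < n.+1%:R by exact: near_natS_gt.
  by apply: filterS => n vn; rewrite clip_id// v_ge0 ltW.
- move=> i; apply: filterS G0 => x g0; apply: cvg_near_cst.
  have : \forall n \near \oo, v x < n.+1%:R by exact: near_natS_gt.
  apply: filterS => n vn; rewrite !mxE vn andbT; case: ltP => // vx.
  by rewrite g0 ?mxE ?mulr0//; apply/eqP; rewrite eq_le vx v_ge0.
Qed.

(* The equation of the larger solution [v'] is tested with
   [Y'(v') (Y(v') - Y(v))]: the choice of [c] makes the singular term absorb
   the derivative of [Y'(v')]. *)
Lemma transformed_energy F' v G v' G' (Z Z' : T -> 'rV[R]_N) :
  L1 mu F' -> (forall x, 0 <= F' x <= f x) -> W v G -> (forall x, 0 <= v x) ->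
  sol F' v' G' -> (\forall x \ae mu, v x <= v' x) ->
  Z = (fun x => (c * sf (v x) ^+ 2) *: G x) ->
  Z' = (fun x => (c * sf (v' x) ^+ 2) *: G' x) ->
  E Z' (fun x => Z' x - Z x) <= c * I (fun x => f x * (Yf (v' x) - Yf (v x))).
Proof.
move=> LF' F01 Wv v_ge0 [Wv' v'_ge0 v'D Lh eqv] vv' ZE Z'E.
have mv := L2_mf (WL2 Wv); have mv' := L2_mf (WL2 Wv').
have WY := W_Yf Wv v_ge0; have WY' := W_Yf Wv' v'_ge0.
rewrite -ZE in WY; rewrite -Z'E in WY'.
pose D x := Yf (v' x) - Yf (v x); have WD := W_B HS WY' WY.
have D1 x : `|D x| <= 1.
  have /andP[a0 a1] := Yf01 (v_ge0 x); have /andP[b0 b1] := Yf01 (v'_ge0 x).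
  by rewrite ler_norml /D; apply/andP; split; lra.
have Y1 x : `|Yf (v' x)| <= 1.
  by have /andP[a0 a1] := Yf01 (v'_ge0 x); rewrite ger0_norm// ltW.
(* [1 + P] is [(1 - Y) ^ 2 = sf ^ 2]. The test function [sf ^ 2 D] is thus [D + P D], built from
   products of bounded members of [W]. *)
pose P x := Yf (v' x) ^+ 2 + - 2 * Yf (v' x).
have WP := W_lin HS (- 2) (W_sqr finmu HS ltr01 Y1 WY') WY'.
have P2 x : `|P x| <= 2.
  have /andP[a0 a1] := Yf01 (v'_ge0 x); rewrite /P ler_norml; set y := Yf _ in a0 a1 *.
  have y2 : 0 <= y * (1 - y) by rewrite mulr_ge0// subr_ge0 ltW.
  have y3 : 0 <= y ^+ 2 by exact: sqr_ge0.
  by apply/andP; split; lra.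
have D2 x : `|D x| <= 2 by apply: le_trans (D1 x) _; rewrite ler1n.
have Wphi := W_D HS WD (W_mul finmu HS (ltr0n R 2) P2 D2 WP WD).
set phi := (fun x => _ + _) in Wphi; set H := (fun x => _ + _ : 'rV_N) in Wphi.
have phiE x : phi x = sf (v' x) ^+ 2 * D x by rewrite /phi /P /D /Yf; ring.
have sf1 x := sf01 (v'_ge0 x).
have ps1 x : `|phi x| <= 1.
  rewrite phiE normrM mulr_ile1//; case/andP: (sf1 x) => s0 s1.
  by rewrite ger0_norm ?sqr_ge0// expr_le1// ltW.
have mphi := L2_mf (WL2 Wphi).
have mD := L2_mf (WL2 WD).
have e := eqv _ _ _ Wphi ps1.
have LZ' := WL2v WY'; have LZ := WL2v WY.
have D0 : \forall x \ae mu, 0 <= D x.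
  by apply: filterS vv' => x vx; rewrite subr_ge0 Yf_le.
have G0 := W_level finmu HS 0 Wv'.
have LfD : L1 mu (fun x => f x * D x) by apply: (L1_mulb _ D1).
have LFp : L1 mu (fun x => F' x * phi x) by apply: (L1_mulb _ ps1).
have le1 : c * I (fun x => F' x * phi x) <= c * I (fun x => f x * D x).
  rewrite ler_pM2l//; apply: Int_le => //; apply: filterS D0 => x Dx.
  rewrite phiE; case/andP: (F01 x) => a0 a1; case/andP: (sf1 x) => s0 s1.
  apply: ler_pM => //; first by rewrite mulr_ge0// sqr_ge0.
  by rewrite ler_piMl// expr_le1// ltW.
apply: le_trans le1; rewrite -e mulrDr.
have Lhp : L1 mu (fun x => h (v' x) * dot (G' x) (G' x) * phi x) by apply: (L1_mulb _ ps1).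
have LEH := L1_EE mb bb (WL2v Wv') (WL2v Wphi).
rewrite -!IntZ// -IntD; [|exact: L1Z|exact: L1Z].
apply: Int_le.
- by apply: L1_EE => //; exact: L2vB.
- by apply: L1D; exact: L1Z.
apply: filterS3 D0 v'D G0 => x Dx vDx g0.
case/andP: (sf1 x) => s0 s1; have := v'_ge0 x; rewrite le_eqVlt => /predU1P[vx|vx].
  rewrite g0 -?vx// !dot0l !mulr0 mul0r mulr0 addr0 Z'E.
  by rewrite g0 -?vx// scaler0 dot0l mulr0.
(* This is [hc] divided by [1 + c v'], with [b] at most [beta]. It makes the reaction dominate the
   term [2 sf D] created by differentiating [sf ^ 2]. *)
have hb2 : 2 * b x * c * sf (v' x) <= h (v' x).
  have p := den_gt0 (v'_ge0 x).
  rewrite /sf ler_pdivrMr//; apply: le_trans (hc vx vDx).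
  by rewrite ler_pM2r// ler_pM2l//; case/andP: (hb x).
rewrite -subr_ge0 phiE.
have -> : H x = sf (v' x) ^+ 2 *: (Z' x - Z x) - (2 * sf (v' x) * D x) *: Z' x.
  apply/rowP => i; rewrite /H /P /D /Yf !mxE; ring.
have -> (k l : R) (X Y : 'rV[R]_N) : dot (G' x) (k *: X - l *: Y) = k * dot (G' x) X - l * dot (G' x) Y.
  by rewrite dotBr !dotZr.
have -> : Z' x = (c * sf (v' x) ^+ 2) *: G' x by rewrite Z'E.
rewrite !dotZl dotZr.
set X := dot (G' x) (_ - _); set s := sf _ in s0 s1 hb2 *; set g2 := dot (G' x) (G' x).
have : 0 <= c * s ^+ 2 * D x * g2 * (h (v' x) - 2 * b x * c * s).
  have h1 : 0 <= c * s ^+ 2 by rewrite mulr_ge0 ?sqr_ge0 ?(ltW c0).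
  by apply: mulr_ge0; [rewrite mulr_ge0 ?dot_ge0// mulr_ge0|rewrite subr_ge0].
by move=> /le_trans; apply; rewrite le_eqVlt; apply/orP; left; apply/eqP; ring.
Qed.

(** The reciprocal of the derivative of [Yf]: multiplication by it recovers the gradient of [v] from
    that of [Yf v]. It is bounded on bounded ranges of [v]. *)
Definition ki (t : R) := c^-1 * (1 + c * t) ^+ 2.

Lemma kiK t : 0 <= t -> ki t * (c * sf t ^+ 2) = 1.
Proof.
by move=> t0; rewrite /ki /sf; field; rewrite !gt_eqF ?den_gt0.
Qed.

Lemma ki_ge0 t : 0 <= ki t.
Proof. by rewrite mulr_ge0 ?sqr_ge0// invr_ge0 ltW. Qed.

Lemma ki_le s t : 0 <= s <= t -> 0 <= ki s <= ki t.
Proof.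
move=> /andP[s0 st]; have t0 := le_trans s0 st; rewrite /ki.
have ci : 0 < c^-1 by rewrite invr_gt0.
have p1 := ltW (den_gt0 s0); have p2 := ltW (den_gt0 t0).
by rewrite mulr_ge0 ?sqr_ge0 ?(ltW ci)//= ler_pM2l// ler_pXn2r ?nnegrE// lerD2l ler_pM2l.
Qed.

Lemma continuous_ki : continuous ki.
Proof.
move=> t; apply: cvgM; first exact: cvg_cst.
have cl : 1 + c * s @[s --> t] --> 1 + c * t.
  by apply: cvgD; [exact: cvg_cst|apply: cvgM; [exact: cvg_cst|exact: cvg_id]].
exact: (cvgM cl cl).
Qed.

Lemma Yf_inv t : 0 <= t -> t = Yf t * (c * (1 - Yf t))^-1.
Proof.
move=> t0; have p := den_gt0 t0.
rewrite /Yf opprB addrCA subrr addr0 /sf; field; rewrite !gt_eqF//.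
Qed.

Lemma inv_Yf y : 0 <= y < 1 -> Yf (y * (c * (1 - y))^-1) = y.
Proof.
move=> /andP[y0 y1]; have p : 0 < 1 - y by rewrite subr_gt0.
have -> : y * (c * (1 - y))^-1 = c^-1 * (y / (1 - y)) by field; rewrite !gt_eqF.
rewrite /Yf /sf mulVKf ?gt_eqF//.
have -> : 1 + y / (1 - y) = (1 - y)^-1 by field; rewrite gt_eqF.
by rewrite invrK; ring.
Qed.

Lemma hm_big m t : Vs m.+1 <= t -> hm m t = 0.
Proof.
move=> Vt; rewrite /cut_profile /cutoff (_ : hi Vs m t = 1) ?subrr ?mulr0//.
by apply: clip_big; rewrite ler01/= ler_pdivlMr ?dV_gt0// mul1r lerD2r.
Qed.

Lemma sol_mass F v G : L1 mu F -> (forall x, 0 <= F x <= f x) -> sol F v G ->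
  I (fun x => h (v x) * dot (G x) (G x)) <= I f.
Proof.
move=> LF F01 [Wv v_ge0 vD Lh eqv].
apply: (reaction_mass finmu HS alpha0 hb h0 Wv v_ge0 Lh _ Lf LF F01 eqv).
  by move=> x; rewrite mulr_ge0 ?dot_ge0.
exact: aeW.
Qed.

Lemma hm_mf m v : measurable_fun setT v -> measurable_fun setT (fun x => hm m (v x)).
Proof.
by move=> mv; apply: measurableT_comp => //; exact: continuous_measurable_fun (@hm_continuous m).
Qed.

Lemma sol_top F v G j : L1 mu F -> (forall x, 0 <= F x <= f x) -> sol F v G ->
  I (fun x => if Vs j < v x then 1 else 0) <= q j * I f.
Proof.
move=> LF F01 sv; have [Wv v_ge0 vD Lh eqv] := sv.
have mv := L2_mf (WL2 Wv); have mG := L2v_mf (WL2v Wv).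
have le m x : hm m (v x) * dot (G x) (G x) <= h (v x) * dot (G x) (G x).
  by rewrite ler_wpM2r ?dot_ge0// hm_le.
have Lm m : L1 mu (fun x => hm m (v x) * dot (G x) (G x)).
  apply: L1_domT Lh _ => [|x].
    by apply: measurable_funM; [exact: hm_mf|exact: mf_dot].
  by rewrite ger0_norm; [exact: le|rewrite mulr_ge0 ?hm_ge0 ?dot_ge0].
apply: (@top j v G (I f) Wv v_ge0 Lm) => m; apply: le_trans (sol_mass LF F01 sv).
exact: Int_leT.
Qed.

(** The order in [k] is established for the least solutions at each level [n], where minimality is
    available, and then passes to the limit in [n]. *)
Lemma truncated_solutions : exists (v_ : nat -> T -> R) (G_ : nat -> T -> 'rV[R]_N),
  (forall k, sol (fun x => Num.min (f x) k%:R) (v_ k) (G_ k)) /\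
  forall k l, (k <= l)%N -> \forall x \ae mu, v_ k x <= v_ l x.
Proof.
pose fk k x := Num.min (f x) k%:R; have mf := L1_mf Lf.
have fk0 k x : 0 <= fk k x by rewrite le_min f0/=.
have L2k k : L2 mu (fk k).
  apply: (L2_bdd finmu (C := k%:R)); first exact: measurable_minr.
  by move=> x; rewrite ger0_norm// ge_min lexx orbT.
have fk_homo k l x : (k <= l)%N -> fk k x <= fk l x.
  by move=> kl; apply: le_min2 => //; rewrite ler_nat.
have /choice[m mP] : forall kn : nat * nat, exists z : (T -> R) * (T -> 'rV[R]_N),
    minsol kn.2 (fk kn.1) z.1 z.2.
  move=> [k n]; have [v [G vG]] := minsol_exists n (L2k k) (fk0 k).
  by exists (v, G).
have /choice[z zP] : forall k, exists z : (T -> R) * (T -> 'rV[R]_N) * (nat -> nat),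
    [/\ sol (fk k) z.1.1 z.1.2,
      forall n, \forall x \ae mu, z.1.1 x <= (m (k, n)).1 x &
      \forall x \ae mu, (m (k, z.2 n)).1 x @[n --> \oo] --> z.1.1 x].
  move=> k; have [v [G [s vGs]]] := level_limit (L2k k) (fk0 k) (fun n => mP (k, n)).
  by exists (v, G, s).
exists (fun k => (z k).1.1), (fun k => (z k).1.2); split=> [k|k l kl].
  by case: (zP k).
have [_ le1 _] := zP k; have [_ _ c1] := zP l.
have le2 : \forall x \ae mu, forall n, (m (k, n)).1 x <= (m (l, n)).1 x.
  apply: ae_foralln => n.
  exact: (minsol_le (leqnn n) (L2k l) (L2k k) (fun x => fk_homo k l x kl) (mP (l, n)) (mP (k, n))).
apply: filterS3 (ae_foralln le1) le2 c1 => x a1 a2 a3.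
by apply: cvg_ger_const a3 _ => n; exact: le_trans (a1 _) (a2 _).
Qed.

(** Strong convergence holds for the gradients of [Yf v_k] only. The limit solution is recovered by
    inverting [Yf]; its gradient is an almost everywhere limit, square-integrable by [energy_bound].
    On [v <= Vs j] the factor [ki] is bounded and strong convergence returns, which is what
    [stability] asks on each cutoff. *)
Lemma integrable_solution : exists v G, sol f v G.
Proof.
have [v_ [G_ [solk mono]]] := truncated_solutions.
set fk := (fun k x => Num.min (f x) k%:R); have mf := L1_mf Lf.
have fk01 k x : 0 <= fk k x <= f x by rewrite le_min f0/= ler0n/= ge_min lexx.
have Lk k : L1 mu (fk k).
  apply: L1_domT Lf _ => [|x]; first exact: measurable_minr.
  by case/andP: (fk01 k x) => a0 a1; rewrite ger0_norm.
have Wk k : W (v_ k) (G_ k) by case: (solk k).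
have vk0 k x : 0 <= v_ k x by case: (solk k).
have mvk k := L2_mf (WL2 (Wk k)); have mGk k := L2v_mf (WL2v (Wk k)).
have EA k : DG mu (G_ k) (G_ k) <= A by exact: energy_bound (Lk k) (fk01 k) (solk k).
pose Y k x := Yf (v_ k x); pose Z k x := (c * sf (v_ k x) ^+ 2) *: G_ k x.
have WY k : W (Y k) (Z k) by exact: W_Yf.
have LZ k := WL2v (WY k).
have Y01 k x : 0 <= Y k x < 1 by exact: Yf01.
have LfY k : L1 mu (fun x => f x * Y k x).
  apply: (L1_mulb (M := 1)) => //; first exact: L2_mf (WL2 (WY k)).
  by move=> x; case/andP: (Y01 k x) => a0 a1; rewrite ger0_norm// ltW.
(* Expanding the square and inserting [transformed_energy] bounds the energy of [Z l - Z k] by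
   [e l - e k]. Boundedness of [Yf] keeps [e] below [2 c] times the integral of [f]. *)
pose e k := 2 * c * I (fun x => f x * Y k x) - E (Z k) (Z k).
have key k l : (k <= l)%N -> E (fun x => Z l x - Z k x) (fun x => Z l x - Z k x) <= e l - e k.
  move=> kl.
  have : E (Z l) (fun x => Z l x - Z k x) <= c * I (fun x => f x * (Y l x - Y k x)).
    exact: transformed_energy (Lk l) (fk01 l) (Wk k) (vk0 k) (solk l) (mono _ _ kl) erefl erefl.
  rewrite (_ : (fun x => f x * _) = fun x => f x * Y l x - f x * Y k x); last first.
    by apply/funext => x; rewrite mulrBr.
  rewrite IntB// (EEBr mb bb)// (EEBB mb bb)// /e.
  move: (E _ _) (E (Z k) _) (E _ _) (I _) (I _) => r1 r2 r3 r4 r5; lra.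
have ndc k l : (k <= l)%N -> e k <= e l.
  by move=> kl; rewrite -subr_ge0; apply: le_trans (key _ _ kl); exact: (E_ge0 mu alpha0 hb).
have Zc : DGcauchy mu Z.
  apply: (energy_cauchy mb alpha0 hb (e := e)) => //.
    apply: nondecreasing_is_cvgn; first by move=> n m; exact: ndc.
    exists (2 * c * I f) => _ [n _ <-].
    have := E_ge0 mu alpha0 hb (Z n).
    have : 2 * c * I (fun x => f x * Y n x) <= 2 * c * I f.
      rewrite ler_pM2l ?mulr_gt0//; apply: Int_leT => // x.
      by case/andP: (Y01 n x) => a0 a1; rewrite ler_piMr// ltW.
    rewrite /e; lra.
  move=> n m nm; rewrite distrC ger0_norm ?subr_ge0 ?ndc//.
  apply: le_trans (key n m nm); rewrite le_eqVlt; apply/orP; left; apply/eqP.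
  by congr Int; apply/funext => x; rewrite -opprB dotNl dotNr opprK.
have [y0 [Zo [s [g [Wy0 _ _ [ss Lg] dom]]]]] := W_complete HS WY Zc.
have mZo := L2v_mf (WL2v Wy0).
(* The truncation only repairs a null set: [y0] is a limit of values in [[0, 1)]. *)
pose y x := clip 1 (y0 x).
have my : measurable_fun setT y by apply: measurable_clip; exact: L2_mf (WL2 Wy0).
have y01 x : 0 <= y x <= 1 by exact: clip01.
have ysn : \forall x \ae mu, y0 x = y x.
  apply: filterS dom => x [[cx _] _]; rewrite /y clip_id//; apply/andP; split.
    by apply: cvg_ger_const cx _ => n; case/andP: (Y01 (s n) x).
  by apply: cvg_ler_const cx _ => n; case/andP: (Y01 (s n) x) => _ /ltW.
have Wy : W y Zo by apply: (W_ae HS Wy0 my mZo ysn); exact: aeW.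
have cY : \forall x \ae mu, Y (s n) x @[n --> \oo] --> y x.
  by apply: filterS2 dom ysn => x [[cx _] _] <-.
have cZ : \forall x \ae mu, forall i, Z (s n) x ord0 i @[n --> \oo] --> Zo x ord0 i /\
    forall n, `|Z (s n) x ord0 i| <= g x.
  by apply: filterS dom => x [_ dx] i; exact: dx.
have Yle : \forall x \ae mu, forall n, Y (s n) x <= y x.
  have mon : \forall x \ae mu, forall n k, v_ (s n) x <= v_ (s (k + n)%N) x.
    apply: ae_foralln => n; apply: ae_foralln => k; apply: mono.
    elim: k => // k ih; rewrite addSn (leq_trans ih)// ltnW//; exact: ss.
  apply: filterS2 cY mon => x cx mx n.
  move: cx; rewrite -(cvg_shiftn n) => /cvg_ger_const; apply => k.
  by rewrite /Y Yf_le.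
have Vs0 j := Vs_gt0 VS V0 j.
(* The limit of [Yf v_k] could reach [1], that is, [v] could become infinite or leave the domain;
   the bound on the superlevel sets, uniform in [k], excludes both. *)
have mass j : I (fun x => if Yf (Vs j) < y x then 1 else 0) <= q j * I f.
  have mi u : measurable_fun setT u -> measurable_fun setT (fun x => if Yf (Vs j) < u x then 1 else 0 : R).
    by move=> mu1; apply: measurable_fun_ifT => //; exact: measurable_fun_ltr.
  have [|||||//] := @Int_fatou _ _ _ mu (fun n x => if Yf (Vs j) < Y (s n) x then 1 else 0)
      (fun x => if Yf (Vs j) < y x then 1 else 0) (q j * I f).
  - move=> n; apply: (L1_bdd finmu (C := 1)); first by apply: mi; exact: L2_mf (WL2 (WY (s n))).
    by move=> x; case: ifP; rewrite ?normr0 ?normr1.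
  - by move=> n x; case: ifP.
  - exact: mi.
  - apply: filterS2 cY Yle => x cx lx; apply: cvg_near_cst; case: ltP => yV.
      have : \forall n \near \oo, Yf (Vs j) < Y (s n) x by exact: cvgr_gt cx _ yV.
      by apply: filterS => n ->.
    by exists 0%N => // n _; rewrite ltNge (le_trans (lx n)).
  - move=> n; apply: le_trans (sol_top j (Lk (s n)) (fk01 (s n)) (solk (s n))).
    rewrite le_eqVlt; apply/orP; left; apply/eqP; congr Int; apply/funext => x.
    by rewrite /Y Yf_lt// ltW.
have yD : \forall x \ae mu, inD (Yf \o Vs) (y x).
  apply: (@mass_inD (Yf \o Vs) y (I f)) => // m /=.
  by rewrite Yf_lt// ltW.
pose v x := y x * (c * (1 - y x))^-1.
have cy0 x : 0 <= c * (1 - y x).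
  by case/andP: (y01 x) => a0 a1; rewrite mulr_ge0 ?subr_ge0// ltW.
have v_ge0 x : 0 <= v x by case/andP: (y01 x) => a0 a1; rewrite mulr_ge0// invr_ge0.
have mv : measurable_fun setT v.
  apply: measurable_funM => //; apply: mf_inv => //.
  by apply: measurable_funM => //; exact: measurable_funB.
have vy : \forall x \ae mu, y x < 1 /\ Yf (v x) = y x.
  apply: filterS yD => x [j] /= yj.
  have y1 : y x < 1.
    by apply: le_lt_trans yj _; case/andP: (Yf01 (ltW (Vs0 j))).
  by split => //; apply: inv_Yf; rewrite y1 andbT; case/andP: (y01 x).
have vD : \forall x \ae mu, inD Vs (v x).
  apply: filterS2 yD vy => x [j] /= yj [_ yv]; exists j.
  by rewrite -Yf_le ?yv// ltW.
have cv : \forall x \ae mu, v_ (s n) x @[n --> \oo] --> v x.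
  apply: filterS2 cY vy => x cx [y1 _].
  under eq_fun do rewrite (Yf_inv (vk0 _ x)).
  apply: cvgM => //; apply: cvgV; first by rewrite mulf_neq0// ?gt_eqF// subr_gt0.
  by apply: cvgM; [exact: cvg_cst|apply: cvgB; [exact: cvg_cst|exact: cx]].
have vle : \forall x \ae mu, forall n, v_ (s n) x <= v x.
  by apply: filterS2 Yle vy => x lx [_ yv] n; rewrite -Yf_le// yv; exact: lx.
pose G x := ki (v x) *: Zo x.
have Gk k x : G_ k x = ki (v_ k x) *: Z k x by rewrite scalerA kiK// scale1r.
have mki u : measurable_fun setT u -> measurable_fun setT (fun x => ki (u x)).
  by move=> mu1; apply: measurableT_comp => //; exact: continuous_measurable_fun continuous_ki.
have mG : mfv G by apply: mfvM => //; exact: mki.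
have cG : \forall x \ae mu, forall i, G_ (s n) x ord0 i @[n --> \oo] --> G x ord0 i.
  apply: filterS2 cv cZ => x cx zx i; rewrite mxE.
  under eq_fun do rewrite Gk mxE.
  apply: cvgM; last exact: (zx i).1.
  by apply: continuous_cvg => //; exact: continuous_ki.
have LG : L2v mu G.
  apply: L2v_dot => //.
  have [|||||//] := @Int_fatou _ _ _ mu (fun n x => dot (G_ (s n) x) (G_ (s n) x)) (fun x => dot (G x) (G x)) A.
  - by move=> n; apply: L1_dot; exact: WL2v (Wk _).
  - by move=> n x; exact: dot_ge0.
  - exact: mf_dot.
  - by apply: filterS cG => x cx; apply: cvg_sumr => i; apply: cvgM; exact: cx.
  - by move=> n; exact: EA.
have Lv : L2 mu v.
  split => //; have [C C0 CP] := W_poincare HS.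
  have [|||||//] := @Int_fatou _ _ _ mu (fun n x => v_ (s n) x ^+ 2) (fun x => v x ^+ 2) (C * A).
  - by move=> n; exact: (WL2 (Wk (s n))).2.
  - by move=> n x; exact: sqr_ge0.
  - exact: measurable_funX.
  - by apply: filterS cv => x cx; exact: cvg_sqr.
  - by move=> n; apply: le_trans (CP _ _ (Wk (s n))) _; rewrite ler_pM2l.
have Z0 : \forall x \ae mu, v x = 0 -> G x = 0.
  apply: filterS2 (W_level finmu HS 0 Wy) vy => x z0 [_ yv] vx.
  by rewrite /G z0 ?scaler0// -yv vx /Yf /sf mulr0 addr0 invr1 subrr.
(* Where [v_k < Vs j] the factor [ki] is at most [ki (Vs j)], so that the gradients of the
   truncations have a square-integrable majorant. *)
have Wj j : W (fun x => clip (Vs j) (v x)) (fun x => (if 0 < v x < Vs j then 1 else 0) *: G x).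
  pose B := ki (Vs j).
  have B0 : 0 <= B by exact: ki_ge0.
  have ZV : \forall x \ae mu, v x = Vs j -> G x = 0.
    apply: filterS2 (W_level finmu HS (Yf (Vs j)) Wy) vy => x z0 [_ yv] vx.
    by rewrite /G z0 ?scaler0// -yv vx.
  have mif u : measurable_fun setT u -> measurable_fun setT (fun x => if 0 < u x < Vs j then 1 else 0 : R).
    move=> mu1; apply: measurable_fun_ifT => //.
    by apply: measurable_and; exact: measurable_fun_ltr.
  (* At the levels [0] and [Vs j] the indicators along the sequence may oscillate, but there the
     limit gradient is [0]. *)
  have cG0 x i : G x = 0 -> (forall i, G_ (s n) x ord0 i @[n --> \oo] --> G x ord0 i) ->
      (if 0 < v_ (s n) x < Vs j then 1 else 0) * G_ (s n) x ord0 i @[n --> \oo] --> (0 : R).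
    move=> gx cx; apply: (@squeeze0 _ _ (fun n => `|G_ (s n) x ord0 i|)).
      by move=> n; rewrite normrM ler_piMl//; case: ifP; rewrite ?normr0 ?normr1.
    by rewrite -(normr0 R); apply: cvg_norm; have := cx i; rewrite gx mxE.
  apply: (W_lim HS (fun n => W_clip_id finmu HS (Vs0 j) (Wk (s n))) (A := fun x => Vs j + B * `|g x|)).
  - exact: measurable_clip.
  - by apply: mfvM => //; exact: mif.
  - by apply: L2D; [exact: L2_cst|apply: L2Z; exact: L2_norm].
  - move=> n; apply: aeW => x.
    by rewrite ger0_norm ?clip_ge0// (le_trans (clip_le _ (ltW (Vs0 j))))// lerDl mulr_ge0.
  - move=> n i; apply: filterS cZ => x zx; rewrite mxE.
    apply: (@le_trans _ _ (B * `|g x|)); last by rewrite lerDr ltW.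
    case: ifPn => [/andP[_ vV]|_]; last by rewrite mul0r normr0 mulr_ge0.
    rewrite mul1r Gk mxE normrM; apply: ler_pM => //.
      have /ki_le/andP[k0 k1] : 0 <= v_ (s n) x <= Vs j by rewrite vk0 ltW.
      by rewrite ger0_norm.
    exact: le_trans ((zx i).2 n) (ler_norm _).
  - apply: filterS cv => x cx; apply: (continuous_cvg _ _ cx); exact: continuous_clip.
  - move=> i; have gz : \forall x \ae mu, (v x = 0 -> G x = 0) /\ (v x = Vs j -> G x = 0).
      by apply: filterS2 Z0 ZV => x z0 zV; split.
    apply: filterS3 gz cv cG => x [z0 zV] cx cgx.
    rewrite mxE; under eq_fun do rewrite mxE.
    have [vx|vx] := eqVneq (v x) 0; first by rewrite z0// mxE mulr0; apply: cG0 => //; exact: z0.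
    have [vx'|vx'] := eqVneq (v x) (Vs j); first by rewrite zV// mxE mulr0; apply: cG0 => //; exact: zV.
    have vp : 0 < v x by rewrite lt_neqAle eq_sym vx v_ge0.
    apply: cvgM; last exact: cgx.
    apply: cvg_near_cst; case: (ltP (v x) (Vs j)) => vV.
      have h1 : \forall n \near \oo, 0 < v_ (s n) x by exact: cvgr_gt cx _ vp.
      have h2 : \forall n \near \oo, v_ (s n) x < Vs j by exact: cvgr_lt cx _ vV.
      by apply: filterS2 h1 h2 => n -> ->; rewrite vp.
    have {}vV : Vs j < v x by rewrite lt_neqAle eq_sym vx'.
    have h2 : \forall n \near \oo, Vs j < v_ (s n) x by exact: cvgr_gt cx _ vV.
    by apply: filterS h2 => n vn; rewrite [v_ _ _ < _]ltNge (ltW vn) !andbF.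
have Wv : W v G.
  apply: (W_lim HS Wj (A := fun x => `|v x| + \sum_(i < N) `|G x ord0 i|)) => //.
  - apply: L2D; first exact: L2_norm.
    by apply: L2_sum => i; apply: L2_norm; exact: LG.
  - move=> j; apply: aeW => x; rewrite ger0_norm ?clip_ge0// (le_trans (clip_le_id _ _))//.
    by rewrite (le_trans (ler_norm _))// lerDl; exact: sumr_ge0.
  - move=> j i; apply: aeW => x; rewrite mxE normrM (bigD1 i)//= addrCA.
    apply: (@le_trans _ _ `|G x ord0 i|); last by rewrite lerDl addr_ge0//; exact: sumr_ge0.
    by rewrite ler_piMl//; case: ifP; rewrite ?normr0 ?normr1.
  - apply: filterS vD => x /inDP-/(_ VS) vj; apply: cvg_near_cst.
    by apply: filterS vj => j vj; rewrite clip_id// v_ge0.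
  - move=> i; apply: filterS2 vD Z0 => x vDx z0; apply: cvg_near_cst.
    have [vx|vx] := eqVneq (v x) 0; first by exists 0%N => // j _; rewrite z0// scaler0 mxE.
    have vp : 0 < v x by rewrite lt_neqAle eq_sym vx v_ge0.
    have [k vk] := vDx; exists k.+1 => // j kj; rewrite mxE vp/= (le_lt_trans vk) ?mul1r//.
    by apply: lt_le_trans (VS k) _; exact: Vs_homo.
exists v, G.
have Lhk n : L1 mu (fun x => h (v_ (s n) x) * dot (G_ (s n) x) (G_ (s n) x)) by case: (solk (s n)).
have lim m : L1 mu (fun x => hm m (v x) * dot (G x) (G x)) /\
    I (fun x => `|cutoff Vs m (v_ (s n) x) * (h (v_ (s n) x) * dot (G_ (s n) x) (G_ (s n) x)) - hm m (v x) * dot (G x) (G x)|) @[n --> \oo] --> 0.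
  have [C hC] := hm_bdd m; have C0 : 0 <= C by apply: le_trans (hC 0).
  have LGG := L1_dot LG LG.
  have Lh : L1 mu (fun x => hm m (v x) * dot (G x) (G x)).
    by apply: (L1_mulbdd (C := C)) LGG => //; exact: hm_mf.
  split => //.
  pose X n x := hm m (v_ (s n) x) * dot (G_ (s n) x) (G_ (s n) x).
  rewrite (_ : (fun n => _) = fun n => I (fun x => `|X n x - hm m (v x) * dot (G x) (G x)|)); last first.
    apply/funext => n; congr Int; apply/funext => x; congr `|_ - _|.
    by rewrite /X /cut_profile mulrA (mulrC (cutoff _ _ _)).
  pose B := ki (Vs m.+1); have VV := Vs0 m.+1.
  have B0 : 0 <= B by exact: ki_ge0.
  rewrite -(Int0 mu).
  apply: (Int_dct (g := fun x => C * (B ^+ 2 * \sum_(i < N) g x ^+ 2) + `|hm m (v x) * dot (G x) (G x)|) _ _ _ _ _).2 => //.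
  - move=> n; apply: measurableT_comp => //; apply: measurable_funB; last exact: L1_mf Lh.
    by apply: measurable_funM; [exact: hm_mf|exact: mf_dot].
  - apply: L1D; last exact: L1_norm.
    by do 2 apply: L1Z; apply: L1_sum => i; exact: Lg.2.
  - move=> n; apply: filterS cZ => x zx; rewrite normr_id.
    apply: le_trans (ler_normB _ _) _; rewrite lerD2r /X.
    have S0 : 0 <= \sum_(i < N) g x ^+ 2 by apply: sumr_ge0 => i _; exact: sqr_ge0.
    have [Vv|vV] := leP (Vs m.+1) (v_ (s n) x).
      rewrite hm_big// mul0r normr0; apply: mulr_ge0 => //.
      by apply: mulr_ge0 => //; exact: sqr_ge0.
    rewrite normrM ler_pM// ger0_norm ?dot_ge0// Gk dotZl dotZr mulrA -expr2.
    apply: ler_pM; rewrite ?sqr_ge0 ?dot_ge0//.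
      have /ki_le/andP[k0 k1] : 0 <= v_ (s n) x <= Vs m.+1 by rewrite vk0 ltW.
      by rewrite ler_pXn2r ?nnegrE.
    apply: ler_sum => i _; rewrite -expr2 -[leLHS]real_normK ?num_real//.
    rewrite ler_pXn2r ?nnegrE ?(zx i).2//.
    by apply: le_trans ((zx i).2 0%N).
  - apply: filterS2 cv cG => x cx gx.
    rewrite -[X in _ --> X](normr0 R) -[X in `|X|](subrr (hm m (v x) * dot (G x) (G x))).
    apply: cvg_norm; apply: cvgB; last exact: cvg_cst.
    apply: cvgM; first by apply: continuous_cvg => //; exact: hm_continuous.
    by apply: cvg_sumr => i; apply: cvgM; exact: gx.
(* Untruncated gradients are only bounded in [L^2] and convergent almost everywhere, which suffices
   for weak convergence. *)
have Ec phi H : W phi H -> E (G_ (s n)) H @[n --> \oo] --> E G H.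
  move=> Wp; apply: (weak_limit (A := A)) => //; last exact: WL2v Wp.
  by move=> n; exact: WL2v (Wk _).
have fkf : \forall x \ae mu, fk (s n) x @[n --> \oo] --> f x.
  apply: aeW => x; apply: cvg_near_cst.
  have h1 : \forall n \near \oo, f x <= n%:R by exact: nbhs_infty_ger.
  apply: filterS h1 => n fn; apply: min_l; apply: le_trans fn _.
  by rewrite ler_nat subseq_ge.
have eqs n phi H M : W phi H -> (forall x, `|phi x| <= M) ->
    E (G_ (s n)) H + I (fun x => h (v_ (s n) x) * dot (G_ (s n) x) (G_ (s n) x) * phi x) = I (fun x => fk (s n) x * phi x).
  by case: (solk (s n)) => _ _ _ _; apply.
have [Lh eqv] := stability finmu HS mb alpha0 hb VS V0 theta01 h_ge0 h0 mh v00 Ch0 hCh hm_continuous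
  Lf (fun n => Wk (s n)) (fun n => vk0 (s n)) Lhk
  (fun n x => mulr_ge0 (h_ge0 _) (dot_ge0 _)) (fun n => Lk (s n)) (fun n => fk01 (s n)) eqs
  (fun n => aeW _ (fun x => lexx _)) fkf Wv v_ge0 cv vD Ec lim.
by split.
Qed.

End monotone_limit.

End singular_problem.

(** * The change of unknown *)

Section real_functions.
Context (R : realType).
Implicit Types (f df : R -> R) (a b s t : R).

Lemma is_derive_continuous f l t : is_derive t (1 : R) f l -> f x @[x --> t] --> f t.
Proof.
by move=> d; have /@ex_derive/derivable1_diffP/differentiable_continuous := d.
Qed.

Lemma mvt f df a b : a <= b -> (forall t, a <= t <= b -> is_derive t (1 : R) f (df t)) ->
  exists2 t, a <= t <= b & f b - f a = df t * (b - a).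
Proof.
move=> ab d.
have [|t|c cab e] := @MVT_segment R f df a b ab.
- by move=> t; rewrite in_itv/= => /andP[h1 h2]; apply: d; rewrite !ltW.
- apply: continuous_in_subspaceT => s; rewrite inE/= in_itv/= => sab.
  exact: is_derive_continuous (d s sab).
- by exists c => //; move: cab; rewrite in_itv.
Qed.

Lemma derive_ge0_le f df a b : a <= b ->
  (forall t, a <= t <= b -> is_derive t (1 : R) f (df t)) ->
  (forall t, a <= t <= b -> 0 <= df t) -> f a <= f b.
Proof.
move=> ab d d0; have [t tab e] := mvt ab d.
by rewrite -subr_ge0 e mulr_ge0 ?d0// subr_ge0.
Qed.

Definition proj a b t : R := Num.max a (Num.min b t).

Lemma proj_in a b t : a <= b -> a <= proj a b t <= b.
Proof. by move=> ab; rewrite le_max lexx/= ge_max ab/= ge_min lexx. Qed.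

Lemma proj_id a b t : a <= t <= b -> proj a b t = t.
Proof. by move=> /andP[h1 h2]; rewrite /proj min_r// max_r. Qed.

Lemma proj_lip a b s t : `|proj a b s - proj a b t| <= `|s - t|.
Proof.
wlog st : s t / s <= t.
  move=> hw; have [st|/ltW ts] := leP s t; first exact: hw.
  by rewrite distrC (distrC s); exact: hw.
rewrite distrC (distrC s) !ger0_norm ?subr_ge0//; last first.
  by apply: le_max2 => //; exact: le_min2.
rewrite /proj; case: (leP b s) => bs; case: (leP b t) => bt.
- by rewrite subrr subr_ge0.
- by have := lt_le_trans bt bs; lra.
- case: (leP a b) => h1; case: (leP a s) => h2; lra.
- case: (leP a t) => h1; case: (leP a s) => h2; lra.
Qed.

(** The profile is differentiable only inside its domain. Composition with the projection on an
    interval gives a bounded and globally Lipschitz function that agrees with it on the support of a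
    cutoff. *)
Lemma proj_C1 f df a b : a <= b ->
  (forall t, a <= t <= b -> is_derive t (1 : R) f (df t)) ->
  (forall t, a <= t <= b -> df x @[x --> t] --> df t) ->
  exists2 L, 0 <= L & forall s t, `|f (proj a b s)| <= L /\
    `|f (proj a b s) - f (proj a b t)| <= L * `|s - t|.
Proof.
move=> ab d cd.
have bnd (g : R -> R) : (forall t, a <= t <= b -> g x @[x --> t] --> g t) ->
    exists C : R, forall t, a <= t <= b -> `|g t| <= C.
  move=> cg.
  have cw : {within `[a, b], continuous (fun t => `|g t|)}.
    apply: continuous_in_subspaceT => t; rewrite inE/= in_itv/= => tM.
    by apply: cvg_norm; exact: cg.
  have [c _ H] := EVT_max ab cw.
  by exists `|g c| => t tM; apply: H; rewrite in_itv.
have [C1 hC1] := bnd f (fun t tab => is_derive_continuous (d t tab)).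
have [C2 hC2] := bnd df cd.
have p1 : 0 <= C1 by apply: le_trans (hC1 a _); rewrite ?lexx.
have p2 : 0 <= C2 by apply: le_trans (hC2 a _); rewrite ?lexx.
have lip s t : a <= s -> s <= t -> t <= b -> `|f s - f t| <= C2 * `|s - t|.
  move=> a_s st tb; have [|c /andP[c1 c2] e] := @mvt f df s t st.
    by move=> r /andP[r1 r2]; apply: d; rewrite (le_trans a_s)// (le_trans r2).
  rewrite distrC e normrM (distrC t) ler_wpM2r// hC2// (le_trans a_s)//.
  exact: le_trans tb.
exists (C1 + C2) => [|s t]; first exact: addr_ge0.
have [/andP[s1 s2] /andP[t1 t2]] := (proj_in s ab, proj_in t ab).
split; first by rewrite (le_trans (hC1 _ _)) ?s1// lerDl.
apply: (@le_trans _ _ (C2 * `|proj a b s - proj a b t|)).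
  have [h1|/ltW h1] := leP (proj a b s) (proj a b t); first exact: lip.
  by rewrite distrC (distrC (proj a b s)); exact: lip.
by apply: ler_pM => //; [rewrite lerDr|exact: proj_lip].
Qed.

Lemma prod_lip (x1 x2 c1 c2 L K e : R) : 0 <= L -> `|x1| <= L -> `|x1 - x2| <= L * e ->
  `|c2| <= 1 -> `|c1 - c2| <= K * e -> `|x1 * c1 - x2 * c2| <= L * (1 + K) * e.
Proof.
move=> L0 h1 h2 h3 h4.
have -> : x1 * c1 - x2 * c2 = (x1 - x2) * c2 + x1 * (c1 - c2) by ring.
apply: le_trans (ler_normD _ _) _; rewrite !normrM mulrDr mulr1 mulrDl lerD//.
  by apply: le_trans h2; rewrite ler_piMr.
by rewrite -mulrA ler_pM.
Qed.

Lemma powR_neg_le (x y r : R) : 0 <= r -> 0 < x -> x <= y -> (y `^ r)^-1 <= (x `^ r)^-1.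
Proof.
move=> r0 x0 xy; have y0 := lt_le_trans x0 xy.
by rewrite lef_pV2 ?posrE ?powR_gt0// ge0_ler_powR ?nnegrE ?(ltW x0) ?(ltW y0).
Qed.

Lemma powR_le1D (x r : R) : 0 <= x -> 0 <= r <= 1 -> x `^ r <= 1 + x.
Proof.
move=> x0 /andP[r0 r1]; have [x1|x1] := leP x 1.
  apply: (@le_trans _ _ (1 `^ r)); first by rewrite ge0_ler_powR ?nnegrE.
  by rewrite powR1 lerDl.
by rewrite (le_trans (ler1_powR (ltW x1) r1))// lerDr.
Qed.

End real_functions.

Section profile.
Context (R : realType) (p theta B : R).
Hypothesis p0 : 0 < p.
Hypothesis theta01 : 0 < theta < 1.
Hypothesis B0 : 0 < B.
Implicit Types s t v : R.

(* [W1 = 1 + U] where [U] solves [U' = (1 + U)^p], [U 0 = 0]; it inverts the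
   primitive of [(1 + u)^(-p)] and is defined where [1 + (1 - p) t > 0]. *)
Definition W1 t := if p == 1 then expR t else (1 + (1 - p) * t) `^ (1 - p)^-1.
Definition dom t := 0 < 1 + (1 - p) * t.
(** With [u = U v] and [U' = W1 ^ p], the density [B |grad u|^2 / u ^ theta] equals this factor
    times [|grad v|^2], and [b / (1 + u) ^ p] times [grad u] is [b] times [grad v]. *)
Definition gradient_profile t := B * W1 t `^ (2 * p) / (W1 t - 1) `^ theta.
Local Notation hp := gradient_profile.
(** The value of [v] that corresponds to [u = n + 1], see [W1_Vp]. The cutoffs on [v] are therefore
    indexed by integer levels of [u]. *)
Definition Vp (n : nat) : R :=
  if p == 1 then ln n.+2%:R else (n.+2%:R `^ (1 - p) - 1) / (1 - p).

Lemma W1_gt0 t : dom t -> 0 < W1 t.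
Proof. by move=> dt; rewrite /W1; case: ifP => _; [exact: expR_gt0|exact: powR_gt0]. Qed.

Lemma W1_0 : W1 0 = 1.
Proof. by rewrite /W1 expR0 mulr0 addr0 powR1; case: ifP. Qed.

Lemma is_derive_W1 t : dom t -> is_derive t (1 : R) W1 (W1 t `^ p).
Proof.
rewrite /dom /W1 => dt; case: eqVneq => [->|p1].
  by rewrite powRr1 ?expR_ge0//; exact: is_derive_expR.
have q0 : 1 - p != 0 by rewrite subr_eq0 eq_sym.
have d1 : is_derive t (1 : R) (fun t : R => 1 + (1 - p) * t : R) (1 - p).
  by apply: is_derive_eq; rewrite /GRing.scale/=; ring.
have d2 := @is_derive1_comp R (fun s => s `^ (1 - p)^-1) (fun t : R => 1 + (1 - p) * t) t _ _ (is_derive1_powR (1 - p)^-1 dt) d1.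
have -> : ((1 + (1 - p) * t) `^ (1 - p)^-1) `^ p =
    (1 - p)^-1 * (1 + (1 - p) * t) `^ ((1 - p)^-1 - 1) * (1 - p).
  rewrite mulrAC mulVf// mul1r -powRrM; congr (_ `^ _); field; exact: q0.
exact: d2.
Qed.

Lemma dom_conv s t r : dom s -> dom t -> s <= r <= t -> dom r.
Proof.
rewrite /dom => ds dt /andP[sr rt]; have [p1|p1] := leP p 1.
  by apply: lt_le_trans ds _; rewrite lerD2l ler_wpM2l// subr_ge0.
by apply: lt_le_trans dt _; rewrite lerD2l ler_wnM2l// subr_le0 ltW.
Qed.

Lemma dom0 : dom 0. Proof. by rewrite /dom mulr0 addr0. Qed.

Lemma W1_le s t : dom s -> dom t -> s <= t -> W1 s <= W1 t.
Proof.
move=> ds dt st; apply: (derive_ge0_le st (df := fun t => W1 t `^ p)) => [r rst|r _].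
  exact: is_derive_W1 (dom_conv ds dt rst).
exact: powR_ge0.
Qed.

Lemma dom_Vp n : dom (Vp n).
Proof.
rewrite /dom /Vp; case: eqVneq => [->|p1]; first by rewrite subrr mul0r addr0.
have q0 : 1 - p != 0 by rewrite subr_eq0 eq_sym.
by rewrite mulrC divfK// addrC subrK powR_gt0.
Qed.

Lemma W1_Vp n : W1 (Vp n) = n.+2%:R.
Proof.
rewrite /W1 /Vp; case: eqVneq => [_|p1]; first by rewrite lnK// posrE.
have q0 : 1 - p != 0 by rewrite subr_eq0 eq_sym.
rewrite mulrC divfK// addrC subrK -powRrM mulfV// powRr1//.
Qed.

Lemma Vp_lt n : Vp n < Vp n.+1.
Proof.
rewrite ltNge; apply/negP => h; have := W1_le (dom_Vp _) (dom_Vp _) h.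
by rewrite !W1_Vp ler_nat ltnn.
Qed.

Lemma Vp0 : 0 < Vp 0.
Proof.
rewrite ltNge; apply/negP => h; have := W1_le (dom_Vp _) dom0 h.
by rewrite W1_Vp W1_0 leNgt ltr1n.
Qed.

Lemma Vp_gt0 n : 0 < Vp n. Proof. exact: (Vs_gt0 Vp_lt Vp0). Qed.

Lemma dom_itv n t : 0 <= t <= Vp n -> dom t.
Proof. exact: dom_conv dom0 (dom_Vp n). Qed.

Lemma dom_inD t : 0 <= t -> inD Vp t -> dom t.
Proof. by move=> t0 [n tn]; apply: (@dom_itv n); rewrite t0. Qed.

Lemma W1_ge1 t : 0 <= t -> dom t -> 1 <= W1 t.
Proof. by move=> t0 dt; rewrite -W1_0; exact: W1_le dom0 dt t0. Qed.

Lemma W1_ge t : 0 <= t -> dom t -> 1 + t <= W1 t.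
Proof.
move=> t0 dt; have [|r /andP[r0 rt] e] := @mvt R W1 (fun t => W1 t `^ p) 0 t t0.
  by move=> r rt; exact: is_derive_W1 (dom_conv dom0 dt rt).
rewrite W1_0 subr0 in e; rewrite -lerBrDl e ler_peMl//.
have dr : dom r by apply: (dom_conv dom0 dt); rewrite r0.
have w1 := W1_ge1 r0 dr.
by rewrite -[leLHS](powRr0 (W1 r)); apply: ler_powR => //; exact: ltW.
Qed.

Lemma W1_convex t : 0 <= t -> dom t -> W1 t - 1 <= t * W1 t `^ p.
Proof.
move=> t0 dt; have [|r /andP[r0 rt] e] := @mvt R W1 (fun t => W1 t `^ p) 0 t t0.
  by move=> r rt; exact: is_derive_W1 (dom_conv dom0 dt rt).
rewrite W1_0 subr0 in e; rewrite e [leLHS]mulrC; apply: (ler_wpM2l t0).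
have dr : dom r by apply: (dom_conv dom0 dt); rewrite r0.
apply: ge0_ler_powR; rewrite ?nnegrE ?(ltW p0) ?(ltW (W1_gt0 _))//.
exact: W1_le.
Qed.

Lemma hp_ge0 t : 0 <= hp t.
Proof. by rewrite !mulr_ge0 ?invr_ge0 ?powR_ge0// ltW. Qed.

(** A convention, not a limit: the power of [0] is [0] and so is its inverse. It is harmless since
    the gradient vanishes where [v = 0]. *)
Lemma hp_0 : hp 0 = 0.
Proof.
by rewrite /hp W1_0 subrr powR0 ?invr0 ?mulr0//; case/andP: theta01 => /gt_eqF ->.
Qed.

Lemma measurable_W1 : measurable_fun setT W1.
Proof.
rewrite /W1; case: (p == 1); first exact: measurable_expR.
apply: (measurableT_comp (measurable_powR _)) => //.
by apply: measurable_funD => //; exact: measurable_funM.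
Qed.

Lemma measurable_W1p r : measurable_fun setT (fun t => W1 t `^ r).
Proof. exact: (measurableT_comp (measurable_powR r) measurable_W1). Qed.

Lemma hpE t : hp t = B * W1 t `^ (2 * p) * (W1 t - 1) `^ (- theta).
Proof. by rewrite powRN. Qed.

Lemma measurable_hp : measurable_fun setT hp.
Proof.
rewrite (_ : hp = fun t => B * W1 t `^ (2 * p) * (W1 t - 1) `^ (- theta)); last first.
  by apply/funext => t; exact: hpE.
apply: measurable_funM.
  by apply: measurable_funM => //; exact: measurable_W1p.
apply: (measurableT_comp (measurable_powR _)) => //.
by apply: measurable_funB => //; exact: measurable_W1.
Qed.

(** On this range [W1] is at most [W1 (Vp 0) = 2], and [W1 - 1] is at least [t]. *)
Lemma hp_bound : forall t, 0 < t <= Vp 0 -> hp t <= (B * 2 `^ (2 * p)) * t `^ (- theta).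
Proof.
move=> t /andP[t0 tV]; have /andP[th0 th1] := theta01.
have dt : dom t by apply: (@dom_itv 0); rewrite (ltW t0).
have w1 := W1_ge (ltW t0) dt.
rewrite /hp powRN; apply: ler_pM.
- by rewrite mulr_ge0 ?powR_ge0// ltW.
- by rewrite invr_ge0 powR_ge0.
- rewrite ler_pM2l//; apply: ge0_ler_powR.
  + by rewrite mulr_ge0// ltW.
  + by rewrite nnegrE ltW// W1_gt0.
  + by rewrite nnegrE.
  + by rewrite -[leRHS](W1_Vp 0); apply: W1_le => //; exact: dom_Vp.
- by apply: powR_neg_le => //; [exact: ltW|lra].
Qed.

Definition dhp t := B * ((2 * p * W1 t `^ (2 * p - 1) * W1 t `^ p) * (W1 t - 1) `^ (- theta) +
  W1 t `^ (2 * p) * (- theta * (W1 t - 1) `^ (- theta - 1) * W1 t `^ p)).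

Lemma W1_gt1 t : 0 < t -> dom t -> 0 < W1 t - 1.
Proof. by move=> t0 dt; have := W1_ge (ltW t0) dt; lra. Qed.

Lemma is_derive_hp t : 0 < t -> dom t -> is_derive t (1 : R) hp (dhp t).
Proof.
move=> t0 dt; have w := W1_gt0 dt; have w1 := W1_gt1 t0 dt; have dW := is_derive_W1 dt.
have d1 := @is_derive1_comp R (fun s => s `^ (2 * p)) W1 t _ _ (is_derive1_powR (2 * p) w) dW.
have dW1 : is_derive t (1 : R) (fun t => W1 t - 1 : R) (W1 t `^ p).
  by apply: is_derive_eq; rewrite subr0.
have d2 := @is_derive1_comp R (fun s => s `^ (- theta)) (fun t => W1 t - 1) t _ _ (is_derive1_powR (- theta) w1) dW1.
rewrite (_ : hp = fun t => B * (((fun s => s `^ (2 * p)) \o W1) t * ((fun s => s `^ (- theta)) \o (fun t => W1 t - 1)) t)); last first.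
  by apply/funext => s; rewrite hpE /= mulrA.
apply: is_derive_eq; rewrite /GRing.scale/= /dhp; ring.
Qed.

Lemma continuous_W1p t r : dom t -> W1 x `^ r @[x --> t] --> W1 t `^ r.
Proof.
move=> dt; apply: (@continuous_comp _ _ _ W1 (fun s => s `^ r)).
  exact: is_derive_continuous (is_derive_W1 dt).
exact: continuous_powR (W1_gt0 dt).
Qed.

Lemma continuous_Up t r : 0 < t -> dom t -> (W1 x - 1) `^ r @[x --> t] --> (W1 t - 1) `^ r.
Proof.
move=> t0 dt; apply: (@continuous_comp _ _ _ (fun t => W1 t - 1) (fun s => s `^ r)).
  by apply: cvgB; [exact: is_derive_continuous (is_derive_W1 dt)|exact: cvg_cst].
exact: continuous_powR (W1_gt1 t0 dt).
Qed.

Lemma continuous_dhp t : 0 < t -> dom t -> dhp x @[x --> t] --> dhp t.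
Proof.
move=> t0 dt; apply: cvgM; first exact: cvg_cst.
apply: cvgD; apply: cvgM.
- by apply: cvgM; [apply: cvgM; [exact: cvg_cst|exact: continuous_W1p]|exact: continuous_W1p].
- exact: continuous_Up.
- exact: continuous_W1p.
- by apply: cvgM; [apply: cvgM; [exact: cvg_cst|exact: continuous_Up]|exact: continuous_W1p].
Qed.

Lemma clip_lip (M s t : R) : 0 <= M -> `|clip M s - clip M t| <= `|s - t|.
Proof. by move=> M0; exact: (@proj_lip R 0 M s t). Qed.

(** For [m > 0] the cutoff is supported in [[1 / m, Vp m.+1]], where the profile is [C^1], so the
    profile may be evaluated at the projection on that interval. For [m = 0] the cutoff vanishes
    identically. *)
Lemma hmp_lip m : exists2 L, 0 <= L & forall s t,
  `|cut_profile Vp hp m s| <= L /\ `|cut_profile Vp hp m s - cut_profile Vp hp m t| <= L * `|s - t|.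
Proof.
have [->|m0] := posnP m.
  have h0 t : cut_profile Vp hp 0 t = 0.
    rewrite /cut_profile /cutoff /lo mul0r sub0r (_ : clip 1 (-1) = 0) ?mul0r ?mulr0//.
    by apply: clip_neg => //; rewrite oppr_le0.
  by exists 0 => // s t; rewrite !h0 subrr normr0 mul0r.
have a0 : 0 < (m%:R : R)^-1 by rewrite invr_gt0 ltr0n.
(* The minimum with [Vp m.+1] only guarantees that the interval is not empty. *)
pose a := Num.min ((m%:R : R)^-1) (Vp m.+1); pose b := Vp m.+1.
have a1 : 0 < a by rewrite lt_min a0 Vp_gt0.
have ab : a <= b by rewrite ge_min lexx orbT.
have dab t : a <= t <= b -> 0 < t /\ dom t.
  move=> /andP[t1 t2]; have tp := lt_le_trans a1 t1; split => //.
  by apply: (@dom_itv m.+1); rewrite ltW.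
have [L L0 hL] := proj_C1 ab (fun t tab => is_derive_hp (dab t tab).1 (dab t tab).2)
  (fun t tab => continuous_dhp (dab t tab).1 (dab t tab).2).
have hE t : cut_profile Vp hp m t = hp (proj a b t) * cutoff Vp m t.
  have [tb|bt] := leP b t.
    have hi1 : hi Vp m t = 1.
      apply: clip_big; rewrite ler01/= ler_pdivlMr ?(dV_gt0 Vp_lt)// mul1r lerD2r//.
    have ct : cutoff Vp m t = 0 by rewrite /cutoff hi1 subrr mulr0.
    have E0 (x : R) : x * cutoff Vp m t = 0 by rewrite ct mulr0.
    exact: etrans (E0 (hp t)) (esym (E0 _)).
  have [ta|at_] := leP t a.
    have lo0 : lo m t = 0.
      apply: clip_neg => //; rewrite subr_le0 mulrC -ler_pdivlMr ?ltr0n// mul1r.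
      by rewrite (le_trans ta)// ge_min lexx.
    have ct : cutoff Vp m t = 0 by rewrite /cutoff lo0 mul0r.
    have E0 (x : R) : x * cutoff Vp m t = 0 by rewrite ct mulr0.
    exact: etrans (E0 (hp t)) (esym (E0 _)).
  by rewrite proj_id// !ltW.
pose K := m%:R + (Vp m.+1 - Vp m)^-1.
have dV := dV_gt0 Vp_lt m.
have K0 : 0 <= K by rewrite addr_ge0// invr_ge0 ltW.
have cl s t : `|cutoff Vp m s - cutoff Vp m t| <= K * `|s - t|.
  have l1 : `|lo m s - lo m t| <= m%:R * `|s - t|.
    apply: le_trans (clip_lip _ _ _) _ => //.
    by rewrite opprB addrA subrK -mulrBr normrM ger0_norm.
  have l2 : `|hi Vp m s - hi Vp m t| <= (Vp m.+1 - Vp m)^-1 * `|s - t|.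
    apply: le_trans (clip_lip _ _ _) _ => //.
    by rewrite -mulrBl opprB addrA subrK normrM mulrC [`|_^-1|]ger0_norm// invr_ge0 ltW.
  have -> : cutoff Vp m s - cutoff Vp m t =
     (lo m s - lo m t) * (1 - hi Vp m s) - lo m t * (hi Vp m s - hi Vp m t).
    by rewrite /cutoff; ring.
  apply: le_trans (ler_normB _ _) _; rewrite !normrM /K mulrDl lerD//.
    apply: le_trans l1; rewrite ler_piMr//.
    by case/andP: (hi01 Vp m s) => h1 h2; rewrite ger0_norm; lra.
  apply: le_trans l2; rewrite ler_piMl//.
  by case/andP: (lo01 m t) => h1 h2; rewrite ger0_norm; lra.
exists (L * (1 + K)) => [|s t]; first by rewrite mulr_ge0// addr_ge0.
rewrite !hE; have [h1 h2] := hL s t; have c01 r : `|cutoff Vp m r| <= 1.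
  by case/andP: (cutoff01 Vp m r) => c1 c2; rewrite ger0_norm.
split.
  rewrite normrM; apply: (@le_trans _ _ (L * 1)); first exact: ler_pM.
  by rewrite ler_wpM2l// lerDl.
exact: (prod_lip L0 h1 h2 (c01 t) (cl s t)).
Qed.

(** The choice of [c] gives [c ^ (1 - theta) <= B / (2 beta)], that is, [2 beta c <= B c ^ theta].
    With [U = W1 - 1], convexity in the form [U <= t W1 ^ p] yields [(c U) ^ theta <= 1 + c U <= W1
    ^ p (1 + c t)]; dividing by [U ^ theta] and using [W1 >= 1] gives the profile. *)
Lemma hp_absorb (beta : R) : 0 < beta -> exists2 c, 0 < c &
  forall t, 0 < t -> inD Vp t -> 2 * beta * c <= hp t * (1 + c * t).
Proof.
move=> beta0; have /andP[th0 th1] := theta01.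
have s0 : 0 < 1 - theta by rewrite subr_gt0.
pose c0 := (B / (2 * beta)) `^ (1 - theta)^-1.
have r0 : 0 < B / (2 * beta) by rewrite divr_gt0// mulr_gt0.
pose c := Num.min 1 c0.
have cp : 0 < c by rewrite lt_min ltr01 powR_gt0.
have c1 : c <= 1 by rewrite ge_min lexx.
exists c => // t t0 tD.
have dt := dom_inD (ltW t0) tD; have w1 := W1_ge1 (ltW t0) dt; have w := W1_gt0 dt.
have u0 := W1_gt1 t0 dt; set U := W1 t - 1 in u0 *.
have key : 2 * beta * c <= B * c `^ theta.
  have ct : c `^ (1 - theta) <= B / (2 * beta).
    apply: (@le_trans _ _ (c0 `^ (1 - theta))).
      by apply: ge0_ler_powR; rewrite ?nnegrE ?(ltW s0) ?(ltW cp) ?powR_ge0// ge_min lexx orbT.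
    by rewrite -powRrM mulVf ?gt_eqF// powRr1// ltW.
  rewrite ler_pdivlMr ?mulr_gt0// in ct.
  have -> : 2 * beta * c = c `^ theta * (c `^ (1 - theta) * (2 * beta)).
    rewrite mulrA -powRD; last by rewrite (gt_eqF cp) implybT.
    by rewrite addrC subrK powRr1 ?(ltW cp)// mulrC.
  by rewrite mulrC ler_wpM2r ?powR_ge0.
apply: le_trans key _.
have wp1 : 1 <= W1 t `^ p.
  by rewrite -[leLHS](powRr0 (W1 t)); apply: ler_powR => //; exact: ltW.
have cv := W1_convex (ltW t0) dt; rewrite -/U in cv.
have h1 : U `^ theta * c `^ theta <= W1 t `^ p * (W1 t `^ p * (1 + c * t)).
  rewrite -powRM ?(ltW u0) ?(ltW cp)//.
  apply: (@le_trans _ _ (1 + U * c)).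
    by apply: powR_le1D; [rewrite mulr_ge0 ?(ltW u0) ?(ltW cp)|rewrite !ltW].
  have h2 : 1 + U * c <= W1 t `^ p * (1 + c * t).
    by have := ler_wpM2r (ltW cp) cv; move: wp1; set w2 := W1 t `^ p; lra.
  apply: le_trans h2 _; apply: ler_peMl => //.
  by rewrite mulr_ge0 ?powR_ge0// addr_ge0// mulr_ge0 ?(ltW cp) ?(ltW t0).
rewrite /hp -/U mulrAC ler_pdivlMr ?powR_gt0//.
have -> : W1 t `^ (2 * p) = W1 t `^ p * W1 t `^ p.
  by rewrite -powRD ?(gt_eqF w) ?implybT//; congr (_ `^ _); ring.
rewrite -!mulrA ler_pM2l// mulrC; exact: h1.
Qed.

End profile.

(** * Energy estimates in the original unknown and return to it *)

Section abstract_problem.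
Context d (T : measurableType d) (R : realType) (N : nat).
Variable mu : {measure set T -> \bar R}.
Variable W : (T -> R) -> (T -> 'rV[R]_N) -> Prop.
Hypothesis finmu : (mu setT < +oo)%E.
Hypothesis HS : sobolev mu W.
Variables (b : T -> R) (alpha beta p theta B : R).
Hypothesis mb : measurable_fun setT b.
Hypothesis alpha0 : 0 < alpha.
Hypothesis beta0 : 0 < beta.
Hypothesis hb : forall x, alpha <= b x <= beta.
Hypothesis p0 : 0 < p.
Hypothesis theta01 : 0 < theta < 1.
Hypothesis B0 : 0 < B.
Implicit Types (u v f F g phi : T -> R) (G H K : T -> 'rV[R]_N).
Local Notation I := (Int mu).
Local Notation E := (EE mu b).
Local Notation W1 := (W1 p).
Local Notation Vp := (Vp p).
Local Notation hp := (gradient_profile p theta B).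
Local Notation dom := (dom p).

Let WL2 := W_L2 HS.
Let WL2v := W_L2v HS.
Let VS := @Vp_lt R p.
Let V0 := @Vp0 R p.
Let h_ge0 := hp_ge0 p theta B0.
Let h00 := hp_0 p B theta01.

Let theta0 : 0 < theta. Proof. by case/andP: theta01. Qed.

Lemma dom_clip j (t : R) : dom (clip (Vp j) t).
Proof. by apply: (@dom_itv _ _ j); rewrite clip_ge0 clip_le// ltW// Vp_gt0. Qed.

Lemma T_itv j (t : R) : 0 <= W1 (clip (Vp j) t) - 1 <= j.+1%:R.
Proof.
have dj := dom_clip j t; have := W1_ge1 (clip_ge0 _ _) dj.
have := W1_le dj (dom_Vp p j) (clip_le _ (ltW (Vp_gt0 p j))).
by rewrite W1_Vp -natr1; move=> h1 h2; apply/andP; split; lra.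
Qed.

(** The gradient of the truncated original unknown, [U] of [clip (Vp j) v] with [U = W1 - 1]. *)
Definition KT j v G x : 'rV[R]_N := (if 0 < v x < Vp j then W1 (v x) `^ p else 0) *: G x.

Lemma W_T j v G : W v G -> W (fun x => W1 (clip (Vp j) (v x)) - 1) (KT j v G).
Proof.
move=> Wv; have Vj := Vp_gt0 p j.
apply: (W_clip (F := fun t => W1 t - 1) (F' := fun t => W1 t `^ p) finmu HS Vj _ _ _ Wv).
- move=> t /dom_itv dt; have dW := is_derive_W1 dt.
  by apply: is_derive_eq; rewrite subr0.
- by move=> t /dom_itv dt; exact: continuous_W1p.
- by rewrite W1_0 subrr.
Qed.

(* Where [0 < v < Vp j] the energy density of [U (v)] is [hp (v) U (v)^theta]
   times that of [v], up to [B]. *)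
Lemma KT_sqr j v G x : B * dot (KT j v G x) (KT j v G x) =
  (if 0 < v x < Vp j then 1 else 0) * (hp (v x) * dot (G x) (G x)) *
  (W1 (clip (Vp j) (v x)) - 1) `^ theta.
Proof.
rewrite /KT dotZl dotZr; case: ifPn => [/andP[v0 vV]|_]; last by rewrite !mul0r mulr0.
have dv : dom (v x) by apply: (@dom_itv _ _ j); rewrite !ltW.
have u0 := W1_gt1 p0 v0 dv; have w0 := W1_gt0 dv.
rewrite clip_id ?ltW// mul1r /gradient_profile.
have -> : W1 (v x) `^ (2 * p) = W1 (v x) `^ p * W1 (v x) `^ p.
  by rewrite -powRD ?(gt_eqF w0) ?implybT//; congr (_ `^ _); ring.
have := powR_gt0 theta u0; set X := (_ - 1) `^ theta; set w := _ `^ p; set g := dot _ _ => X0.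
by field; rewrite gt_eqF.
Qed.

Lemma hmp_ge0 m t : 0 <= cut_profile Vp hp m t.
Proof. by apply: mulr_ge0 => //; case/andP: (cutoff01 Vp m t). Qed.

Lemma measurable_chi j v : measurable_fun setT v ->
  measurable_fun setT (fun x => if 0 < v x < Vp j then 1 else 0 : R).
Proof.
move=> mv; apply: measurable_fun_ifT => //.
by apply: measurable_and; exact: measurable_fun_ltr.
Qed.

Lemma hp_mf v : measurable_fun setT v -> measurable_fun setT (fun x => hp (v x)).
Proof. by move=> mv; apply: (measurableT_comp (measurable_hp p theta B)). Qed.

(** The truncation [T] of [U v] equals [j + 1] where [v > Vp j], so Poincare's inequality bounds
    [(j + 1) ^ 2] times the measure of that set by the energy of [T]. By [KT_sqr] this energy is at
    most [(j + 1) ^ theta * A / B], because [T <= j + 1]. The exponent [2 - theta] that remains is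
    positive. *)
Lemma profile_top : exists2 q : nat -> R, q @ \oo --> 0 & forall j v G A, W v G ->
  (forall x, 0 <= v x) ->
  (forall m, L1 mu (fun x => cut_profile Vp hp m (v x) * dot (G x) (G x))) ->
  (forall m, I (fun x => cut_profile Vp hp m (v x) * dot (G x) (G x)) <= A) ->
  I (fun x => if Vp j < v x then 1 else 0) <= q j * A.
Proof.
have [C C0 CP] := W_poincare HS; have th2 : 0 < 2 - theta by case/andP: theta01; lra.
exists (fun j => C / B * en R j `^ (2 - theta)).
  apply: cvgZ0; apply: cvg_powR0 => //; first by move=> n; rewrite ltW// en_gt0.
  exact: en_cvg.
move=> j v G A Wv v_ge0 Lm LA; have mv := L2_mf (WL2 Wv); have mG := L2v_mf (WL2v Wv).
have WT := W_T j Wv; pose chi x : R := if 0 < v x < Vp j then 1 else 0.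
have mchi : measurable_fun setT chi by exact: measurable_chi.
have mg : measurable_fun setT (fun x => hp (v x) * dot (G x) (G x)).
  by apply: measurable_funM; [exact: hp_mf|exact: mf_dot].
have chi01 x : 0 <= chi x <= 1 by rewrite /chi; case: ifP; rewrite lexx ler01.
have [|||||L1h Ih] := @Int_fatou _ _ _ mu (fun m x => chi x * (cut_profile Vp hp m (v x) * dot (G x) (G x)))
    (fun x => chi x * (hp (v x) * dot (G x) (G x))) A.
- by move=> m; apply: (L1_mulbdd (C := 1)) => // x; case/andP: (chi01 x) => c0 c1; rewrite ger0_norm.
- move=> m x; case/andP: (chi01 x) => c0 c1.
  by apply: mulr_ge0 => //; apply: mulr_ge0; [exact: hmp_ge0|exact: dot_ge0].
- exact: measurable_funM.
- apply: aeW => x; rewrite /chi; case: ifPn => [/andP[vx vV]|_]; last first.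
    by under eq_fun do rewrite mul0r; rewrite mul0r; exact: cvg_cst.
  apply: cvgM; first exact: cvg_cst.
  apply: cvgM; last exact: cvg_cst.
  apply: (cutoff_to_h VS h00); last exact: ltW.
  by exists j; rewrite ltW.
- move=> m; apply: le_trans (LA m); apply: Int_leT => //.
    by apply: (L1_mulbdd (C := 1)) => // x; case/andP: (chi01 x) => c0 c1; rewrite ger0_norm.
  move=> x; case/andP: (chi01 x) => c0 c1; apply: ler_piMl => //.
  by apply: mulr_ge0; [exact: hmp_ge0|exact: dot_ge0].
pose J : R := j.+1%:R; have J0 : 0 < J by rewrite ltr0n.
have LK := L1_dot (WL2v WT) (WL2v WT).
have DK : DG mu (KT j v G) (KT j v G) <= B^-1 * (J `^ theta * A).
  rewrite ler_pdivlMl// -IntZ//.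
  apply: (@le_trans _ _ (J `^ theta * I (fun x => chi x * (hp (v x) * dot (G x) (G x))))); last first.
    by rewrite ler_wpM2l ?powR_ge0.
  rewrite -IntZ//; apply: Int_leT; [exact: L1Z|exact: L1Z|].
  move=> x; rewrite KT_sqr mulrC; have /andP[t0 t1] := T_itv j (v x).
  apply: ler_wpM2r; first by case/andP: (chi01 x) => c0 _; apply: mulr_ge0 => //; apply: mulr_ge0; rewrite ?dot_ge0 ?h_ge0.
  by apply: ge0_ler_powR; rewrite ?nnegrE ?(ltW theta0).
have mi : measurable_fun setT (fun x => if Vp j < v x then 1 else 0 : R).
  by apply: measurable_fun_ifT => //; exact: measurable_fun_ltr.
have Li : L1 mu (fun x => if Vp j < v x then 1 else 0).
  by apply: (L1_bdd finmu (C := 1)) => // x; case: ifP; rewrite ?normr0 ?normr1.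
have h1 : J ^+ 2 * I (fun x => if Vp j < v x then 1 else 0) <= C * (B^-1 * (J `^ theta * A)).
  apply: (@le_trans _ _ (C * DG mu (KT j v G) (KT j v G))); last by rewrite ler_pM2l.
  apply: le_trans (CP _ _ WT); rewrite -IntZ//; apply: Int_leT.
  - exact: L1Z.
  - exact: (WL2 WT).2.
  - move=> x; case: ltP => vx; last by rewrite mulr0 sqr_ge0.
    rewrite mulr1 clip_big; last by rewrite !ltW// Vp_gt0.
    by rewrite W1_Vp /J -[j.+2%:R]natr1 addrK.
have -> : C / B * en R j `^ (2 - theta) * A = (J ^+ 2)^-1 * (C * (B^-1 * (J `^ theta * A))).
  have e : en R j `^ (2 - theta) = J `^ theta / J ^+ 2.
    rewrite /en -powR_inv1 ?ltW// -powRrM mulN1r opprB powRB ?(gt_eqF J0) ?implybT//.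
    by rewrite powR_mulrn// ltW.
  by rewrite e; set X := J `^ theta; field; rewrite !gt_eqF.
by rewrite ler_pdivlMl// exprn_gt0.
Qed.

Variable f : T -> R.
Hypothesis Lf : L1 mu f.
Hypothesis f0 : forall x, 0 <= f x.
Variable Cs : R.
(* Since [theta < 2] the right-hand side is absorbed by the energy of
   [u = U (v)]. *)
Hypothesis Hsob : forall u G, W u G -> (forall x, 0 <= u x) ->
  L1 mu (fun x => f x * u x `^ theta) /\
  I (fun x => f x * u x `^ theta) <= Cs + B / 2 * DG mu G G.

(** The test function is [T ^ theta], with [T] the truncation of [U v], regularized as
    [(T + en) ^ theta - en ^ theta]. The second-order term has a sign and is dropped; by [KT_sqr]
    the reaction controls [B] times the energy of [T], and [Hsob] returns only half of that energy
    on the right. *)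
Lemma T_energy j F v G : L1 mu F -> (forall x, 0 <= F x <= f x) ->
  sol mu W b Vp hp F v G -> DG mu (KT j v G) (KT j v G) <= 2 * Cs / B.
Proof.
move=> LF F01 [Wv v_ge0 vD Lh eqv].
have mv := L2_mf (WL2 Wv); have mG := L2v_mf (WL2v Wv).
have WT := W_T j Wv; have Vj := Vp_gt0 p j.
pose Tj x := W1 (clip (Vp j) (v x)) - 1.
have Tj0 x : 0 <= Tj x by case/andP: (T_itv j (v x)).
have mTj : measurable_fun setT Tj := L2_mf (WL2 WT).
have mTt : measurable_fun setT (fun x => Tj x `^ theta).
  exact: (measurableT_comp (measurable_powR theta) mTj).
pose phi n x := (Tj x + en R n) `^ theta - en R n `^ theta.
pose J : R := (j.+1%:R + 1) `^ theta.
have Wphi n : W (phi n) (fun x => (if 0 < v x < Vp j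
    then theta * (W1 (v x) - 1 + en R n) `^ (theta - 1) * W1 (v x) `^ p else 0) *: G x).
  have e0 := en_gt0 R n.
  apply: (W_clip (F := fun t => (W1 t - 1 + en R n) `^ theta - en R n `^ theta)
    (F' := fun t => theta * (W1 t - 1 + en R n) `^ (theta - 1) * W1 t `^ p) finmu HS Vj _ _ _ Wv).
  - move=> t tV; have dt := dom_itv tV; have dW := is_derive_W1 dt.
    have w1 : 1 <= W1 t by apply: W1_ge1 => //; case/andP: tV.
    have s0 : 0 < W1 t - 1 + en R n by rewrite ltr_wpDl// subr_ge0.
    have d1 : is_derive t (1 : R) (fun t => W1 t - 1 + en R n : R) (W1 t `^ p).
      by apply: is_derive_eq; rewrite subr0 addr0.
    have d2 := @is_derive1_comp R (fun s => s `^ theta) (fun t => W1 t - 1 + en R n) t _ _ (is_derive1_powR theta s0) d1.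
    have d3 : is_derive t (1 : R) (fun t => ((fun s => s `^ theta) \o (fun t => W1 t - 1 + en R n)) t - en R n `^ theta : R)
        (theta * (W1 t - 1 + en R n) `^ (theta - 1) * W1 t `^ p).
      by apply: is_derive_eq; rewrite subr0.
    exact: d3.
  - move=> t tV; have dt := dom_itv tV.
    have w1 : 1 <= W1 t by apply: W1_ge1 => //; case/andP: tV.
    apply: cvgM; last exact: continuous_W1p.
    apply: cvgM; first exact: cvg_cst.
    apply: (@continuous_comp _ _ _ (fun t => W1 t - 1 + en R n) (fun s => s `^ (theta - 1))).
      apply: cvgD; last exact: cvg_cst.
      by apply: cvgB; [exact: is_derive_continuous (is_derive_W1 dt)|exact: cvg_cst].
    by apply: continuous_powR; rewrite ltr_wpDl// subr_ge0.
  - by rewrite W1_0 subrr add0r subrr.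
have phi01 n x : 0 <= phi n x <= J.
  have e0 := en_gt0 R n; have e1 : en R n <= 1 by rewrite invf_le1// ler1n.
  have /andP[_ t1] := T_itv j (v x).
  rewrite /phi subr_ge0; apply/andP; split.
    have te : 0 <= Tj x + en R n by rewrite addr_ge0// ltW.
    by apply: ge0_ler_powR; rewrite ?nnegrE ?(ltW theta0) ?(ltW e0)// lerDr.
  apply: (@le_trans _ _ ((Tj x + en R n) `^ theta)); first by rewrite gerBl powR_ge0.
  have te : 0 <= Tj x + en R n by rewrite addr_ge0// ltW.
  by apply: ge0_ler_powR; [exact: ltW|rewrite nnegrE|rewrite nnegrE addr_ge0|exact: lerD].
have phiJ n x : `|phi n x| <= J by case/andP: (phi01 n x) => a0 a1; rewrite ger0_norm.
have mphi n : measurable_fun setT (phi n) := L2_mf (WL2 (Wphi n)).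
have cphi x : phi n x @[n --> \oo] --> Tj x `^ theta.
  rewrite -[X in _ --> X]subr0; apply: cvgB; last first.
    by apply: cvg_powR0 => //; [move=> n; rewrite ltW// en_gt0|exact: en_cvg].
  have cT : Tj x + en R n @[n --> \oo] --> Tj x.
    by rewrite -[X in _ --> X]addr0; apply: cvgD; [exact: cvg_cst|exact: en_cvg].
  have := Tj0 x; rewrite le_eqVlt => /predU1P[Tx|Tx]; last exact: cvg_powR.
  rewrite -Tx in cT *; rewrite powR0 ?gt_eqF//.
  by apply: cvg_powR0 => // n; rewrite add0r ltW// en_gt0.
have test n : I (fun x => hp (v x) * dot (G x) (G x) * phi n x) <= I (fun x => F x * phi n x).
  rewrite -(eqv _ _ _ (Wphi n) (phiJ n)) lerDr.
  apply: (E_chi_ge0 mu alpha0 hb) => x; case: ifP => // _.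
  by rewrite !mulr_ge0 ?powR_ge0// ltW.
have dct u : L1 mu u -> I (fun x => u x * phi n x) @[n --> \oo] --> I (fun x => u x * Tj x `^ theta).
  move=> Lu; have mu1 := L1_mf Lu.
  apply: (Int_dct (g := fun x => J * `|u x|) _ _ _ _ _).2 => //.
  - by move=> n; exact: measurable_funM.
  - exact: measurable_funM.
  - by apply: L1Z; exact: L1_norm.
  - by move=> n; apply: aeW => x; rewrite normrM mulrC ler_wpM2r.
  - by apply: aeW => x; apply: cvgM; [exact: cvg_cst|exact: cphi].
have le1 : I (fun x => hp (v x) * dot (G x) (G x) * Tj x `^ theta) <= I (fun x => F x * Tj x `^ theta).
  rewrite -subr_le0; apply: (cvg_ler_const (cvgB (dct _ Lh) (dct _ LF))) => n.
  by rewrite /= subr_le0.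
have [LfT IfT] := Hsob WT Tj0.
have LJ u : L1 mu u -> L1 mu (fun x => u x * Tj x `^ theta).
  apply: (L1_mulb (M := J)) => // x; rewrite ger0_norm ?powR_ge0//.
  have /andP[_ t1] := T_itv j (v x).
  apply: ge0_ler_powR; [exact: ltW|by rewrite nnegrE|by rewrite nnegrE addr_ge0|].
  by rewrite (le_trans t1)// lerDl.
have le2 : I (fun x => F x * Tj x `^ theta) <= I (fun x => f x * Tj x `^ theta).
  apply: Int_leT => //; first exact: LJ.
  by move=> x; rewrite ler_wpM2r ?powR_ge0//; case/andP: (F01 x).
have le3 : B * DG mu (KT j v G) (KT j v G) <= I (fun x => hp (v x) * dot (G x) (G x) * Tj x `^ theta).
  have LK := L1_dot (WL2v WT) (WL2v WT).
  rewrite -IntZ//; apply: Int_leT; [exact: L1Z|exact: LJ|].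
  move=> x; rewrite KT_sqr ler_wpM2r ?powR_ge0// ler_piMl//.
    by rewrite mulr_ge0 ?dot_ge0.
  by case: ifP.
rewrite ler_pdivlMr// mulrC.
have := le_trans le3 (le_trans le1 (le_trans le2 IfT)).
set D := DG _ _ _; set BD := B * D; have -> : B / 2 * D = BD / 2 by rewrite /BD; ring.
lra.
Qed.

Definition KU v G x : 'rV[R]_N := W1 (v x) `^ p *: G x.

(** The bound of [T_energy] does not depend on [j], so Fatou's lemma gives the one on [KU]. Since
    [W1 >= 1], the gradient of [v] is dominated by that of [U v]. *)
Lemma sol_energy F v G : L1 mu F -> (forall x, 0 <= F x <= f x) ->
  sol mu W b Vp hp F v G ->
  [/\ L2v mu (KU v G), DG mu (KU v G) (KU v G) <= 2 * Cs / B & DG mu G G <= 2 * Cs / B].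
Proof.
move=> LF F01 sv; have [Wv v_ge0 vD Lh eqv] := sv.
have mv := L2_mf (WL2 Wv); have mG := L2v_mf (WL2v Wv).
have mK : mfv (KU v G).
  by apply: mfvM => //; apply: (measurableT_comp (measurable_W1p p p)).
have G0 := W_level finmu HS 0 Wv.
have [|||||LK DK] := @Int_fatou _ _ _ mu (fun j x => dot (KT j v G x) (KT j v G x))
    (fun x => dot (KU v G x) (KU v G x)) (2 * Cs / B).
- by move=> j; exact: L1_dot (WL2v (W_T j Wv)) (WL2v (W_T j Wv)).
- by move=> j x; exact: dot_ge0.
- exact: mf_dot.
- apply: filterS2 vD G0 => x [k vk] g0; apply: cvg_near_cst; exists k.+1 => // j kj.
  have := v_ge0 x; rewrite le_eqVlt => /predU1P[vx|vx].
    by rewrite /KT /KU g0// !scaler0.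
  rewrite /KT /KU vx/= (le_lt_trans vk)//; apply: lt_le_trans (VS k) _.
  exact: Vs_homo.
- by move=> j; exact: T_energy LF F01 sv.
have LKv : L2v mu (KU v G) by exact: L2v_dot.
split => //; apply: le_trans DK; apply: Int_le => //; first exact: L1_dot (WL2v Wv) (WL2v Wv).
apply: filterS vD => x vDx; rewrite /KU dotZl dotZr mulrA ler_peMl ?dot_ge0//.
have w1 : 1 <= W1 (v x) by apply: W1_ge1 => //; exact: dom_inD.
have wp : 1 <= W1 (v x) `^ p.
  by rewrite -[leLHS](powRr0 (W1 (v x))); apply: ler_powR => //; exact: ltW.
by rewrite -[leLHS]mulr1; apply: ler_pM.
Qed.

(** [u = U v] belongs to [W] as a limit of its truncations, dominated by [u] and its gradient.
    Almost everywhere [v] is positive and in the domain, [1 + u = W1], and both integrands become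
    those of the equation for [v]. *)
Lemma abstract_existence : (\forall x \ae mu, 0 < f x) -> exists u K, [/\ W u K,
  \forall x \ae mu, 0 < u x, L1 mu (fun x => dot (K x) (K x) / u x `^ theta) &
  forall phi H M, W phi H -> (forall x, `|phi x| <= M) ->
    I (fun x => b x / (1 + u x) `^ p * dot (K x) (H x)) +
    B * I (fun x => dot (K x) (K x) / u x `^ theta * phi x) = I (fun x => f x * phi x)].
Proof.
move=> fpos.
have [q q0 top] := profile_top.
have hl m : exists2 L, 0 <= L & forall s t, `|cut_profile Vp hp m s - cut_profile Vp hp m t| <= L * `|s - t|.
  by have [L L0 hL] := hmp_lip theta B p0 m; exists L => // s t; case: (hL s t).
have hbd m : exists C, forall t, `|cut_profile Vp hp m t| <= C.
  by have [L L0 hL] := hmp_lip theta B p0 m; exists L => t; case: (hL t t).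
have [c c0 hc] := hp_absorb p0 theta01 B0 beta0.
have Ch0 : 0 < B * 2 `^ (2 * p) by rewrite mulr_gt0// powR_gt0.
have eb F v G : L1 mu F -> (forall x, 0 <= F x <= f x) -> sol mu W b Vp hp F v G ->
    DG mu G G <= 2 * Cs / B.
  by move=> LF F01 sv; case: (sol_energy LF F01 sv).
have [v [G sv]] := integrable_solution finmu HS mb alpha0 hb VS V0 theta01 h_ge0 h00
  (measurable_hp p theta B) V0 Ch0 (hp_bound p0 theta01 B0) hl hbd q0 top c0 hc Lf f0 eb.
have F01 x : 0 <= f x <= f x by rewrite f0 lexx.
have [LK DK _] := sol_energy Lf F01 sv.
have [Wv v_ge0 vD Lh eqv] := sv.
have mv := L2_mf (WL2 Wv); have mG := L2v_mf (WL2v Wv).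
have vpos : \forall x \ae mu, 0 < v x.
  exact: (sol_positive finmu HS mb alpha0 hb h_ge0 Lf f0 fpos sv).
pose u x := W1 (v x) - 1.
have mW1 : measurable_fun setT (fun x => W1 (v x)) by exact: (measurableT_comp (measurable_W1 p)).
have mu1 : measurable_fun setT u by exact: measurable_funB.
have good : \forall x \ae mu, [/\ 0 < v x, inD Vp (v x), 0 < W1 (v x) & 0 < u x].
  apply: filterS2 vD vpos => x vDx vx; have dv := dom_inD (ltW vx) vDx.
  by split => //; [exact: W1_gt0|exact: W1_gt1].
have cT : \forall x \ae mu, W1 (clip (Vp j) (v x)) - 1 @[j --> \oo] --> u x.
  apply: filterS good => x [vx [k vk] _ _]; apply: cvg_near_cst; exists k => // j kj.
  by rewrite clip_id// (ltW vx) (le_trans vk)// Vs_homo.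
have Lu : L2 mu u.
  split => //; have [C C0 CP] := W_poincare HS.
  have [|||||//] := @Int_fatou _ _ _ mu (fun j x => (W1 (clip (Vp j) (v x)) - 1) ^+ 2) (fun x => u x ^+ 2) (C * (2 * Cs / B)).
  - by move=> j; exact: (WL2 (W_T j Wv)).2.
  - by move=> j x; exact: sqr_ge0.
  - exact: measurable_funX.
  - by apply: filterS cT => x cx; exact: cvg_sqr.
  - move=> j; apply: le_trans (CP _ _ (W_T j Wv)) _; rewrite ler_pM2l//.
    exact: T_energy Lf F01 sv.
have Wu : W u (KU v G).
  apply: (W_lim HS (fun j => W_T j Wv) (A := fun x => `|u x| + \sum_(i < N) `|KU v G x ord0 i|)) => //.
  - exact: L2v_mf LK.
  - apply: L2D; first exact: L2_norm.
    by apply: L2_sum => i; apply: L2_norm; exact: LK.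
  - move=> j; apply: filterS good => x [vx vDx _ ux].
    have /andP[t0 _] := T_itv j (v x).
    rewrite ger0_norm// (le_trans _ (_ : u x <= _))//.
      by rewrite lerD2r; apply: W1_le; [exact: dom_clip|exact: dom_inD (ltW vx) vDx|exact: clip_le_id (ltW vx)].
    by rewrite (le_trans (ler_norm _))// lerDl; exact: sumr_ge0.
  - move=> j i; apply: aeW => x; rewrite (bigD1 i)//= addrCA.
    apply: (@le_trans _ _ `|KU v G x ord0 i|); last by rewrite lerDl addr_ge0//; exact: sumr_ge0.
    by rewrite /KT /KU !mxE; case: ifP => // _; rewrite mul0r normr0.
  - move=> i; apply: filterS good => x [vx [k vk] _ _]; apply: cvg_near_cst; exists k.+1 => // j kj.
    rewrite /KT vx/= (le_lt_trans vk)//; apply: lt_le_trans (VS k) _.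
    exact: Vs_homo.
have mdK : measurable_fun setT (fun x => dot (KU v G x) (KU v G x) / u x `^ theta).
  apply: measurable_funM; first by apply: mf_dot; exact: L2v_mf LK.
  rewrite (_ : (fun x => _) = fun x => u x `^ (- theta)); last by apply/funext => x; rewrite powRN.
  exact: (measurableT_comp (measurable_powR _)).
have hE : \forall x \ae mu, B^-1 * (hp (v x) * dot (G x) (G x)) = dot (KU v G x) (KU v G x) / u x `^ theta.
  apply: filterS good => x [vx _ wx ux]; rewrite /KU dotZl dotZr /gradient_profile -/(u x).
  have -> : W1 (v x) `^ (2 * p) = W1 (v x) `^ p * W1 (v x) `^ p.
    by rewrite -powRD ?(gt_eqF wx) ?implybT//; congr (_ `^ _); ring.
  have := powR_gt0 theta ux; set X := _ `^ theta; set w := _ `^ p; set g := dot _ _ => X0.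
  by field; rewrite !gt_eqF.
exists u, (KU v G); split => //.
- by apply: filterS good => x [].
- by apply: (L1_ae_eq mdK _ hE); exact: L1Z.
move=> phi H M Wp pM; rewrite -(eqv _ _ _ Wp pM).
have mp := L2_mf (WL2 Wp).
congr (_ + _).
  apply: Int_ae_eq.
  - apply: measurable_funM; last by apply: mf_dot; [exact: L2v_mf LK|exact: L2v_mf (WL2v Wp)].
    apply: measurable_funM => //.
    rewrite (_ : (fun x => _) = fun x => W1 (v x) `^ (- p)); last by apply/funext => x; rewrite powRN /u addrC subrK.
    exact: (measurableT_comp (measurable_powR _)).
  - by apply: measurable_funM => //; apply: mf_dot => //; exact: L2v_mf (WL2v Wp).
  - apply: filterS good => x [vx _ wx ux]; rewrite /KU dotZl /u addrC subrK.
    by rewrite mulrA divfK// gt_eqF// powR_gt0.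
have LBu : L1 mu (fun x => dot (KU v G x) (KU v G x) / u x `^ theta * phi x).
  apply: (L1_mulb mp pM).
  by apply: (L1_ae_eq mdK _ hE); exact: L1Z.
rewrite -IntZ//; apply: Int_ae_eq.
- by apply: measurable_funM => //; exact: measurable_funM.
- by apply: measurable_funM => //; exact: L1_mf Lh.
- apply: filterS hE => x <-; rewrite -!mulrA mulKf ?gt_eqF//.
Qed.

End abstract_problem.

(** * Lebesgue measure in coordinates *)

Section coordinates.
Context (R : realType).
Local Notation mR := (measurableTypeR R).

Section fixed_dimension.
Variable n : nat.
Local Notation T0 := (caratheodory_type (@lebesgue_outer R n)).
Local Notation tp := (n.-tuple mR).
Local Notation tau := (tuple_lebesgue R n).
Local Notation mu := (lebesgue R n).

(** Tuples carry the product sigma-algebra and rows the Caratheodory one, which may contain more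
    sets; [tup] is the measurable direction. Measurability of a function of rows is checked after
    composition with [row_of] and pulled back along [tup]. *)
Definition row_of (t : tp) : 'rV[R]_n := \row_i tnth t i.
Definition tup (x : T0) : tp := [tuple (x : 'rV[R]_n) ord0 i | i < n].

Lemma row_ofK : cancel row_of tup.
Proof. by move=> t; apply: eq_from_tnth => i; rewrite tnth_mktuple mxE. Qed.

Lemma tupK : cancel tup row_of.
Proof. by move=> x; apply/rowP => i; rewrite mxE tnth_mktuple. Qed.

Lemma tup_cara (A : set tp) : measurable A -> measurable (tup @^-1` A).
Proof.
move=> mA; suff : (@lebesgue_outer R n).-caratheodory (tup @^-1` A) by [].
have eI : row_of @^-1` (tup @^-1` A) = A.
  by apply/seteqP; split => t /=; rewrite row_ofK.
have cA : (mu_ext tau).-caratheodory (row_of @^-1` (tup @^-1` A)).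
  by rewrite eI; exact: (caratheodory_measurable_mu_ext tau mA).
by move=> X; exact: (cA (row_of @^-1` X)).
Qed.

Lemma measurable_tup : measurable_fun setT tup.
Proof. by move=> _ A mA; rewrite setTI; exact: tup_cara. Qed.

Lemma lebesgue_tup (A : set tp) : measurable A -> mu (tup @^-1` A) = tau A.
Proof.
move=> mA; rewrite -[RHS](measurable_mu_extE tau mA).
rewrite /lebesgue /lebesgue_outer; congr (mu_ext tau _).
by apply/seteqP; split => t /=; rewrite row_ofK.
Qed.

Lemma ge0_integral_tup (g : tp -> \bar R) : measurable_fun setT g ->
  (forall t, 0 <= g t)%E -> (\int[mu]_x g (tup x) = \int[tau]_t g t)%E.
Proof.
move=> mg g0.
have <- := ge0_integral_pushforward measurable_tup mu measurableT mg (fun y _ => g0 y).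
apply: eq_measure_integral; first exact: measurable_tup.
by move=> mt A mA _; exact: (lebesgue_tup mA).
Qed.

Definition box (a c : 'I_n -> R) : set tp := [set t | forall i, a i < tnth t i < c i].

Lemma box_measurable a c : measurable (box a c).
Proof.
have -> : box a c = \bigcap_(i in [set: 'I_n]) ((fun t : tp => tnth t i) @^-1` `]a i, c i[%classic).
  apply/seteqP; split => t /=.
    by move=> ht i _ /=; rewrite in_itv/=.
  by move=> ht i; have := ht i Logic.I; rewrite /= in_itv/=.
apply: fin_bigcap_measurable => // i _.
rewrite -[X in measurable X]setTI; apply: measurable_tnth => //.
Qed.

Definition rat_lo (q : 'rV[rat]_n * nat) (i : 'I_n) : R := ratr (q.1 ord0 i) - q.2.+1%:R^-1.
Definition rat_hi (q : 'rV[rat]_n * nat) (i : 'I_n) : R := ratr (q.1 ord0 i) + q.2.+1%:R^-1.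

(** The cubes have rational centres and radii [1 / (k + 1)], hence form a countable family. A point
    of the closed cube is within twice the radius of [x], and the radius is at most a third of that
    of a ball in [U]. *)
Lemma rational_box (U : set 'rV[R]_n) (x : 'rV[R]_n) : open U -> U x ->
  exists q, (forall i, rat_lo q i < x ord0 i < rat_hi q i) /\
    (forall y : 'rV[R]_n, (forall i, rat_lo q i <= y ord0 i <= rat_hi q i) -> U y).
Proof.
move=> oU Ux; have /nbhs_ballP[e /= e0 eU] := open_nbhs_nbhs (conj oU Ux).
have e2 : 0 < e / 3 by rewrite divr_gt0.
have [k kP] := en_small e2; set d := en R k in kP *; have d0 : 0 < d := en_gt0 R k.
have de : d <= e / 3 by exact: kP.
have qex i : exists q : rat, x ord0 i - d < ratr q < x ord0 i + d.
  have [|q qI] := @rat_in_itvoo R (x ord0 i - d) (x ord0 i + d); first by lra.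
  by exists q; move: qI; rewrite in_itv.
have /choice[q qP] := qex.
exists (\row_i q i, k); split => [i|y yb].
  rewrite /rat_lo /rat_hi mxE -/(en R k) -/d.
  by have /andP[h1 h2] := qP i; apply/andP; split; lra.
apply: eU; rewrite /ball/=; split => // i0 i; rewrite (ord1 i0).
have := yb i; rewrite /rat_lo /rat_hi mxE -/(en R k) -/d => /andP[h1 h2]; have /andP[h3 h4] := qP i.
by rewrite /ball/= ltr_norml; apply/andP; split; lra.
Qed.

Lemma open_tup_measurable (U : set 'rV[R]_n) : open U -> measurable (row_of @^-1` U).
Proof.
move=> oU; pose bx q : set tp := box (rat_lo q) (rat_hi q).
pose good q := bx q `<=` row_of @^-1` U.
have -> : row_of @^-1` U = \bigcup_(q in [set: 'rV[rat]_n * nat]) (if `[< good q >] then bx q else set0).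
  apply/seteqP; split => t; last first.
    by move=> [q _]; case: asboolP => // gq /gq.
  move=> /= Ut; have [q [tq qU]] := rational_box oU Ut.
  exists q => //; rewrite asboolT => [|s sb]; first by move=> i; have := tq i; rewrite mxE.
  by apply: qU => i; rewrite mxE; have /andP[h1 h2] := sb i; rewrite !ltW.
apply: countable_bigcupT_measurable => // q.
by case: asboolP => // _; exact: box_measurable.
Qed.

Lemma continuous_row_measurable (w : 'rV[R]_n -> R) : continuous w ->
  measurable_fun setT (w \o row_of).
Proof.
move=> cw; apply: (measurability _ (RGenOInfty.measurableE R)).
move=> _ [_ [a ->] <-]; rewrite setTI comp_preimage.
apply: open_tup_measurable; apply: open_comp; last exact: interval_open.
by move=> x _; exact: cw.
Qed.

Lemma continuous_measurable_cara (w : 'rV[R]_n -> R) : continuous w ->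
  measurable_fun [set: T0] (w : T0 -> R).
Proof.
move=> cw; rewrite (_ : (w : T0 -> R) = (w \o row_of) \o tup); last first.
  by apply/funext => x /=; rewrite tupK.
exact: measurableT_comp (continuous_row_measurable cw) measurable_tup.
Qed.

Lemma open_cara (U : set 'rV[R]_n) : open U -> measurable (U : set T0).
Proof.
move=> oU; rewrite (_ : (U : set T0) = tup @^-1` (row_of @^-1` U)).
  exact: tup_cara (open_tup_measurable oU).
by apply/seteqP; split => x /=; rewrite tupK.
Qed.

End fixed_dimension.

Section one_more_coordinate.
Variable n : nat.
Local Notation tau := (tuple_lebesgue R).
Local Notation leb := (@lebesgue_measure R).
Implicit Types (g : n.+1.-tuple mR -> \bar R).

End one_more_coordinate.

Lemma box_finite n (a c : 'I_n -> R) : (tuple_lebesgue R n (box a c) < +oo)%E.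
Proof.
elim: n a c => [|n ih] a c.
  by rewrite (le_lt_trans (_ : _ <= 1)%E) ?ltry//= diracE; case: (_ \in _); rewrite lee_fin ?ler01.
rewrite [X in (X < _)%E](_ : _ = (lebesgue_measure \x tuple_lebesgue R n)%E
    (`]a ord0, c ord0[%classic `*` box (a \o lift ord0) (c \o lift ord0))); last first.
  rewrite /= /cons_measure /pushforward; congr (product_measure1 _ _).
  apply/seteqP; split => -[s y] /=.
    move=> h; split; first by have := h ord0; rewrite /tcons /= in_itv/= (tnth_nth 0).
    by move=> i; have := h (lift ord0 i); rewrite /= !(tnth_nth 0)/=.
  move=> [s0 hy] i; case: (unliftP ord0 i) => [j ->|->].
    by have := hy j; rewrite /= !(tnth_nth 0)/=.
  by move: s0; rewrite in_itv/= (tnth_nth 0).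
rewrite product_measure1E//; last exact: box_measurable.
have leb_fin : (lebesgue_measure `]a ord0, c ord0[%classic < +oo :> \bar R)%E.
  by rewrite lebesgue_measure_itv/=; case: ifP => _; rewrite ?ltry// -EFinD ltry.
by rewrite lte_mul_pinfty// ge0_fin_numE.
Qed.

End coordinates.

(** * Smooth functions *)

Section smooth_functions.
Context (R : realType) (n : nat).
Implicit Types (u v w : 'rV[R]_n -> R) (i : 'I_n).
Local Notation dv := (delta_mx ord0).

Lemma smooth_diff u x : smooth u -> differentiable (u : 'rV[R]_n -> R^o) x.
Proof. by move=> su; exact: (su [::]). Qed.

Lemma smooth_partial i u : smooth u -> smooth (partial i u).
Proof. by move=> su s x; have := su (rcons s i) x; rewrite foldr_rcons. Qed.

(** Coinduction principle: it is enough to exhibit a class of differentiable functions that is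
    stable under partial derivatives. *)
Lemma smooth_coind (P : ('rV[R]_n -> R) -> Prop) :
  (forall u, P u -> (forall x, differentiable (u : 'rV[R]_n -> R^o) x) /\
    forall i, P (partial i u)) -> forall u, P u -> smooth u.
Proof.
move=> step u Pu s; elim/last_ind: s u Pu => [|s i ih] u Pu x /=.
  exact: (step u Pu).1.
by rewrite foldr_rcons; apply: ih; exact: (step u Pu).2.
Qed.

Lemma smooth_derivable u x h : smooth u -> derivable (u : 'rV[R]_n -> R^o) x h.
Proof. by move=> su; apply: diff_derivable; exact: smooth_diff. Qed.

Lemma smooth_continuous u : smooth u -> continuous u.
Proof. by move=> su x; exact: differentiable_continuous (smooth_diff x su). Qed.

Lemma partialD i u v : smooth u -> smooth v ->
  partial i (fun x => u x + v x) = fun x => partial i u x + partial i v x.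
Proof.
move=> su sv; apply/funext => x; rewrite /partial.
exact: (@deriveD _ _ R^o u v x (dv i) (@smooth_derivable u x (dv i) su) (@smooth_derivable v x (dv i) sv)).
Qed.

Lemma partialM i u v : smooth u -> smooth v ->
  partial i (fun x => u x * v x) = fun x => partial i u x * v x + u x * partial i v x.
Proof.
move=> su sv; apply/funext => x; rewrite /partial.
have := @deriveM _ _ (u : _ -> R^o) v x (dv i) (@smooth_derivable u x (dv i) su) (@smooth_derivable v x (dv i) sv).
by rewrite /GRing.scale/= => ->; ring.
Qed.

Lemma partial_cst i (c : R) : partial i (fun=> c) = fun=> 0.
Proof. by apply/funext => x; exact: derive_cst. Qed.

Lemma growth_line (f : 'rV[R]_n -> R) x h (s : R) :
  (fun k : R => k^-1 *: (((fun s => f (x + s *: h)) \o shift s) (k *: (1 : R)) - f (x + s *: h))) =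
  (fun k : R => k^-1 *: ((f \o shift (x + s *: h)) (k *: h) - f (x + s *: h))).
Proof.
apply/funext => k /=; congr (_ *: (f _ - _)).
by rewrite [k *: (1 : R)]mulr1 scalerDl addrCA.
Qed.

Lemma is_derive_line u x h (s : R) : smooth u ->
  is_derive s (1 : R) (fun s => u (x + s *: h)) ('D_h (u : _ -> R^o) (x + s *: h)).
Proof.
move=> su; have := @smooth_derivable u (x + s *: h) h su; rewrite /derivable -growth_line => d.
by apply: DeriveDef => //; rewrite /derive -growth_line.
Qed.

Lemma derive_line (f : 'rV[R]_n -> R) x h l :
  is_derive (0 : R) (1 : R) (fun s => f (x + s *: h)) l -> 'D_h (f : _ -> R^o) x = l.
Proof. by case=> _ <-; rewrite /derive growth_line scale0r addr0. Qed.

Lemma smooth_cst (c : R) : smooth (fun _ : 'rV[R]_n => c).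
Proof.
apply: (@smooth_coind (fun u => exists c : R, u = fun=> c)); last by exists c.
move=> u [{}c ->]; split => [x|i]; first exact: differentiable_cst.
by exists 0; exact: partial_cst.
Qed.

Lemma smoothD u v : smooth u -> smooth v -> smooth (fun x => u x + v x).
Proof.
move=> su sv; apply: (@smooth_coind (fun w => exists u v, [/\ smooth u, smooth v & w = fun x => u x + v x])).
  move=> _ [{su sv}u [{}v [su sv ->]]]; split => [x|i].
    exact: (@differentiableD _ _ _ (u : _ -> R^o) v x (smooth_diff x su) (smooth_diff x sv)).
  by exists (partial i u), (partial i v); rewrite partialD//; split => //; exact: smooth_partial.
by exists u, v.
Qed.

Lemma smooth_sum (J : Type) (s : seq J) (F : J -> 'rV[R]_n -> R) : (forall j, smooth (F j)) ->
  smooth (fun x => \sum_(j <- s) F j x).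
Proof.
move=> sF; elim: s => [|j s ih]; first by under eq_fun do rewrite big_nil; exact: smooth_cst.
by under eq_fun do rewrite big_cons; exact: smoothD.
Qed.

(** Products alone are not stable under partial derivatives; finite sums of products of smooth
    functions are, by the Leibniz rule. *)
Lemma smoothM u v : smooth u -> smooth v -> smooth (fun x => u x * v x).
Proof.
pose P w := exists s : seq (('rV[R]_n -> R) * ('rV[R]_n -> R)),
  (forall p, List.In p s -> smooth p.1 /\ smooth p.2) /\ w = fun x => \sum_(p <- s) p.1 x * p.2 x.
move=> su sv; apply: (@smooth_coind P); last first.
  exists [:: (u, v)]; split => [p [<-|[]]//|].
  by apply/funext => x; rewrite big_seq1.
move=> _ [s [ss ->]]; elim: s ss => [|[{su}u {sv}v] s ih] ss.
  under eq_fun do rewrite big_nil; split => [x|i]; first exact: differentiable_cst.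
  by exists [::]; split => //; rewrite partial_cst; apply/funext => x; rewrite big_nil.
have [su sv] := ss (u, v) (or_introl erefl).
have [d1 d2] := ih (fun p ps => ss p (or_intror ps)).
under eq_fun do rewrite big_cons; split => [x|i].
  apply: (@differentiableD _ _ _ (fun x => u x * v x : R^o) (fun x => \sum_(p <- s) p.1 x * p.2 x : R^o) x) => //.
  by apply: differentiableM; exact: smooth_diff.
have [r [rs e]] := d2 i.
exists [:: (partial i u, v), (u, partial i v) & r]; split.
  move=> p [<-|[<-|/rs//]] /=; split => //; exact: smooth_partial.
apply/funext => x; rewrite !big_cons/= -(congr1 (@^~ x) e) addrA /partial.
have du := @smooth_derivable u x (dv i) su; have dw := @smooth_derivable v x (dv i) sv.
have := @deriveD _ _ R^o (fun x => u x * v x : R^o) (fun x => \sum_(p <- s) p.1 x * p.2 x : R^o) x (dv i).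
rewrite /= => ->; [|exact: derivableM|exact: diff_derivable].
congr (_ + _); have := @deriveM _ _ (u : _ -> R^o) v x (dv i) du dw.
by rewrite /GRing.scale/= => ->; ring.
Qed.

Lemma smoothZ c u : smooth u -> smooth (fun x => c * u x).
Proof. by move=> su; apply: smoothM => //; exact: smooth_cst. Qed.

Lemma partialZ i c u : smooth u -> partial i (fun x => c * u x) = fun x => c * partial i u x.
Proof.
move=> su; rewrite partialM//; last exact: smooth_cst.
by apply/funext => x; rewrite partial_cst mul0r add0r.
Qed.

Lemma partial_coord i j : partial j (fun x : 'rV[R]_n => x ord0 i) = fun=> (i == j)%:R.
Proof.
apply/funext => x; rewrite /partial.
apply: cvg_lim; first exact: Rhausdorff.
apply: (@cvg_trans _ ((fun=> (i == j)%:R : R) @ (0 : R)^')); last exact: cvg_cst.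
apply: near_eq_cvg; near=> h.
have h0 : h != 0 by near: h; exact: nbhs_dnbhs_neq.
by rewrite /= !mxE eqxx/= eq_sym addrK /GRing.scale/= mulKf.
Unshelve. all: by end_near. Qed.

Lemma smooth_coord i : smooth (fun x : 'rV[R]_n => x ord0 i).
Proof.
apply: (@smooth_coind (fun u => u = (fun x => x ord0 i) \/ smooth u)); last by left.
move=> u [->|su]; split.
- by move=> x; exact: differentiable_coord.
- by move=> j; right; rewrite partial_coord; exact: smooth_cst.
- by move=> x; exact: smooth_diff.
- by move=> j; right; exact: smooth_partial.
Qed.

Lemma smooth_prod (J : Type) (s : seq J) (F : J -> 'rV[R]_n -> R) : (forall j, smooth (F j)) ->
  smooth (fun x => \prod_(j <- s) F j x).
Proof.
move=> sF; elim: s => [|j s ih]; first by under eq_fun do rewrite big_nil; exact: smooth_cst.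
by under eq_fun do rewrite big_cons; exact: smoothM.
Qed.

Lemma smooth_horner (p : {poly R}) u : smooth u -> smooth (fun x => p.[u x]) /\
  forall i, partial i (fun x => p.[u x]) = fun x => p^`().[u x] * partial i u x.
Proof.
move=> su; elim/poly_ind: p => [|p c [ih1 ih2]].
  split => [|i]; first by under eq_fun do rewrite horner0; exact: smooth_cst.
  under eq_fun do rewrite horner0; rewrite partial_cst.
  by apply/funext => x; rewrite deriv0 horner0 mul0r.
have e : (fun x => (p * 'X + c%:P).[u x]) = fun x => p.[u x] * u x + c.
  by apply/funext => x; rewrite hornerMXaddC.
rewrite e; have s1 := smoothM ih1 su; split => [|i].
  by apply: smoothD => //; exact: smooth_cst.
rewrite partialD//; last exact: smooth_cst.
rewrite partialM// partial_cst ih2; apply/funext => x.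
rewrite derivD derivM derivX derivC mulr1 addr0 !hornerE; ring.
Qed.

End smooth_functions.

(** * The function [exp (- 1 / t)] and its derivatives *)

Section exponential_bump.
Context (R : realType).
Implicit Types (q : {poly R}) (t : R).

Definition ebump q t : R := if 0 < t then q.[t^-1] * expR (- t^-1) else 0.
(** The derivative of [q (1 / t) exp (- 1 / t)] has the same form, with this polynomial; the family
    is thus closed under differentiation. *)
Definition ebump_next q : {poly R} := 'X^2 * (q - q^`()).

Lemma expR_pow_bound k (s : R) : 0 < s -> s ^+ k * expR (- s) <= k`!%:R.
Proof.
move=> s0; rewrite expRN ler_pdivrMr ?expR_gt0//.
case: k => [|k]; first by rewrite expr0 fact0 mul1r -expR0 ler_expR ltW.
have := expR_ge1Dxn k (ltW s0).
rewrite -ler_pdivrMl ?ltr0n ?fact_gt0// mulrC => h; apply: le_trans h.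
by rewrite lerDr.
Qed.

(** Each monomial of [q] is controlled by [s ^ k exp (- s) <= k!] with [s = 1 / t] and two extra
    powers of [s]. The quadratic bound makes the difference quotients at [0] vanish. *)
Lemma ebump_bound q : exists C, forall t, `|ebump q t| <= C * t ^+ 2.
Proof.
exists (\sum_(i < size q) `|q`_i| * (i.+2)`!%:R) => t.
rewrite /ebump; case: ifPn => t0; last first.
  by rewrite normr0 mulr_ge0 ?sqr_ge0// sumr_ge0.
have s0 : 0 < t^-1 by rewrite invr_gt0.
rewrite horner_coef mulr_suml mulr_suml; apply: le_trans (ler_norm_sum _ _ _) _.
apply: ler_sum => i _; rewrite normrM normrM -!mulrA ler_wpM2l//.
rewrite !ger0_norm ?expR_ge0 ?exprn_ge0 ?(ltW s0)//.
have := expR_pow_bound i.+2 s0; rewrite -ler_pdivrMr ?exprn_gt0//.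
by rewrite -exprVn !exprS [in leLHS]mulrA; set e := expR _; nra.
Qed.

Lemma is_derive_ebump q t : is_derive t (1 : R) (ebump q) (ebump (ebump_next q) t).
Proof.
case: (ltgtP t 0) => [t0|t0|->].
- rewrite {2}/ebump ltNge (ltW t0)/=.
  have d0 : is_derive t (1 : R) (cst (0 : R)) 0 by exact: is_derive_cst.
  apply: near_eq_is_derive d0.
  near=> s; rewrite /ebump ltNge (_ : s <= 0)//; apply: ltW.
  by near: s; exact: lt_nbhsl.
- have tn : t != 0 by rewrite gt_eqF.
  rewrite {2}/ebump t0.
  apply: (near_eq_is_derive (f := fun t => q.[t^-1] * expR (- t^-1) : R^o)).
    near=> s; rewrite /ebump (_ : 0 < s)//.
    by near: s; exact: lt_nbhsr.
  have dV : is_derive t (1 : R) (fun s : R => s^-1 : R) (- t ^- 2).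
    have := @is_deriveV R (fun s => s) t 1 1 tn (is_derive_id t 1).
    by move=> h; apply: is_derive_eq; rewrite /GRing.scale/= mulr1.
  have dN : is_derive t (1 : R) (fun s : R => - s^-1 : R) (t ^- 2).
    by apply: is_derive_eq; rewrite opprK.
  have dq : is_derive (t^-1) (1 : R) (fun s => q.[s]) (q^`().[t^-1]).
    by rewrite derivE derive1E; apply/derivableP; exact: derivable_horner.
  have d1 := @is_derive1_comp R (fun s => q.[s]) (fun s : R => s^-1) t _ _ dq dV.
  have d2 := @is_derive1_comp R expR (fun s : R => - s^-1) t _ _ (is_derive_expR _) dN.
  have E : (ebump_next q).[t^-1] = t ^- 2 * (q.[t^-1] - q^`().[t^-1]).
    by rewrite /ebump_next !hornerE exprVn.
  have d3 : is_derive t (1 : R) (fun s => ((fun s => q.[s]) \o (fun s : R => s^-1)) s * (expR \o (fun s : R => - s^-1)) s : R)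
    ((ebump_next q).[t^-1] * expR (- t^-1)).
    apply: is_derive_eq; rewrite E /GRing.scale/=; ring.
  exact: d3.
rewrite {2}/ebump ltxx.
have [C hC] := ebump_bound q.
have e0 : ebump q 0 = 0 by rewrite /ebump ltxx.
have C0 : 0 <= C by have := le_trans (normr_ge0 _) (hC 1); rewrite expr1n mulr1.
have cv : h^-1 *: ((ebump q \o shift 0) (h *: (1 : R)) - ebump q 0) @[h --> (0 : R)^'] --> (0 : R).
  apply/cvgrPdist_le => e ep; near=> h.
  have h0 : h != 0 by near: h; exact: nbhs_dnbhs_neq.
  rewrite e0 subr0 /= addr0 /GRing.scale/= mulr1 sub0r normrN normrM normfV.
  rewrite ler_pdivrMl ?normr_gt0//; apply: le_trans (hC h) _.
  rewrite -[h ^+ 2]real_normK ?num_real// expr2 mulrA [leRHS]mulrC ler_wpM2r//.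
  have : `|h| <= e / (C + 1).
    near: h; apply: dnbhs0_le; rewrite divr_gt0// ltr_wpDl//.
  rewrite ler_pdivlMr; last by rewrite ltr_wpDl.
  by have := normr_ge0 h; nra.
by apply: DeriveDef; [apply/cvg_ex; exists 0|apply: cvg_lim => //; exact: Rhausdorff].
Unshelve. all: by end_near. Qed.

Lemma ebump01 t : 0 <= ebump 1 t <= 1.
Proof.
rewrite /ebump; case: ifP => t0; last by rewrite lexx ler01.
by rewrite hornerC mul1r expR_ge0/= -expR0 ler_expR oppr_le0 invr_ge0 ltW.
Qed.

Lemma ebump_gt0 t : (0 < ebump 1 t) = (0 < t).
Proof. by rewrite /ebump; case: ifP; rewrite ?ltxx// hornerC mul1r expR_gt0. Qed.

Lemma ebump_cvg t : ebump 1 (k.+1%:R * t) @[k --> \oo] --> (if 0 < t then 1 else 0 : R).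
Proof.
rewrite /ebump; under eq_fun do rewrite hornerC mul1r pmulr_rgt0 ?ltr0n//.
case: ifP => t0; last exact: cvg_cst.
suff : expR (- (k.+1%:R * t)^-1) @[k --> \oo] --> expR (- (0 * t^-1)) by rewrite mul0r oppr0 expR0.
apply: continuous_cvg; first exact: continuous_expR.
apply: cvgN; under eq_fun do rewrite invfM.
by apply: cvgM; [exact: cvg_harmonic|exact: cvg_cst].
Qed.

(** The stable class is that of finite sums of smooth functions multiplied by [ebump r u]; the chain
    rule replaces [r] by [ebump_next r]. *)
Lemma smooth_ebump n (u : 'rV[R]_n -> R) q : smooth u -> smooth (fun x => ebump q (u x)).
Proof.
move=> su.
pose P w := exists s : seq (('rV[R]_n -> R) * {poly R}),
  (forall p, List.In p s -> smooth p.1) /\ w = fun x => \sum_(p <- s) p.1 x * ebump p.2 (u x).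
apply: (@smooth_coind _ _ P); last first.
  exists [:: (fun=> 1, q)]; split => [p [<-|[]]//|]; first exact: smooth_cst.
  by apply/funext => x; rewrite big_seq1 mul1r.
move=> _ [s [ss ->]]; elim: s ss => [|[a r] s ih] ss.
  under eq_fun do rewrite big_nil; split => [x|i]; first exact: differentiable_cst.
  by exists [::]; split => //; rewrite partial_cst; apply/funext => x; rewrite big_nil.
have sa : smooth a := ss (a, r) (or_introl erefl).
have [d1 d2] := ih (fun p ps => ss p (or_intror ps)).
have du x : differentiable (fun x => ebump r (u x) : R^o) x.
  apply: (@differentiable_comp _ _ R^o R^o (u : _ -> R^o) (ebump r : R^o -> R^o)).
    exact: smooth_diff.
  by apply/derivable1_diffP; exact: (@ex_derive _ _ _ _ _ _ _ (is_derive_ebump r (u x))).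
have dE i x : partial i (fun x => ebump r (u x)) x = ebump (ebump_next r) (u x) * partial i u x.
  apply: derive_line.
  have l1 := is_derive_line x (delta_mx ord0 i) 0 su.
  have := @is_derive1_comp R (ebump r) (fun s : R => u (x + s *: delta_mx ord0 i)) 0 _ _ (is_derive_ebump r _) l1.
  by rewrite scale0r addr0.
under eq_fun do rewrite big_cons; split => [x|i].
  apply: (@differentiableD _ _ _ (fun x => a x * ebump r (u x) : R^o) (fun x => \sum_(p <- s) p.1 x * ebump p.2 (u x) : R^o) x) => //.
  by apply: differentiableM => //; exact: smooth_diff.
have [t [ts e]] := d2 i.
exists [:: (partial i a, r), (fun x => a x * partial i u x, ebump_next r) & t]; split.
  move=> p [<-|[<-|/ts//]] /=; first exact: smooth_partial.
  by apply: smoothM => //; exact: smooth_partial.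
apply/funext => x; rewrite !big_cons/= -(congr1 (@^~ x) e) addrA [in LHS]/partial.
have da := @smooth_derivable _ _ a x (delta_mx ord0 i) sa.
have dr : derivable (fun x => ebump r (u x) : R^o) x (delta_mx ord0 i) by exact: diff_derivable.
have := @deriveD _ _ R^o (fun x => a x * ebump r (u x) : R^o) (fun x => \sum_(p <- s) p.1 x * ebump p.2 (u x) : R^o) x (delta_mx ord0 i).
rewrite /= => ->; [|exact: derivableM|exact: diff_derivable].
congr (_ + _); have := @deriveM _ _ (a : _ -> R^o) (fun x => ebump r (u x) : R^o) x (delta_mx ord0 i) da dr.
rewrite -!/(partial i _ _) dE /GRing.scale/= => ->; ring.
Qed.

End exponential_bump.

(** * Integration along lines and the Gagliardo inequality *)

Section one_dimensional.
Context (R : realType).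
Local Notation mR := (measurableTypeR R).
Local Notation leb := (@lebesgue_measure R).

Definition cls1 (M C : R) (g : mR -> R) := [/\ measurable_fun setT g,
  forall s, `|g s| <= C & forall s, M <= `|s| -> g s = 0].

Lemma cls1_L1 M C g : 0 <= M -> cls1 M C g -> L1 leb g /\ `|Int leb g| <= C * (2 * M).
Proof.
move=> M0 [mg gC gM]; have C0 : 0 <= C by apply: le_trans (gC 0).
pose i : mR -> R := \1_(`]-M, M[%classic).
have Li : L1 leb i by exact: (integrable_indic_itv (- M) M false true).
have gi s : `|g s| <= C * i s.
  rewrite /i indicE; case: (boolP (s \in _)) => [_|]; first by rewrite mulr1.
  rewrite notin_setE /= in_itv/= => /negP h; rewrite gM ?normr0 ?mulr0//.
  by rewrite leNgt; apply: contra h; rewrite ltr_norml.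
have Lg : L1 leb g by apply: L1_domT (L1Z C Li) gi.
split => //; apply: le_trans (Int_abs Lg) _.
apply: le_trans (Int_leT (L1_norm Lg) (L1Z C Li) gi) _.
rewrite IntZ// ler_wpM2l// /Int /Rintegral /i.
rewrite integral_indic//= setIT lebesgue_measure_itv/= lte_fin.
by case: ifP => _ /=; lra.
Qed.

Lemma ftc_line (F f : R -> R) a c : a < c -> (forall t, is_derive t (1 : R) F (f t)) ->
  continuous f -> Int leb (f \_ `[a, c]) = F c - F a.
Proof.
move=> ac dF cf; have cF t : {for t, continuous F} by exact: is_derive_continuous (dF t).
rewrite /Int -Rintegral_mkcond /Rintegral (@continuous_FTC2 _ f F)//.
- by apply: continuous_subspaceT => t; exact: cf.
- split => [t _||]; first exact: (@ex_derive _ _ _ _ _ _ _ (dF t)).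
    exact: cvg_at_right_filter (cF a).
  exact: cvg_at_left_filter (cF c).
- by move=> t _; rewrite derive1E; exact: (@derive_val _ _ _ _ _ _ _ (dF t)).
Qed.

Lemma line_zero (F f : R -> R) M C : 0 < M -> (forall t, is_derive t (1 : R) F (f t)) ->
  continuous f -> (forall s, M <= `|s| -> F s = 0) -> cls1 M C f -> Int leb f = 0.
Proof.
move=> M0 dF cf FM [mf fC fM].
have -> : f = f \_ `[- M, M].
  apply/funext => s; rewrite patchE; case: ifPn => //; rewrite notin_setE /= in_itv/= => /negP h.
  by apply: fM; rewrite leNgt; apply: contra h; rewrite ltr_norml => /andP[h1 h2]; rewrite !ltW.
rewrite (ftc_line _ dF cf); last by lra.
by rewrite !FM ?subrr// ?normrN ger0_norm// ltW.
Qed.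

Lemma line_le (F f : R -> R) M C t : 0 < M -> (forall t, is_derive t (1 : R) F (f t)) ->
  continuous f -> F (- M) = 0 -> (forall s, s <= - M -> F s = 0) -> cls1 M C f ->
  F t <= Int leb (fun s => `|f s|).
Proof.
move=> M0 dF cf FM FM' cl; have [Lf _] := cls1_L1 (ltW M0) cl.
have [tM|Mt] := leP t (- M); first by rewrite FM'//; apply: Int_ge0.
have e := ftc_line Mt dF cf; rewrite FM subr0 in e; rewrite -e.
have p s : `|(f \_ `[(- M)%R, t]) s| <= `|f s| by rewrite patchE; case: ifP; rewrite ?normr0.
have Lp : L1 leb (f \_ `[- M, t]).
  apply: L1_domT (L1_norm Lf) p.
  have mf := L1_mf Lf.
  apply/(measurable_restrictT _ _).1 => //; exact: measurable_funTS.
apply: Int_leT => //; first exact: L1_norm.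
by move=> s; rewrite (le_trans (ler_norm _)).
Qed.

End one_dimensional.

Section several_dimensions.
Context (R : realType).
Local Notation mR := (measurableTypeR R).
Local Notation leb := (@lebesgue_measure R).
Local Notation tau := (tuple_lebesgue R).

(** Bounded measurable functions supported in a fixed cube. The class is stable under slicing and
    partial integration, which settles the integrability conditions of Fubini's theorem once and for
    all. *)
Definition cls n (M C : R) (g : n.-tuple mR -> R) := [/\ measurable_fun setT g,
  forall t, `|g t| <= C & forall t i, M <= `|tnth t i| -> g t = 0].

Definition upd n (t : n.-tuple mR) i (s : R) : n.-tuple mR :=
  [tuple if j == i then s else tnth t j | j < n].

Lemma cls_L1 n M C g : @cls n M C g -> L1 (tau n) g.
Proof.
move=> [mg gC gM].
pose B := @box R n (fun=> - M) (fun=> M).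
have mB : measurable B := box_measurable _ _.
have LB : L1 (tau n) (\1_B : _ -> R).
  apply/integrableP; split; first exact/measurable_EFinP.
  rewrite (eq_integral (fun x => (\1_B x)%:E)); last by move=> x _; rewrite /= ger0_norm.
  by rewrite integral_indic// setIT box_finite.
apply: L1_domT (L1Z C LB) _ => // t; rewrite indicE; case: (boolP (t \in B)) => [_|].
  by rewrite mulr1.
rewrite notin_setE => h.
have [i hi] : exists i, M <= `|tnth t i|.
  apply: contrapT => hn; apply: h => i; rewrite -ltr_norml ltNge; apply/negP => hi.
  by apply: hn; exists i.
by rewrite (gM t i)// normr0 mulr0.
Qed.

Section slices.
Variable n : nat.
Implicit Types (g : n.+1.-tuple mR -> R).

Lemma tnth_tcons0 s (y : n.-tuple mR) : tnth (tcons (s, y)) ord0 = s.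
Proof. by rewrite (tnth_nth 0). Qed.

Lemma tnth_tconsS s (y : n.-tuple mR) j : tnth (tcons (s, y)) (lift ord0 j) = tnth y j.
Proof. by rewrite !(tnth_nth 0). Qed.

Lemma upd_tcons0 s r (y : n.-tuple mR) : upd (tcons (s, y)) ord0 r = tcons (r, y).
Proof.
apply: eq_from_tnth => i; rewrite tnth_mktuple; case: (unliftP ord0 i) => [j ->|->].
  by rewrite !tnth_tconsS.
by rewrite eqxx tnth_tcons0.
Qed.

Lemma upd_tconsS s r (y : n.-tuple mR) j :
  upd (tcons (s, y)) (lift ord0 j) r = tcons (s, upd y j r).
Proof.
apply: eq_from_tnth => i; rewrite tnth_mktuple; case: (unliftP ord0 i) => [k ->|->].
  by rewrite !tnth_tconsS tnth_mktuple (inj_eq lift_inj).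
by rewrite !tnth_tcons0.
Qed.

Lemma cls_slice M C g s : cls M C g -> cls M C (fun y => g (tcons (s, y))).
Proof.
move=> [mg gC gM]; split => [|y|y j yM]; last by apply: (gM _ (lift ord0 j)); rewrite tnth_tconsS.
  apply: (measurableT_comp mg); apply: (measurableT_comp (@measurable_tcons R n)).
  exact: measurable_pair1.
exact: gC.
Qed.

Lemma cls_line M C g y : cls M C g -> cls1 M C (fun s => g (tcons (s, y))).
Proof.
move=> [mg gC gM]; split => [|s|s sM]; last by apply: (gM _ ord0); rewrite tnth_tcons0.
  apply: (measurableT_comp mg); apply: (measurableT_comp (@measurable_tcons R n)).
  exact: measurable_pair2.
exact: gC.
Qed.

Lemma L1_tcons M C g : cls M C g ->
  (leb \x tau n)%E.-integrable setT (EFin \o (g \o @tcons R n)).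
Proof.
move=> cg; have Lg := cls_L1 cg; have mg := L1_mf Lg.
apply/integrableP; split.
  by apply/measurable_EFinP; exact: measurableT_comp mg (@measurable_tcons R n).
have /integrableP[_] := Lg; apply: le_lt_trans.
have mag : measurable_fun setT (fun t : n.+1.-tuple mR => `|(EFin \o g) t|)%E.
  by apply: measurableT_comp => //; exact/measurable_EFinP.
by rewrite (ge0_integral_pushforward (@measurable_tcons R n) (leb \x tau n)%E measurableT mag (fun y _ => abse_ge0 _)).
Qed.

Lemma Int_tcons M C g : cls M C g -> Int (tau n.+1) g = Rintegral (leb \x tau n)%E setT (g \o @tcons R n).
Proof.
move=> cg; have Lg := cls_L1 cg; have mg := L1_mf Lg.
rewrite /Int /Rintegral; congr fine.
rewrite (integral_pushforward (@measurable_tcons R n) (mu := (leb \x tau n)%E) (D := setT) (f := EFin \o g))//.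
  exact/measurable_EFinP.
rewrite preimage_setT; exact: L1_tcons cg.
Qed.

Lemma Int_cons M C g : 0 <= M -> cls M C g ->
  Int (tau n.+1) g = Int leb (fun s => Int (tau n) (fun y => g (tcons (s, y)))).
Proof.
move=> M0 cg; rewrite (Int_tcons cg) /Int /Rintegral; congr fine.
rewrite -(integral12_prod_meas1 (L1_tcons cg)); apply: eq_integral => s _.
exact: esym (IntE (cls_L1 (cls_slice s cg))).
Qed.

Lemma Int_cons2 M C g : 0 <= M -> cls M C g ->
  Int (tau n.+1) g = Int (tau n) (fun y => Int leb (fun s => g (tcons (s, y)))).
Proof.
move=> M0 cg; rewrite (Int_tcons cg) /Int /Rintegral; congr fine.
rewrite -(integral21_prod_meas1 (L1_tcons cg)); apply: eq_integral => y _.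
exact: esym (IntE (cls1_L1 M0 (cls_line y cg)).1).
Qed.

Lemma cls_inner M C g : 0 <= M -> cls M C g ->
  cls M (C * (2 * M)) (fun y => Int leb (fun s => g (tcons (s, y)))).
Proof.
move=> M0 cg; split => [|y|y j yM].
- apply: (measurableT_comp (f := fine)) => //.
  exact: (measurable_fubini_G (L1_tcons cg)).
- exact: (cls1_L1 M0 (cls_line y cg)).2.
- rewrite -[RHS](Int0 leb); congr Int; apply/funext => s.
  by case: cg => _ _ gM; apply: (gM _ (lift ord0 j)); rewrite tnth_tconsS.
Qed.

Lemma cls_outer M C g : 0 <= M -> cls M C g ->
  exists C', cls1 M C' (fun s => Int (tau n) (fun y => g (tcons (s, y)))).
Proof.
move=> M0 cg; pose B := @box R n (fun=> - M) (fun=> M).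
have mB : measurable B := box_measurable _ _.
have LB : L1 (tau n) (\1_B : _ -> R).
  apply/integrableP; split; first exact/measurable_EFinP.
  rewrite (eq_integral (fun x => (\1_B x)%:E)); last by move=> x _; rewrite /= ger0_norm.
  by rewrite integral_indic// setIT box_finite.
exists (Int (tau n) (fun y => C * \1_B y)); split => [|s|s sM].
- apply: (measurableT_comp (f := fine)) => //.
  exact: (measurable_fubini_F (L1_tcons cg)).
- have Ls := cls_L1 (cls_slice s cg); apply: le_trans (Int_abs Ls) _.
  apply: Int_leT; [exact: L1_norm|exact: L1Z|].
  move=> y; rewrite indicE; case: (boolP (y \in B)) => [_|].
    by rewrite mulr1; case: cg.
  rewrite notin_setE => h.
  have [i hi] : exists i, M <= `|tnth y i|.
    apply: contrapT => hn; apply: h => i; rewrite -ltr_norml ltNge; apply/negP => hi.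
    by apply: hn; exists i.
  by case: (cls_slice s cg) => _ _ /(_ y i hi) ->; rewrite normr0 mulr0.
- rewrite -[RHS](Int0 (tau n)); congr Int; apply/funext => y.
  by case: cg => _ _ gM; apply: (gM _ ord0); rewrite tnth_tcons0.
Qed.

End slices.

(** Fubini's theorem, by induction on the dimension: the direction [i] is either the first
    coordinate, integrated innermost, or a direction of the slices. *)
Lemma Int_line_zero n M C (g : n.-tuple mR -> R) i : 0 <= M -> cls M C g ->
  (forall t, Int leb (fun s => g (upd t i s)) = 0) -> Int (tau n) g = 0.
Proof.
move=> M0; elim: n g i => [|n ih] g i; first by case: i.
case: (unliftP ord0 i) => [j ->|->] cg g0.
  rewrite (Int_cons M0 cg) -[RHS](Int0 leb); congr Int; apply/funext => s.
  apply: (ih _ j (cls_slice s cg)) => y; rewrite -[RHS](g0 (tcons (s, y))).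
  by congr Int; apply/funext => r; rewrite upd_tconsS.
rewrite (Int_cons2 M0 cg) -[RHS](Int0 (tau n)); congr Int; apply/funext => y.
rewrite -[RHS](g0 (tcons (0, y))).
by congr Int; apply/funext => r; rewrite upd_tcons0.
Qed.

End several_dimensions.

(** * Hoelder's inequality for real-valued integrals *)

Section holder.
Context d (T : measurableType d) (R : realType).
Variable mu : {measure set T -> \bar R}.
Implicit Types f g : T -> R.
Local Notation I := (Int mu).

Lemma powR_divl (x a r : R) : 0 <= x -> 0 < a -> (x / a) `^ r = x `^ r / a `^ r.
Proof.
move=> x0 a0; rewrite powRM ?invr_ge0 ?(ltW a0)//; congr (_ * _).
by rewrite -(powR_inv1 (ltW a0)) -powRrM mulN1r powRN.
Qed.

(** [a] and [c] are the two norms. Young's inequality for [f / a] and [g / c] integrates to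
    [1 / p + 1 / q = 1]. *)
Lemma holder_normalized f g (p q a c : R) : 0 < p -> 0 < q -> p^-1 + q^-1 = 1 ->
  (forall x, 0 <= f x) -> (forall x, 0 <= g x) -> L1 mu (fun x => f x * g x) ->
  L1 mu (fun x => f x `^ p) -> L1 mu (fun x => g x `^ q) -> 0 < a -> 0 < c ->
  I (fun x => f x `^ p) = a `^ p -> I (fun x => g x `^ q) = c `^ q ->
  I (fun x => f x * g x) <= a * c.
Proof.
move=> p0 q0 pq f0 g0 Lfg Lf Lg a0 c0 aE cE.
have ap := powR_gt0 p a0; have cq := powR_gt0 q c0.
have ac : 0 < a * c by exact: mulr_gt0.
suff : (a * c)^-1 * I (fun x => f x * g x) <= 1 by rewrite ler_pdivrMl// mulr1.
rewrite -IntZ//.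
apply: (@le_trans _ _ (I (fun x => (p^-1 / a `^ p) * f x `^ p + (q^-1 / c `^ q) * g x `^ q))).
  apply: Int_leT; [exact: L1Z|by apply: L1D; exact: L1Z|].
  move=> x; have := conjugate_powR (divr_ge0 (f0 x) (ltW a0)) (divr_ge0 (g0 x) (ltW c0)) p0 q0 pq.
  rewrite !powR_divl//; move: (f x `^ p) (g x `^ q) (a `^ p) (c `^ q) => u v u' v'.
  rewrite invfM.
  have -> : f x / a * (g x / c) = a^-1 * c^-1 * (f x * g x) by ring.
  have -> : u / u' / p + v / v' / q = p^-1 / u' * u + q^-1 / v' * v by ring.
  by [].
rewrite IntD ?IntZ//; [|exact: L1Z|exact: L1Z].
by rewrite aE cE !divfK ?gt_eqF// pq.
Qed.

Lemma Int_holder f g (p q : R) : 0 < p -> 0 < q -> p^-1 + q^-1 = 1 ->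
  measurable_fun setT f -> measurable_fun setT g ->
  (forall x, 0 <= f x) -> (forall x, 0 <= g x) ->
  L1 mu (fun x => f x `^ p) -> L1 mu (fun x => g x `^ q) ->
  L1 mu (fun x => f x * g x) /\
  I (fun x => f x * g x) <= I (fun x => f x `^ p) `^ p^-1 * I (fun x => g x `^ q) `^ q^-1.
Proof.
move=> p0 q0 pq mf mg f0 g0 Lf Lg.
have Lfg : L1 mu (fun x => f x * g x).
  apply: (L1_domT (g := fun x => p^-1 * f x `^ p + q^-1 * g x `^ q)).
  - exact: measurable_funM.
  - by apply: L1D; exact: L1Z.
  - move=> x; rewrite ger0_norm ?mulr_ge0// ![_^-1 * _]mulrC; exact: conjugate_powR.
split => //; set X := I (fun x => f x `^ p); set Y := I (fun x => g x `^ q).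
have X0 : 0 <= X by apply: Int_ge0 => x; exact: powR_ge0.
have Y0 : 0 <= Y by apply: Int_ge0 => x; exact: powR_ge0.
have zero (u v : T -> R) (r : R) : 0 < r -> L1 mu (fun x => u x `^ r) -> I (fun x => u x `^ r) <= 0 ->
    measurable_fun setT (fun x => u x * v x) -> I (fun x => u x * v x) = 0.
  move=> r0 Lu Iu muv; rewrite -(Int0 mu); apply: Int_ae_eq => //.
  have : \forall x \ae mu, u x `^ r = 0.
    by apply: Int_eq0 => //; apply: aeW => x; exact: powR_ge0.
  by apply: filterS => x /powR_eq0_eq0 ->; rewrite mul0r.
have mfg := L1_mf Lfg.
have [X1|X1] := leP X 0; first by rewrite (zero f g p p0 Lf X1)// mulr_ge0 ?powR_ge0.
have [Y1|Y1] := leP Y 0.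
  under eq_fun do rewrite mulrC.
  rewrite (zero g f q q0 Lg Y1) ?mulr_ge0 ?powR_ge0//.
  by under eq_fun do rewrite mulrC.
apply: (holder_normalized p0 q0 pq f0 g0 Lfg Lf Lg); try exact: powR_gt0.
- by rewrite -powRrM mulVf ?gt_eqF// powRr1.
- by rewrite -powRrM mulVf ?gt_eqF// powRr1.
Qed.

End holder.

(** * Gagliardo's inequality *)

Section gagliardo.
Context (R : realType).
Local Notation mR := (measurableTypeR R).
Local Notation leb := (@lebesgue_measure R).
Local Notation tau := (tuple_lebesgue R).

Lemma cls_powR n M C (g : n.-tuple mR -> R) (r : R) : 0 < r -> cls M C g ->
  (forall t, 0 <= g t) -> cls M (C `^ r) (fun t => g t `^ r).
Proof.
move=> r0 [mg gC gM] g0; split => [|t|t i tM].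
- exact: (measurableT_comp (measurable_powR r) mg).
- rewrite ger0_norm ?powR_ge0//; have := gC t; rewrite ger0_norm// => h.
  by apply: ge0_ler_powR; rewrite ?nnegrE ?(ltW r0)// (le_trans (g0 t)).
- by rewrite (gM t i)// powR0// gt_eqF.
Qed.

Lemma cls_mul n M C C' (g h : n.-tuple mR -> R) : measurable_fun setT h ->
  (forall t, `|h t| <= C') -> cls M C g -> cls M (C * C') (fun t => g t * h t).
Proof.
move=> mh hC [mg gC gM]; split => [|t|t i tM]; first exact: measurable_funM.
  by rewrite normrM ler_pM.
by rewrite (gM t i)// mul0r.
Qed.

Section step.
Variables (n : nat) (M C C' : R) (Phi g : n.+2.-tuple mR -> R).
Hypothesis M0 : 0 <= M.
Hypothesis cPhi : cls M C Phi.
Hypothesis cg : cls M C' g.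
Hypothesis Phi0 : forall t, 0 <= Phi t.
Hypothesis g0 : forall t, 0 <= g t.
Hypothesis Phig : forall t i, Phi t <= Int leb (fun s => g (upd t i s)).

Let A (y : n.+1.-tuple mR) := Int leb (fun s => g (tcons (s, y))).
Local Notation k := (n.+1%:R^-1 : R).

(** [A] is the integral of [g] over the first coordinate and dominates [Phi], so
    [Phi ^ (1 + k) <= Phi A ^ k]. The hypothesis bounds the integral of the right-hand side over
    each slice by the slice integral of [g] times a constant, and integration over the slices
    restores the full integral of [g]. *)
Lemma gagliardo_step :
  (forall s, Int (tau n.+1) (fun y => Phi (tcons (s, y)) * A y `^ k) <=
    Int (tau n.+1) (fun y => g (tcons (s, y))) * Int (tau n.+1) A `^ k) ->
  Int (tau n.+2) (fun t => Phi t `^ (1 + k)) <= Int (tau n.+2) g `^ (1 + k).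
Proof.
move=> hs; have k0 : 0 < k by rewrite invr_gt0.
have A0 y : 0 <= A y by apply: Int_ge0 => s.
have cA := cls_inner M0 cg.
have r0 : 0 < 1 + k by rewrite addr_gt0.
have cP := cls_powR r0 cPhi Phi0.
rewrite (Int_cons M0 cP).
have Ig : Int (tau n.+2) g = Int (tau n.+1) A by exact: Int_cons2 M0 cg.
have I0 : 0 <= Int (tau n.+2) g by exact: Int_ge0.
have PA s y : Phi (tcons (s, y)) <= A y.
  have := Phig (tcons (s, y)) ord0.
  by under eq_fun do rewrite upd_tcons0.
have [C1 c1] := cls_outer M0 cP; have [C2 c2] := cls_outer M0 cg.
have [L1' _] := cls1_L1 M0 c1; have [L2' _] := cls1_L1 M0 c2.
apply: (@le_trans _ _ (Int leb (fun s => Int (tau n.+2) g `^ k * Int (tau n.+1) (fun y => g (tcons (s, y)))))).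
  apply: Int_leT; [exact: L1'|exact: L1Z|].
  move=> s; rewrite mulrC Ig; apply: le_trans (hs s).
  have cAk := cls_powR k0 cA A0.
  apply: Int_leT.
  - exact: cls_L1 (cls_slice s cP).
  - have [mA AC _] := cAk.
    exact: cls_L1 (cls_mul mA AC (cls_slice s cPhi)).
  - move=> y; rewrite powRD; last by rewrite gt_eqF.
    rewrite powRr1//; apply: ler_wpM2l => //.
    by apply: ge0_ler_powR; rewrite ?nnegrE ?(ltW k0).
rewrite IntZ// -(Int_cons M0 cg) powRD; last by rewrite gt_eqF.
by rewrite powRr1// mulrC.
Qed.

End step.

Lemma Int_tuple1 M C (g : 1.-tuple mR -> R) : 0 <= M -> cls M C g ->
  Int (tau 1) g = Int leb (fun s => g (tcons (s, [tuple]))).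
Proof.
move=> M0 cg; rewrite (Int_cons M0 cg); congr Int; apply/funext => s.
rewrite /Int /Rintegral /= integral_dirac//=.
  by rewrite indicE in_setT mul1r.
by apply/measurable_EFinP; case: (cls_slice s cg).
Qed.

(* Gagliardo's inequality, by induction on the dimension: on the slice [s]
   the exponent [n / (n - 1)] of the previous dimension is combined through
   Hoelder's inequality with the integral over the first coordinate. *)
Lemma gagliardo n M C C' (Phi g : n.+2.-tuple mR -> R) : 0 <= M ->
  cls M C Phi -> cls M C' g -> (forall t, 0 <= Phi t) -> (forall t, 0 <= g t) ->
  (forall t i, Phi t <= Int leb (fun s => g (upd t i s))) ->
  Int (tau n.+2) (fun t => Phi t `^ (1 + n.+1%:R^-1)) <= Int (tau n.+2) g `^ (1 + n.+1%:R^-1).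
Proof.
move=> M0; elim: n C C' Phi g => [|n ih] C C' Phi g cP cg P0 g0 Pg.
  (* Dimension two: a slice has a single coordinate left, and [Phi] on it is at most the integral of
     [g] over the slice, which does not depend on the point. *)
  apply: (gagliardo_step M0 cP cg P0 g0 Pg) => s; rewrite invr1.
  have cA := cls_inner M0 cg.
  have A0 y : 0 <= Int leb (fun s => g (tcons (s, y))) by apply: Int_ge0 => r.
  have -> : (fun y => Phi (tcons (s, y)) * Int leb (fun s => g (tcons (s, y))) `^ 1) =
      (fun y => Phi (tcons (s, y)) * Int leb (fun s => g (tcons (s, y)))).
    by apply/funext => y; rewrite powRr1.
  rewrite powRr1; last exact: Int_ge0.
  have [mA AC _] := cA.
  rewrite -IntZ; last exact: cls_L1 cA.
  apply: Int_leT.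
  - exact: cls_L1 (cls_mul mA AC (cls_slice s cP)).
  - by apply: L1Z; exact: cls_L1 cA.
  - move=> y; apply: ler_wpM2r => //.
    have := Pg (tcons (s, y)) (lift ord0 ord0).
    rewrite (Int_tuple1 M0 (cls_slice s cg)).
    under eq_fun do rewrite upd_tconsS.
    rewrite (_ : (fun r => g (tcons (s, upd y ord0 r))) = fun r => g (tcons (s, tcons (r, [tuple]))))//.
    apply/funext => r; congr (g (tcons (s, _))); apply: eq_from_tnth => i.
    by rewrite tnth_mktuple (ord1 i) eqxx tnth_tcons0.
apply: (gagliardo_step M0 cP cg P0 g0 Pg) => s.
have A0 y : 0 <= Int leb (fun s => g (tcons (s, y))) by apply: Int_ge0 => r.
have cA := cls_inner M0 cg.
set A := (fun y => Int leb _) in A0 cA *.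
have cPs := cls_slice s cP; have cgs := cls_slice s cg.
have q0 : 0 < n.+2%:R :> R by rewrite ltr0n.
have k0 : 0 < (n.+2%:R : R)^-1 by rewrite invr_gt0.
have p0 : 0 < 1 + (n.+1%:R : R)^-1 by rewrite addr_gt0// invr_gt0.
have nz : (n.+1%:R : R) != 0 by rewrite pnatr_eq0.
have nz2 : (n.+2%:R : R) != 0 by rewrite pnatr_eq0.
have pE : (1 + (n.+1%:R : R)^-1)^-1 = n.+1%:R / n.+2%:R.
  have -> : 1 + (n.+1%:R : R)^-1 = n.+2%:R / n.+1%:R by rewrite -[n.+2%:R]natr1; field.
  by rewrite invfM invrK mulrC.
(* The exponent [(n + 2) / (n + 1)] of the lower dimension and its conjugate [n + 2]: the factor
   [A ^ (1 / (n + 2))] raised to the latter is [A] itself. *)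
have pq : (1 + (n.+1%:R : R)^-1)^-1 + n.+2%:R^-1 = 1.
  by rewrite pE -[X in _ + X]mul1r -mulrDl natr1 divff.
have cAk := cls_powR k0 cA A0; have [mAk AkC _] := cAk.
have AkK : (fun y => (A y `^ n.+2%:R^-1) `^ n.+2%:R) = A.
  by apply/funext => y; rewrite -powRrM mulVf// (powRr1 (A0 y)).
have [mPs _ _] := cPs.
have [_ h] := Int_holder (mu := tau n.+2) (f := fun y => Phi (tcons (s, y))) (g := fun y => A y `^ n.+2%:R^-1)
  p0 q0 pq mPs mAk (fun y => P0 _) (fun y => powR_ge0 _ _) (cls_L1 (cls_powR p0 cPs (fun y => P0 _)))
  (eq_rect_r (L1 (tau n.+2)) (cls_L1 cA) AkK).
apply: le_trans h _; rewrite AkK; apply: ler_wpM2r; first exact: powR_ge0.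
have gs0 : 0 <= Int (tau n.+2) (fun y => g (tcons (s, y))) by exact: Int_ge0.
have gE : Int (tau n.+2) (fun y => g (tcons (s, y))) =
    (Int (tau n.+2) (fun y => g (tcons (s, y))) `^ (1 + n.+1%:R^-1)) `^ (1 + n.+1%:R^-1)^-1.
  by rewrite -powRrM mulfV ?gt_eqF// powRr1.
rewrite [leRHS]gE.
apply: ge0_ler_powR; rewrite ?nnegrE ?invr_ge0 ?(ltW p0) ?powR_ge0//.
  by apply: Int_ge0 => y; exact: powR_ge0.
apply: (ih C C' _ _ cPs cgs) => // y i.
have := Pg (tcons (s, y)) (lift ord0 i).
by under eq_fun do rewrite upd_tconsS.
Qed.

End gagliardo.

(** * Test functions of an open set *)

Section restricted_measure.
Context d (T : measurableType d) (R : realType).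
Variables (mu : {measure set T -> \bar R}) (D : set T) (mD : measurable D).
Local Notation nu := (mrestr mu mD).

Lemma ge0_integral_mrestr (f : T -> \bar R) : measurable_fun setT f ->
  (forall x, 0 <= f x)%E -> (\int[nu]_x f x = \int[mu]_(x in D) f x)%E.
Proof.
move=> mf f0; rewrite (@ge0_negligible_integral _ _ _ nu setT (~` D))//.
- rewrite setTD setCK; apply: eq_measure_integral => A mA AD.
  by change (mu (A `&` D) = mu A); rewrite setIidl.
- exact: measurableC.
- by change (mu (~` D `&` D) = 0%E); rewrite setICl measure0.
Qed.

Lemma integral_mrestr (f : T -> \bar R) : measurable_fun setT f ->
  (\int[nu]_x f x = \int[mu]_(x in D) f x)%E.
Proof.
move=> mf; rewrite [LHS]integralE [RHS]integralE !ge0_integral_mrestr//.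
- exact: measurable_funeneg.
- exact: measurable_funepos.
Qed.

Lemma L1_mrestr (f : T -> R) : measurable_fun setT f ->
  L1 nu f <-> mu.-integrable D (EFin \o f).
Proof.
move=> mf; have mf' : measurable_fun setT (EFin \o f) by exact/measurable_EFinP.
have E : (\int[nu]_x `|(EFin \o f) x| = \int[mu]_(x in D) `|(EFin \o f) x|)%E.
  by rewrite ge0_integral_mrestr//; exact: measurableT_comp.
split => /integrableP[_ h]; apply/integrableP; split.
- exact: measurable_funTS.
- by rewrite -E.
- exact: mf'.
- by rewrite E.
Qed.

Lemma Int_mrestr (f : T -> R) : measurable_fun setT f -> Int nu f = \int[mu]_(x in D) f x.
Proof. by move=> mf; rewrite /Int /Rintegral integral_mrestr//; exact/measurable_EFinP. Qed.

Lemma ae_mrestr (P : T -> Prop) :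
  {ae nu, forall x, P x} <-> {ae mu, forall x, D x -> P x}.
Proof.
split => -[A [mA A0 PA]].
  exists (A `&` D); split; [exact: measurableI|exact: A0|].
  by move=> x /= /not_implyP[Dx nPx]; split => //; exact: PA.
exists (A `|` ~` D); split; first by apply: measurableU => //; exact: measurableC.
  rewrite /mrestr setIUl setICl setU0; apply/eqP; rewrite eq_le measure_ge0 andbT -A0.
  by apply: le_measure; rewrite ?inE//; exact: measurableI.
move=> x /= nPx; have [Dx|] := pselect (D x); last by right.
by left; apply: PA => /= h; exact: nPx (h Dx).
Qed.

End restricted_measure.

Section test_functions.
Context (R : realType) (n : nat) (O : set 'rV[R]_n).
Implicit Types (u v phi psi : 'rV[R]_n -> R) (i : 'I_n).

Lemma partial_off i u (K : set 'rV[R]_n) x : closed K -> (forall y, ~ K y -> u y = 0) ->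
  ~ K x -> partial i u x = 0.
Proof.
move=> cK u0 Kx; rewrite /partial.
have -> : 'D_(delta_mx ord0 i) (u : _ -> R^o) x = 'D_(delta_mx ord0 i) (cst 0 : _ -> R^o) x.
  apply: near_eq_derive.
  have : nbhs x (~` K) by apply: open_nbhs_nbhs; split => //; exact: closed_openC.
  by apply: filterS => y /u0.
exact: derive_cst.
Qed.

Lemma rV_compact_closed (K : set 'rV[R]_n) : compact K -> closed K.
Proof. by apply: compact_closed; exact: norm_hausdorff. Qed.

Lemma Cc_partial i phi : Cc_smooth O phi -> Cc_smooth O (partial i phi).
Proof.
move=> [sp [K [cK KO p0]]]; split; first exact: smooth_partial.
exists K; split => // x; apply: partial_off => //; exact: rV_compact_closed.
Qed.

Lemma Cc_add phi psi : Cc_smooth O phi -> Cc_smooth O psi ->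
  Cc_smooth O (fun x => phi x + psi x).
Proof.
move=> [sp [K [cK KO p0]]] [sq [L [cL LO q0]]]; split; first exact: smoothD.
exists (K `|` L); split; [exact: compactU|by rewrite subUset|].
by move=> x /not_orP[Kx Lx]; rewrite p0// q0// addr0.
Qed.

Lemma Cc_mul phi u : Cc_smooth O phi -> smooth u -> Cc_smooth O (fun x => phi x * u x).
Proof.
move=> [sp [K [cK KO p0]]] su; split; first exact: smoothM.
by exists K; split => // x /p0 ->; rewrite mul0r.
Qed.

Lemma Cc_scale c phi : Cc_smooth O phi -> Cc_smooth O (fun x => c * phi x).
Proof.
move=> Cp; under eq_fun do rewrite mulrC.
exact: Cc_mul Cp (smooth_cst c).
Qed.

Lemma Cc_horner (p : {poly R}) phi : p.[0] = 0 -> Cc_smooth O phi ->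
  Cc_smooth O (fun x => p.[phi x]).
Proof.
move=> p0 [sp [K [cK KO q0]]]; split; first exact: (smooth_horner p sp).1.
by exists K; split => // x /q0 ->.
Qed.

Lemma Cc_off phi x : Cc_smooth O phi -> ~ O x -> phi x = 0.
Proof. by move=> [_ [K [_ KO p0]]] Ox; apply: p0 => /KO. Qed.

Lemma bounded_off_compact (w : 'rV[R]_n -> R) (K : set 'rV[R]_n) : continuous w -> compact K ->
  (forall x, ~ K x -> w x = 0) -> exists2 C, 0 <= C & forall x, `|w x| <= C.
Proof.
move=> cw cK p0.
have : compact (w @` K).
  by apply: continuous_compact => //; apply: continuous_subspaceT.
move=> /compact_bounded/pinfty_ex_gt0[C C0 CP]; exists C; first exact: ltW.
move=> x; have [Kx|/p0 ->] := pselect (K x); last by rewrite normr0 ltW.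
by apply: CP; exists x.
Qed.

Lemma Cc_bounded phi : Cc_smooth O phi -> exists2 C, 0 <= C & forall x, `|phi x| <= C.
Proof.
move=> [sp [K [cK KO p0]]].
exact: bounded_off_compact (smooth_continuous sp) cK p0.
Qed.

End test_functions.

Section domain.
Context (R : realType) (n : nat) (O : set 'rV[R]_n) (oO : open O).
Local Notation mR := (measurableTypeR R).
Local Notation T0 := (caratheodory_type (@lebesgue_outer R n)).
Local Notation mu := (lebesgue R n).
Local Notation tau := (tuple_lebesgue R n).
Local Notation leb := (@lebesgue_measure R).
Implicit Types (u v phi psi : 'rV[R]_n -> R) (i : 'I_n).

(** Restricting the measure, and not the space, lets the abstract theory with its integrals over the
    full type apply to total functions; the complement of [O] becomes a null set. *)
Definition dmu : set T0 -> \bar R := mrestr mu (open_cara oO).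
HB.instance Definition _ := Measure.on dmu.
Local Notation nu := dmu.
Local Notation upd := (@upd R n).

Lemma measurable_row_of (g : T0 -> \bar R) :
  measurable_fun setT (g \o @row_of R n) -> measurable_fun setT g.
Proof.
move=> mg; rewrite (_ : g = (g \o @row_of R n) \o @tup R n); last first.
  by apply/funext => x /=; rewrite tupK.
exact: measurableT_comp mg (@measurable_tup R n).
Qed.

Lemma ge0_integral_dmu (g : T0 -> \bar R) : measurable_fun setT (g \o @row_of R n) ->
  (forall x, 0 <= g x)%E -> (forall x, ~ O x -> g x = 0%E) ->
  (\int[nu]_x g x = \int[tau]_t g (row_of t))%E.
Proof.
move=> mg g0 gO; rewrite ge0_integral_mrestr//; last exact: measurable_row_of.
rewrite integral_mkcond (_ : g \_ O = fun x => (g \o @row_of R n) (tup x)).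
  by rewrite ge0_integral_tup// => t; exact: g0.
apply/funext => x; rewrite /= tupK patchE; case: ifPn => //.
by rewrite notin_setE => /gO ->.
Qed.

Lemma L1_dmu (w : T0 -> R) : (forall x, ~ O x -> w x = 0) -> L1 tau (w \o @row_of R n) ->
  L1 nu w /\ Int nu w = Int tau (w \o @row_of R n).
Proof.
move=> wO Lw; have mw := L1_mf Lw.
have mw' : measurable_fun setT (EFin \o w).
  by apply: measurable_row_of; exact/measurable_EFinP.
split.
  apply/integrableP; split => //.
  rewrite (@ge0_integral_dmu (fun x => `|(EFin \o w) x|)%E)//.
  - by case/integrableP : Lw.
  - apply: (measurableT_comp (f := @abse R) _ (g := EFin \o (w \o @row_of R n))) => //.
    exact/measurable_EFinP.
  - by move=> x /wO /= ->; rewrite normr0.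
have mw2 : measurable_fun setT ((EFin \o w) \o @row_of R n) by exact/measurable_EFinP.
have Ep : (\int[nu]_x (EFin \o w)^\+ x = \int[tau]_t (EFin \o w)^\+ (row_of t))%E.
  apply: (@ge0_integral_dmu (fun x => (EFin \o w)^\+%E x)) => [|x|x /wO].
  - by have := measurable_funepos mw2; rewrite !unlock.
  - exact: funepos_ge0.
  - by rewrite unlock/= => ->; rewrite maxxx.
have En : (\int[nu]_x (EFin \o w)^\- x = \int[tau]_t (EFin \o w)^\- (row_of t))%E.
  apply: (@ge0_integral_dmu (fun x => (EFin \o w)^\-%E x)) => [|x|x /wO].
  - by have := measurable_funeneg mw2; rewrite !unlock.
  - exact: funeneg_ge0.
  - by rewrite unlock/= => ->; rewrite oppr0 maxxx.
rewrite /Int /Rintegral; congr fine; rewrite integralE [RHS]integralE; congr (_ - _)%E.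
  by rewrite Ep; congr integral; rewrite !unlock.
by rewrite En; congr integral; rewrite !unlock.
Qed.

Variable M0 : R.
Hypothesis M00 : 0 < M0.
Hypothesis OM : forall x, O x -> forall i, `|x ord0 i| < M0.

Lemma dmu_fin : (nu setT < +oo)%E.
Proof.
rewrite /dmu /mrestr setTI; apply: (@le_lt_trans _ _ (mu (@tup R n @^-1` box (fun=> - M0) (fun=> M0)))).
  apply: le_measure; rewrite ?inE; [exact: open_cara|by apply: tup_cara; exact: box_measurable|].
  by move=> x Ox i; rewrite tnth_mktuple -ltr_norml; exact: OM.
by rewrite lebesgue_tup ?box_finite//; exact: box_measurable.
Qed.

Lemma cls_off w C : continuous w -> (forall x, ~ O x -> w x = 0) ->
  (forall x, `|w x| <= C) -> cls M0 C (w \o @row_of R n).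
Proof.
move=> cw wO wC; split => [|t|t i tM]; first exact: continuous_row_measurable.
  exact: wC.
by apply: wO => /OM/(_ i); rewrite mxE ltNge tM.
Qed.

Lemma L1_off w C : continuous w -> (forall x, ~ O x -> w x = 0) ->
  (forall x, `|w x| <= C) -> L1 nu w /\ Int nu w = Int tau (w \o @row_of R n).
Proof. by move=> cw wO wC; apply: L1_dmu => //; exact: cls_L1 (cls_off cw wO wC). Qed.

Lemma row_upd t i s : row_of (upd t i s) = row_of (upd t i 0) + s *: delta_mx ord0 i.
Proof.
apply/rowP => j; rewrite !mxE !tnth_mktuple eqxx/=; case: eqVneq => _.
  by rewrite mulr1 add0r.
by rewrite mulr0 addr0.
Qed.

Lemma continuous_line w t i : continuous w -> continuous (fun s : R => w (row_of (upd t i s)) : R).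
Proof.
move=> cw s; under eq_fun do rewrite row_upd.
apply: (@continuous_comp _ _ _ (fun s : R => row_of (upd t i 0) + s *: delta_mx ord0 i) w).
  by apply: cvgD; [exact: cvg_cst|apply: cvgZr_tmp; exact: cvg_id].
by rewrite -row_upd; exact: cw.
Qed.

Lemma is_derive_upd w t i s : smooth w ->
  is_derive s (1 : R) (fun s => w (row_of (upd t i s))) (partial i w (row_of (upd t i s))).
Proof.
move=> sw; rewrite row_upd; under eq_fun do rewrite row_upd.
exact: is_derive_line.
Qed.

Lemma cls1_line w C t i : continuous w -> (forall x, ~ O x -> w x = 0) ->
  (forall x, `|w x| <= C) -> cls1 M0 C (fun s => w (row_of (upd t i s))).
Proof.
move=> cw wO wC; split => [|s|s sM].
- by apply: continuous_measurable_fun; exact: continuous_line.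
- exact: wC.
- by apply: wO => /OM/(_ i); rewrite mxE tnth_mktuple eqxx ltNge sM.
Qed.

Lemma Cc_L1 phi : Cc_smooth O phi -> L1 nu phi /\ Int nu phi = Int tau (phi \o @row_of R n).
Proof.
move=> Cp; have [C _ bC] := Cc_bounded Cp; apply: (L1_off _ _ bC) => [x|x].
  exact: smooth_continuous Cp.1 x.
exact: Cc_off Cp.
Qed.

(** On every line in the direction [i] the fundamental theorem of calculus gives [0], since the test
    function vanishes at both ends. *)
Lemma Int_partial0 i phi : Cc_smooth O phi -> Int nu (partial i phi) = 0.
Proof.
move=> Cp; have Cd := Cc_partial i Cp; have [C C0 bC] := Cc_bounded Cd.
rewrite (Cc_L1 Cd).2; apply: (@Int_line_zero R n M0 C _ i); first exact: ltW.
  apply: cls_off => //; first exact: smooth_continuous Cd.1.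
  by move=> x; exact: Cc_off Cd.
move=> t; apply: (@line_zero R (fun s => phi (row_of (upd t i s))) _ M0 C) => //.
- by move=> s; apply: is_derive_upd; exact: Cp.1.
- by apply: continuous_line; exact: smooth_continuous Cd.1.
- by move=> s sM; apply: (Cc_off Cp) => /OM/(_ i); rewrite mxE tnth_mktuple eqxx ltNge sM.
- apply: cls1_line => //; first exact: smooth_continuous Cd.1.
  by move=> x; exact: Cc_off Cd.
Qed.

Lemma Int_by_parts i phi u : Cc_smooth O phi -> smooth u ->
  Int nu (fun x => u x * partial i phi x) = - Int nu (fun x => partial i u x * phi x).
Proof.
move=> Cp su; have := Int_partial0 i (Cc_mul Cp su); rewrite partialM//; last exact: Cp.1.
have C1 := Cc_mul (Cc_partial i Cp) su; have C2 := Cc_mul Cp (smooth_partial i su).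
rewrite IntD; [|exact: (Cc_L1 C1).1|exact: (Cc_L1 C2).1].
move/eqP; rewrite addr_eq0 => /eqP.
under eq_fun do rewrite mulrC; move=> ->; congr (- Int _ _); apply/funext => x; exact: mulrC.
Qed.

End domain.

Section square_power.
Context (R : realType).
Implicit Types a t : R.

Lemma continuous_sqr_powR a : 0 < a -> continuous (fun t : R => (t ^+ 2) `^ a : R).
Proof.
move=> a0 t; have ct : (s ^+ 2 : R) @[s --> t] --> (t ^+ 2 : R) by exact: exprn_continuous.
have [->|t0] := eqVneq t 0; last first.
  apply: (@continuous_comp _ _ _ (fun s : R => s ^+ 2) (fun s : R => s `^ a)); first exact: ct.
  by apply: continuous_powR; rewrite exprn_even_gt0.
rewrite /continuous_at expr0n powR0 ?gt_eqF//; apply/cvgrPdist_le => e e0.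
have : (r ^+ 2 : R) @[r --> (0 : R)] --> (0 ^+ 2 : R) by exact: exprn_continuous.
rewrite expr0n => /cvgr_lt h; near=> s.
rewrite sub0r normrN ger0_norm ?powR_ge0//.
rewrite -[leRHS](powRr1 (ltW e0)) -(mulVf (lt0r_neq0 a0)) powRrM.
apply: ge0_ler_powR; rewrite ?nnegrE ?(ltW a0) ?sqr_ge0 ?powR_ge0//.
apply: ltW.
by near: s; apply: h; rewrite powR_gt0.
Unshelve. all: by end_near. Qed.

Lemma sqr_powRD1 a t : 0 < a -> (t ^+ 2) `^ (1 + a) = t ^+ 2 * (t ^+ 2) `^ a.
Proof.
move=> a0; rewrite powRD; last by rewrite gt_eqF ?addr_gt0.
by rewrite powRr1 ?sqr_ge0.
Qed.

(** The function is [|t| ^ (2 + 2 a)]; written as a power of the square it is differentiable at [0]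
    too, without smoothing of the absolute value. *)
Lemma is_derive_sqr_powR a t : 0 < a ->
  is_derive t (1 : R) (fun s : R => (s ^+ 2) `^ (1 + a) : R) (2 * (1 + a) * (t * (t ^+ 2) `^ a)).
Proof.
move=> a0; have [->|t0] := eqVneq t 0; last first.
  have p : 0 < t ^+ 2 by rewrite exprn_even_gt0.
  have d1 : is_derive t (1 : R) (fun s : R => s ^+ 2 : R) (2 * t).
    by have := @is_deriveX R R id 2 t 1 1 (is_derive_id t 1); rewrite /GRing.scale/= mulr1.
  have := @is_derive1_comp R (fun s : R => s `^ (1 + a)) (fun s : R => s ^+ 2) t _ _ (is_derive1_powR (1 + a) p) d1.
  rewrite /comp addrAC subrr add0r => h; apply: is_derive_eq.
  by move: (_ `^ a) => z; ring.
have cv : h^-1 *: (((fun s : R => (s ^+ 2) `^ (1 + a)) \o shift 0) (h *: (1 : R)) - (0 ^+ 2) `^ (1 + a)) @[h --> (0 : R)^'] --> (0 : R).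
  have c0 : (h * (h ^+ 2) `^ a : R) @[h --> (0 : R)] --> (0 : R).
    suff : (h * (h ^+ 2) `^ a : R) @[h --> (0 : R)] --> (0 * (0 ^+ 2) `^ a : R) by rewrite mul0r.
    by apply: cvgM; [exact: cvg_id|exact: continuous_sqr_powR].
  have c1 : (h * (h ^+ 2) `^ a : R) @[h --> (0 : R)^'] --> (0 : R).
    by apply: cvg_trans c0; apply: cvg_app; exact: nbhs_dnbhs.
  apply: cvg_trans c1; apply: near_eq_cvg; near=> h.
  have h0 : h != 0 by near: h; exact: nbhs_dnbhs_neq.
  rewrite expr0n powR0 ?gt_eqF ?addr_gt0// subr0 /= addr0 [h *: 1]mulr1 sqr_powRD1//.
  by rewrite /GRing.scale/= expr2 !mulrA mulVf// mul1r.
rewrite !mul0r mulr0.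
by apply: DeriveDef; [apply/cvg_ex; exists 0|apply: cvg_lim => //; exact: Rhausdorff].
Unshelve. all: by end_near. Qed.

End square_power.

Section inequalities.
Context (R : realType) (n : nat) (O : set 'rV[R]_n) (oO : open O).
Local Notation mR := (measurableTypeR R).
Local Notation tau := (tuple_lebesgue R n).
Local Notation leb := (@lebesgue_measure R).
Local Notation nu := (dmu oO).
Local Notation upd := (@upd R n).
Implicit Types (u v phi psi : 'rV[R]_n -> R) (i : 'I_n).

Variable M0 : R.
Hypothesis M00 : 0 < M0.
Hypothesis OM : forall x, O x -> forall i, `|x ord0 i| < M0.

Definition gradf phi (x : 'rV[R]_n) : 'rV[R]_n := \row_i partial i phi x.

Lemma Cc_L2 phi : Cc_smooth O phi -> L2 nu phi.
Proof.
move=> Cp; split; first exact: L1_mf (Cc_L1 oO OM Cp).1.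
by under eq_fun do rewrite expr2; exact: (Cc_L1 oO OM (Cc_mul Cp Cp.1)).1.
Qed.

Lemma Cc_L2v phi : Cc_smooth O phi -> L2v nu (gradf phi).
Proof.
by move=> Cp i; under eq_fun do rewrite mxE; apply: Cc_L2; exact: Cc_partial.
Qed.

(** Integrate [d_i (phi ^ 2 x_i) = phi ^ 2 + 2 phi (d_i phi) x_i], whose left-hand side has integral
    [0]. Since [|x_i| < M0], Young's inequality bounds the last term by
    [phi ^ 2 / 2 + 2 M0 ^ 2 |grad phi| ^ 2]. *)
Lemma Cc_poincare i phi : Cc_smooth O phi ->
  Int nu (fun x => phi x ^+ 2) <= 4 * M0 ^+ 2 * DG nu (gradf phi) (gradf phi).
Proof.
move=> Cp; have [_ L2p] := Cc_L2 Cp; have sp := Cp.1.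
have Lg := L1_dot (Cc_L2v Cp) (Cc_L2v Cp).
have Cw : Cc_smooth O (fun x => phi x * (phi x * x ord0 i)).
  by apply: Cc_mul => //; apply: smoothM => //; exact: smooth_coord.
have I0 := Int_partial0 oO M00 OM i Cw; have Ld := (Cc_L1 oO OM (Cc_partial i Cw)).1.
rewrite -IntZ//.
suff : Int nu (fun x => phi x ^+ 2) <= Int nu (fun x => partial i (fun x => phi x * (phi x * x ord0 i)) x +
    (2^-1 * phi x ^+ 2 + 2^-1 * (4 * M0 ^+ 2 * dot (gradf phi x) (gradf phi x)))).
  rewrite IntD//; last by apply: L1D; apply: L1Z => //; exact: L1Z.
  rewrite IntD ?IntZ//; [|exact: L1Z|exact: L1Z|by do 2 apply: L1Z].
  rewrite I0; move: (Int _ _) (Int _ _) => X Y; lra.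
apply: Int_leT => //.
  by apply: L1D => //; apply: L1D; apply: L1Z => //; exact: L1Z.
move=> x; have [Ox|Ox] := pselect (O x); last first.
  rewrite (Cc_off Cp Ox) (Cc_off (Cc_partial i Cw) Ox) expr0n/= mulr0 !add0r.
  by do 2 (apply: mulr_ge0 => //); [rewrite mulr_ge0// sqr_ge0|exact: dot_ge0].
have sx := @smooth_coord R n i.
rewrite partialM//; last exact: smoothM.
rewrite partialM// partial_coord eqxx mulr1.
have h1 := sqr_le_dot (gradf phi x) i; rewrite mxE in h1.
have /ltW h2 := OM Ox i; move: h1 h2.
move: (dot _ _) (phi x) (partial i phi x) (x ord0 i) => D p q z h1 h2.
have h3 : q ^+ 2 * z ^+ 2 <= D * M0 ^+ 2.
  apply: ler_pM; rewrite ?sqr_ge0//.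
  by rewrite -(real_normK (num_real z)) lerXn2r ?nnegrE ?(ltW M00).
by have := sqr_ge0 (p + 2 * (q * z)); nra.
Qed.


Lemma continuous_gradf phi : smooth phi -> continuous (fun x => dot (gradf phi x) (gradf phi x) : R).
Proof.
move=> sp; apply: (@smooth_continuous R n); apply: smooth_sum => i.
rewrite (_ : (fun x => _) = fun x => partial i phi x * partial i phi x).
  by apply: smoothM; exact: smooth_partial.
by apply/funext => x; rewrite !mxE.
Qed.

End inequalities.

Lemma rV_continuousM (R : realType) n (u v : 'rV[R]_n -> R) : continuous u -> continuous v ->
  continuous (fun x => u x * v x).
Proof. by move=> cu cv x; exact: (@cvgM _ _ (nbhs x) _ u v _ _ (cu x) (cv x)). Qed.

(** * Sobolev's inequality for test functions *)

Section sobolev_inequality.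
Context (R : realType).

(** The hypotheses give [X ^ 2 <= Y ^ (2 r) <= (E X) ^ r]. For [X > 0] the power [X ^ r] may be
    divided out, and [2 - r > 0]. *)
Lemma self_improve (X Y E r : R) : 0 <= X -> 0 <= Y -> 0 <= E -> 0 < r < 2 ->
  X <= Y `^ r -> Y ^+ 2 <= E * X -> X <= E `^ (r / (2 - r)).
Proof.
move=> X0 Y0 E0 /andP[r0 r2] XY YE.
have [X1|X1] := leP X 0; first by apply: le_trans X1 _; exact: powR_ge0.
have d0 : 0 < 2 - r by lra.
have h : X `^ 2 <= (E * X) `^ r.
  apply: (@le_trans _ _ ((Y `^ r) `^ 2)); first by apply: ge0_ler_powR; rewrite ?nnegrE ?powR_ge0.
  rewrite -powRrM mulrC powRrM powR_mulrn//.
  by apply: ge0_ler_powR; rewrite ?nnegrE ?(ltW r0) ?sqr_ge0// mulr_ge0.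
have Xr : 0 < X `^ r by exact: powR_gt0.
have h2 : X `^ (2 - r) <= E `^ r.
  rewrite -(ler_pM2r Xr).
  have <- : X `^ 2 = X `^ (2 - r) * X `^ r by rewrite -powRD ?(gt_eqF X1) ?implybT// subrK.
  by rewrite -powRM.
have -> : X = (X `^ (2 - r)) `^ (2 - r)^-1 by rewrite -powRrM mulfV ?gt_eqF// powRr1.
rewrite powRrM; clear -h2 d0.
by apply: ge0_ler_powR; rewrite ?nnegrE ?powR_ge0// invr_ge0 ltW.
Qed.

Lemma sobolev_exponentE (z : R) : 0 < z -> (1 + z^-1) * (1 + (z + 1)^-1) = 1 + 2 * z^-1.
Proof. by move=> z0; field; rewrite gt_eqF//= gt_eqF// addr_gt0. Qed.

Lemma sobolev_exponentE2 (z : R) : 0 < z ->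
  1 + 2 * z^-1 = (1 + (z + 1)^-1) / (2 - (1 + (z + 1)^-1)).
Proof.
move=> z0; have z1 : z + 1 != 0 by rewrite gt_eqF// addr_gt0.
have -> : 2 - (1 + (z + 1)^-1) = z / (z + 1) by field.
by field; rewrite z1 gt_eqF.
Qed.

Variable k : nat.
Local Notation n := k.+3.
Variables (O : set 'rV[R]_n) (oO : open O).
Local Notation mR := (measurableTypeR R).
Local Notation tau := (tuple_lebesgue R n).
Local Notation leb := (@lebesgue_measure R).
Local Notation nu := (dmu oO).
Local Notation upd := (@upd R n).
Implicit Types (phi : 'rV[R]_n -> R) (i : 'I_n).

Variable M0 : R.
Hypothesis M00 : 0 < M0.
Hypothesis OM : forall x, O x -> forall i, `|x ord0 i| < M0.

Local Notation a := (k.+1%:R^-1 : R).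

Lemma sobolev_exponent_gt0 : 0 < a. Proof. by rewrite invr_gt0. Qed.


Let pw phi x : R := `|phi x| * (phi x ^+ 2) `^ a.
Let sg phi x : R := Num.sqrt (dot (gradf phi x) (gradf phi x)).

Lemma continuous_pw phi : smooth phi -> continuous (pw phi : 'rV[R]_n -> R).
Proof.
move=> sp; have cp := smooth_continuous sp; apply: rV_continuousM => x.
  exact: (cvg_norm (cp x)).
apply: (@continuous_comp _ _ _ phi (fun s : R => (s ^+ 2) `^ a)); first exact: cp.
by apply: continuous_sqr_powR; exact: sobolev_exponent_gt0.
Qed.

Lemma continuous_sg phi : smooth phi -> continuous (sg phi : 'rV[R]_n -> R).
Proof.
move=> sp x; apply: (@continuous_comp _ _ _ (fun x => dot (gradf phi x) (gradf phi x)) Num.sqrt).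
  exact: continuous_gradf.
exact: sqrt_continuous.
Qed.

(** In dimension [n = k + 3] one has [a = 1 / (n - 2)], and the left-hand side is [|phi|] to the
    power [2 (n - 1) / (n - 2)]. It is the integral of its derivative along the line, and
    [|d_i phi|] is at most the length of the gradient, so that one integrand serves all
    directions. *)
Lemma Cc_sobolev_line phi t i : Cc_smooth O phi ->
  (phi (row_of t) ^+ 2) `^ (1 + a) <=
  Int leb (fun s => 2 * (1 + a) * (pw phi (row_of (upd t i s)) * sg phi (row_of (upd t i s)))).
Proof.
move=> Cp; have a0 := sobolev_exponent_gt0; have [sp [K [cK KO pK]]] := Cp.
pose w1 x : R := 2 * (1 + a) * (phi x * (phi x ^+ 2) `^ a) * partial i phi x.
pose w2 x : R := 2 * (1 + a) * (pw phi x * sg phi x).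
have cphi := smooth_continuous sp; have cd := smooth_continuous (smooth_partial i sp).
have c1 : continuous w1.
  apply: rV_continuousM cd; apply: rV_continuousM; first exact: smooth_continuous (smooth_cst _).
  apply: rV_continuousM => // x.
  apply: (@continuous_comp _ _ _ phi (fun s : R => (s ^+ 2) `^ a)); first exact: cphi.
  exact: continuous_sqr_powR.
have c2 : continuous w2.
  apply: rV_continuousM; first exact: smooth_continuous (smooth_cst _).
  by apply: rV_continuousM; [exact: continuous_pw|exact: continuous_sg].
have k1 x : ~ K x -> w1 x = 0 by move=> /pK e; rewrite /w1 e !(mul0r, mulr0).
have k2 x : ~ K x -> w2 x = 0 by move=> /pK e; rewrite /w2 /pw e normr0 !(mul0r, mulr0).
have [C1 C10 b1] := bounded_off_compact c1 cK k1.
have [C2 C20 b2] := bounded_off_compact c2 cK k2.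
have o1 x : ~ O x -> w1 x = 0 by move=> Ox; apply: k1 => /KO.
have o2 x : ~ O x -> w2 x = 0 by move=> Ox; apply: k2 => /KO.
have cl1 := cls1_line OM t i c1 o1 b1; have cl2 := cls1_line OM t i c2 o2 b2.
have [L1_ _] := cls1_L1 (ltW M00) cl1; have [L2_ _] := cls1_L1 (ltW M00) cl2.
apply: (@le_trans _ _ (Int leb (fun s => `|w1 (row_of (upd t i s))|))); last first.
  apply: Int_leT => //; first exact: L1_norm.
  move=> s; rewrite /w1 /w2 /pw /sg; set x := row_of _.
  rewrite !normrM [`|2|]ger0_norm// [`|1 + a|]ger0_norm ?addr_ge0 ?(ltW a0)//.
  rewrite [`|_ `^ _|]ger0_norm ?powR_ge0// -mulrA.
  apply: ler_wpM2l; first by rewrite mulr_ge0// addr_ge0// ltW.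
  apply: ler_wpM2l; first by apply: mulr_ge0 => //; exact: powR_ge0.
  rewrite -sqrtr_sqr ler_wsqrtr//; have := sqr_le_dot (gradf phi x) i; by rewrite mxE.
have tE : upd t i (tnth t i) = t.
  by apply: eq_from_tnth => j; rewrite tnth_mktuple; case: eqVneq => // ->.
pose F (s : R) : R := (phi (row_of (upd t i s)) ^+ 2) `^ (1 + a).
have FM s : M0 <= `|s| -> F s = 0.
  move=> sM; rewrite /F (Cc_off Cp) ?expr0n ?powR0 ?gt_eqF ?addr_gt0//.
  by move=> /OM/(_ i); rewrite mxE tnth_mktuple eqxx ltNge sM.
rewrite -[X in row_of X]tE.
apply: (@line_le R F (fun s => w1 (row_of (upd t i s))) M0 C1 (tnth t i) M00).
- move=> s; have := @is_derive1_comp R (fun r : R => (r ^+ 2) `^ (1 + a)) (fun s => phi (row_of (upd t i s))) s _ _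
    (is_derive_sqr_powR _ a0) (is_derive_upd t i s sp).
  by rewrite -mulrA => h; apply: is_derive_eq; rewrite /w1 mulrA.
- exact: continuous_line.
- by apply: FM; rewrite normrN ger0_norm// ltW.
- move=> s sM; apply: FM; rewrite ler0_norm; last by have := ltW M00; lra.
  by lra.
- exact: cl1.
Qed.

(** The exponent [n / (n - 1)] of Gagliardo's inequality turns the power above into the critical
    one, [2 n / (n - 2) = 2 (1 + 2 a)], which gives [X <= Y ^ (n / (n - 1))]. The square of [pw] is
    again the critical power, so Cauchy-Schwarz yields [Y ^ 2 <= c ^ 2 DG X], and [self_improve]
    solves for [X]. *)
Lemma Cc_sobolev phi : Cc_smooth O phi ->
  L1 nu (fun x => (phi x ^+ 2) `^ (1 + 2 * a)) /\
  Int nu (fun x => (phi x ^+ 2) `^ (1 + 2 * a)) <=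
  ((2 * (1 + a)) ^+ 2 * DG nu (gradf phi) (gradf phi)) `^ (1 + 2 * a).
Proof.
move=> Cp; have a0 := sobolev_exponent_gt0; have [sp [K [cK KO pK]]] := Cp.
have s0 : 0 < 1 + 2 * a by rewrite addr_gt0// mulr_gt0.
pose c : R := 2 * (1 + a).
have c0 : 0 <= c by rewrite mulr_ge0// addr_ge0// ltW.
pose Ph x : R := (phi x ^+ 2) `^ (1 + a).
pose w2 x : R := c * (pw phi x * sg phi x).
pose w3 x : R := (phi x ^+ 2) `^ (1 + 2 * a).
have cphi := smooth_continuous sp.
have c1 : continuous Ph.
  move=> x; apply: (@continuous_comp _ _ _ phi (fun s : R => (s ^+ 2) `^ (1 + a))); first exact: cphi.
  by apply: continuous_sqr_powR; rewrite addr_gt0.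
have c3 : continuous w3.
  move=> x; apply: (@continuous_comp _ _ _ phi (fun s : R => (s ^+ 2) `^ (1 + 2 * a))); first exact: cphi.
  exact: continuous_sqr_powR.
have c2 : continuous w2.
  apply: rV_continuousM; first exact: smooth_continuous (smooth_cst _).
  by apply: rV_continuousM; [exact: continuous_pw|exact: continuous_sg].
have k1 x : ~ K x -> Ph x = 0 by move=> /pK e; rewrite /Ph e expr0n powR0// gt_eqF ?addr_gt0.
have k2 x : ~ K x -> w2 x = 0 by move=> /pK e; rewrite /w2 /pw e normr0 !(mul0r, mulr0).
have k3 x : ~ K x -> w3 x = 0 by move=> /pK e; rewrite /w3 e expr0n powR0// gt_eqF.
have [C1 C10 b1] := bounded_off_compact c1 cK k1.
have [C2 C20 b2] := bounded_off_compact c2 cK k2.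
have [C3 C30 b3] := bounded_off_compact c3 cK k3.
have o1 x : ~ O x -> Ph x = 0 by move=> Ox; apply: k1 => /KO.
have o2 x : ~ O x -> w2 x = 0 by move=> Ox; apply: k2 => /KO.
have o3 x : ~ O x -> w3 x = 0 by move=> Ox; apply: k3 => /KO.
have [L3 I3] := L1_off oO OM c3 o3 b3; have [L2_ I2] := L1_off oO OM c2 o2 b2.
split => //.
have w20 x : 0 <= w2 x.
  by rewrite /w2; apply: mulr_ge0 => //; apply: mulr_ge0; [apply: mulr_ge0 => //; exact: powR_ge0|exact: sqrtr_ge0].
have := @gagliardo R k.+1 M0 C1 C2 (Ph \o @row_of R n) (w2 \o @row_of R n) (ltW M00)
  (cls_off OM c1 o1 b1) (cls_off OM c2 o2 b2) (fun t => powR_ge0 _ _) (fun t => w20 _)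
  (fun t i => Cc_sobolev_line t i Cp).
rewrite -I2.
have eE : (1 + a) * (1 + (k.+2%:R)^-1) = 1 + 2 * a by rewrite -[k.+2%:R]natr1 sobolev_exponentE.
have -> : Int tau (fun t => (Ph \o @row_of R n) t `^ (1 + k.+2%:R^-1)) = Int nu w3.
  by rewrite I3; congr Int; apply/funext => t; rewrite /Ph /w3/= -powRrM eE.
set X := Int nu w3; set Y := Int nu w2 => XY.
have X0 : 0 <= X by apply: Int_ge0 => x; exact: powR_ge0.
have Y0 : 0 <= Y by exact: Int_ge0.
have E0 : 0 <= c ^+ 2 * DG nu (gradf phi) (gradf phi) by rewrite mulr_ge0 ?sqr_ge0 ?DG_ge0.
have -> : 1 + 2 * a = (1 + k.+2%:R^-1) / (2 - (1 + k.+2%:R^-1)).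
  by rewrite -[k.+2%:R]natr1 sobolev_exponentE2.
apply: self_improve X0 Y0 E0 _ XY _.
  have h : 0 < (k.+2%:R : R)^-1 < 1 by rewrite invr_gt0 ltr0n/= invf_lt1 ?ltr1n// ltr0n.
  by case/andP: h => h1 h2; rewrite addr_gt0//= -ltrBrDl (_ : 2 - 1 = 1)//; ring.
have qE x : pw phi x ^+ 2 = w3 x.
  rewrite /pw /w3 exprMn real_normK ?num_real// powRD; last by rewrite gt_eqF.
  rewrite (_ : 2 * a = a * 2); last exact: mulrC.
  by rewrite powRrM powR_mulrn ?powR_ge0// powRr1 ?sqr_ge0.
have gE x : sg phi x ^+ 2 = dot (gradf phi x) (gradf phi x) by rewrite sqr_sqrtr// dot_ge0.
have Lq : L2 nu (pw phi).
  split; last by under eq_fun do rewrite qE.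
  by apply: continuous_measurable_cara; exact: continuous_pw.
have Ls : L2 nu (sg phi).
  split; last by under eq_fun do rewrite gE; exact: L1_dot (Cc_L2v oO OM Cp) (Cc_L2v oO OM Cp).
  by apply: continuous_measurable_cara; exact: continuous_sg.
rewrite /Y IntZ; last exact: L2_mul.
rewrite exprMn -mulrA ler_wpM2l ?sqr_ge0//; apply: le_trans (Int_CS Lq Ls) _.
under eq_fun do rewrite qE.
by under [X in _ * Int _ X]eq_fun do rewrite gE; rewrite mulrC.
Qed.

End sobolev_inequality.

(** * The fundamental lemma of the calculus of variations *)

Section almost_everywhere_sign.
Context d (T : measurableType d) (R : realType).
Variable mu : {measure set T -> \bar R}.
Implicit Types f h : T -> R.

Lemma ae_le0 f h : L1 mu f ->
  (\forall x \ae mu, f x = Num.max (h x) 0) -> Int mu f <= 0 -> \forall x \ae mu, h x <= 0.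
Proof.
move=> Lf fh If.
have : \forall x \ae mu, f x = 0.
  by apply: Int_eq0 => //; apply: filterS fh => x ->; rewrite le_max lexx orbT.
by apply: filterS2 fh => x -> <-; rewrite le_max lexx.
Qed.

Lemma ae_eq0 h : (\forall x \ae mu, h x <= 0) -> (\forall x \ae mu, - h x <= 0) ->
  \forall x \ae mu, h x = 0.
Proof.
by apply: filterS2 => x h1; rewrite oppr_le0 => h2; apply/eqP; rewrite eq_le h1.
Qed.

End almost_everywhere_sign.

(** * Bumps in boxes and functions orthogonal to them *)

Section box_bumps.
Context (R : realType) (n : nat).
Local Notation mR := (measurableTypeR R).
Local Notation T0 := (caratheodory_type (@lebesgue_outer R n)).
Local Notation tp := (n.-tuple mR).
Local Notation tau := (tuple_lebesgue R n).
Local Notation mu := (lebesgue R n).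
Implicit Types (a c : 'I_n -> R) (x : 'rV[R]_n).

Lemma ebump_le (s t : R) : s <= t -> ebump 1 s <= ebump 1 t.
Proof.
move=> st; rewrite /ebump; case: ifPn => s0; last by have /andP[] := ebump01 t.
rewrite (lt_le_trans s0 st) !hornerC !mul1r ler_expR lerN2 lef_pV2 ?posrE//.
exact: lt_le_trans st.
Qed.

Lemma ebump_shift_cvg (t : R) :
  ebump 1 (k.+1%:R * t - 1) @[k --> \oo] --> (if 0 < t then 1 else 0 : R).
Proof.
case: ifPn => [t0|]; last first.
  rewrite -leNgt => t0; rewrite (_ : (fun k : nat => _) = fun=> 0); first exact: cvg_cst.
  apply/funext => k; rewrite /ebump ltNge (_ : _ <= 0)//.
  by rewrite subr_le0 (le_trans _ ler01)// mulr_ge0_le0.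
have h := @ebump_cvg R (t / 2); rewrite divr_gt0// in h.
apply: (squeeze_cvgr _ h (cvg_cst (1 : R))).
have [m _ mP] := near_natS_gt (2 / t); exists m => // k /= mk.
have /andP[_ ->] := ebump01 (k.+1%:R * t - 1); rewrite andbT; apply: ebump_le.
have := mP k mk; rewrite ltr_pdivrMr// => /ltW.
by set z := _ * t; rewrite mulrA -/z; lra.
Qed.

(** The shift by [1] inside each factor keeps the support at distance [1 / (k + 1)] from the faces,
    hence compact in the open box; as [k] grows the bumps tend to the indicator of the box. *)
Definition bump k a c x : R := \prod_(i < n)
  (ebump 1 (k.+1%:R * (x ord0 i - a i) - 1) * ebump 1 (k.+1%:R * (c i - x ord0 i) - 1)).

Lemma smooth_bump k a c : smooth (bump k a c).
Proof.
apply: smooth_prod => i; apply: smoothM; apply: smooth_ebump; apply: smoothD; try exact: smooth_cst;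
  apply: smoothZ; apply: smoothD; try exact: smooth_cst; try exact: smooth_coord.
by under eq_fun do rewrite -mulN1r; apply: smoothZ; exact: smooth_coord.
Qed.

Lemma bump01 k a c x : 0 <= bump k a c x <= 1.
Proof.
rewrite /bump; apply: (big_ind (fun z : R => 0 <= z <= 1)) => [|u v /andP[u0 u1] /andP[v0 v1]|i _].
- by rewrite ler01 lexx.
- by rewrite mulr_ge0//= mulr_ile1.
- have /andP[u0 u1] := ebump01 (k.+1%:R * (x ord0 i - a i) - 1).
  have /andP[v0 v1] := ebump01 (k.+1%:R * (c i - x ord0 i) - 1).
  by rewrite mulr_ge0//= mulr_ile1.
Qed.

Lemma bump_off k a c x : ~ (forall i, a i + k.+1%:R^-1 <= x ord0 i <= c i - k.+1%:R^-1) ->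
  bump k a c x = 0.
Proof.
move=> /existsNP[i hi]; rewrite /bump (bigD1 i)//=.
suff -> : ebump 1 (k.+1%:R * (x ord0 i - a i) - 1) * ebump 1 (k.+1%:R * (c i - x ord0 i) - 1) = 0.
  by rewrite mul0r.
have k0 : 0 < k.+1%:R :> R by rewrite ltr0n.
apply/eqP; rewrite mulf_eq0; apply: contra_notT hi; rewrite negb_or => /andP[h1 h2].
have h (t : R) : ebump 1 (k.+1%:R * t - 1) != 0 -> k.+1%:R^-1 <= t.
  move=> hn; have : 0 < k.+1%:R * t - 1.
    by rewrite -ebump_gt0 lt_neqAle eq_sym hn/=; case/andP: (ebump01 (k.+1%:R * t - 1)).
  by rewrite subr_gt0 -ltr_pdivrMl// mulr1 => /ltW.
have := h _ h1; have := h _ h2; move: (k.+1%:R^-1) (x ord0 i) => d z.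
by move=> h3 h4; apply/andP; split; lra.
Qed.

Lemma Cc_bump k a c (O : set 'rV[R]_n) : (forall t, box a c t -> O (row_of t)) ->
  Cc_smooth O (bump k a c).
Proof.
move=> bO; split; first exact: smooth_bump.
exists [set x | forall i, `[a i + k.+1%:R^-1, c i - k.+1%:R^-1]%classic (x ord0 i)]; split.
- apply: (@rV_compact _ n (fun i => `[a i + k.+1%:R^-1, c i - k.+1%:R^-1]%classic)) => i.
  exact: segment_compact.
- move=> x xb; rewrite -(tupK x); apply: bO => i; rewrite tnth_mktuple.
  have k0 : 0 < k.+1%:R^-1 :> R by rewrite invr_gt0.
  have := xb i; rewrite /= in_itv/= => /andP[h1 h2].
  by rewrite (lt_le_trans _ h1) ?ltrDl// (le_lt_trans h2)// ltrBlDr ltrDl.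
- by move=> x xb; apply: bump_off => h; apply: xb => i; rewrite /= in_itv/=.
Qed.

Lemma bump_cvg a c x : bump k a c x @[k --> \oo] --> (\1_(box a c) (tup x) : R).
Proof.
have cp (s : seq 'I_n) : (\prod_(i <- s)
    (ebump 1 (k.+1%:R * (x ord0 i - a i) - 1) * ebump 1 (k.+1%:R * (c i - x ord0 i) - 1)) : R) @[k --> \oo] -->
    (\prod_(i <- s) ((if 0 < (x ord0 i - a i)%R then 1 else 0) * (if 0 < (c i - x ord0 i)%R then 1 else 0)) : R).
  elim: s => [|i s ih]; first by under eq_fun do rewrite big_nil; rewrite big_nil; exact: cvg_cst.
  under eq_fun do rewrite big_cons; rewrite big_cons; apply: cvgM ih.
  by apply: cvgM; exact: ebump_shift_cvg.
suff <- : \prod_(i < n) ((if 0 < (x ord0 i - a i)%R then 1 else 0) * (if 0 < (c i - x ord0 i)%R then 1 else 0)) =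
  \1_(box a c) (tup x) :> R by exact: cp.
rewrite indicE; case: (boolP (tup x \in box a c)) => [/set_mem h|].
  rewrite big1// => i _; have := h i; rewrite tnth_mktuple => /andP[h1 h2].
  by rewrite !subr_gt0 h1 h2 mulr1.
rewrite notin_setE => /existsNP[i]; rewrite tnth_mktuple => /negP hi.
rewrite (bigD1 i)//= !subr_gt0.
by move: hi; rewrite negb_and => /orP[]/negbTE ->; rewrite ?mul0r ?mulr0 ?mul0r.
Qed.

Definition boxes : set (set tp) := [set A | exists a c, A = box a c].

Lemma boxes_generate (A : set tp) : measurable A -> <<s boxes >> A.
Proof.
apply: smallest_sub; first exact: smallest_sigma_algebra.
apply: (big_ind (fun S : set (set tp) => S `<=` <<s boxes >>)) => // [S S' h h'|j _].
  by rewrite subUset.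
move=> _ [B mB <-].
suff : measurable_fun [set: g_sigma_algebraType boxes] (fun t : g_sigma_algebraType boxes => tnth (t : tp) j : mR).
  by move=> /(_ measurableT _ mB).
apply: (measurability _ (RGenOInfty.measurableE R)) => _ [_ [y ->] <-]; rewrite setTI.
have -> : (fun t : tp => tnth t j) @^-1` [set` `]y, +oo[] =
    \bigcup_m box (fun i => if i == j then y else - m%:R) (fun=> m%:R).
  apply/seteqP; split => t /=; last first.
    by move=> [m _ /(_ j)]; rewrite eqxx in_itv/= andbT => /andP[].
  rewrite in_itv/= andbT => yt.
  exists (\max_(i < n) (Num.trunc `|tnth t i|).+1) => // i.
  have h : `|tnth t i| < (\max_(i < n) (Num.trunc `|tnth t i|).+1)%:R.
    apply: (lt_le_trans (truncnS_gt _)); rewrite ler_nat.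
    exact: (leq_bigmax i).
  by move: h; rewrite ltr_norml => /andP[h1 ->]; rewrite andbT; case: eqVneq => [->|].
apply: sigma_algebra_bigcup => m; apply: sub_sigma_algebra.
by exists (fun i => if i == j then y else - m%:R), (fun=> m%:R).
Qed.

Lemma setI_closed_boxes : setI_closed boxes.
Proof.
move=> _ _ [a [c ->]] [a' [c' ->]].
exists (fun i => Num.max (a i) (a' i)), (fun i => Num.min (c i) (c' i)).
apply/seteqP; split => t.
  by move=> [h h'] i; have /andP[h1 h2] := h i; have /andP[h3 h4] := h' i; rewrite gt_max lt_min h1 h2 h3.
by move=> h; split => i; have := h i; rewrite gt_max lt_min => /andP[/andP[h1 h2] /andP[h3 h4]]; apply/andP.
Qed.

(** Boxes generate only the product sigma-algebra. A set of finite outer measure has nearly optimal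
    covers by sets of that sigma-algebra, and the intersection of countably many of them has the
    same measure. *)
Lemma tup_hull (E : set T0) : (mu E < +oo)%E ->
  exists A : set tp, [/\ measurable A, E `<=` @tup R n @^-1` A & (tau A <= mu E)%E].
Proof.
move=> Efin.
have fE : mu_ext tau (@row_of R n @^-1` E) \is a fin_num.
  by rewrite ge0_fin_numE// outer_measure_ge0.
have ex k : exists A : set tp, [/\ measurable A, E `<=` @tup R n @^-1` A &
    (tau A <= mu E + k.+1%:R^-1%:E)%E].
  have k0 : 0 < k.+1%:R^-1 :> R by rewrite invr_gt0.
  have [_ [F [mF FE] <-] hF] := lb_ereal_inf_adherent k0 fE.
  have mU : measurable (\bigcup_j F j) by exact: bigcup_measurable.
  exists (\bigcup_j F j); split => //.
    by move=> x Ex /=; apply: FE; rewrite /= tupK.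
  apply: le_trans (ltW hF); exact: measure_sigma_subadditive.
have /choice[A AP] := ex.
exists (\bigcap_k A k); split.
- by apply: bigcap_measurable => // k _; case: (AP k).
- by move=> x Ex k _; case: (AP k) => _ + _; apply.
- apply/lee_addgt0Pr => e e0; have [k kP] := en_small e0.
  have [mA _ h] := AP k; apply: (@le_trans _ _ (tau (A k))).
    apply: le_measure; rewrite ?inE//; last exact: bigcap_inf.
    by apply: bigcap_measurable => // j _; case: (AP j).
  by apply: le_trans h _; rewrite leeD2l// lee_fin; exact: (kP k).
Qed.

Section vanishing.
Variables (h : T0 -> R) (a c : 'I_n -> R).
Hypothesis Lh : L1 mu h.
Hypothesis h_off : forall x : T0, ~ box a c (tup x) -> h x = 0.
Hypothesis h_bump : forall k a' c', (forall i, a i <= a' i) -> (forall i, c' i <= c i) ->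
  Int mu (fun x => h x * bump k a' c' x) = 0.

Let ind (A : set tp) (x : T0) : R := \1_A (tup x).

Let m_ind A : measurable A -> measurable_fun setT (ind A).
Proof.
move=> mA; apply: (measurableT_comp (f := (\1_A : tp -> R))); last exact: measurable_tup.
exact: measurable_indic.
Qed.

Let m_hind A : measurable A -> measurable_fun setT (fun x : T0 => h x * ind A x).
Proof. by move=> mA; apply: measurable_funM; [exact: (L1_mf Lh)|exact: m_ind]. Qed.

Let le_hind A x : `|h x * ind A x| <= `|h x|.
Proof.
by rewrite /ind indicE normrM; case: (_ \in _); rewrite ?normr1 ?mulr1// normr0 mulr0.
Qed.

Let L_hind A : measurable A -> L1 mu (fun x : T0 => h x * ind A x).
Proof. by move=> mA; apply: (L1_domT (m_hind mA) (L1_norm Lh)); exact: le_hind. Qed.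

Let box_zero A : boxes A -> Int mu (fun x => h x * ind A x) = 0.
Proof.
move=> [a' [c' ->]].
pose a1 i := Num.max (a i) (a' i); pose c1 i := Num.min (c i) (c' i).
have E x : h x * ind (box a' c') x = h x * ind (box a1 c1) x.
  have [Qx|Qx] := pselect (box a c (tup x)); last by rewrite h_off// !mul0r.
  congr (_ * _); rewrite /ind !indicE; congr (_%:R); congr nat_of_bool; apply/idP/idP => /set_mem hx; apply/mem_set => i.
    by have := hx i; have := Qx i; rewrite /a1 /c1 gt_max lt_min => /andP[-> ->] /andP[-> ->].
  by have := hx i; rewrite /a1 /c1 gt_max lt_min => /andP[/andP[_ ->] /andP[_ ->]].
under eq_fun do rewrite E.
have : Int mu (fun x => h x * bump k a1 c1 x) @[k --> \oo] --> Int mu (fun x => h x * ind (box a1 c1) x).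
  refine (@Int_dct _ _ _ mu (fun k (x : T0) => h x * bump k a1 c1 x) (fun x : T0 => h x * ind (box a1 c1) x)
    (fun x : T0 => `|h x|) _ _ _ _ _).2.
  - move=> k; apply: measurable_funM; first exact: (L1_mf Lh).
    by apply: continuous_measurable_cara; exact: smooth_continuous (smooth_bump k a1 c1).
  - by apply: m_hind; exact: box_measurable.
  - exact: L1_norm.
  - move=> k; apply: aeW => x; rewrite normrM -[leRHS]mulr1 ler_wpM2l//.
    by have /andP[h0 h1] := bump01 k a1 c1 x; rewrite ger0_norm.
  - by apply: aeW => x; apply: cvgM; [exact: cvg_cst|exact: bump_cvg].
rewrite (_ : (fun k => _) = fun=> 0); first by move=> /cvg_unique; apply => //; exact: cvg_cst.
by apply/funext => k; apply: h_bump => i; rewrite /a1 /c1 ?le_max ?ge_min lexx.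
Qed.

(** The sets with this property form a lambda-system, and the boxes are a generating class stable
    under intersection. *)
Let all_zero A : measurable A -> Int mu (fun x => h x * ind A x) = 0.
Proof.
move=> mA.
pose H : set (set tp) := [set A | measurable A /\ Int mu (fun x => h x * ind A x) = 0].
suff : H A by case.
apply: (@lambda_system_subset _ boxes setI_closed_boxes setT H); last exact: boxes_generate.
- split => //.
  + split; first exact: measurableT.
    rewrite -[RHS](@box_zero (box a c)); last by exists a, c.
    congr Int; apply/funext => x; have [Qx|Qx] := pselect (box a c (tup x)); last by rewrite h_off// !mul0r.
    by rewrite /ind !indicE in_setT mem_set.
  + move=> A1 A2 A21 [m1 z1] [m2 z2]; split; first exact: measurableD.
    rewrite (_ : (fun x => _) = fun x => h x * ind A1 x - h x * ind A2 x).
      by rewrite IntB ?z1 ?z2 ?subrr//; exact: L_hind.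
    apply/funext => x; rewrite -mulrBr; congr (_ * _); rewrite /ind !indicE in_setD.
    case: (boolP (tup x \in A2)) => [/[dup] /set_mem/A21/mem_set ->|_]; first by rewrite subrr.
    by rewrite andbT subr0.
  + move=> F ndF HF; have mU : measurable (\bigcup_j F j) by apply: bigcup_measurable => j _; case: (HF j).
    split => //.
    have : Int mu (fun x => h x * ind (F k) x) @[k --> \oo] --> Int mu (fun x => h x * ind (\bigcup_j F j) x).
      refine (@Int_dct _ _ _ mu (fun k (x : T0) => h x * ind (F k) x) (fun x : T0 => h x * ind (\bigcup_j F j) x)
        (fun x : T0 => `|h x|) _ _ _ _ _).2.
      * by move=> k; apply: m_hind; case: (HF k).
      * exact: m_hind.
      * exact: L1_norm.
      * by move=> k; apply: aeW => x; exact: le_hind.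
      * apply: aeW => x; apply: cvgM; first exact: cvg_cst.
        rewrite /ind indicE; case: (boolP (tup x \in _)) => [/set_mem[j _ Fj]|].
          apply: cvg_near_cst; exists j => // k /= jk; rewrite indicE mem_set//.
          by have /subsetPset := ndF _ _ jk; apply.
        rewrite notin_setE => nU; rewrite (_ : (fun k => _) = fun=> 0); first exact: cvg_cst.
        by apply/funext => k; rewrite indicE memNset// => Fk; apply: nU; exists k.
    rewrite (_ : (fun k => _) = fun=> 0); first by move=> /cvg_unique; apply => //; exact: cvg_cst.
    by apply/funext => k; case: (HF k).
- by move=> B Bb; split; [case: Bb => a' [c' ->]; exact: box_measurable|exact: box_zero].
- by [].
Qed.

(** The set [h > 0] differs by a null set from the preimage of its hull [A], so the integral of [h]
    over [A], which is [0], is the integral of the positive part of [h]. *)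
Lemma vanishing_le : {ae mu, forall x, h x <= 0}.
Proof.
have mh := L1_mf Lh.
pose E : set T0 := [set x | 0 < h x].
have mE : measurable E.
  rewrite (_ : E = h @^-1` `]0, +oo[); first by rewrite -[X in measurable X]setTI; exact: mh.
  by apply/seteqP; split => x /=; rewrite in_itv/= andbT.
have Q_fin : (mu (@tup R n @^-1` box a c) < +oo)%E.
  by rewrite lebesgue_tup ?box_finite//; exact: box_measurable.
have EQ : E `<=` @tup R n @^-1` box a c.
  by move=> x Ex; apply: contrapT => /h_off hx; move: Ex; rewrite /E/= hx ltxx.
have E_fin : (mu E < +oo)%E.
  by apply: le_lt_trans Q_fin; apply: le_measure; rewrite ?inE//; apply: tup_cara; exact: box_measurable.
have [A [mA EA tA]] := tup_hull E_fin.
have mA' := tup_cara mA.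
have null : mu (@tup R n @^-1` A `\` E) = 0%E.
  have h1 : (tau A = mu (@tup R n @^-1` A `\` E) + mu E)%E.
    by rewrite -(lebesgue_tup mA) -[X in (_ + mu X)%E](setIidr EA); exact: measureDI.
  apply/eqP; rewrite eq_le measure_ge0 andbT.
  rewrite -(@leeD2rE _ (mu E)) ?add0e -?h1//.
  by rewrite ge0_fin_numE// measure_ge0.
have ae0 : \forall x \ae mu, h x * ind A x = Num.max (h x) 0.
  exists (@tup R n @^-1` A `\` E); split => //; first exact: measurableD.
  move=> x /=; apply: contra_notP => hx; rewrite /ind indicE.
  have [Ex|Ex] := pselect (E x); first by rewrite mem_set ?mulr1 ?max_l// ?ltW//; exact: EA.
  have h0 : h x <= 0 by rewrite leNgt; apply/negP.
  rewrite memNset ?mulr0 ?max_r// => Ax; exact: hx.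
by apply: ae_le0 (L_hind mA) ae0 _; rewrite all_zero.
Qed.

End vanishing.

Lemma vanishing (h : T0 -> R) (a c : 'I_n -> R) : L1 mu h ->
  (forall x : T0, ~ box a c (tup x) -> h x = 0) ->
  (forall k a' c', (forall i, a i <= a' i) -> (forall i, c' i <= c i) ->
    Int mu (fun x => h x * bump k a' c' x) = 0) ->
  {ae mu, forall x, h x = 0}.
Proof.
move=> Lh ho hb; have h1 := vanishing_le Lh ho hb.
have h2 : {ae mu, forall x, - h x <= 0}.
  apply: (@vanishing_le (fun x => - h x) a c); first exact: L1N.
    by move=> x /ho ->; rewrite oppr0.
  move=> k a' c' ha hc; under eq_fun do rewrite mulNr.
  rewrite IntN ?hb ?oppr0//.
  apply: (L1_domT _ (L1_norm Lh)).
    apply: measurable_funM; first exact: (L1_mf Lh).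
    by apply: continuous_measurable_cara; exact: smooth_continuous (smooth_bump k a' c').
  move=> x; rewrite normrM -[leRHS]mulr1 ler_wpM2l//.
  by have /andP[b0 b1] := bump01 k a' c' x; rewrite ger0_norm.
exact: ae_eq0 h1 h2.
Qed.

End box_bumps.

(** * Weierstrass approximation *)

Section weierstrass.
Context (R : realType).
Implicit Types (f : R -> R) (M : R).

Lemma uniformly_continuous_itv f M e : continuous f -> 0 < e ->
  exists2 d, 0 < d & forall s t, - M <= t <= M -> `|s - t| < d -> `|f s - f t| <= e.
Proof.
move=> cf e0; have e2 : 0 < e / 2 by rewrite divr_gt0.
have /compact_near_coveringP cK := @segment_compact R (- M) M.
suff H x : `[- M, M]%classic x -> \forall x' \near x & i \near \oo, forall s, `|s - x'| < i.+1%:R^-1 -> `|f s - f x'| <= e.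
  have [k _ kP] := cK nat \oo (fun k t => forall s, `|s - t| < k.+1%:R^-1 -> `|f s - f t| <= e) _ H.
  exists k.+1%:R^-1; first by rewrite invr_gt0.
  move=> s t tM st; apply: (kP k (leqnn k)) => //=.
move=> _.
have /cvgrPdist_lt/(_ _ e2)/nbhs_ballP[d /= d0 dP] := cf x.
have d2 : 0 < d / 2 by rewrite divr_gt0.
have [m mP] := en_small d2.
near=> t k => s st.
have tx : `|t - x| < d / 2.
  by near: t; apply/nbhs_ballP; exists (d / 2) => //= y; rewrite /ball/= distrC.
have sk : k.+1%:R^-1 <= d / 2 by apply: (mP k); near: k; exists m.
have h1 : `|f x - f t| < e / 2.
  by apply: dP; rewrite /ball/= distrC (lt_trans tx)// ltr_pdivrMr// ltr_pMr// ltr1n.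
have h2 : `|f x - f s| < e / 2.
  apply: dP; rewrite /ball/= distrC -(subrKA t) (le_lt_trans (ler_normD _ _))//.
  by rewrite [ltRHS](splitr d) ltrD// (lt_le_trans st).
rewrite -(subrKA (f x)) (le_trans (ler_normD _ _))// [leRHS](splitr e) lerD// ltW//.
by rewrite distrC.
Unshelve. all: by end_near. Qed.

(* Bernstein's polynomials as the expectations of [g] along the random walk
   that starts from [s] and jumps by [h] with probability [p]. *)
Fixpoint walk (p : {poly R}) (h : R) n (g : R -> R) (s : R) : {poly R} :=
  if n is n'.+1 then p * walk p h n' g (s + h) + (1 - p) * walk p h n' g s else (g s)%:P.

Lemma walk_le p h n g g' s x : 0 <= p.[x] <= 1 -> (forall y, g y <= g' y) ->
  (walk p h n g s).[x] <= (walk p h n g' s).[x].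
Proof.
move=> /andP[p0 p1] gg; elim: n s => [|n ih] s /=; first by rewrite !hornerC.
by rewrite !hornerE; apply: lerD; apply: ler_wpM2l => //; rewrite subr_ge0.
Qed.

(** Mean and variance of [n] independent jumps: the mean position is [s + n h p], the variance
    [n h ^ 2 p (1 - p)]. *)
Lemma walk_moments p h n s c x a b :
  (walk p h n (fun y => a + b * (y - c) ^+ 2) s).[x] =
  a + b * ((s + n%:R * (h * p.[x]) - c) ^+ 2 + n%:R * (h ^+ 2 * (p.[x] * (1 - p.[x])))).
Proof.
elim: n s => [|n ih] s /=; first by rewrite hornerC !mul0r !addr0.
rewrite hornerD !hornerM !ih hornerD hornerN hornerC -[n.+1%:R]natr1.
by move: (p.[x]) (n%:R : R) => q m; ring.
Qed.

(** Uniform continuity and boundedness give [|f y - f x| <= e / 2 + K (y - x) ^ 2] with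
    [K = 2 C / d ^ 2]. The walk starts from [- M] and makes [m + 1] jumps of length [2 M / (m + 1)]
    with probability [(x + M) / (2 M)]: its mean is exactly [x] and its variance at most
    [M ^ 2 / (m + 1)]. *)
Lemma weierstrass f M e : continuous f -> 0 < M -> 0 < e ->
  exists p : {poly R}, forall x, - M <= x <= M -> `|p.[x] - f x| <= e.
Proof.
move=> cf M0 e0; have e2 : 0 < e / 2 by rewrite divr_gt0.
have [d d0 dP] := uniformly_continuous_itv M cf e2.
have : compact (f @` `[- M, M]).
  by apply: continuous_compact; [exact: continuous_subspaceT|exact: segment_compact].
move=> /compact_bounded/pinfty_ex_gt0[C C0 CP].
have fC x : - M <= x <= M -> `|f x| <= C by move=> xM; apply: CP; exists x => //=; rewrite in_itv.
(* Composing [f] with the projection makes the quadratic bound hold at every real [y], as the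
   monotonicity of [walk] asks. *)
pose cl (y : R) := Num.max (- M) (Num.min M y).
have clM y : - M <= cl y <= M by rewrite /cl le_max lexx/= ge_max ge_min lexx andbT; lra.
have cl_dist y x : - M <= x <= M -> `|cl y - x| <= `|y - x|.
  rewrite /cl => /andP[x1 x2]; have [h1|h1] := leP M y.
    by rewrite max_r; [rewrite !ger0_norm; lra|lra].
  have [h2|h2] := leP (- M) y; first by [].
  by rewrite !ler0_norm; lra.
pose K := 2 * C / d ^+ 2.
have d2 : 0 < d ^+ 2 by rewrite exprn_gt0.
have K0 : 0 <= K by rewrite divr_ge0// ?(ltW d2)// mulr_ge0// ltW.
have key x y : - M <= x <= M -> `|f (cl y) - f x| <= e / 2 + K * (y - x) ^+ 2.
  move=> xM; have y2 : 0 <= K * (y - x) ^+ 2 by rewrite mulr_ge0 ?sqr_ge0.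
  have [h|h] := ltP `|cl y - x| d; first by apply: le_trans (dP _ _ xM h) _; rewrite lerDl.
  apply: (@le_trans _ _ (K * (y - x) ^+ 2)); last by rewrite lerDr ltW.
  apply: (@le_trans _ _ (2 * C)).
    by have := ler_normB (f (cl y)) (f x); have := fC _ (clM y); have := fC _ xM; lra.
  rewrite /K -mulrA ler_peMr//; first by rewrite mulr_ge0// ltW.
  rewrite mulrC ler_pdivlMr// mul1r -(real_normK (num_real (y - x))).
  by rewrite lerXn2r ?nnegrE ?(ltW d0)// (le_trans h)// cl_dist.
have N2 : 0 < 2 * M by rewrite mulr_gt0.
have [m mP] : exists m, K * M ^+ 2 * 2 / e < m.+1%:R.
  by have [m _ mP] := near_natS_gt (K * M ^+ 2 * 2 / e); exists m; apply: mP => /=.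
pose p : {poly R} := (2 * M)^-1 *: ('X + M%:P).
pose h := 2 * M / m.+1%:R.
exists (walk p h m.+1 (f \o cl) (- M)) => x xM.
have px : p.[x] = (x + M) / (2 * M) by rewrite /p !hornerE mulrC.
have p01 : 0 <= p.[x] <= 1.
  by rewrite px divr_ge0 ?(ltW N2)//=; [rewrite ler_pdivrMr// mul1r|]; move/andP: xM => [? ?]; lra.
have n0 : m.+1%:R != 0 :> R by rewrite pnatr_eq0.
have mean : - M + m.+1%:R * (h * p.[x]) - x = 0.
  rewrite px /h; move: n0; move: (m.+1%:R : R) => z z0.
  by field; rewrite z0 gt_eqF.
have bound : K * (m.+1%:R * (h ^+ 2 * (p.[x] * (1 - p.[x])))) <= e / 2.
  have -> : m.+1%:R * (h ^+ 2 * (p.[x] * (1 - p.[x]))) = 4 * M ^+ 2 * (p.[x] * (1 - p.[x])) / m.+1%:R.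
    by rewrite /h; move: n0; move: (m.+1%:R : R) => z z0; field.
  rewrite mulrA ler_pdivrMr ?ltr0n//.
  rewrite ltr_pdivrMr// in mP.
  have p4 : 4 * (p.[x] * (1 - p.[x])) <= 1 by have := sqr_ge0 (2 * p.[x] - 1); nra.
  have KM : 0 <= K * M ^+ 2 by rewrite mulr_ge0 ?sqr_ge0.
  have : K * M ^+ 2 * (4 * (p.[x] * (1 - p.[x]))) <= K * M ^+ 2 by rewrite ler_piMr.
  by move: mP; move: (m.+1%:R : R) => z; lra.
have up : (walk p h m.+1 (f \o cl) (- M)).[x] <= f x + e / 2 + K * (m.+1%:R * (h ^+ 2 * (p.[x] * (1 - p.[x])))).
  apply: le_trans (walk_le h m.+1 (- M) p01 (g' := fun y => f x + e / 2 + K * (y - x) ^+ 2) _) _.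
    by move=> y /=; have := key x y xM; rewrite ler_norml => /andP[_]; lra.
  by rewrite walk_moments mean expr0n add0r.
have lo : f x - e / 2 + - K * (m.+1%:R * (h ^+ 2 * (p.[x] * (1 - p.[x])))) <= (walk p h m.+1 (f \o cl) (- M)).[x].
  apply: le_trans _ (walk_le h m.+1 (- M) p01 (g := fun y => f x - e / 2 + - K * (y - x) ^+ 2) _).
    by rewrite walk_moments mean expr0n add0r.
  by move=> y /=; have := key x y xM; rewrite ler_norml => /andP[+ _]; lra.
rewrite ler_norml; move: bound up lo; rewrite mulNr; set z := K * _; set w := horner _ _.
by move: z w (f x) => z w v; lra.
Qed.

Lemma poly_primitive (q : {poly R}) : exists2 p : {poly R}, p^`() = q & p.[0] = 0.
Proof.
exists (\poly_(i < (size q).+1) (q`_i.-1 / i%:R)).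
  apply/polyP => i; rewrite coef_deriv coef_poly ltnS /=.
  case: ltnP => iq; last by rewrite mul0rn nth_default.
  by rewrite -[LHS]mulr_natr divfK// pnatr_eq0.
by rewrite horner_coef0 coef_poly /= invr0 mulr0.
Qed.

End weierstrass.

(** * The closure of the test functions *)

Lemma derive_bound0 (R : realType) (F F' : R -> R) (M C x : R) :
  (forall t : R, - M <= t <= M -> is_derive t (1 : R) F (F' t)) -> F 0 = 0 ->
  (forall t, - M <= t <= M -> `|F' t| <= C) -> `|x| <= M -> `|F x| <= C * `|x|.
Proof.
move=> dF F0 F'C; rewrite ler_norml => /andP[x1 x2].
have [x0|x0] := leP 0 x.
  have [|t /andP[t0 tx] e] := @mvt R F F' 0 x x0.
    by move=> t /andP[t0 tx]; apply: dF; apply/andP; split; lra.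
  rewrite -[F x]subr0 -F0 e subr0 normrM ler_wpM2r//.
  by apply: F'C; apply/andP; split; lra.
have [|t /andP[t0 tx] e] := @mvt R F F' x 0 (ltW x0).
  by move=> t /andP[t0 tx]; apply: dF; apply/andP; split; lra.
rewrite -normrN -[- F x]add0r -F0 e sub0r normrM normrN ler_wpM2r//.
by apply: F'C; apply/andP; split; lra.
Qed.

Section L2_closure.
Context d (T : measurableType d) (R : realType) (N : nat).
Variable mu : {measure set T -> \bar R}.
Variable P : (T -> R) -> (T -> 'rV[R]_N) -> Prop.
Hypothesis P_L2 : forall u G, P u G -> L2 mu u.
Hypothesis P_L2v : forall u G, P u G -> L2v mu G.
Implicit Types (u v w : T -> R) (G H K : T -> 'rV[R]_N).

Lemma Int_sqrB_le u v w : L2 mu u -> L2 mu v -> L2 mu w ->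
  Int mu (fun x => (u x - w x) ^+ 2) <=
  2 * Int mu (fun x => (u x - v x) ^+ 2) + 2 * Int mu (fun x => (v x - w x) ^+ 2).
Proof.
move=> Lu Lv Lw; have L1_ := (L2B Lu Lv).2; have L2_ := (L2B Lv Lw).2.
rewrite -!IntZ// -IntD; [|exact: L1Z..].
apply: Int_leT; [exact: (L2B Lu Lw).2|by apply: L1D; exact: L1Z|].
move=> x; have -> : u x - w x = (u x - v x) + (v x - w x) by rewrite addrA subrK.
by have := sqr_ge0 ((u x - v x) - (v x - w x)); nra.
Qed.

Lemma Int_sqr_le u v : L2 mu u -> L2 mu v ->
  Int mu (fun x => v x ^+ 2) <= 2 * Int mu (fun x => (u x - v x) ^+ 2) + 2 * Int mu (fun x => u x ^+ 2).
Proof.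
move=> Lu Lv; have L1_ := (L2B Lu Lv).2.
rewrite -!IntZ//; [|exact: Lu.2]; rewrite -IntD; [|exact: L1Z|by apply: L1Z; exact: Lu.2].
apply: Int_leT; [exact: Lv.2|by apply: L1D; apply: L1Z => //; exact: Lu.2|].
by move=> x; have := sqr_ge0 (v x - 2 * u x); nra.
Qed.

Lemma DG_le G H : L2v mu G -> L2v mu H ->
  DG mu H H <= 2 * DG mu (fun x => H x - G x) (fun x => H x - G x) + 2 * DG mu G G.
Proof.
move=> LG LH; have A1 := L1_dot (L2vB LH LG) (L2vB LH LG); have A2 := L1_dot LG LG.
rewrite /DG -!IntZ// -IntD; [|exact: L1Z..].
apply: Int_leT; [exact: L1_dot|by apply: L1D; exact: L1Z|].
move=> x; have := dot_ge0 (H x - 2 *: G x).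
rewrite !(dotBl, dotBr, dotDl, dotDr, dotNl, dotNr, dotZl, dotZr) (dotC (G x) (H x)).
by move: (dot (H x) (H x)) (dot (H x) (G x)) (dot (G x) (G x)) => r1 r2 r3; lra.
Qed.

Definition L2_closure u G := [/\ L2 mu u, L2v mu G & forall e, 0 < e ->
  exists v H, [/\ P v H, Int mu (fun x => (v x - u x) ^+ 2) <= e &
    DG mu (fun x => H x - G x) (fun x => H x - G x) <= e]].

Lemma L2_closure_sub u G : P u G -> L2_closure u G.
Proof.
move=> Pu; split; [exact: P_L2 Pu|exact: P_L2v Pu|move=> e e0; exists u, G; split => //].
  by under eq_fun do rewrite subrr expr0n; rewrite Int0 ltW.
by rewrite /DG; under eq_fun do rewrite subrr dot0l; rewrite Int0 ltW.
Qed.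

Lemma L2_closure_idem u G : L2 mu u -> L2v mu G ->
  (forall e, 0 < e -> exists v H, [/\ L2_closure v H, Int mu (fun x => (v x - u x) ^+ 2) <= e &
    DG mu (fun x => H x - G x) (fun x => H x - G x) <= e]) -> L2_closure u G.
Proof.
move=> Lu LG h; split => // e e0; have e4 : 0 < e / 4 by rewrite divr_gt0.
have [v [H [[Lv LH hv] v1 v2]]] := h _ e4.
have [w [K [Pw w1 w2]]] := hv _ e4.
exists w, K; split => //.
  by apply: le_trans (Int_sqrB_le (P_L2 Pw) Lv Lu) _; lra.
by apply: le_trans (DGBB_le (P_L2v Pw) LH LG) _; lra.
Qed.

Lemma L2_closure_closed (u_ : nat -> T -> R) (G_ : nat -> T -> 'rV[R]_N) u G :
  (forall n, L2_closure (u_ n) (G_ n)) -> L2 mu u -> L2v mu G ->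
  Int mu (fun x => (u_ n x - u x) ^+ 2) @[n --> \oo] --> 0 ->
  DG mu (fun x => G_ n x - G x) (fun x => G_ n x - G x) @[n --> \oo] --> 0 ->
  L2_closure u G.
Proof.
move=> h Lu LG cu cG; apply: L2_closure_idem => // e e0.
have /cvgr_lt/(_ _ e0)[m _ mP] := cu; have /cvgr_lt/(_ _ e0)[k _ kP] := cG.
exists (u_ (maxn m k)), (G_ (maxn m k)); split => //; apply: ltW.
  by apply: mP; rewrite /= leq_maxl.
by apply: kP; rewrite /= leq_maxr.
Qed.

Lemma L2_closure_lin c u G v H :
  (forall u G v H, P u G -> P v H -> P (fun x => u x + c * v x) (fun x => G x + c *: H x)) ->
  L2_closure u G -> L2_closure v H -> L2_closure (fun x => u x + c * v x) (fun x => G x + c *: H x).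
Proof.
move=> Plin [Lu LG hu] [Lv LH hv].
split; [by apply: L2D => //; exact: L2Z|by apply: L2vD => //; exact: L2vZ|move=> e e0].
have c0 : 0 < 2 + 2 * c ^+ 2 by rewrite ltr_pwDl// mulr_ge0// sqr_ge0.
have e1 : 0 < e / (2 + 2 * c ^+ 2) by rewrite divr_gt0.
have [u' [G' [Pu u1 u2]]] := hu _ e1; have [v' [H' [Pv v1 v2]]] := hv _ e1.
have bound (X Y Z : R) : X <= 2 * Y + 2 * (c ^+ 2 * Z) -> Y <= e / (2 + 2 * c ^+ 2) ->
    Z <= e / (2 + 2 * c ^+ 2) -> X <= e.
  rewrite !ler_pdivlMr// => h1 h2 h3; rewrite -(ler_pM2r c0); apply: le_trans (ler_wpM2r (ltW c0) h1) _.
  by have := ler_wpM2l (sqr_ge0 c) h3; move: (c ^+ 2) h2 => z; nra.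
exists (fun x => u' x + c * v' x), (fun x => G' x + c *: H' x); split; first exact: Plin.
  apply: bound u1 v1; have Lu' := P_L2 Pu; have Lv' := P_L2 Pv.
  have A1 := (L2B Lu' Lu).2; have A2 := (L2B Lv' Lv).2.
  rewrite -!IntZ; [|by do ?apply: L1Z..].
  rewrite -IntD; [|by do ?apply: L1Z..].
  apply: Int_leT; [|by apply: L1D; do ?apply: L1Z|].
    by have := (L2B (L2D Lu' (L2Z c Lv')) (L2D Lu (L2Z c Lv))).2.
  move=> x; have := sqr_ge0 ((u' x - u x) - c * (v' x - v x)).
  have -> : u' x + c * v' x - (u x + c * v x) = (u' x - u x) + c * (v' x - v x) by ring.
  by move: (u' x - u x) (v' x - v x) => y z; nra.
apply: bound u2 v2; have Lu' := P_L2v Pu; have Lv' := P_L2v Pv.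
have A1 := L1_dot (L2vB Lu' LG) (L2vB Lu' LG); have A2 := L1_dot (L2vB Lv' LH) (L2vB Lv' LH).
rewrite /DG -!IntZ; [|by do ?apply: L1Z..].
rewrite -IntD; [|by do ?apply: L1Z..].
apply: Int_leT; [|by apply: L1D; do ?apply: L1Z|].
  by apply: L1_dot; apply: L2vB; apply: L2vD => //; exact: L2vZ.
move=> x; have := dot_ge0 ((G' x - G x) - c *: (H' x - H x)).
have -> : G' x + c *: H' x - (G x + c *: H x) = (G' x - G x) + c *: (H' x - H x).
  by rewrite scalerBr opprD addrACA.
move: (G' x - G x) (H' x - H x) => y z.
rewrite !(dotBl, dotBr, dotDl, dotDr, dotNl, dotNr, dotZl, dotZr) (dotC z y).
by move: (dot y y) (dot y z) (dot z z) => r1 r2 r3; nra.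
Qed.

(** Besides pointwise convergence under a common bound, the distances to the limit stay below [1];
    this keeps the energies of the approximations under control in [W01_critical]. *)
Lemma L2_closure_seq u G : L2_closure u G ->
  exists (v : nat -> T -> R) (H : nat -> T -> 'rV[R]_N) (g : T -> R),
  [/\ forall n, P (v n) (H n), L2 mu g,
      forall n, Int mu (fun x => (v n x - u x) ^+ 2) <= 1 /\
        DG mu (fun x => H n x - G x) (fun x => H n x - G x) <= 1 &
      \forall x \ae mu, [/\ v n x @[n --> \oo] --> u x, forall n, `|v n x| <= g x &
        forall i, H n x ord0 i @[n --> \oo] --> G x ord0 i /\ forall n, `|H n x ord0 i| <= g x]].
Proof.
move=> [Lu LG hu].
have /choice[p pP] : forall n, exists p : (T -> R) * (T -> 'rV[R]_N),
    [/\ P p.1 p.2, Int mu (fun x => (p.1 x - u x) ^+ 2) <= en R n &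
    DG mu (fun x => p.2 x - G x) (fun x => p.2 x - G x) <= en R n].
  by move=> n; have [v [H h]] := hu _ (en_gt0 R n); exists (v, H).
pose F n (j : option 'I_N) x := if j is Some i then (p n).2 x ord0 i else (p n).1 x.
pose f (j : option 'I_N) x := if j is Some i then G x ord0 i else u x.
have LF n j : L2 mu (F n j).
  by case: j => [i|]; have [Pp _ _] := pP n; [exact: (P_L2v Pp i)|exact: P_L2 Pp].
have Lf j : L2 mu (f j) by case: j => [i|]; [exact: LG|exact: Lu].
have bd n j : Int mu (fun x => (F n j x - f j x) ^+ 2) <= en R n.
  have [Pp p1 p2] := pP n; case: j => [i|]; last exact: p1.
  apply: le_trans p2; apply: Int_leT.
  - exact: (L2B (LF n (Some i)) (LG i)).2.
  - by apply: L1_dot; apply: L2vB => //; exact: P_L2v Pp.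
  - by move=> x; have := sqr_le_dot ((p n).2 x - G x) i; rewrite 2!mxE.
have [|f' [s [g [Lf' cf' s_inc Lg main]]]] := L2_family_limit LF.
  move=> e e0; have e4 : 0 < e / 4 by rewrite divr_gt0.
  have [k kP] := en_small e4; exists k => n m kn km j.
  apply: le_trans (Int_sqrB_le (LF n j) (Lf j) (LF m j)) _.
  have h1 := le_trans (bd n j) (kP _ kn); have h2 := le_trans (bd m j) (kP _ km).
  have <- : Int mu (fun x => (F m j x - f j x) ^+ 2) = Int mu (fun x => (f j x - F m j x) ^+ 2).
    by congr Int; apply/funext => x; rewrite -sqrrN opprB.
  by lra.
have ff' j : \forall x \ae mu, f' j x = f j x.
  apply: Int_sqr_ae_eq => //; apply/ler_addgt0Pr => e e0; rewrite add0r.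
  have e4 : 0 < e / 4 by rewrite divr_gt0.
  have [k kP] := en_small e4; have /cvgr_lt/(_ _ e4)[m _ mP] := cf' j.
  pose l := maxn k m.
  have h1 := le_trans (bd l j) (kP _ (leq_maxl _ _)).
  have h2 := mP l (leq_maxr _ _); rewrite /= in h2.
  apply: le_trans (Int_sqrB_le (Lf' j) (LF l j) (Lf j)) _.
  have <- : Int mu (fun x => (F l j x - f' j x) ^+ 2) = Int mu (fun x => (f' j x - F l j x) ^+ 2).
    by congr Int; apply/funext => x; rewrite -sqrrN opprB.
  by lra.
have en1 n : en R n <= 1 by rewrite /en invf_le1 ?ler1n// ltr0n.
exists (fun n => (p (s n)).1), (fun n => (p (s n)).2), g; split => //.
- by move=> n; case: (pP (s n)).
- by move=> n; have [_ h1 h2] := pP (s n); split; [apply: le_trans h1 _|apply: le_trans h2 _].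
- have aeff : \forall x \ae mu, forall j, f' j x = f j x.
    by apply: filter_forall => j; exact: ff'.
  apply: filterS2 main aeff => x hx ex; split.
  + by have [+ _] := hx None; rewrite ex.
  + by have [_ +] := hx None.
  + by move=> i; have := hx (Some i); rewrite ex.
Qed.

(** Along a dominated sequence, [|F t| <= C |t|] and [|F'| <= C] provide the majorants for dominated
    convergence. On [P] itself the image only has to lie in the closure, since [F] of a test
    function is not smooth. *)
Lemma L2_closure_chain (F F' : R -> R) C u G :
  (forall t : R, is_derive t (1 : R) F (F' t)) -> continuous F' ->
  (forall t, `|F' t| <= C) -> F 0 = 0 ->
  (forall v H, P v H -> L2_closure (fun x => F (v x)) (fun x => F' (v x) *: H x)) ->
  L2_closure u G -> L2_closure (fun x => F (u x)) (fun x => F' (u x) *: G x).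
Proof.
move=> dF cF' F'C F0 PF cu; have [Lu LG _] := cu.
have [v [H [g [Pv Lg _ ae]]]] := L2_closure_seq cu.
have C0 : 0 <= C := le_trans (normr_ge0 _) (F'C 0).
have cF : continuous F by move=> t; exact: is_derive_continuous (dF t).
have mF : measurable_fun setT F by exact: continuous_measurable_fun.
have mF' : measurable_fun setT F' by exact: continuous_measurable_fun.
have Fle t : `|F t| <= C * `|t|.
  by apply: (@derive_bound0 R F F' `|t|).
have Lg' := L2Z C Lg.
have [|||||LFu cFu] := @L2_dct _ _ _ mu (fun n x => F (v n x)) (fun x => F (u x)) (fun x => C * g x).
- by move=> n; apply: (measurableT_comp mF); exact: L2_mf (P_L2 (Pv n)).
- by apply: (measurableT_comp mF); exact: L2_mf Lu.
- exact: Lg'.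
- move=> n; apply: filterS ae => x [_ vg _]; apply: le_trans (Fle _) _.
  by rewrite ler_wpM2l.
- by apply: filterS ae => x [vu _ _]; apply: continuous_cvg => //; exact: cF.
have LH n : L2v mu (fun x => F' (v n x) *: H n x).
  apply: L2v_mulbdd; [|move=> x; exact: F'C|exact: P_L2v (Pv n)].
  by apply: (measurableT_comp mF'); exact: L2_mf (P_L2 (Pv n)).
have [||||LFG cFG] := @L2v_dct _ _ _ _ mu (fun n x => F' (v n x) *: H n x) (fun x => F' (u x) *: G x) (fun x => C * g x) LH.
- apply: mfvM; last exact: L2v_mf.
  by apply: (measurableT_comp mF'); exact: L2_mf Lu.
- exact: Lg'.
- move=> n i; apply: filterS ae => x [_ _ /(_ i)[_ hg]].
  by rewrite mxE normrM ler_pM.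
- move=> i; apply: filterS ae => x [vu _ /(_ i)[hG _]].
  under eq_fun do rewrite mxE; rewrite mxE; apply: cvgM => //.
  by apply: continuous_cvg => //; exact: cF'.
by apply: L2_closure_closed cFu cFG => // n; exact: PF.
Qed.

(** The factor [4] comes from two squared triangle inequalities, one for the function and one for
    the gradient. *)
Lemma L2_closure_poincare C : 0 <= C ->
  (forall u G, P u G -> Int mu (fun x => u x ^+ 2) <= C * DG mu G G) ->
  forall u G, L2_closure u G -> Int mu (fun x => u x ^+ 2) <= 4 * C * DG mu G G.
Proof.
move=> C0 hP u G [Lu LG hu]; apply/ler_addgt0Pr => e e0.
have c0 : 0 < 2 + 4 * C by rewrite ltr_pwDl// mulr_ge0.
have e1 : 0 < e / (2 + 4 * C) by rewrite divr_gt0.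
have [v [H [Pv v1 v2]]] := hu _ e1.
have Lv := P_L2 Pv; have LH := P_L2v Pv.
have h1 := Int_sqr_le Lv Lu; have h2 := DG_le LG LH; have h3 := hP _ _ Pv.
have h4 := ler_wpM2l C0 h2.
have h5 := ler_wpM2l C0 v2.
have E : e = 2 * (e / (2 + 4 * C)) + 4 * (C * (e / (2 + 4 * C))) by field; rewrite gt_eqF.
rewrite [X in _ + X]E; move: v1 h1 h3 h4 h5; rewrite mulrDr !(mulrCA C 2) -mulrA.
lra.
Qed.

End L2_closure.

Section sobolev_space.
Context (R : realType) (n : nat) (O : set 'rV[R]_n) (oO : open O).
Local Notation T0 := (caratheodory_type (@lebesgue_outer R n)).
Local Notation nu := (dmu oO).
Implicit Types (phi : 'rV[R]_n -> R).
Variable M0 : R.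
Hypothesis M00 : 0 < M0.
Hypothesis OM : forall x, O x -> forall i, `|x ord0 i| < M0.

Definition test_pair (phi : T0 -> R) (H : T0 -> 'rV[R]_n) : Prop :=
  Cc_smooth O phi /\ H = gradf phi.

Definition W01 := L2_closure nu test_pair.

Lemma test_pair_L2 phi H : test_pair phi H -> L2 nu phi.
Proof. by move=> [Cp _]; exact: Cc_L2 oO _ OM _ Cp. Qed.

Lemma test_pair_L2v phi H : test_pair phi H -> L2v nu H.
Proof. by move=> [Cp ->]; exact: Cc_L2v oO _ OM _ Cp. Qed.

Lemma W01_Cc phi : Cc_smooth O phi -> W01 phi (gradf phi).
Proof. by move=> Cp; apply: L2_closure_sub; [exact: test_pair_L2|exact: test_pair_L2v|]. Qed.

Lemma gradf_lin c phi psi : smooth phi -> smooth psi ->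
  gradf (fun x => phi x + c * psi x) = fun x => gradf phi x + c *: gradf psi x.
Proof.
move=> sp sq; apply/funext => x; apply/rowP => i; rewrite !mxE.
by rewrite partialD ?partialZ//; exact: smoothZ.
Qed.

Lemma W01_lin c u G v H : W01 u G -> W01 v H ->
  W01 (fun x => u x + c * v x) (fun x => G x + c *: H x).
Proof.
apply: L2_closure_lin; [exact: test_pair_L2|exact: test_pair_L2v|].
move=> {u G v H} u G v H [Cu ->] [Cv ->]; split.
  by apply: Cc_add => //; exact: Cc_scale.
by rewrite gradf_lin//; [exact: Cu.1|exact: Cv.1].
Qed.

(** A polynomial close to [F'] on the range of the test function has a primitive [p] with [p.[0] =
    0]; composing with [p] preserves smoothness and compact support. Integrating the error of the
    derivative from [0] controls the error of [F] as well. *)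
Lemma Cc_chain (F F' : R -> R) C phi :
  (forall t : R, is_derive t (1 : R) F (F' t)) -> continuous F' ->
  (forall t, `|F' t| <= C) -> F 0 = 0 -> Cc_smooth O phi ->
  W01 (fun x => F (phi x)) (fun x => F' (phi x) *: gradf phi x).
Proof.
move=> dF cF' F'C F0 Cp.
have [M1 M10 bM1] := Cc_bounded Cp; pose M := M1 + 1.
have M_gt0 : 0 < M by rewrite /M; lra.
have bM x : `|phi x| <= M by rewrite (le_trans (bM1 x))// lerDl.
have sp := Cp.1; have fin := dmu_fin oO OM.
have Lp := Cc_L2 oO OM Cp; have Lg := Cc_L2v oO OM Cp.
have mp := L2_mf Lp; have Ld := L1_dot Lg Lg.
have L1_1 : L1 nu (fun=> 1) by exact: L1_cst.
(* An error [de] in the derivative costs at most [de ^ 2 A] in both squared distances, which is why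
   [de] is the square root of [e / A]. *)
pose A := M ^+ 2 * Int nu (fun=> 1) + DG nu (gradf phi) (gradf phi) + 1.
have I1 : 0 <= Int nu (fun=> 1) by exact: Int_ge0.
have D0 := DG_ge0 nu (gradf phi).
have A0 : 0 < A by rewrite /A ltr_wpDl// addr_ge0// mulr_ge0// sqr_ge0.
have MA : M ^+ 2 * Int nu (fun=> 1) <= A by rewrite /A -addrA lerDl addr_ge0.
have DA : DG nu (gradf phi) (gradf phi) <= A.
  by rewrite /A -addrA addrCA lerDl addr_ge0// mulr_ge0// sqr_ge0.
have mF : measurable_fun setT F.
  by apply: continuous_measurable_fun => t; exact: is_derive_continuous (dF t).
have mF' : measurable_fun setT F' by exact: continuous_measurable_fun.
have LF : L2 nu (fun x => F (phi x)).
  apply: (L2_dom _ (L2Z C (L2_norm Lp))); first exact: measurableT_comp mF mp.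
  by apply: aeW => x; apply: (@derive_bound0 R F F' `|phi x|).
have LF' : L2v nu (fun x => F' (phi x) *: gradf phi x).
  apply: (@L2v_mulbdd _ _ _ _ nu (fun x : T0 => F' (phi x)) C _ (measurableT_comp mF' mp) _ Lg).
  by move=> x; exact: F'C.
split => // e e0; pose de := Num.sqrt (e / A).
have deA : de ^+ 2 * A = e by rewrite sqr_sqrtr ?divfK ?gt_eqF// divr_ge0// ltW.
have de0 : 0 < de by rewrite sqrtr_gt0 divr_gt0.
have [q qP] := weierstrass cF' M_gt0 de0.
have [p pq p0] := poly_primitive q.
have pF t : `|t| <= M -> `|p.[t] - F t| <= de * M.
  move=> tM; apply: (@le_trans _ _ (de * `|t|)); last by rewrite ler_wpM2l// ltW.
  apply: (@derive_bound0 R (fun t => p.[t] - F t) (fun t => q.[t] - F' t) M de) => //.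
    by move=> s _; rewrite -pq; apply: is_deriveB.
  by rewrite p0 F0 subrr.
have [sv gv] := smooth_horner p sp.
have Cv := Cc_horner p0 Cp.
have gE x : gradf (fun x => p.[phi x]) x = q.[phi x] *: gradf phi x.
  by apply/rowP => i; rewrite !mxE gv pq.
exists (fun x => p.[phi x]), (gradf (fun x => p.[phi x])); split; first by split.
  apply: (@le_trans _ _ (Int nu (fun x => (de * M) ^+ 2 * 1))).
    apply: Int_leT; [exact: (L2B (Cc_L2 oO OM Cv) LF).2|exact: L1Z|].
    move=> x; rewrite mulr1 -(real_normK (num_real (_ - _))) lerXn2r ?nnegrE//.
      by rewrite mulr_ge0// ltW.
    exact: pF.
  by rewrite IntZ// -deA exprMn -mulrA ler_wpM2l ?sqr_ge0.
apply: (@le_trans _ _ (Int nu (fun x => de ^+ 2 * dot (gradf phi x) (gradf phi x)))).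
  apply: Int_leT; [|exact: L1Z|].
    have Lv := Cc_L2v oO OM Cv.
    exact: (L1_dot (L2vB Lv LF') (L2vB Lv LF')).
  move=> x; rewrite gE -scalerBl dotZl dotZr mulrA -expr2.
  apply: ler_wpM2r; first exact: dot_ge0.
  rewrite -(real_normK (num_real (_ - _))) lerXn2r ?nnegrE ?(ltW de0)//.
  by apply: qP; rewrite -ler_norml.
by rewrite IntZ// -deA ler_wpM2l ?sqr_ge0.
Qed.

End sobolev_space.

Lemma ae_row_eq d (T : measurableType d) (R : realType) n (mu : {measure set T -> \bar R})
  (G H : T -> 'rV[R]_n) : (forall i, \forall x \ae mu, G x ord0 i = H x ord0 i) ->
  \forall x \ae mu, G x = H x.
Proof.
move=> GH; have : \forall x \ae mu, forall i, G x ord0 i = H x ord0 i by exact: filter_forall.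
by apply: filterS => x h; apply/rowP.
Qed.

Section sobolev_space_theory.
Context (R : realType) (n : nat) (O : set 'rV[R]_n) (oO : open O).
Local Notation T0 := (caratheodory_type (@lebesgue_outer R n)).
Local Notation nu := (dmu oO).
Local Notation mu := (lebesgue R n).
Local Notation W := (W01 oO).
Implicit Types (phi : 'rV[R]_n -> R) (u v g : T0 -> R) (G H : T0 -> 'rV[R]_n).
Variable M0 : R.
Hypothesis M00 : 0 < M0.
Hypothesis OM : forall x, O x -> forall i, `|x ord0 i| < M0.

Lemma L1_restrict (K : set 'rV[R]_n) g : measurable (K : set T0) -> K `<=` O -> L1 nu g ->
  L1 mu (g \_ K).
Proof.
move=> mK KO Lg; have mg := L1_mf Lg.
have mO := open_cara oO.
have LO : L1 mu (g \_ O).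
  by have := (@L1_mrestr _ _ _ mu O mO g mg).1 Lg; rewrite (integrable_mkcond _ mO) restrict_EFin.
apply: (L1_domT _ (L1_norm LO)).
  by apply/(measurable_restrictT _ mK); exact: measurable_funTS.
move=> x; rewrite !patchE; case: ifPn => [/set_mem/KO/mem_set ->//|_].
by rewrite normr0.
Qed.

Lemma Int_restrict g : measurable_fun setT g -> Int nu g = Int mu (g \_ O).
Proof. by move=> mg; rewrite (@Int_mrestr _ _ _ mu O (open_cara oO) g mg) /Int -Rintegral_mkcond. Qed.

Lemma ae_dmu (P : T0 -> Prop) : {ae nu, forall x, P x} <-> ae_in O P.
Proof. exact: (@ae_mrestr _ _ _ mu O (open_cara oO) P). Qed.

Lemma compact_cara (K : set 'rV[R]_n) : compact K -> measurable (K : set T0).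
Proof.
move=> /rV_compact_closed/closed_openC/open_cara/measurableC.
by rewrite setCK.
Qed.

(** The set [O] is a union of countably many cubes whose closures lie in [O]. On each of them [g] is
    integrable and orthogonal to all bumps, so [vanishing] applies. *)
Lemma weak_zero (g : 'rV[R]_n -> R) :
  (forall K : set 'rV[R]_n, compact K -> K `<=` O -> L1 mu (g \_ K)) ->
  (forall phi, Cc_smooth O phi -> Int mu ((fun x => g x * phi x) \_ O) = 0) ->
  ae_in O (fun x => g x = 0).
Proof.
move=> Lg g0.
pose bx q : set T0 := @tup R n @^-1` box (@rat_lo R n q) (@rat_hi R n q).
pose good q := forall y : 'rV[R]_n, (forall i, @rat_lo R n q i <= y ord0 i <= @rat_hi R n q i) -> O y.
have zero q : good q -> {ae mu, forall x, (g \_ (bx q)) x = 0}.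
  move=> gq.
  pose K : set 'rV[R]_n := [set x | forall i, `[@rat_lo R n q i, @rat_hi R n q i]%classic (x ord0 i)].
  have cK : compact K.
    by apply: (@rV_compact _ n (fun i => `[@rat_lo R n q i, @rat_hi R n q i]%classic)) => i; exact: segment_compact.
  have KO : K `<=` O.
    by move=> x Kx; apply: gq => i; have := Kx i; rewrite /= in_itv.
  have bK : bx q `<=` K.
    by move=> x hx i; have /andP[h1 h2] := hx i; rewrite tnth_mktuple in h1 h2; rewrite /= in_itv/= !ltW.
  have mb : measurable (bx q) by apply: tup_cara; exact: box_measurable.
  have Lb : L1 mu (g \_ (bx q)).
    have LK := Lg K cK KO.
    rewrite (_ : g \_ (bx q) = (g \_ K) \_ (bx q)).
      apply: (L1_domT _ (L1_norm LK)).
        by apply/(measurable_restrictT _ mb); apply: measurable_funTS; exact: L1_mf LK.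
      by move=> x; rewrite [X in `|X|]patchE; case: ifP => // _; rewrite normr0.
    apply/funext => x; rewrite !patchE; case: ifPn => // /set_mem/bK/mem_set ->//.
  apply: (vanishing Lb (a := @rat_lo R n q) (c := @rat_hi R n q)).
    by move=> x hx; rewrite patchE memNset.
  move=> k a' c' ha hc; rewrite -(g0 (bump k a' c')); last first.
    apply: Cc_bump => t tb; apply: gq => i; rewrite mxE; have /andP[h1 h2] := tb i.
    by rewrite (le_trans (ha i) (ltW h1)) (le_trans (ltW h2) (hc i)).
  congr Int; apply/funext => x; rewrite !patchE.
  case: ifPn => [/set_mem/bK/KO/mem_set ->//|xb].
  rewrite mul0r bump_off ?mulr0 ?if_same// => hx; move/negP: xb; apply; apply/mem_set => i.
  rewrite tnth_mktuple; have /andP[h1 h2] := hx i.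
  have k0 : 0 < k.+1%:R^-1 :> R by rewrite invr_gt0.
  have := ha i; have := hc i; move: k0 h1 h2; move: (k.+1%:R^-1) => d *.
  by apply/andP; split; lra.
have : {ae mu, forall x, forall q, good q -> (g \_ (bx q)) x = 0}.
  apply: filterS (_ : {ae mu, forall x, forall j, if unpickle j is Some q then good q -> (g \_ (bx q)) x = 0 else True}).
    by move=> x hx q gq; have := hx (pickle q); rewrite pickleK; exact.
  apply/ae_foralln => j; case: unpickle => [q|]; last exact: aeW.
  by have [gq|gq] := pselect (good q); [apply: filterS (zero q gq)|exact: aeW].
apply: filterS => x hx Ox; have [q [xq gq]] := rational_box oO Ox.
have := hx q gq; rewrite patchE mem_set// => i.
by rewrite tnth_mktuple.
Qed.


Lemma W01_chainC1 (F F' : R -> R) C :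
  (forall t : R, is_derive t (1 : R) F (F' t)) -> continuous F' ->
  (forall t, `|F' t| <= C) -> F 0 = 0 ->
  forall u G, W u G -> W (fun x => F (u x)) (fun x => F' (u x) *: G x).
Proof.
move=> dF cF' F'C F0 u G Wu.
refine (@L2_closure_chain _ _ _ _ nu (@test_pair R n O) (fun phi H => @test_pair_L2 R n O oO M0 OM phi H)
  (fun phi H => @test_pair_L2v R n O oO M0 OM phi H) F F' C u G dF cF' F'C F0 _ Wu).
by move=> v H [Cv ->]; exact: (Cc_chain oO OM dF cF' F'C F0 Cv).
Qed.

(** For test functions this is integration by parts. By Cauchy-Schwarz the defect depends
    continuously on the pair in [L^2]; its square is shown to be below every positive number. *)
Lemma W01_weak u G phi i : W u G -> Cc_smooth O phi ->
  Int nu (fun x => u x * partial i phi x) = - Int nu (fun x => G x ord0 i * phi x).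
Proof.
move=> [Lu LG hu] Cp; have Cd := Cc_partial i Cp.
have Lp := Cc_L2 oO OM Cp; have Ld := Cc_L2 oO OM Cd.
set A := Int nu (fun x => partial i phi x ^+ 2); set B := Int nu (fun x => phi x ^+ 2).
have A0 : 0 <= A by apply: Int_ge0 => x; exact: sqr_ge0.
have B0 : 0 <= B by apply: Int_ge0 => x; exact: sqr_ge0.
apply/eqP; rewrite -subr_eq0 opprK -sqrf_eq0 eq_le sqr_ge0 andbT.
apply/ler_addgt0Pr => e e0; rewrite add0r.
have c0 : 0 < 2 * (A + B) + 1 by rewrite ltr_wpDl// mulr_ge0// addr_ge0.
have e1 : 0 < e / (2 * (A + B) + 1) by rewrite divr_gt0.
have [v [H [[Cv ->] v1 v2]]] := hu _ e1.
have Lv := Cc_L2 oO OM Cv; have Lg := Cc_L2v oO OM Cv.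
have ibp := Int_by_parts oO M00 OM i Cp Cv.1.
have L1a := L2_mul (L2B Lv Lu) Ld; have L1b := L2_mul (L2B (Lg i) (LG i)) Lp.
have E : Int nu (fun x => u x * partial i phi x) + Int nu (fun x => G x ord0 i * phi x) =
    - (Int nu (fun x => (v x - u x) * partial i phi x) +
       Int nu (fun x => (gradf v x ord0 i - G x ord0 i) * phi x)).
  have -> : Int nu (fun x => (v x - u x) * partial i phi x) =
      Int nu (fun x => v x * partial i phi x) - Int nu (fun x => u x * partial i phi x).
    rewrite -IntB; [|exact: L2_mul|exact: L2_mul].
    by congr Int; apply/funext => x; rewrite mulrBl.
  have -> : Int nu (fun x => (gradf v x ord0 i - G x ord0 i) * phi x) =
      Int nu (fun x => gradf v x ord0 i * phi x) - Int nu (fun x => G x ord0 i * phi x).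
    rewrite -IntB; [|exact: L2_mul (Lg i) Lp|exact: L2_mul].
    by congr Int; apply/funext => x; rewrite mulrBl.
  have -> : Int nu (fun x => gradf v x ord0 i * phi x) = Int nu (fun x => partial i v x * phi x).
    by congr Int; apply/funext => x; rewrite mxE.
  by rewrite ibp; ring.
have h1 := Int_CS (L2B Lv Lu) Ld; have h2 := Int_CS (L2B (Lg i) (LG i)) Lp.
have v2' : Int nu (fun x => (gradf v x ord0 i - G x ord0 i) ^+ 2) <= e / (2 * (A + B) + 1).
  apply: le_trans v2; apply: Int_leT; first exact: (L2B (Lg i) (LG i)).2.
    by apply: L1_dot; exact: L2vB.
  move=> x; have := sqr_le_dot (gradf v x - G x) i.
  by have -> : (gradf v x - G x) ord0 i = gradf v x ord0 i - G x ord0 i by rewrite !mxE.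
have h1' := le_trans h1 (ler_wpM2r A0 v1); have h2' := le_trans h2 (ler_wpM2r B0 v2').
rewrite E sqrrN; apply: (@le_trans _ _ (2 * (e / (2 * (A + B) + 1) * A) + 2 * (e / (2 * (A + B) + 1) * B))).
  move: h1' h2'; move: (Int _ _) (Int _ _) (_ * A) (_ * B) => X Y a b h1' h2'.
  by have := sqr_ge0 (X - Y); nra.
have -> : 2 * (e / (2 * (A + B) + 1) * A) + 2 * (e / (2 * (A + B) + 1) * B) =
  e * ((2 * (A + B)) / (2 * (A + B) + 1)) by ring.
rewrite ler_piMr// ?(ltW e0)// ler_pdivrMr// mul1r; lra.
Qed.

Lemma W01_uniq u G v H : W u G -> W v H -> (\forall x \ae nu, u x = v x) ->
  \forall x \ae nu, G x = H x.
Proof.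
move=> Wu Wv uv; have [Lu LG _] := Wu; have [Lv LH _] := Wv.
have comp i : \forall x \ae nu, G x ord0 i = H x ord0 i.
  have Lg := L2B (LG i) (LH i).
  have L1g := L2_L1 (dmu_fin oO OM) Lg.
  have : ae_in O (fun x => G x ord0 i - H x ord0 i = 0).
    apply: weak_zero => [K cK KO|phi Cp].
      by apply: (L1_restrict _ KO L1g); exact: compact_cara.
    have Lp := Cc_L2 oO OM Cp; have Ld := Cc_L2 oO OM (Cc_partial i Cp).
    rewrite -Int_restrict; last exact: L1_mf (L2_mul Lg Lp).
    have -> : Int nu (fun x => (G x ord0 i - H x ord0 i) * phi x) =
      Int nu (fun x => G x ord0 i * phi x) - Int nu (fun x => H x ord0 i * phi x).
      rewrite -IntB; [|exact: L2_mul (LG i) Lp|exact: L2_mul (LH i) Lp].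
      by congr Int; apply/funext => x; rewrite mulrBl.
    have e1 := W01_weak i Wu Cp; have e2 := W01_weak i Wv Cp.
    have e3 : Int nu (fun x => u x * partial i phi x) = Int nu (fun x => v x * partial i phi x).
      apply: Int_ae_eq; [exact: L1_mf (L2_mul Lu Ld)|exact: L1_mf (L2_mul Lv Ld)|].
      by apply: filterS uv => x ->.
    by apply: oppr_inj; rewrite opprB oppr0 -[X in _ - X]opprK -e1 e3 e2 opprK subrr.
  move=> h; apply: (filterS (P := fun x => G x ord0 i - H x ord0 i = 0)).
    by move=> x /eqP; rewrite subr_eq0 => /eqP.
  exact: (ae_dmu _).2 h.
exact: ae_row_eq comp.
Qed.

(** The bumps of all rational cubes, enumerated together with their index [k]; cubes that leave [O]
    and codes of nothing are given the zero function. *)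
Lemma W01_cover : exists (psi : nat -> T0 -> R) (H : nat -> T0 -> 'rV[R]_n),
    [/\ forall i, W (psi i) (H i), forall i x, 0 <= psi i x <= 1 &
     \forall x \ae nu, exists i, 0 < psi i x].
Proof.
pose bx q := @box R n (@rat_lo R n q) (@rat_hi R n q).
pose psi (j : nat) : T0 -> R := if unpickle j is Some (q, k) then
  if `[< forall t, bx q t -> O (row_of t) >] then bump k (@rat_lo R n q) (@rat_hi R n q) else fun=> 0
  else fun=> 0.
have C0 : Cc_smooth O (fun=> 0).
  split; first exact: smooth_cst.
  by exists set0; split => //; exact: compact0.
have Cpsi j : Cc_smooth O (psi j).
  rewrite /psi; case: unpickle => [[q k]|//]; case: asboolP => // h.
  exact: Cc_bump.
exists psi, (fun j => gradf (psi j)); split.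
- by move=> j; exact: W01_Cc OM _ (Cpsi j).
- move=> j x; rewrite /psi; case: unpickle => [[q k]|]; last by rewrite lexx ler01.
  by case: asboolP => _; [exact: bump01|rewrite lexx ler01].
- apply: (ae_dmu _).2; apply: aeW => x Ox.
  have [q [xq gq]] := rational_box oO Ox.
  have bO t : bx q t -> O (row_of t).
    by move=> tb; apply: gq => i; rewrite mxE; have /andP[h1 h2] := tb i; rewrite !ltW.
  have := @bump_cvg R n (@rat_lo R n q) (@rat_hi R n q) x.
  rewrite indicE mem_set; last by move=> i; rewrite tnth_mktuple.
  move=> /cvgr_gt/(_ 0 ltr01)[k _ /(_ k (leqnn k)) kP].
  by exists (pickle (q, k)); rewrite /psi pickleK asboolT.
Qed.

End sobolev_space_theory.

Lemma W01_sobolev (R : realType) (n : nat) (O : set 'rV[R]_n.+1) (oO : open O) (M0 : R) :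
  0 < M0 -> (forall x, O x -> forall i, `|x ord0 i| < M0) -> sobolev (dmu oO) (W01 oO).
Proof.
move=> M00 OM.
have tL2 := fun phi H => @test_pair_L2 R n.+1 O oO M0 OM phi H.
have tL2v := fun phi H => @test_pair_L2v R n.+1 O oO M0 OM phi H.
apply: Sobolev.
- by move=> u G [].
- by move=> u G [].
- by move=> c u G v H; exact: W01_lin OM c u G v H.
- by move=> u_ G_ u G; exact: L2_closure_closed.
- by move=> F F' C dF cF' F'C F0 u G; exact: W01_chainC1 OM _ _ _ dF cF' F'C F0 u G.
- by move=> u G v H; exact: W01_uniq M00 OM u G v H.
- exists (4 * (4 * M0 ^+ 2)); first by rewrite !mulr_gt0// exprn_gt0.
  move=> u G; apply: L2_closure_poincare => //; first by rewrite mulr_ge0// sqr_ge0.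
  by move=> v H [Cv ->]; exact: Cc_poincare M00 OM ord0 v Cv.
- exact: W01_cover OM.
Qed.

(** * The critical power in the closure and the bound on the source *)

Section source_bound.
Context (R : realType) (k : nat).
Local Notation n := k.+3.
Context (O : set 'rV[R]_n) (oO : open O).
Local Notation T0 := (caratheodory_type (@lebesgue_outer R n)).
Local Notation nu := (dmu oO).
Local Notation W := (W01 oO).
Local Notation a := (k.+1%:R^-1 : R).
Local Notation s := (1 + 2 * a : R).
Implicit Types (u f : T0 -> R) (G : T0 -> 'rV[R]_n).
Variable M0 : R.
Hypothesis M00 : 0 < M0.
Hypothesis OM : forall x, O x -> forall i, `|x ord0 i| < M0.

Let s0 : 0 < s. Proof. by rewrite addr_gt0// mulr_gt0// sobolev_exponent_gt0. Qed.

(** Fatou's lemma along approximating test functions. Their gradients are within squared distance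
    [1] of [G], whence the energy bound [2 (1 + DG)]. *)
Lemma W01_critical u G : W u G -> L1 nu (fun x => (u x ^+ 2) `^ s) /\
  Int nu (fun x => (u x ^+ 2) `^ s) <= ((2 * (1 + a)) ^+ 2 * (2 * (1 + DG nu G G))) `^ s.
Proof.
move=> Wu; have [Lu LG _] := Wu.
have [v [H [g [Pv Lg bd ae]]]] := @L2_closure_seq _ _ _ _ nu (@test_pair R n O) (fun phi H => @test_pair_L2 R n O oO M0 OM phi H)
  (fun phi H => @test_pair_L2v R n O oO M0 OM phi H) u G Wu.
have cs : continuous (fun t : R => (t ^+ 2) `^ s : R) by exact: continuous_sqr_powR.
have [|||||//] := @Int_fatou _ _ _ nu (fun m x => (v m x ^+ 2) `^ s) (fun x => (u x ^+ 2) `^ s)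
  (((2 * (1 + a)) ^+ 2 * (2 * (1 + DG nu G G))) `^ s).
- by move=> m; have [Cv _] := Pv m; exact: (Cc_sobolev oO M00 OM Cv).1.
- by move=> m x; exact: powR_ge0.
- apply: (measurableT_comp (f := fun t : R => (t ^+ 2) `^ s)); last exact: L2_mf Lu.
  exact: continuous_measurable_fun.
- pose Fs (t : R) : R := (t ^+ 2) `^ s.
  have cvx x : v m x @[m --> \oo] --> u x -> Fs (v m x) @[m --> \oo] --> Fs (u x).
    by move=> vu; apply: continuous_cvg => //; exact: cs.
  by apply: filterS ae => x [vu _ _]; exact: cvx.
- move=> m; have [Cv eH] := Pv m; apply: le_trans (Cc_sobolev oO M00 OM Cv).2 _.
  have LH := Cc_L2v oO OM Cv; have := DG_le LG LH; have [_] := bd m; rewrite eH.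
  have D0 := DG_ge0 nu (gradf (v m)); move: D0.
  move: (DG nu (fun x => _ - _) _) (DG nu (gradf _) _) (DG nu G G) => D1 D2 D3 D20 h1 h2.
  have p0 : 0 <= (2 * (1 + a)) ^+ 2 by exact: sqr_ge0.
  apply: ge0_ler_powR; rewrite ?nnegrE ?(ltW s0)//; [exact: mulr_ge0|apply: mulr_ge0 => //; lra|].
  by apply: ler_wpM2l => //; lra.
Qed.

(** Here [2 s] is the Sobolev exponent, and the exponent [m] of [f] is conjugate to
    [q = 2 s / theta]. Hoelder's inequality leaves [(1 + D) ^ (theta / 2)] up to a constant, [D]
    being the energy; as [1 + D >= 1], the exponent may be raised to [1 / 2]. With [y ^ 2 = 1 + D],
    the estimate [K y <= B / 2 * y ^ 2 + K ^ 2 / (2 B)] gives [Cs]. *)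
Lemma W01_source_bound f theta B : measurable_fun setT f -> (forall x, 0 <= f x) ->
  0 < theta < 1 -> 0 < B -> L1 nu (fun x => f x `^ (2 * s / (2 * s - theta))) ->
  exists Cs, forall u G, W u G -> (forall x, 0 <= u x) ->
    L1 nu (fun x => f x * u x `^ theta) /\
    Int nu (fun x => f x * u x `^ theta) <= Cs + B / 2 * DG nu G G.
Proof.
move=> mf f0 /andP[t0 t1] B0 Lf.
have a0 := @sobolev_exponent_gt0 R k.
set m := 2 * s / (2 * s - theta) in Lf *; pose q := 2 * s / theta.
have d0 : 0 < 2 * s - theta by move: a0 t1; move: (a) => z z0 t1; lra.
have m0 : 0 < m by rewrite divr_gt0// mulr_gt0.
have q0 : 0 < q by rewrite divr_gt0// mulr_gt0.
have sn : s != 0 by rewrite gt_eqF.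
have mq : m^-1 + q^-1 = 1.
  rewrite /m /q !invf_div; move: s sn s0 {d0 m0 q0 Lf} => z z0 _.
  by field.
set X := Int nu (fun x => f x `^ m) `^ m^-1.
have X0 : 0 <= X by exact: powR_ge0.
set c := (2 * (1 + a)) ^+ 2 * 2; have c0 : 0 <= c by rewrite mulr_ge0// sqr_ge0.
pose K := X * c `^ (theta / 2); have K0 : 0 <= K by rewrite mulr_ge0// powR_ge0.
exists (B / 2 + K ^+ 2 / (2 * B)) => u G Wu u0; have [Lu LG _] := Wu.
have uE x : (u x `^ theta) `^ q = (u x ^+ 2) `^ s.
  rewrite -powRrM -(powR_mulrn _ (u0 x)) -powRrM; congr (_ `^ _).
  by rewrite /q mulrC divfK ?gt_eqF.
have [Ls Is] := W01_critical Wu.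
have mu_ : measurable_fun setT (fun x => u x `^ theta).
  by apply: (measurableT_comp (measurable_powR _)); exact: L2_mf Lu.
have Lsq : L1 nu (fun x => (u x `^ theta) `^ q) by under eq_fun do rewrite uE.
have [L1fu Ifu] := Int_holder m0 q0 mq mf mu_ f0 (fun x => powR_ge0 _ _) Lf Lsq.
split => //; apply: le_trans Ifu _; under [X in _ * Int _ X `^ _]eq_fun do rewrite uE.
rewrite -/X; set D := DG nu G G in Is *; have D0 : 0 <= D := DG_ge0 nu G.
have D1 : 0 <= 1 + D by rewrite addr_ge0.
have h1 : Int nu (fun x => (u x ^+ 2) `^ s) `^ q^-1 <= c `^ (theta / 2) * Num.sqrt (1 + D).
  have sq : s * q^-1 = theta / 2 by rewrite /q invf_div mulrC -mulrA; move: s sn => z zn; field.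
  apply: (@le_trans _ _ (((c * (1 + D)) `^ s) `^ q^-1)).
    apply: ge0_ler_powR; rewrite ?nnegrE ?powR_ge0 ?invr_ge0 ?(ltW q0)//.
      by apply: Int_ge0 => x; exact: powR_ge0.
    by apply: le_trans Is _; rewrite /c mulrA.
  rewrite -powRrM sq powRM//; apply: ler_wpM2l; first exact: powR_ge0.
  rewrite -powR12_sqrt//; apply: ler_powR; first by rewrite lerDl.
  by rewrite ler_pdivrMr// mulVf// ltW.
apply: le_trans (ler_wpM2l X0 h1) _; rewrite mulrA -/K.
have := sqr_sqrtr D1; move: (Num.sqrt (1 + D)) => y yE.
have E : B / 2 + K ^+ 2 / (2 * B) + B / 2 * D = B / 2 * y ^+ 2 + K ^+ 2 / (2 * B) by rewrite yE; ring.
rewrite E -subr_ge0; have -> : B / 2 * y ^+ 2 + K ^+ 2 / (2 * B) - K * y = (B * y - K) ^+ 2 / (2 * B).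
  by field; rewrite gt_eqF.
by rewrite divr_ge0 ?sqr_ge0// mulr_ge0// ltW.
Qed.

End source_bound.

(** * Weak gradients *)

Lemma ae_and d (T : measurableType d) (R : realType) (mu : {measure set T -> \bar R}) (P Q : T -> Prop) :
  {ae mu, forall x, P x} -> {ae mu, forall x, Q x} -> {ae mu, forall x, P x /\ Q x}.
Proof. by apply: filterS2 => x. Qed.

Section weak_gradients.
Context (R : realType) (n : nat) (O : set 'rV[R]_n) (oO : open O).
Local Notation T0 := (caratheodory_type (@lebesgue_outer R n)).
Local Notation nu := (dmu oO).
Local Notation mu := (lebesgue R n).
Local Notation W := (W01 oO).
Implicit Types (phi psi : 'rV[R]_n -> R) (F : 'rV[R]_n -> R) (u f : T0 -> R) (G : T0 -> 'rV[R]_n).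
Variable M0 : R.
Hypothesis M00 : 0 < M0.
Hypothesis OM : forall x, O x -> forall i, `|x ord0 i| < M0.

Let mO : measurable (O : set T0) := open_cara oO.

Lemma ae_in_mono (P Q : 'rV[R]_n -> Prop) : (forall x, O x -> P x -> Q x) -> ae_in O P -> ae_in O Q.
Proof.
by move=> PQ -[A [mA A0 PA]]; exists A; split => // x /= h; apply: PA => /= h'; apply: h => Ox; exact/PQ/h'.
Qed.

Lemma ae_in_and (P Q : 'rV[R]_n -> Prop) : ae_in O P -> ae_in O Q -> ae_in O (fun x => P x /\ Q x).
Proof. by move=> /(ae_dmu oO) h1 /(ae_dmu oO) h2; apply/(ae_dmu oO); exact: ae_and h1 h2. Qed.

Lemma lebesgue_complete : measure_is_complete mu.
Proof. exact: measure_is_complete_caratheodory. Qed.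

(** [grad] is an arbitrary choice among weak gradients, known only up to a null set; completeness of
    the Caratheodory measure makes it measurable all the same. *)
Lemma measurable_on_ae F f : measurable_fun setT f -> ae_in O (fun x => F x = f x) ->
  measurable_on O F.
Proof.
move=> mf Ff; suff : measurable_fun (O : set T0) (EFin \o (F : T0 -> R)) by move/measurable_EFinP.
apply: (ae_measurable_fun lebesgue_complete (f := EFin \o f)); last first.
  by apply/measurable_EFinP; exact: measurable_funTS.
by apply: ae_in_mono Ff => x Ox /= ->.
Qed.

Lemma integral_on_ae F f : L1 nu f -> ae_in O (fun x => F x = f x) ->
  (\int[mu]_(x in O) (F x)%:E = (Int nu f)%:E)%E.
Proof.
move=> Lf Ff; have mf := L1_mf Lf.
rewrite (IntE Lf) (@integral_mrestr _ _ _ mu O mO (EFin \o f)); last exact/measurable_EFinP.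
apply: ae_eq_integral => //.
- by apply/measurable_EFinP; exact: measurable_on_ae mf Ff.
- by apply: measurable_funTS; exact/measurable_EFinP.
- by apply: ae_in_mono Ff => x Ox /= ->.
Qed.

Lemma integ_ae F f : L1 nu f -> ae_in O (fun x => F x = f x) -> integ O F = Int nu f.
Proof. by move=> Lf Ff; rewrite /integ /Rintegral (integral_on_ae Lf Ff). Qed.

Lemma integE F : integ O F = Int mu (F \_ O).
Proof. by rewrite /integ Rintegral_mkcond. Qed.

Lemma L1_on_ae F f : L1 nu f -> ae_in O (fun x => F x = f x) -> L1 mu (F \_ O).
Proof.
move=> Lf Ff; apply: (@L1_ae_eq _ _ _ mu (f \_ O)).
- by apply/(measurable_restrictT _ mO); exact: measurable_on_ae (L1_mf Lf) Ff.
- exact: L1_restrict mO _ Lf.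
- move: Ff => -[A [mA A0 FA]]; exists A; split => // x /= h; apply: FA => /= h'; apply: h.
  by rewrite !patchE; case: ifPn => // /set_mem/h' ->.
Qed.

Lemma Lp1_ae F f : L1 nu f -> ae_in O (fun x => F x = f x) -> Lp O 1%:E F.
Proof. by move=> Lf Ff; apply/Lfun1_integrable; exact: L1_on_ae Lf Ff. Qed.

Lemma Lp2_ae F f : L2 nu f -> ae_in O (fun x => F x = f x) -> Lp O 2%:E F.
Proof.
move=> [mf Lf] Ff; have mF := measurable_on_ae mf Ff.
have mF' : measurable_fun setT (F \_ O : T0 -> R) by apply/(measurable_restrictT _ mO).
have LF : L1 mu (fun x => (F \_ O) x ^+ 2).
  have := @L1_on_ae (fun x => F x ^+ 2) _ Lf; rewrite (_ : (fun x => F x ^+ 2) \_ O = fun x => (F \_ O) x ^+ 2).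
    by apply; apply: ae_in_mono Ff => x Ox /= ->.
  by apply/funext => x; rewrite !patchE; case: ifP => //; rewrite expr0n.
rewrite /Lp inE; apply/andP; split; rewrite inE/=; first exact: mF'.
rewrite /finite_norm unlock; apply: poweR_lty.
have /integrableP[_] := LF; apply: le_lt_trans; rewrite le_eqVlt; apply/orP; left; apply/eqP.
apply: eq_integral => x _ /=.
rewrite [`|_ ^+ 2|]ger0_norm ?sqr_ge0//.
by rewrite (@powR_mulrn _ _ 2)// real_normK// num_real.
Qed.

Lemma L2_of_Lp2 F : Lp O 2%:E F -> L2 nu (F \_ O).
Proof.
move=> LF; have iF := Lfun2_integrable_sqr LF.
have mF : measurable_fun setT (F \_ O : T0 -> R).
  by move: LF; rewrite /Lp inE => /andP[]; rewrite inE.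
split => //; apply/(@L1_mrestr _ _ _ mu O mO); first exact: measurable_funX.
exact: integrableS iF.
Qed.

Lemma L1loc_mul F phi : L1loc O F -> Cc_smooth O phi -> L1 mu ((fun x => F x * phi x) \_ O).
Proof.
move=> LF Cp; have [sp [K [cK KO pK]]] := Cp; have [C C0 bC] := Cc_bounded Cp.
have /Lfun1_integrable LK := LF K cK KO.
rewrite (_ : _ \_ O = fun x => phi x * (F \_ K) x).
  apply: (@L1_mulbdd _ _ _ mu _ _ C) => //.
  exact: continuous_measurable_cara (smooth_continuous sp).
apply/funext => x; rewrite !patchE; case: (boolP (x \in K)) => [/set_mem Kx|xK].
  by rewrite mem_set 1?mulrC//; exact: KO.
rewrite notin_setE in xK; have := pK x xK => ->; rewrite mul0r mulr0.
by case: ifP.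
Qed.

Lemma L1loc_sub F F' : L1loc O F -> L1loc O F' -> L1loc O (fun x => F x - F' x).
Proof.
move=> LF LF' K cK KO; have /Lfun1_integrable L1_ := LF K cK KO; have /Lfun1_integrable L2_ := LF' K cK KO.
apply/Lfun1_integrable; have := L1B L1_ L2_; rewrite /L1.
rewrite (_ : (fun x => (F \_ K) x - (F' \_ K) x) = (fun x => F x - F' x) \_ K)//.
by apply/funext => x; rewrite !patchE; case: ifP => //; rewrite subr0.
Qed.

Lemma L1loc_L2 f : L2 nu f -> L1loc O f.
Proof.
move=> Lf K cK KO; apply/Lfun1_integrable.
exact: (L1_restrict (compact_cara cK) KO (L2_L1 (dmu_fin oO OM) Lf)).
Qed.

Lemma integB_Cc F F' phi : L1loc O F -> L1loc O F' -> Cc_smooth O phi ->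
  integ O (fun x => (F x - F' x) * phi x) = integ O (fun x => F x * phi x) - integ O (fun x => F' x * phi x).
Proof.
move=> LF LF' Cp; rewrite !integE -IntB; [|exact: L1loc_mul..].
by congr Int; apply/funext => x; rewrite !patchE; case: ifP => _; rewrite ?mulrBl ?subr0.
Qed.

Lemma weak_gradient_W01 u G : W u G -> weak_gradient O u G.
Proof.
move=> Wu; have [Lu LG _] := Wu; split; [exact: L1loc_L2|by move=> i; exact: L1loc_L2 (LG i)|].
move=> phi i Cp; have Lp := Cc_L2 oO OM Cp; have Ld := Cc_L2 oO OM (Cc_partial i Cp).
rewrite (@integ_ae _ (fun x => u x * partial i phi x)); [|exact: L2_mul|exact: aeW].
rewrite (@integ_ae _ (fun x => G x ord0 i * phi x)); [|exact: L2_mul (LG i) Lp|exact: aeW].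
exact: W01_weak M00 OM u G phi i Wu Cp.
Qed.

Lemma weak_gradient_uniq F G G' : weak_gradient O F G -> weak_gradient O F G' ->
  ae_in O (fun x => G x = G' x).
Proof.
move=> [LF LG eG] [_ LG' eG']; apply/(ae_dmu oO); apply: ae_row_eq => i; apply/(ae_dmu oO).
have L := L1loc_sub (LG i) (LG' i).
have : ae_in O (fun x => G x ord0 i - G' x ord0 i = 0).
  apply: (@weak_zero R n O oO) => [K cK KO|phi Cp]; first by apply/Lfun1_integrable; exact: L.
  rewrite -integE integB_Cc//.
  by apply: oppr_inj; rewrite opprB oppr0 -[X in _ - X]opprK -eG// eG'// opprK subrr.
by apply: ae_in_mono => x _ /eqP; rewrite subr_eq0 => /eqP.
Qed.

Lemma grad_weak F : (exists G, weak_gradient O F G) -> weak_gradient O F (grad O F).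
Proof. exact: xgetPex. Qed.

Lemma grad_ae F G : weak_gradient O F G -> ae_in O (fun x => grad O F x = G x).
Proof.
move=> wG; apply: (weak_gradient_uniq (F := F)) => //.
by apply: grad_weak; exists G.
Qed.

(** In [H10] the distance involves the gradient chosen for the difference [F \- psi]; this
    identifies it almost everywhere. *)
Lemma weak_gradientB F G psi : weak_gradient O F G -> Cc_smooth O psi ->
  weak_gradient O (F \- psi) (fun x => G x - gradf psi x).
Proof.
move=> [LF LG eG] Cp; have [Lp LH eH] := weak_gradient_W01 (W01_Cc oO OM Cp).
split.
- exact: L1loc_sub LF Lp.
- move=> i; rewrite (_ : (fun x => _) = fun x => G x ord0 i - gradf psi x ord0 i); first exact: L1loc_sub (LG i) (LH i).
  by apply/funext => x; rewrite !mxE.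
- move=> phi i Cphi; rewrite integB_Cc//; last exact: Cc_partial.
  rewrite (_ : (fun x => (G x - gradf psi x) ord0 i * phi x) = fun x => (G x ord0 i - gradf psi x ord0 i) * phi x).
    by have -> := integB_Cc (LG i) (LH i) Cphi; rewrite eG// eH// opprK opprB addrC.
  by apply/funext => x; rewrite !mxE.
Qed.

Lemma H1norm_ae F f H : L2 nu f -> L2v nu H -> ae_in O (fun x => F x = f x) ->
  ae_in O (fun x => grad O F x = H x) ->
  H1norm O F = (Num.sqrt (Int nu (fun x => f x ^+ 2 + dot (H x) (H x))))%:E.
Proof.
move=> Lf LH Ff FH; rewrite /H1norm (@integral_on_ae _ (fun x => f x ^+ 2 + dot (H x) (H x))).
- by rewrite poweR_EFin powR12_sqrt//; apply: Int_ge0 => x; rewrite addr_ge0 ?sqr_ge0 ?dot_ge0.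
- by apply: L1D; [exact: Lf.2|exact: L1_dot].
- by apply: ae_in_mono (ae_in_and Ff FH) => x Ox /= [-> ->].
Qed.

Lemma H10_W01 u G : W u G -> H10 O u.
Proof.
move=> Wu; have [Lu LG hu] := Wu; have wG := weak_gradient_W01 Wu; have aG := grad_ae wG.
split.
  split; [exact: Lp2_ae Lu (aeW _ _)|by exists G|move=> i].
  by apply: Lp2_ae (LG i) _; apply: ae_in_mono aG => x Ox /= ->.
(* Two squared distances are added under the root of [H1norm]: together they stay at most
   [e ^ 2 / 2]. *)
move=> e e0; have e2 : 0 < e ^+ 2 / 4 by rewrite divr_gt0// exprn_gt0.
have [psi [_ [[Cp ->] h1 h2]]] := hu _ e2; exists psi => //.
have Lp := Cc_L2 oO OM Cp; have Lg := Cc_L2v oO OM Cp.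
have D1 := L2B Lu Lp; have D2 := L2vB LG Lg.
rewrite (H1norm_ae D1 D2 (aeW _ _)) ?lte_fin//; last exact: grad_ae (weak_gradientB wG Cp).
rewrite -[e in ltRHS]ger0_norm ?ltW// -sqrtr_sqr ltr_sqrt ?exprn_gt0//.
rewrite IntD; [|exact: D1.2|exact: L1_dot].
have <- : Int nu (fun x => (psi x - u x) ^+ 2) = Int nu (fun x => (u x - psi x) ^+ 2).
  by congr Int; apply/funext => x; rewrite -sqrrN opprB.
have <- : Int nu (fun x => dot (gradf psi x - G x) (gradf psi x - G x)) =
    Int nu (fun x => dot (G x - gradf psi x) (G x - gradf psi x)).
  by congr Int; apply/funext => x; rewrite -opprB dotNl dotNr opprK.
rewrite /DG in h2; apply: le_lt_trans (lerD h1 h2) _.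
by have : 0 < e ^+ 2 by [rewrite exprn_gt0]; lra.
Qed.

(** Values off [O] are arbitrary in [H10]. Extending the function and its chosen gradient by [0]
    gives representatives that are measurable on the whole space. *)
Lemma W01_H10 F : H10 O F -> exists f H,
  [/\ W f H, ae_in O (fun x => F x = f x) & ae_in O (fun x => grad O F x = H x)].
Proof.
move=> [[LF [G wG] LgF] hF].
pose f : T0 -> R := F \_ O; pose H (x : T0) : 'rV[R]_n := \row_i ((fun x => grad O F x ord0 i) \_ O) x.
have Ff x : O x -> F x = f x by move=> Ox; rewrite /f patchE mem_set.
have FH x : O x -> grad O F x = H x.
  by move=> Ox; apply/rowP => i; rewrite mxE patchE mem_set.
have Lf : L2 nu f by exact: L2_of_Lp2.
have LH : L2v nu H by move=> i; under eq_fun do rewrite mxE; exact: L2_of_Lp2.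
exists f, H; split; [split => // e e0|exact: aeW|exact: aeW].
have [psi Cp hp] := hF (Num.sqrt e) ltac:(by rewrite sqrtr_gt0).
have Lp := Cc_L2 oO OM Cp; have Lg := Cc_L2v oO OM Cp.
have D1 := L2B Lf Lp; have D2 := L2vB LH Lg.
have wgF : weak_gradient O F (grad O F).
  by apply: grad_weak; exists G.
have gB := grad_ae (weak_gradientB wgF Cp).
have gB' : ae_in O (fun x => grad O (F \- psi) x = H x - gradf psi x).
  by apply: ae_in_mono gB => x Ox /= ->; rewrite FH.
rewrite (H1norm_ae D1 D2 _ gB') ?lte_fin in hp; last by apply: aeW => x Ox /=; rewrite Ff.
rewrite ltr_sqrt// in hp.
exists psi, (gradf psi); split; first by split.
  apply: le_trans (ltW hp); rewrite IntD; [|exact: D1.2|exact: L1_dot].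
  have <- : Int nu (fun x => (psi x - f x) ^+ 2) = Int nu (fun x => (f x - psi x) ^+ 2).
    by congr Int; apply/funext => x; rewrite -sqrrN opprB.
  by rewrite lerDl; apply: Int_ge0 => x; exact: dot_ge0.
apply: le_trans (ltW hp); rewrite IntD; [|exact: D1.2|exact: L1_dot].
have <- : DG nu (fun x => gradf psi x - H x) (fun x => gradf psi x - H x) =
    Int nu (fun x => dot (H x - gradf psi x) (H x - gradf psi x)).
  by congr Int; apply/funext => x; rewrite -opprB dotNl dotNr opprK.
by rewrite lerDr; apply: Int_ge0 => x; exact: sqr_ge0.
Qed.

End weak_gradients.

Lemma L2_closure_ae d (T : measurableType d) (R : realType) N (mu : {measure set T -> \bar R})
  (P : (T -> R) -> (T -> 'rV[R]_N) -> Prop) (u v : T -> R) G :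
  (forall u G, P u G -> L2 mu u) -> L2_closure mu P u G -> measurable_fun setT v ->
  (\forall x \ae mu, u x = v x) -> L2_closure mu P v G.
Proof.
move=> PL2 [Lu LG h] mv uv; have Lv := L2_ae_eq mv Lu uv; split => // e e0.
have [w [H [Pw w1 w2]]] := h e e0; exists w, H; split => //.
rewrite (@Int_ae_eq _ _ _ mu _ (fun x => (w x - u x) ^+ 2))//.
- exact: L1_mf (L2B (PL2 _ _ Pw) Lv).2.
- exact: L1_mf (L2B (PL2 _ _ Pw) Lu).2.
- by apply: filterS uv => x ->.
Qed.

(** * Translating the hypotheses on the domain and the data *)

Section domain_data.
Context (R : realType) (n : nat) (O : set 'rV[R]_n) (oO : open O).
Local Notation T0 := (caratheodory_type (@lebesgue_outer R n)).
Local Notation nu := (dmu oO).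
Local Notation mu := (lebesgue R n).
Local Notation W := (W01 oO).
Implicit Types (F : 'rV[R]_n -> R) (u v : T0 -> R) (G : T0 -> 'rV[R]_n).

Lemma bounded_coord : bounded_set O ->
  exists2 M0 : R, 0 < M0 & forall x : 'rV[R]_n, O x -> forall i, `|x ord0 i| < M0.
Proof.
move=> /pinfty_ex_gt0[M M_gt0 hM]; exists (M + 1); first by rewrite addr_gt0.
move=> x Ox i; apply: (@le_lt_trans _ _ M); last by rewrite ltrDl.
apply: le_trans (hM x Ox); rewrite /Num.norm/= mx_normrE.
exact: (le_bigmax _ (fun ij : 'I_1 * 'I_n => `|x ij.1 ij.2|) (ord0, i)).
Qed.

Lemma Lp_measurable F q : Lp O q F -> measurable_fun setT (F \_ O : T0 -> R).
Proof. by rewrite /Lp inE => /andP[]; rewrite inE. Qed.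

Lemma Lp_oo_bound F : Lp O +oo%E F -> exists2 M : R, 0 <= M & ae_in O (fun x => `|F x| <= M).
Proof.
rewrite /Lp inE => /andP[_]; rewrite inE/= /finite_norm unlock; case: ifPn => [_ h|]; last first.
  (* Default branch of the essential supremum norm, where the whole space is null and any bound
     holds almost everywhere. *)
  rewrite -leNgt => h _; exists 0 => //; exists setT; split => //.
  by apply/eqP; rewrite eq_le h measure_ge0.
exists (Num.max 0 (fine (ess_sup mu (abse \o (EFin \o F \_ O))))); first by rewrite le_max lexx.
have [A [mA A0 FA]] := ess_sup_ge mu (abse \o (EFin \o F \_ O)).
exists A; split => // x /= hx; apply: FA => /= h'; apply: hx => Ox.
move: h h' => /=; rewrite [(F \_ O) x]patchE mem_set//.
case: (ess_sup _ _) => [r| |] //=; rewrite lee_fin => _ Fr.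
by rewrite le_max Fr orbT.
Qed.

Lemma powR_le1DpowR (x q r : R) : 0 <= x -> 0 < q -> q <= r -> x `^ q <= 1 + x `^ r.
Proof.
move=> x0 q0 qr; have [x1|x1] := leP x 1.
  apply: (@le_trans _ _ 1); last by rewrite lerDl powR_ge0.
  by have <- : 1 `^ q = 1 :> R by [rewrite powR1]; apply: ge0_ler_powR; rewrite ?nnegrE ?(ltW q0).
by apply: (@le_trans _ _ (x `^ r)); [apply: ler_powR => //; exact: ltW|rewrite lerDr].
Qed.

Variable M0 : R.
Hypothesis OM : forall x, O x -> forall i, `|x ord0 i| < M0.

Lemma Lp_L1_powR F q m : 1 <= q -> (q%:E <= m)%E -> Lp O m F -> L1 nu (fun x => `|(F \_ O) x| `^ q).
Proof.
move=> q1 qm LF; have q0 : 0 < q by exact: lt_le_trans q1.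
have fin := dmu_fin oO OM; have mF := Lp_measurable LF.
have mFq r : measurable_fun setT (fun x : T0 => `|(F \_ O) x| `^ r).
  by apply: (measurableT_comp (measurable_powR _)); exact: measurableT_comp.
case: m qm LF => [r| |//] qm LF.
  rewrite lee_fin in qm.
  have Lr : L1 nu (fun x => `|(F \_ O) x| `^ r).
    apply/(@L1_mrestr _ _ _ mu O (open_cara oO)) => //.
    by apply: integrableS (Lfun_integrable (le_trans q1 qm) LF) => //; exact: open_cara.
  apply: (L1_domT (mFq q) (L1D (L1_cst fin 1) Lr)) => x.
  by rewrite ger0_norm ?powR_ge0// powR_le1DpowR.
have [M M_ge0 bM] := Lp_oo_bound LF.
apply: (L1_dom (mFq q) (L1_cst fin (M `^ q))); apply/(ae_dmu oO).
apply: (ae_in_mono _ bM) => x Ox Fx; rewrite ger0_norm ?powR_ge0//.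
by apply: ge0_ler_powR; rewrite ?nnegrE ?(ltW q0)// patchE mem_set.
Qed.

End domain_data.

Section integrands.
Context d (T : measurableType d) (R : realType) (N : nat).
Variable mu : {measure set T -> \bar R}.
Implicit Types (b u f : T -> R) (G H : T -> 'rV[R]_N).

Lemma measurable_clamp (a c : R) f : measurable_fun setT f ->
  measurable_fun setT (fun x => Num.max a (Num.min c (f x))).
Proof. by move=> mf; apply: measurable_maxr => //; exact: measurable_minr. Qed.

Lemma L1_damped b u G H (beta p : R) : 0 < p -> measurable_fun setT b -> L2 mu u ->
  (forall x, 0 <= b x <= beta) -> (\forall x \ae mu, 0 < u x) -> L2v mu G -> L2v mu H ->
  L1 mu (fun x => b x / (1 + u x) `^ p * dot (G x) (H x)).
Proof.
move=> p0 mb Lu bb u0 LG LH; have Ld := L1_dot LG LH.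
apply: (L1_dom _ (L1Z beta (L1_norm Ld))).
  apply: measurable_funM; last exact: L1_mf Ld.
  apply: measurable_funM => //; rewrite (_ : (fun x => _) = fun x => (1 + u x) `^ (- p)).
    apply: (measurableT_comp (measurable_powR _)); apply: measurable_funD => //; exact: L2_mf Lu.
  by apply/funext => x; rewrite powRN.
apply: filterS u0 => x ux; rewrite normrM ler_wpM2r//; have /andP[h1 h2] := bb x.
have w1 : 1 <= (1 + u x) `^ p.
  have e1 : 1 `^ p = 1 :> R by rewrite powR1.
  rewrite -[leLHS]e1; apply: ge0_ler_powR; rewrite ?nnegrE ?(ltW p0)//; lra.
rewrite ger0_norm ?divr_ge0 ?powR_ge0// ler_pdivrMr ?(lt_le_trans ltr01)//.
by apply: (le_trans h2); apply: ler_peMr w1; exact: le_trans h1 h2.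
Qed.

(** With [z = N - 2], [1 + 2 / z] is [N / (N - 2)]: the exponent of the theorem is the one of
    [W01_source_bound]. *)
Lemma critical_exponentE (z theta : R) : 0 < z ->
  2 * (z + 2) / (2 * (z + 2) - theta * (z + 2 - 2)) =
  2 * (1 + 2 * z^-1) / (2 * (1 + 2 * z^-1) - theta).
Proof.
move=> z0; have zn : z != 0 by rewrite gt_eqF.
have -> : 2 * (z + 2) - theta * (z + 2 - 2) = z * (2 * (1 + 2 * z^-1) - theta) by field.
have -> : 2 * (z + 2) = z * (2 * (1 + 2 * z^-1)) by field.
by rewrite -mulf_div divff// mul1r.
Qed.

End integrands.

Theorem theorem1p1 (R : realType) (N : nat) (hN : (3 <= N)%N)
    (Omega : set 'rV[R]_N) (hOb : bounded_set Omega) (hOo : open Omega)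
    (B p : R) (hB : 0 < B) (hp : 0 < p)
    (b : 'rV[R]_N -> R) (hbm : measurable_on Omega b)
    (alpha beta : R) (halpha : 0 < alpha) (hbeta : 0 < beta)
    (hb : ae_in Omega (fun x => alpha <= b x <= beta))
    (theta : R) (htheta : 0 < theta < 1)
    (f : 'rV[R]_N -> R) (hfpos : ae_in Omega (fun x => 0 < f x))
    (m : \bar R)
    (hm : ((2 * N%:R / (2 * N%:R - theta * (N%:R - 2)))%:E <= m)%E)
    (hf : Lp Omega m f) :
  exists u : 'rV[R]_N -> R,
    [/\ H10 Omega u,
        ae_in Omega (fun x => 0 < u x),
        Lp Omega 1%:E
          (fun x => dot (grad Omega u x) (grad Omega u x) / (u x `^ theta)) &
        forall phi : 'rV[R]_N -> R,
          H10 Omega phi -> Lp Omega +oo%E phi ->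
          integ Omega (fun x => b x / ((1 + u x) `^ p)
                                * dot (grad Omega u x) (grad Omega phi x))
          + B * integ Omega (fun x => dot (grad Omega u x) (grad Omega u x)
                                      / (u x `^ theta) * phi x)
          = integ Omega (fun x => f x * phi x)].
Proof.
case: N hN Omega hOb hOo b hbm hb f hfpos hm hf => [//|[//|[//|k]]] _ O bO oO b mb hb f fpos hm hf.
have [M0 M00 OM] := bounded_coord bO.
have HS := W01_sobolev oO M00 OM; have fin := dmu_fin oO OM.
pose s : R := 1 + 2 * k.+1%:R^-1.
have a0 := @sobolev_exponent_gt0 R k.
have /andP[t0 t1] := htheta.
have d0 : 0 < 2 * s - theta.
  by rewrite /s; move: a0 t1; move: (k.+1%:R^-1) => z z0 tz; lra.
pose q := 2 * s / (2 * s - theta).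
have qE : 2 * k.+3%:R / (2 * k.+3%:R - theta * (k.+3%:R - 2)) = q.
  have -> : k.+3%:R = k.+1%:R + 2 :> R by rewrite -natrD addn2.
  by rewrite critical_exponentE.
rewrite qE in hm.
have q1 : 1 <= q by rewrite /q ler_pdivlMr// mul1r; lra.
(* The abstract result wants its sign and ellipticity conditions at every point, whereas the data
   satisfy them almost everywhere on [O]; source and coefficient are changed on a null set and off
   [O]. *)
pose g : 'rV[R]_k.+3 -> R := f \_ O; pose f1 x := Num.max 0 (g x).
have mg := Lp_measurable hf.
have mf1 : measurable_fun setT (f1 : caratheodory_type (@lebesgue_outer R k.+3) -> R)
  by exact: measurable_maxr (measurable_cst _) mg.
have f10 x : 0 <= f1 x by rewrite le_max lexx.
have f1g x : f1 x <= `|g x| by rewrite ge_max normr_ge0 ler_norm.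
have Lgq := Lp_L1_powR oO OM q1 hm hf.
have Lfq : L1 (dmu oO) (fun x => f1 x `^ q).
  apply: (L1_domT _ Lgq); first exact: (measurableT_comp (measurable_powR _)).
  move=> x; rewrite ger0_norm ?powR_ge0//.
  by apply: ge0_ler_powR; rewrite ?nnegrE// (le_trans ler01).
have Lf1 : L1 (dmu oO) f1.
  apply: (L1_domT mf1 (L1D (L1_cst fin 1) Lfq)) => x; rewrite ger0_norm//.
  by rewrite -[leLHS](powRr1 (f10 x)) powR_le1DpowR.
have f1E : ae_in O (fun x => f x = f1 x).
  by apply: ae_in_mono fpos => x Ox fx; rewrite /f1 /g patchE mem_set// max_r// ltW.
have f1pos : {ae dmu oO, forall x, 0 < f1 x}.
  by apply/(ae_dmu oO); apply: ae_in_mono (ae_in_and oO fpos f1E) => x Ox /= [fx <-].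
(* If [O] is null, nothing relates [alpha] and [beta]; the maximum makes the projection interval
   nonempty in every case. *)
pose beta1 := Num.max alpha beta.
pose b1 x := Num.max alpha (Num.min beta1 ((b \_ O) x)).
have beta10 : 0 < beta1 by rewrite lt_max halpha.
have mb1 : measurable_fun setT (b1 : caratheodory_type (@lebesgue_outer R k.+3) -> R).
  by apply: measurable_clamp; apply/(measurable_restrictT _ (open_cara oO)).
have b1b x : alpha <= b1 x <= beta1.
  by rewrite le_max lexx/= ge_max /beta1 le_max lexx/= ge_min lexx.
have b1E : ae_in O (fun x => b x = b1 x).
  apply: ae_in_mono hb => x Ox /= /andP[h1 h2]; rewrite /b1 patchE mem_set// min_r ?max_r//.
  by rewrite le_max h2 orbT.
have [Cs hCs] := W01_source_bound M00 OM mf1 f10 htheta hB Lfq.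
have [u [K [Wu u0 LK eqn]]] := abstract_existence fin HS mb1 halpha beta10 b1b hp htheta hB Lf1 f10 hCs f1pos.
have [Lu LvK _] := Wu.
have gE := grad_ae oO (weak_gradient_W01 M00 OM Wu).
have u0' : ae_in O (fun x => 0 < u x) by apply/(ae_dmu oO).
exists u; split.
- exact: (H10_W01 M00 OM Wu).
- exact: u0'.
- by apply: (Lp1_ae LK); apply: ae_in_mono gE => x Ox ->.
move=> phi hphi /Lp_oo_bound[M M_ge0 bM].
have [v [H [Wv vE HE]]] := W01_H10 oO M00 OM hphi.
have [Lv LvH _] := Wv.
(* The test function is bounded only almost everywhere. The projected representative is bounded
   everywhere and keeps the gradient [H], as membership in the closure ignores null sets. *)
pose w x := Num.max (- M) (Num.min M (v x)).
have wM x : `|w x| <= M.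
  by rewrite ler_norml /w le_max lexx/= ge_max ge_min lexx/= andbT; lra.
have mw : measurable_fun setT w.
  exact: measurable_clamp (L2_mf Lv).
have phiw : ae_in O (fun x => phi x = w x).
  apply: ae_in_mono (ae_in_and oO vE bM) => x Ox /= [e]; rewrite e ler_norml => /andP[h1 h2].
  by rewrite /w min_r// max_r.
have Ww : W01 oO w H.
  refine (@L2_closure_ae _ _ _ _ (dmu oO) (@test_pair R k.+3 O) v w H
    (fun psi H' => @test_pair_L2 R k.+3 O oO M0 OM psi H') Wv mw _); apply/(ae_dmu oO).
  by apply: ae_in_mono (ae_in_and oO vE phiw) => x Ox /= [-> ->].
have e := eqn _ _ _ Ww wM.
have L1_ : L1 (dmu oO) (fun x => b1 x / (1 + u x) `^ p * dot (K x) (H x)).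
  by apply: (L1_damped (beta := beta1)) => // x; have /andP[h1 ->] := b1b x; rewrite (le_trans (ltW halpha) h1).
have L2_ : L1 (dmu oO) (fun x => dot (K x) (K x) / u x `^ theta * w x).
  under eq_fun do rewrite mulrC; exact: (L1_mulbdd mw wM LK).
have L3_ : L1 (dmu oO) (fun x => f1 x * w x).
  under eq_fun do rewrite mulrC; exact: (L1_mulbdd mw wM Lf1).
rewrite (integ_ae L1_); last first.
  by apply: ae_in_mono (ae_in_and oO b1E (ae_in_and oO gE HE)) => x Ox /= [-> [-> ->]].
rewrite (integ_ae L2_); last first.
  by apply: ae_in_mono (ae_in_and oO gE phiw) => x Ox /= [-> ->].
rewrite (integ_ae L3_); last first.
  by apply: ae_in_mono (ae_in_and oO f1E phiw) => x Ox /= [-> ->].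
exact: e.
Qed.
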